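(* Let $H$ be a logarithmic neighborhood of $-\infty$ of type $(a,k)$ contained in $\{\mathrm{Re}(w)\le-1\}$, let $g\in E_0(H)$, let $t_n=\frac{n-0.5}{k}$ for $n\ge0$, and suppose that no $t_n$ belongs to the support of $\mathcal Lg$. Then the sequence of evanescent partial sums $\tilde S_ng$ tends uniformly to $g$ on a logarithmic neighborhood of $-\infty$.
   Context: Notation. $\mathbb R^+=[0,\infty)$, $R(w_0,v)=\{w_0+tv:t\ge0\}$, $C_-(w_0,\theta)=w_0-\{w\in\mathbb C^*:|\mathrm{Arg}(w)|<\theta\}$. A neighborhood of $-\infty$ is a set $H\subset\mathbb C$ such that for every $\theta\in[0,\pi/2[$ there is $w_0\in H$ with $C_-(w_0,\theta)\subset H$, and such that $H=\bigcup_{w_0\in H\cap\mathbb R}C_-(w_0,\theta(w_0))$, where $\theta(w_0)\le\pi/2$ is the biggest angle with $C_-(w_0,\theta(w_0))\subset H$. Its border has the form $\{x+iy:x=\rho(|y|)\}$ with $\rho$ convex on $\mathbb R^+$. It is called logarithmic of type $(a,k)$, $a\in\mathbb R$, $k>0$, if $\rho(y)=a-k\log(y)$ for $y$ big enough; a neighborhood containing a logarithmic one is also regarded as logarithmic (by restriction). $E_0(H)$ is the space of bounded holomorphic functions on $H$ extending continuously to the border. Laplace transform. Fix a real base point $w_0\in H$. For $g\in E_0(H)$, $\mathcal Lg=\mathcal L_{w_0}g\in\mathcal O(\mathbb C\setminus\mathbb R^+)$ is defined by $\mathcal L_{w_0}g(p)=\int_{w_0}^{w_1}g(w)e^{-pw}dw+\int_{R(w_1,v)}g(w)e^{-pw}dw$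 for any ray $R(w_1,v)\subset\overline H$ with $\mathrm{Re}(v)<0$, $\mathrm{Re}(pv)>0$ (independent of $w_1,v$). The support of $\mathcal Lg$ is the set of $\beta\in\mathbb R^+$ such that $\mathcal L_{w_0}g$ does not extend holomorphically to a neighborhood of $\beta$. Primitives. For a function $h$ on $\mathbb C\setminus\mathbb R^+$ with exponential decay as $\mathrm{Re}(p)\to-\infty$, $Ih$ is its primitive tending to $0$ as $\mathrm{Re}(p)\to-\infty$; $I^n$ is the $n$-th iterate. The function $I^n\mathcal Lg$ extends continuously to the real interval $[0,(n-2)/k]$ from above and from below, the extensions being denoted $(I^n\mathcal Lg)^+$ and $(I^n\mathcal Lg)^-$. Put $\varphi_n(t)=(I^n\mathcal Lg)^-(t)-(I^n\mathcal Lg)^+(t)$ for $t\in[0,(n-2)/k]$, and $\varphi_n(t)=0$ for $t<0$. Since $\mathcal Lg$ is holomorphic near $t_n$, $\varphi_{n+3}$ coincides near $t_n$ with a polynomial; $\varphi_{n+3}^{(j)}(t_n)$ denotes its $j$-th derivative at $t_n$. Partial sums: $S_ng(w)=S_{[t_0,t_n]}g(w)=\frac{1}{2i\pi}\int_\gamma\mathcal Lg(p)e^{pw}dp$, where $\gamma$ is a simple loop circling once counterclockwise around $[t_0,t_n]$, meeting $\mathbb R$ exactly at $t_0$ and $t_n$. Evanescent partial sums: $\tilde S_ng(w)=S_ng(w)-\frac{1}{2i\pi}BT_n^2(w)$, where $BT_n^2(w)=\sum_{r=0}^{n+2}(-1)^r\varphi_{n+3}^{(n-r+2)}(t_n)\,w^re^{wt_n}$.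 *)

(* Defs.v *)
(* Stdlib reals with Coquelicot.  Subsets of the complex plane are predicates
   [C -> Prop]; functions are total, and only their values on the relevant
   domain matter. *)
From Stdlib Require Import Reals ClassicalEpsilon.
From Coquelicot Require Import Coquelicot.
Local Open Scope R_scope.
Local Open Scope C_scope.

(* The complex number satisfying [P]; meaningful when there is exactly one. *)
Definition the_C (P : C -> Prop) : C := epsilon (inhabits (RtoC 0)) P.

Definition Cexp (z : C) : C :=
  ((exp (Re z) * cos (Im z))%R, (exp (Re z) * sin (Im z))%R).

(* [alpha] is the principal argument of [w], for [w <> 0]. *)
Definition is_Arg (w : C) (alpha : R) : Prop :=
  (- PI < alpha <= PI)%R /\
  w = RtoC (Cmod w) * (cos alpha, sin alpha).

Definition C_minus (w0 : C) (theta : R) (w : C) : Prop :=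
  exists u : C, u <> 0 /\
    (exists alpha : R, is_Arg u alpha /\ (Rabs alpha < theta)%R) /\
    w = w0 - u.

Definition set_incl (A B : C -> Prop) : Prop := forall w, A w -> B w.

Definition closure (A : C -> Prop) (w : C) : Prop :=
  forall eps : R, (0 < eps)%R -> exists z, A z /\ (Cmod (z - w) < eps)%R.

Definition border (A : C -> Prop) (w : C) : Prop :=
  closure A w /\ closure (fun z => ~ A z) w.

(* Neighborhoods of -oo *)

Definition biggest_angle (H : C -> Prop) (w0 : C) (theta : R) : Prop :=
  (theta <= PI / 2)%R /\ set_incl (C_minus w0 theta) H /\
  forall theta' : R, (theta' <= PI / 2)%R ->
    set_incl (C_minus w0 theta') H -> (theta' <= theta)%R.

Definition nbhd_minfty (H : C -> Prop) : Prop :=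
  (forall theta : R, (0 <= theta < PI / 2)%R ->
     exists w0 : C, H w0 /\ set_incl (C_minus w0 theta) H) /\
  (forall w : C, H w <->
     exists (x0 theta : R),
       H (RtoC x0) /\ biggest_angle H (RtoC x0) theta /\
       C_minus (RtoC x0) theta w).

Definition convex_on_Rplus (rho : R -> R) : Prop :=
  forall x y l : R, (0 <= x)%R -> (0 <= y)%R -> (0 <= l <= 1)%R ->
    (rho (l * x + (1 - l) * y) <= l * rho x + (1 - l) * rho y)%R.

Definition border_profile (H : C -> Prop) (rho : R -> R) : Prop :=
  convex_on_Rplus rho /\
  forall x y : R, border H (x, y) <-> x = rho (Rabs y).

Definition strictly_logarithmic (a k : R) (H : C -> Prop) : Prop :=
  nbhd_minfty H /\
  exists rho : R -> R, border_profile H rho /\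
    exists Y : R, forall y : R, (Y < y)%R -> rho y = (a - k * ln y)%R.

(* A neighborhood containing a logarithmic one counts as logarithmic. *)
Definition logarithmic_of_type (a k : R) (H : C -> Prop) : Prop :=
  nbhd_minfty H /\
  exists H1 : C -> Prop, strictly_logarithmic a k H1 /\ set_incl H1 H.

Definition logarithmic (H : C -> Prop) : Prop :=
  exists a k : R, (0 < k)%R /\ logarithmic_of_type a k H.

Definition holomorphic_at (f : C -> C) (z : C) : Prop :=
  ex_derive (K := C_AbsRing) (V := C_NormedModule) f z.

(* On the border, [g] stands for its continuous extension. *)
Definition E0 (H : C -> Prop) (g : C -> C) : Prop :=
  (forall w, H w -> holomorphic_at g w) /\
  (exists M : R, forall w, H w -> (Cmod (g w) <= M)%R) /\
  (forall w, closure H w ->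
     filterlim (T := C_UniformSpace) (U := C_UniformSpace) g
       (within (closure H) (locally (T := C_UniformSpace) w))
       (locally (T := C_UniformSpace) (g w))).

(* Integrals along curves *)

Definition C1_curve (h : R -> C) : Prop :=
  exists d : R -> C,
    (forall t, is_derive (K := R_AbsRing) (V := C_R_NormedModule) h t (d t)) /\
    (forall t, continuous (T := R_UniformSpace) (U := C_UniformSpace) d t).

Inductive piecewise_C1 (c : R -> C) : R -> R -> Prop :=
| piecewise_C1_piece (a b : R) (h : R -> C) :
    (a < b)%R -> C1_curve h ->
    (forall t, (a <= t <= b)%R -> c t = h t) -> piecewise_C1 c a b
| piecewise_C1_cat (a m b : R) :
    piecewise_C1 c a m -> piecewise_C1 c m b -> piecewise_C1 c a b.

(* Unspecified at the finitely many corners, which integrals ignore. *)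
Definition velocity (c : R -> C) (t : R) : C :=
  (Derive (fun s => Re (c s)) t, Derive (fun s => Im (c s)) t).

Definition is_path_int (f : C -> C) (c : R -> C) (a b : R) (l : C) : Prop :=
  is_RInt (V := C_R_NormedModule) (fun t => f (c t) * velocity c t) a b l.

Definition is_ray_int (f : C -> C) (w1 v : C) (l : C) : Prop :=
  is_RInt_gen (V := C_R_NormedModule)
    (fun t => f (w1 + RtoC t * v) * v) (at_point 0%R) (Rbar_locally p_infty) l.

(* Laplace transform *)

Definition in_Rplus (p : C) : Prop := (0 <= Re p)%R /\ Im p = 0%R.

Definition is_Laplace (H : C -> Prop) (w0 : R) (g : C -> C) (p l : C) : Prop :=
  exists (w1 v : C) (c : R -> C) (I1 I2 : C),
    (Re v < 0)%R /\ (0 < Re (p * v))%R /\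
    (forall t : R, (0 <= t)%R -> closure H (w1 + RtoC t * v)) /\
    piecewise_C1 c 0 1 /\ c 0%R = RtoC w0 /\ c 1%R = w1 /\
    (forall t : R, (0 <= t <= 1)%R -> closure H (c t)) /\
    is_path_int (fun w => g w * Cexp (- (p * w))) c 0 1 I1 /\
    is_ray_int (fun w => g w * Cexp (- (p * w))) w1 v I2 /\
    l = I1 + I2.

(* Meaningful for [p] outside [0, +oo). *)
Definition Laplace (H : C -> Prop) (w0 : R) (g : C -> C) (p : C) : C :=
  the_C (is_Laplace H w0 g p).

Definition extends_holomorphically_at (L : C -> C) (beta : R) : Prop :=
  exists (U : C -> Prop) (F : C -> C),
    open (T := C_UniformSpace) U /\ U (RtoC beta) /\
    (forall p, U p -> holomorphic_at F p) /\
    (forall p, U p -> ~ in_Rplus p -> F p = L p).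

Definition support (L : C -> C) (beta : R) : Prop :=
  (0 <= beta)%R /\ ~ extends_holomorphically_at L beta.

(* Primitives vanishing as Re p -> -oo *)

Definition is_primitive_minfty (h F : C -> C) : Prop :=
  (forall p, ~ in_Rplus p ->
     is_derive (K := C_AbsRing) (V := C_NormedModule) F p (h p)) /\
  (forall eps : R, (0 < eps)%R ->
     exists M : R, forall p, (Re p < M)%R -> (Cmod (F p) < eps)%R).

(* Determined by [h] outside [0, +oo). *)
Definition primitive_minfty (h : C -> C) : C -> C :=
  epsilon (inhabits (fun _ : C => RtoC 0)) (is_primitive_minfty h).

Definition iter_primitive (n : nat) (h : C -> C) : C -> C :=
  Nat.iter n primitive_minfty h.

Definition value_from_above (F : C -> C) (t : R) : C :=
  the_C (fun l =>
    filterlim (T := C_UniformSpace) (U := C_UniformSpace) F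
      (within (fun p => (0 < Im p)%R)
         (locally (T := C_UniformSpace) (RtoC t)))
      (locally (T := C_UniformSpace) l)).

Definition value_from_below (F : C -> C) (t : R) : C :=
  the_C (fun l =>
    filterlim (T := C_UniformSpace) (U := C_UniformSpace) F
      (within (fun p => (Im p < 0)%R)
         (locally (T := C_UniformSpace) (RtoC t)))
      (locally (T := C_UniformSpace) l)).

(* Meaningful for [t <= (n - 2) / k] when [L] is the Laplace transform of an
   element of [E0 H], [H] being logarithmic of type [(a, k)]. *)
Definition phi (L : C -> C) (n : nat) (t : R) : C :=
  if Rlt_dec t 0 then RtoC 0
  else value_from_below (iter_primitive n L) t
       - value_from_above (iter_primitive n L) t.

Definition CDerive_n (f : R -> C) (j : nat) (t : R) : C :=
  (Derive_n (fun s => Re (f s)) j t, Derive_n (fun s => Im (f s)) j t).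

(* Partial sums *)

(* A simple loop meeting the real line exactly at [x < y] and circling once
   counterclockwise around the segment [x, y] goes from [y] to [x] through the upper
   half-plane and comes back through the lower half-plane. *)
Definition encircling_loop (x y : R) (c : R -> C) : Prop :=
  piecewise_C1 c 0 1 /\
  (forall s t : R, (0 <= s < 1)%R -> (0 <= t < 1)%R -> c s = c t -> s = t) /\
  exists m : R, (0 < m < 1)%R /\
    c 0%R = RtoC y /\ c m = RtoC x /\ c 1%R = RtoC y /\
    (forall t : R, (0 < t < m)%R -> (0 < Im (c t))%R) /\
    (forall t : R, (m < t < 1)%R -> (Im (c t) < 0)%R).

(* The value of [L] at [y] is irrelevant: the loop passes there only at its
   endpoints. *)
Definition is_partial_sum (L : C -> C) (x y : R) (w l : C) : Prop :=
  exists (c : R -> C) (I : C),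
    encircling_loop x y c /\
    is_path_int (fun p => L p * Cexp (p * w)) c 0 1 I /\
    l = / (2 * Ci * RtoC PI) * I.

Definition partial_sum (L : C -> C) (x y : R) (w : C) : C :=
  the_C (is_partial_sum L x y w).

Definition t_ (k : R) (n : nat) : R := ((INR n - 1 / 2) / k)%R.

Definition S_ (L : C -> C) (k : R) (n : nat) (w : C) : C :=
  partial_sum L (t_ k 0) (t_ k n) w.

Definition BT2 (L : C -> C) (k : R) (n : nat) (w : C) : C :=
  sum_n (G := C_AbelianGroup)
    (fun r => (-1) ^ r * CDerive_n (phi L (n + 3)) (n + 2 - r) (t_ k n)
              * w ^ r * Cexp (w * RtoC (t_ k n)))
    (n + 2).

Definition evanescent_S (L : C -> C) (k : R) (n : nat) (w : C) : C :=
  S_ L k n w - / (2 * Ci * RtoC PI) * BT2 L k n w.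

(* Main.v *)
(** Let [L] be the Laplace transform of [g] and [N = n + 3].  As [I] divides the integrand by
    [- w], the iterated primitive [I^N L] is the Laplace transform of [g w / (- w)^N].  In the
    upper (lower) half-plane it is an integral along the lower (upper) half of a fixed
    logarithmic contour [gamma] in [H], and this integral still converges up to the real axis
    for [Re p <= t_n].  In the integral of [L p e^(p w)] over a loop around [[t_0, t_n]],
    integrate by parts [N] times on each half of the loop.  Since [phi_(j+1)' = phi_j] near
    [t_n], the boundary terms at [t_n] add up to [BT_n^2 w], and what remains is the integral
    over [gamma] of

      g(u) (w / u)^N (e^(t_n (w - u)) - e^(t_0 (w - u))) / (w - u) du.

    As [t_0 < 0], Cauchy's formula identifies the contribution of [t_0] with [2 i pi g w].  The
    contribution of [t_n] is [O(C^n |w|^N e^(t_n Re w))], which decays geometrically on a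
    logarithmic neighborhood that lies far enough to the left and has a larger type. *)
Require Import Defs.
From Stdlib Require Import Reals Lra Lia Psatz Classical ClassicalEpsilon.
From Stdlib Require Import FunctionalExtensionality PropExtensionality.
From Coquelicot Require Import Coquelicot.
Local Open Scope R_scope.

(** * Limits and derivatives *)

(** On the real axis the kernel [exp (- p u)] no longer decays along the contour: at height [y] it
    may be of order [(1 + y) ^ (k Re p)], at most [(1 + y) ^ n] since [t_n < n / k]. The [n + 3]
    divisions by [u] leave [(1 + y) ^ (-3)]; one of these powers pays for a Lipschitz estimate in
    [p], hence for continuity up to the axis. The transform is defined with rays that vary with [p],
    whereas the estimates need one curve per half-plane. Both are read off a single primitive of
    [g w exp (- p w)] on [H]: every admissible integral is a limit of it at infinity, and only far
    values are compared. Likewise half a loop contributes a difference of one-sided limits of a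
    primitive, whatever its shape; at [t_0], where the iterated primitives are continuous, the
    boundary sums of the two halves cancel. Cauchy's formula is reduced to simple fractions, whose
    integral along the unbounded contour is a difference of logarithms. As [|w| >= 1], for [n >= 3]
    the error is bounded by a constant times the [n]-th power of a multiple of
    [|w|^2 exp (Re w / (2 k))]; the type [16 k] makes this base small. *)

Lemma half_pos (x : R) : 0 < x -> 0 < x / 2.
Proof. lra. Qed.

(** Limits are measured with [Cmod], while the neighborhoods of [C_UniformSpace] are those of a
    product; [locally_C_iff] and [flim_filterlim] reconcile the two. The filter laws are assumed
    only by the lemmas that use them. *)
Definition flim {T : Type} (f : T -> C) (F : (T -> Prop) -> Prop) (l : C) : Prop :=
  forall eps : R, 0 < eps -> F (fun t => Cmod (f t - l) < eps).

Lemma norm_C_R (z : C) : norm (K := R_AbsRing) (V := C_R_NormedModule) z = Cmod z.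
Proof.
  destruct z as [x y]. unfold Cmod. cbn. unfold prod_norm. cbn. f_equal.
  unfold norm; simpl; unfold abs; simpl.
  rewrite !Rmult_1_r. rewrite <- !Rabs_mult.
  rewrite !Rabs_pos_eq; try apply Rle_0_sqr. ring.
Qed.

Lemma locally_C_iff (z : C) (P : C -> Prop) :
  locally (T := C_UniformSpace) z P <->
  exists d, 0 < d /\ forall u, Cmod (u - z) < d -> P u.
Proof.
  split.
  - intros [d Hd]. exists d. split; [apply cond_pos|]. intros u Hu. apply Hd.
    apply C_NormedModule_mixin_compat1. exact Hu.
  - intros (d & Hd & HP).
    assert (H2 : 0 < sqrt 2) by (apply sqrt_lt_R0; lra).
    (* A square of half-side [d / sqrt 2] lies in the disc of radius [d]. *)
    assert (Hd' : 0 < d / sqrt 2) by (apply Rdiv_lt_0_compat; assumption).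
    exists (mkposreal _ Hd'). intros u Hu. apply HP.
    apply C_NormedModule_mixin_compat2 in Hu. simpl in Hu.
    replace (sqrt 2 * (d / sqrt 2)) with d in Hu by (field; lra). exact Hu.
Qed.

Lemma locally_R_iff (x : R) (P : R -> Prop) :
  locally x P <-> exists d, 0 < d /\ forall u, Rabs (u - x) < d -> P u.
Proof.
  split.
  - intros [d Hd]. exists d. split; [apply cond_pos|]. intros u Hu. apply Hd. exact Hu.
  - intros (d & Hd & HP). exists (mkposreal _ Hd). intros u Hu. apply HP. exact Hu.
Qed.

Lemma flim_filterlim {T} (f : T -> C) F (FF : Filter F) l :
  flim f F l <-> filterlim f F (locally (T := C_UniformSpace) l).
Proof.
  split.
  - intros H P HP. apply locally_C_iff in HP. destruct HP as (d & Hd & HP).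
    specialize (H d Hd). unfold filtermap. revert H. apply filter_imp. intros t. apply HP.
  - intros H eps He. apply (H (fun z => Cmod (z - l) < eps)).
    apply locally_C_iff. exists eps. split; auto.
Qed.

Lemma flim_eq {T} (f : T -> C) (F : (T -> Prop) -> Prop) l m :
  flim f F l -> l = m -> flim f F m.
Proof. intros H <-. exact H. Qed.

Section FlimRules.
Context {T : Type} (F : (T -> Prop) -> Prop) {FF : Filter F}.

Lemma flim_ext_loc (f g : T -> C) l :
  F (fun t => f t = g t) -> flim f F l -> flim g F l.
Proof.
  intros H Hf eps He. generalize (filter_and _ _ H (Hf eps He)). apply filter_imp.
  intros t [<- Ht]. exact Ht.
Qed.

Lemma flim_ext (f g : T -> C) l : (forall t, f t = g t) -> flim f F l -> flim g F l.
Proof. intros H. apply flim_ext_loc. apply filter_forall. exact H. Qed.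

Lemma flim_const (c : C) : flim (fun _ => c) F c.
Proof.
  intros eps He. apply filter_forall. intros _.
  replace (c - c)%C with (RtoC 0) by ring. rewrite Cmod_0. exact He.
Qed.

Lemma flim_plus f g l m :
  flim f F l -> flim g F m -> flim (fun t => f t + g t)%C F (l + m)%C.
Proof.
  intros Hf Hg eps He.
  generalize (filter_and _ _ (Hf (eps / 2) (half_pos _ He)) (Hg (eps / 2) (half_pos _ He))).
  apply filter_imp. intros t [H1 H2].
  replace (f t + g t - (l + m))%C with ((f t - l) + (g t - m))%C by ring.
  eapply Rle_lt_trans; [apply Cmod_triangle|]. lra.
Qed.

Lemma flim_bound f l : flim f F l -> F (fun t => Cmod (f t) <= Cmod l + 1).
Proof.
  intros Hf. generalize (Hf 1 Rlt_0_1). apply filter_imp. intros t Ht.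
  replace (f t) with ((f t - l) + l)%C by ring.
  generalize (Cmod_triangle (f t - l) l). lra.
Qed.

Lemma flim_mult f g l m :
  flim f F l -> flim g F m -> flim (fun t => f t * g t)%C F (l * m)%C.
Proof.
  intros Hf Hg eps He.
  assert (Hl := Cmod_ge_0 l). assert (Hm := Cmod_ge_0 m).
  pose (e := eps / (2 * (Cmod l + Cmod m + 2))).
  assert (He' : 0 < e) by (unfold e; apply Rdiv_lt_0_compat; lra).
  generalize (filter_and _ _ (flim_bound _ _ Hg) (filter_and _ _ (Hf e He') (Hg e He'))).
  apply filter_imp. intros t (H0 & H1 & H2).
  replace (f t * g t - l * m)%C with ((f t - l) * g t + l * (g t - m))%C by ring.
  eapply Rle_lt_trans; [apply Cmod_triangle|]. rewrite !Cmod_mult.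
  assert (Cmod (f t - l) * Cmod (g t) <= e * (Cmod m + 1)).
  { apply Rmult_le_compat; try apply Cmod_ge_0; lra. }
  assert (Cmod l * Cmod (g t - m) <= Cmod l * e).
  { apply Rmult_le_compat_l; lra. }
  assert (e * (Cmod l + Cmod m + 2) = eps / 2) by (unfold e; field; lra).
  nra.
Qed.

Lemma flim_opp f l : flim f F l -> flim (fun t => - f t)%C F (- l)%C.
Proof.
  intros Hf. apply (flim_ext (fun t => RtoC (-1) * f t)%C); [intros; ring|].
  replace (- l)%C with (RtoC (-1) * l)%C by ring.
  apply flim_mult; [apply flim_const|exact Hf].
Qed.

Lemma flim_minus f g l m :
  flim f F l -> flim g F m -> flim (fun t => f t - g t)%C F (l - m)%C.
Proof. intros Hf Hg. apply flim_plus; [|apply flim_opp]; assumption. Qed.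

Lemma flim_inv f l : l <> RtoC 0 -> flim f F l -> flim (fun t => / f t)%C F (/ l)%C.
Proof.
  intros Hl Hf eps He.
  assert (Hm : 0 < Cmod l) by (apply Cmod_gt_0; exact Hl).
  assert (He' : 0 < eps * Cmod l * Cmod l / 2).
  { apply Rdiv_lt_0_compat; [|lra]. repeat apply Rmult_lt_0_compat; lra. }
  generalize (filter_and _ _ (Hf (Cmod l / 2) (half_pos _ Hm)) (Hf _ He')).
  apply filter_imp. intros t (H1 & H2).
  assert (H3 : Cmod l / 2 < Cmod (f t)).
  { assert (Cmod l <= Cmod (f t) + Cmod (f t - l)); [|lra].
    replace l with (f t + - (f t - l))%C at 1 by ring.
    rewrite <- (Cmod_opp (f t - l)). apply Cmod_triangle. }
  assert (Hft : f t <> RtoC 0) by (apply Cmod_gt_0; lra).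
  replace (/ f t - / l)%C with (- (f t - l) * / (f t * l))%C by (field; auto).
  rewrite Cmod_mult, Cmod_opp, Cmod_inv, Cmod_mult by (apply Cmult_neq_0; auto).
  apply (Rmult_lt_reg_r (Cmod (f t) * Cmod l)); [apply Rmult_lt_0_compat; lra|].
  rewrite Rmult_assoc, Rinv_l, Rmult_1_r by (apply Rgt_not_eq; apply Rmult_lt_0_compat; lra).
  eapply Rlt_le_trans; [exact H2|].
  replace (eps * Cmod l * Cmod l / 2) with (eps * ((Cmod l / 2) * Cmod l)) by field.
  apply Rmult_le_compat_l; [lra|]. apply Rmult_le_compat_r; lra.
Qed.

Lemma flim_squeeze f l (b : T -> R) :
  (forall eps, 0 < eps -> F (fun t => b t < eps)) ->
  F (fun t => Cmod (f t - l) <= b t) -> flim f F l.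
Proof.
  intros Hb H eps He. generalize (filter_and _ _ H (Hb eps He)). apply filter_imp.
  intros t [H1 H2]. lra.
Qed.
End FlimRules.

Lemma flim_unique {T} (F : (T -> Prop) -> Prop) {FF : ProperFilter F} f l m :
  flim f F l -> flim f F m -> l = m.
Proof.
  intros Hl Hm.
  destruct (Req_dec (Cmod (l - m)) 0) as [H|H].
  - apply Cmod_eq_0 in H. replace l with ((l - m) + m)%C by ring. rewrite H. ring.
  - exfalso. assert (Hp : 0 < Cmod (l - m) / 2).
    { generalize (Cmod_ge_0 (l - m)). lra. }
    destruct (filter_ex _ (filter_and _ _ (Hl _ Hp) (Hm _ Hp))) as (t & H1 & H2).
    assert (Cmod (l - m) <= Cmod (f t - l) + Cmod (f t - m)); [|lra].
    replace (l - m)%C with (- (f t - l) + (f t - m))%C by ring.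
    rewrite <- (Cmod_opp (f t - l)). apply Cmod_triangle.
Qed.

Lemma flim_comp {T U} (f : T -> U) (g : U -> C) F G l :
  filterlim f F G -> flim g G l -> flim (fun t => g (f t)) F l.
Proof. intros Hf Hg eps He. apply (Hf _ (Hg eps He)). Qed.

Definition Ccont (f : C -> C) (z : C) : Prop :=
  flim f (locally (T := C_UniformSpace) z) (f z).
Definition Rcont (c : R -> C) (t : R) : Prop := flim c (locally t) (c t).

Lemma flim_Ccont {T} (F : (T -> Prop) -> Prop) {FF : Filter F} (f : T -> C) (g : C -> C) l :
  flim f F l -> Ccont g l -> flim (fun t => g (f t)) F (g l).
Proof. intros Hf Hg. eapply flim_comp; [|exact Hg]. apply flim_filterlim; assumption. Qed.

Lemma Rcont_continuous c t :
  Rcont c t <-> continuous (T := R_UniformSpace) (U := C_UniformSpace) c t.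
Proof. apply flim_filterlim. apply locally_filter. Qed.

Lemma locally_self {T : UniformSpace} (x : T) P : locally x P -> P x.
Proof. apply locally_singleton. Qed.

(** [locally x] is not punctured: [x] belongs to all its neighborhoods, so a limit there is the
    value at [x]. In particular a Caratheodory slope takes the value of the derivative at the base
    point. *)
Lemma flim_self {T : UniformSpace} (f : T -> C) (x : T) l :
  flim f (locally x) l -> f x = l.
Proof.
  intros H. destruct (Req_dec (Cmod (f x - l)) 0) as [E|E].
  - apply Cmod_eq_0 in E. replace (f x) with ((f x - l) + l)%C by ring. rewrite E. ring.
  - exfalso. assert (Hp : 0 < Cmod (f x - l)) by (generalize (Cmod_ge_0 (f x - l)); lra).
    generalize (locally_self x _ (H _ Hp)). lra.
Qed.

(* Derivatives in Caratheodory's form, along a map [i] into [C]: with [i] the identity of [C]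
   this is complex differentiability, with [i] the inclusion of [R] it is the velocity of a
   curve. *)
Definition deriv_along {T : UniformSpace} (i : T -> C) (f : T -> C) (t : T) (l : C) : Prop :=
  exists q : T -> C,
    (forall s, (f s - f t)%C = (q s * (i s - i t))%C) /\ flim q (locally t) l.

Definition Cderiv (f : C -> C) (z l : C) : Prop := deriv_along (T := C_UniformSpace) (fun u : C => u) f z l.
Definition Rderiv (c : R -> C) (t : R) (l : C) : Prop := deriv_along (T := R_UniformSpace) RtoC c t l.

(** The slope is the difference quotient, completed by [l] at [t]; injectivity of [i] at [t] ensures
    that no other point needs the completion. *)
Lemma deriv_along_intro {T : UniformSpace} (i f : T -> C) t l :
  (forall s, i s = i t -> s = t) ->
  (forall eps, 0 < eps ->
     locally t (fun s => Cmod (f s - f t - l * (i s - i t)) <= eps * Cmod (i s - i t))) ->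
  deriv_along i f t l.
Proof.
  intros Hi H.
  exists (fun s => match excluded_middle_informative (i s = i t) with
                   | left _ => l
                   | right _ => (f s - f t) / (i s - i t)
                   end)%C.
  split.
  - intros s. destruct excluded_middle_informative as [E|E].
    + rewrite (Hi s E). ring.
    + field. intros E'. apply E. replace (i s) with ((i s - i t) + i t)%C by ring.
      rewrite E'. ring.
  - intros eps He. generalize (H (eps / 2) (half_pos _ He)). apply filter_imp. intros s Hs.
    destruct excluded_middle_informative as [E|E].
    + replace (l - l)%C with (RtoC 0) by ring. rewrite Cmod_0; exact He.
    + assert (Hn : (i s - i t)%C <> RtoC 0).
      { intros E'. apply E. replace (i s) with ((i s - i t) + i t)%C by ring.
        rewrite E'. ring. }
      assert (Hp : 0 < Cmod (i s - i t)) by (apply Cmod_gt_0; exact Hn).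
      replace ((f s - f t) / (i s - i t) - l)%C
        with ((f s - f t - l * (i s - i t)) / (i s - i t))%C by (field; exact Hn).
      rewrite Cmod_div by exact Hn.
      apply Rle_lt_trans with (eps / 2); [|lra].
      apply Rmult_le_reg_r with (1 := Hp). unfold Rdiv at 1.
      rewrite Rmult_assoc, Rinv_l by lra. lra.
Qed.

Lemma deriv_along_elim {T : UniformSpace} (i f : T -> C) t l :
  deriv_along i f t l -> forall eps, 0 < eps ->
     locally t (fun s => Cmod (f s - f t - l * (i s - i t)) <= eps * Cmod (i s - i t)).
Proof.
  intros (q & Hq & Hl) eps He. generalize (Hl eps He). apply filter_imp. intros s Hs.
  rewrite Hq. replace (q s * (i s - i t) - l * (i s - i t))%C
    with ((q s - l) * (i s - i t))%C by ring.
  rewrite Cmod_mult. apply Rmult_le_compat_r; [apply Cmod_ge_0|lra].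
Qed.

Section GdRules.
Context {T : UniformSpace} (i : T -> C) (t : T) (Hi : flim i (locally t) (i t)).

Lemma deriv_along_cont f l : deriv_along i f t l -> flim f (locally t) (f t).
Proof.
  intros (q & Hq & Hl).
  apply (flim_ext _ (fun s => f t + q s * (i s - i t))%C).
  { intros s. rewrite <- Hq. ring. }
  apply (flim_eq _ _ (f t + l * (i t - i t))%C); [|ring].
  apply flim_plus; [apply _|apply flim_const; apply _|]. apply flim_mult; [apply _|exact Hl|].
  apply flim_minus; [apply _|exact Hi|apply flim_const; apply _].
Qed.

Lemma deriv_along_const c : deriv_along i (fun _ => c) t (RtoC 0).
Proof. exists (fun _ => RtoC 0). split; [intros; ring|apply flim_const; apply _]. Qed.

Lemma deriv_along_id : deriv_along i i t (RtoC 1).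
Proof. exists (fun _ => RtoC 1). split; [intros; ring|apply flim_const; apply _]. Qed.

Lemma deriv_along_plus f g l m :
  deriv_along i f t l -> deriv_along i g t m -> deriv_along i (fun s => f s + g s)%C t (l + m)%C.
Proof.
  intros (q & Hq & Hl) (r & Hr & Hm). exists (fun s => q s + r s)%C. split.
  - intros s. replace (f s + g s - (f t + g t))%C with ((f s - f t) + (g s - g t))%C by ring.
    rewrite Hq, Hr. ring.
  - apply flim_plus; [apply _|exact Hl|exact Hm].
Qed.

Lemma deriv_along_mult f g l m :
  deriv_along i f t l -> deriv_along i g t m -> deriv_along i (fun s => f s * g s)%C t (l * g t + f t * m)%C.
Proof.
  intros Hf (r & Hr & Hm). assert (Cf := deriv_along_cont _ _ Hf). destruct Hf as (q & Hq & Hl).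
  exists (fun s => q s * g t + f s * r s)%C. split.
  - intros s. replace (f s * g s - f t * g t)%C
      with ((f s - f t) * g t + f s * (g s - g t))%C by ring. rewrite Hq, Hr. ring.
  - apply flim_plus; [apply _|apply flim_mult; [apply _|exact Hl|apply flim_const; apply _]|].
    apply flim_mult; [apply _|exact Cf|exact Hm].
Qed.

Lemma deriv_along_scal c f l : deriv_along i f t l -> deriv_along i (fun s => c * f s)%C t (c * l)%C.
Proof.
  intros Hf. replace (c * l)%C with (RtoC 0 * f t + c * l)%C by ring.
  apply (deriv_along_mult (fun _ => c)); [apply deriv_along_const|exact Hf].
Qed.

Lemma deriv_along_opp f l : deriv_along i f t l -> deriv_along i (fun s => - f s)%C t (- l)%C.
Proof.
  intros (q & Hq & Hl). exists (fun s => - q s)%C. split.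
  - intros s. replace (- f s - - f t)%C with (- (f s - f t))%C by ring. rewrite Hq. ring.
  - apply flim_opp; [apply _|exact Hl].
Qed.

Lemma deriv_along_minus f g l m :
  deriv_along i f t l -> deriv_along i g t m -> deriv_along i (fun s => f s - g s)%C t (l - m)%C.
Proof. intros Hf Hg. apply deriv_along_plus; [exact Hf|apply deriv_along_opp; exact Hg]. Qed.

Lemma deriv_along_comp (f : C -> C) g l m :
  Cderiv f (g t) l -> deriv_along i g t m -> deriv_along i (fun s => f (g s)) t (l * m)%C.
Proof.
  intros (q & Hq & Hl) Hg. assert (Cg := deriv_along_cont _ _ Hg). destruct Hg as (r & Hr & Hm).
  exists (fun s => q (g s) * r s)%C. split.
  - intros s. rewrite Hq, Hr. ring.
  - apply flim_mult; [apply _| |exact Hm].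
    (* The slope [q] is continuous at [g t], because its limit there is its value; hence it can be
       composed with [g]. *)
    assert (E := flim_self _ _ _ Hl). rewrite <- E. rewrite <- E in Hl.
    apply (flim_Ccont _ g q (g t) Cg Hl).
Qed.

Lemma deriv_along_ext_loc f g l :
  (forall s, i s = i t -> s = t) ->
  locally t (fun s => f s = g s) -> deriv_along i f t l -> deriv_along i g t l.
Proof.
  intros Hj H Hf. apply deriv_along_intro; [exact Hj|]. intros eps He.
  generalize (filter_and _ _ H (deriv_along_elim _ _ _ _ Hf eps He)). apply filter_imp.
  rewrite <- (locally_self t _ H). intros s [<- Hs]. exact Hs.
Qed.
End GdRules.

Lemma Ccont_id z : flim (fun u : C => u) (locally (T := C_UniformSpace) z) z.
Proof.
  intros e He. apply locally_C_iff. exists e. split; auto.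
Qed.

Lemma Rcont_RtoC t : flim RtoC (locally t) (RtoC t).
Proof.
  intros e He. apply locally_R_iff. exists e. split; auto.
  intros u Hu. rewrite <- RtoC_minus, Cmod_R. exact Hu.
Qed.

(** The identity defining a slope must hold at every point, so [/ u] is first redefined at [0] by
    the value of its tangent at [z]. *)
Lemma Cderiv_inv z : z <> RtoC 0 -> Cderiv (fun u => / u)%C z (- / (z * z))%C.
Proof.
  intros Hz. apply deriv_along_ext_loc with
    (f := fun u => match excluded_middle_informative (u = RtoC 0) with
                   | left _ => (/ z - (u - z) / (z * z))%C | right _ => (/ u)%C end).
  - auto.
  - apply locally_C_iff. exists (Cmod z). split; [apply Cmod_gt_0; exact Hz|].
    intros u Hu. destruct excluded_middle_informative as [->|]; [|reflexivity].
    exfalso. replace (0 - z)%C with (- z)%C in Hu by ring. rewrite Cmod_opp in Hu. lra.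
  - exists (fun u => match excluded_middle_informative (u = RtoC 0) with
                   | left _ => (- / (z * z))%C | right _ => (- / (u * z))%C end).
    split.
    + intros u. destruct (excluded_middle_informative (z = RtoC 0)); [contradiction|].
      destruct excluded_middle_informative as [->|Hu]; field; auto.
    + apply (flim_ext_loc _ (fun u => - / (u * z))%C).
      * apply locally_C_iff. exists (Cmod z). split; [apply Cmod_gt_0; exact Hz|].
        intros u Hu. destruct excluded_middle_informative as [->|]; [|reflexivity].
        exfalso. replace (0 - z)%C with (- z)%C in Hu by ring. rewrite Cmod_opp in Hu. lra.
      * apply flim_opp; [apply _|]. apply flim_inv; [apply _|apply Cmult_neq_0; auto|].
        apply flim_mult; [apply _|apply Ccont_id|apply flim_const; apply _].
Qed.

(** The neighborhoods on the right are those of the absolute ring [C_AbsRing], on the left those of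
    the product; [locally_C] converts between them. *)
Lemma Cderiv_is_derive f z l :
  Cderiv f z l <-> is_derive (K := C_AbsRing) (V := C_NormedModule) f z l.
Proof.
  split.
  - intros H. split; [apply is_linear_scal_l|].
    intros x Hx. apply (is_filter_lim_locally_unique (V := AbsRing_NormedModule C_AbsRing)) in Hx.
    subst x. intros eps. change (locally (T := AbsRing_UniformSpace C_AbsRing) z (fun x =>
      norm (minus (minus (f x) (f z)) (scal (minus x z) l)) <= eps * norm (minus x z))).
    apply locally_C.
    generalize (deriv_along_elim _ _ _ _ H eps (cond_pos eps)). apply filter_imp. intros s Hs.
    change (Cmod ((f s - f z) - (s - z) * l)%C <= eps * Cmod (s - z)%C).
    replace (f s - f z - (s - z) * l)%C with (f s - f z - l * (s - z))%C by ring. exact Hs.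
  - intros [_ H]. apply deriv_along_intro; [auto|]. intros eps He.
    specialize (H z (fun P HP => HP) (mkposreal eps He)).
    apply locally_C in H. revert H. apply filter_imp. intros s Hs.
    change (Cmod ((f s - f z) - (s - z) * l)%C <= eps * Cmod (s - z)%C) in Hs.
    replace (f s - f z - l * (s - z))%C with (f s - f z - (s - z) * l)%C by ring. exact Hs.
Qed.

Lemma Rderiv_is_derive c t l :
  Rderiv c t l <-> is_derive (K := R_AbsRing) (V := C_R_NormedModule) c t l.
Proof.
  assert (E : forall s,
    norm (K := R_AbsRing) (V := C_R_NormedModule)
      (minus (minus (c s) (c t)) (scal (minus s t) l))
    = Cmod (c s - c t - l * (RtoC s - RtoC t))%C).
  { intros s. rewrite norm_C_R. f_equal. destruct (c s), (c t), l.
    unfold minus, plus, opp, scal; simpl.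
    unfold prod_plus, prod_opp, prod_scal, scal, mult, plus, opp; simpl; unfold mult; simpl.
    unfold Cminus, Cplus, Copp, Cmult; simpl. f_equal; ring. }
  split.
  - intros H. split; [apply is_linear_scal_l|].
    intros x Hx. apply (is_filter_lim_locally_unique (V := AbsRing_NormedModule R_AbsRing)) in Hx. subst x.
    intros eps.
    generalize (deriv_along_elim _ _ _ _ H eps (cond_pos eps)). apply filter_imp. intros s Hs.
    rewrite <- RtoC_minus, Cmod_R in Hs. refine (Rle_trans _ _ _ (Req_le _ _ (E s)) _).
    rewrite <- RtoC_minus. exact Hs.
  - intros [_ H]. apply deriv_along_intro; [intros s Hs; apply RtoC_inj; exact Hs|]. intros eps He.
    specialize (H t (fun P HP => HP) (mkposreal eps He)). revert H.
    apply filter_imp. intros s Hs.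
    assert (K := Rle_trans _ _ _ (Req_le _ _ (eq_sym (E s))) Hs).
    rewrite <- RtoC_minus, Cmod_R. rewrite <- RtoC_minus in K. exact K.
Qed.

Lemma Rderiv_pair (c1 c2 : R -> R) t d1 d2 :
  is_derive c1 t d1 -> is_derive c2 t d2 -> Rderiv (fun s => (c1 s, c2 s)) t (d1, d2).
Proof.
  intros H1 H2. apply deriv_along_intro; [intros s Hs; apply RtoC_inj; exact Hs|]. intros eps He.
  destruct H1 as [_ H1], H2 as [_ H2].
  specialize (H1 t (fun P HP => HP) (mkposreal (eps / 2) ltac:(lra))).
  specialize (H2 t (fun P HP => HP) (mkposreal (eps / 2) ltac:(lra))).
  generalize (filter_and _ _ H1 H2). apply filter_imp. intros s [K1 K2].
  unfold norm, minus, plus, opp, scal, mult in K1, K2; simpl in K1, K2.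
  unfold abs, mult in K1, K2; simpl in K1, K2. unfold abs in K1, K2. simpl in K1, K2.
  rewrite <- RtoC_minus, Cmod_R.
  set (a := c1 s - c1 t - d1 * (s - t)). set (b := c2 s - c2 t - d2 * (s - t)).
  replace ((c1 s, c2 s) - (c1 t, c2 t) - (d1, d2) * RtoC (s - t))%C
    with (RtoC a + RtoC b * Ci)%C.
  2:{ unfold a, b. apply injective_projections; simpl; ring. }
  eapply Rle_trans; [apply Cmod_triangle|]. rewrite Cmod_mult, Cmod_Ci, !Cmod_R.
  replace a with (c1 s + - c1 t + - ((s + - t) * d1)) by (unfold a; ring).
  replace b with (c2 s + - c2 t + - ((s + - t) * d2)) by (unfold b; ring).
  unfold Rminus. lra.
Qed.

Lemma Rderiv_fst c t l : Rderiv c t l -> is_derive (fun s => Re (c s)) t (Re l).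
Proof.
  intros H. split; [apply is_linear_scal_l|].
  intros x Hx. apply (is_filter_lim_locally_unique (V := AbsRing_NormedModule R_AbsRing)) in Hx. subst x. intros eps.
  generalize (deriv_along_elim _ _ _ _ H eps (cond_pos eps)). apply filter_imp. intros s Hs.
  rewrite <- RtoC_minus, Cmod_R in Hs.
  eapply Rle_trans; [|exact Hs]. eapply Rle_trans; [|apply re_le_Cmod].
  right. unfold minus, plus, opp, scal; simpl. unfold mult, norm; simpl. unfold abs; simpl.
  unfold Re, Im. f_equal. ring.
Qed.

Lemma im_le_Cmod z : Rabs (Im z) <= Cmod z.
Proof. eapply Rle_trans; [|apply Rmax_Cmod]. apply Rmax_r. Qed.

Lemma Rderiv_snd c t l : Rderiv c t l -> is_derive (fun s => Im (c s)) t (Im l).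
Proof.
  intros H. split; [apply is_linear_scal_l|].
  intros x Hx. apply (is_filter_lim_locally_unique (V := AbsRing_NormedModule R_AbsRing)) in Hx. subst x. intros eps.
  generalize (deriv_along_elim _ _ _ _ H eps (cond_pos eps)). apply filter_imp. intros s Hs.
  rewrite <- RtoC_minus, Cmod_R in Hs.
  eapply Rle_trans; [|exact Hs]. eapply Rle_trans; [|apply im_le_Cmod].
  right. unfold minus, plus, opp, scal; simpl. unfold mult, norm; simpl. unfold abs; simpl.
  unfold Re, Im. f_equal. ring.
Qed.

Lemma Cmod_le_abs z : Cmod z <= Rabs (Re z) + Rabs (Im z).
Proof.
  destruct z as [x y]. simpl. replace (x, y) with (RtoC x + RtoC y * Ci)%C.
  - eapply Rle_trans; [apply Cmod_triangle|]. rewrite Cmod_mult, Cmod_Ci, !Cmod_R. lra.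
  - apply injective_projections; simpl; ring.
Qed.

Lemma Rcont_pair (c1 c2 : R -> R) t :
  continuous c1 t -> continuous c2 t -> Rcont (fun s => (c1 s, c2 s)) t.
Proof.
  intros H1 H2. apply Rcont_continuous.
  intros P [d Hd]. assert (K1 := H1 _ (locally_ball (c1 t) d)).
  assert (K2 := H2 _ (locally_ball (c2 t) d)). unfold filtermap in *.
  generalize (filter_and _ _ K1 K2). apply filter_imp. intros s [B1 B2].
  apply Hd. split; assumption.
Qed.

(** * Integrals of curves in C *)

Notation is_CI f a b l := (is_RInt (V := C_R_NormedModule) f a b l).
Notation CI f a b := (RInt (V := C_R_CompleteNormedModule) f a b).

Lemma is_CI_unique (f : R -> C) a b (l m : C) : is_CI f a b l -> is_CI f a b m -> l = m.
Proof.
  intros H1 H2.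
  rewrite <- (is_RInt_unique (V := C_R_CompleteNormedModule) f a b l H1).
  apply (is_RInt_unique (V := C_R_CompleteNormedModule) f a b m H2).
Qed.

Lemma is_CI_CI (f : R -> C) a b (l : C) : is_CI f a b l -> CI f a b = l.
Proof. intros H. apply (is_RInt_unique (V := C_R_CompleteNormedModule) f a b l H). Qed.

Lemma is_CI_cont f a b :
  (forall t, Rmin a b <= t <= Rmax a b -> Rcont f t) -> is_CI f a b (CI f a b).
Proof.
  intros H. apply (RInt_correct (V := C_R_CompleteNormedModule)).
  apply (ex_RInt_continuous (V := C_R_CompleteNormedModule)).
  intros t Ht. apply Rcont_continuous. apply H; exact Ht.
Qed.

Lemma is_CI_plus f g a b l m :
  is_CI f a b l -> is_CI g a b m -> is_CI (fun t => f t + g t)%C a b (l + m)%C.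
Proof. apply (is_RInt_plus (V := C_R_NormedModule)). Qed.

Lemma is_CI_minus f g a b l m :
  is_CI f a b l -> is_CI g a b m -> is_CI (fun t => f t - g t)%C a b (l - m)%C.
Proof. apply (is_RInt_minus (V := C_R_NormedModule)). Qed.

Lemma is_CI_Chasles f a b c l m :
  is_CI f a b l -> is_CI f b c m -> is_CI f a c (l + m)%C.
Proof. apply (is_RInt_Chasles (V := C_R_NormedModule)). Qed.

Lemma is_CI_swap f a b l : is_CI f b a l -> is_CI f a b (- l)%C.
Proof. apply (is_RInt_swap (V := C_R_NormedModule)). Qed.

Lemma is_CI_point f a : is_CI f a a (RtoC 0).
Proof. apply (is_RInt_point (V := C_R_NormedModule)). Qed.

Lemma is_CI_const c a b : is_CI (fun _ => c) a b (RtoC (b - a) * c)%C.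
Proof.
  assert (H := is_RInt_const (V := C_R_NormedModule) a b c).
  replace (RtoC (b - a) * c)%C with (scal (V := C_R_NormedModule) (b - a) c); [exact H|].
  apply injective_projections; simpl; unfold scal; simpl; unfold mult; simpl; ring.
Qed.

Lemma is_CI_pair f a b l :
  is_RInt (fun t => Re (f t)) a b (Re l) -> is_RInt (fun t => Im (f t)) a b (Im l) ->
  is_CI f a b l.
Proof.
  intros H1 H2. rewrite (surjective_pairing l).
  apply (is_RInt_fct_extend_pair (U := R_NormedModule) (V := R_NormedModule)); assumption.
Qed.

Lemma is_CI_Re f a b l : is_CI f a b l -> is_RInt (fun t => Re (f t)) a b (Re l).
Proof. apply (is_RInt_fct_extend_fst (U := R_NormedModule) (V := R_NormedModule)). Qed.

Lemma is_CI_Im f a b l : is_CI f a b l -> is_RInt (fun t => Im (f t)) a b (Im l).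
Proof. apply (is_RInt_fct_extend_snd (U := R_NormedModule) (V := R_NormedModule)). Qed.

(** [C_R_NormedModule] has real scalars, so a complex factor goes through real and imaginary
    parts. *)
Lemma is_CI_scal c f a b l : is_CI f a b l -> is_CI (fun t => c * f t)%C a b (c * l)%C.
Proof.
  intros H. assert (H1 := is_CI_Re _ _ _ _ H). assert (H2 := is_CI_Im _ _ _ _ H).
  apply is_CI_pair.
  - exact (is_RInt_minus _ _ _ _ _ _ (is_RInt_scal _ _ _ (Re c) _ H1)
             (is_RInt_scal _ _ _ (Im c) _ H2)).
  - exact (is_RInt_plus _ _ _ _ _ _ (is_RInt_scal _ _ _ (Re c) _ H2)
             (is_RInt_scal _ _ _ (Im c) _ H1)).
Qed.

Lemma is_CI_ext (f g : R -> C) a b (l : C) :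
  (forall t, Rmin a b < t < Rmax a b -> f t = g t) -> is_CI f a b l -> is_CI g a b l.
Proof. apply (is_RInt_ext (V := C_R_NormedModule)). Qed.

Lemma is_CI_le f (g : R -> R) a b l m :
  a <= b -> (forall t, a <= t <= b -> Cmod (f t) <= g t) ->
  is_CI f a b l -> is_RInt g a b m -> Cmod l <= m.
Proof.
  intros Hab H Hf Hg. rewrite <- norm_C_R.
  apply (norm_RInt_le (V := C_R_NormedModule) f g a b l m Hab); try assumption.
  intros t Ht. rewrite norm_C_R. apply H; exact Ht.
Qed.

Lemma is_CI_le_const f a b l M :
  a <= b -> (forall t, a <= t <= b -> Cmod (f t) <= M) -> is_CI f a b l ->
  Cmod l <= (b - a) * M.
Proof.
  intros Hab H Hf. apply (is_CI_le f (fun _ => M) a b l); auto.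
  apply (is_RInt_const (V := R_NormedModule)).
Qed.

Lemma CI_FTC (c d : R -> C) a b :
  (forall t, Rmin a b <= t <= Rmax a b -> Rderiv c t (d t)) ->
  (forall t, Rmin a b <= t <= Rmax a b -> Rcont d t) ->
  is_CI d a b (c b - c a)%C.
Proof.
  intros H1 H2.
  apply (is_RInt_derive (V := C_R_CompleteNormedModule)).
  - intros t Ht. apply Rderiv_is_derive. apply H1; exact Ht.
  - intros t Ht. apply Rcont_continuous. apply H2; exact Ht.
Qed.

Lemma mean_value (c d : R -> C) a b M : a <= b ->
  (forall t, a <= t <= b -> Rderiv c t (d t)) -> (forall t, a <= t <= b -> Rcont d t) ->
  (forall t, a <= t <= b -> Cmod (d t) <= M) -> Cmod (c b - c a)%C <= (b - a) * M.
Proof.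
  intros Hab H1 H2 H3. apply (is_CI_le_const d a b); auto.
  apply CI_FTC; rewrite Rmin_left, Rmax_right by exact Hab; assumption.
Qed.

Definition clamp (a b t : R) : R := Rmax a (Rmin b t).

Lemma clamp_in a b t : a <= b -> a <= clamp a b t <= b.
Proof. intros. unfold clamp, Rmax, Rmin. repeat destruct Rle_dec; lra. Qed.

Lemma clamp_id a b t : a <= t <= b -> clamp a b t = t.
Proof. intros. unfold clamp, Rmax, Rmin. repeat destruct Rle_dec; lra. Qed.

Lemma clamp_lip a b s t : Rabs (clamp a b s - clamp a b t) <= Rabs (s - t).
Proof. unfold clamp, Rmax, Rmin, Rabs. repeat destruct Rle_dec; repeat destruct Rcase_abs; lra. Qed.

Definition Rcont_on (f : R -> C) (a b : R) : Prop :=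
  forall t, a <= t <= b -> flim f (within (fun s => a <= s <= b) (locally t)) (f t).

Lemma Rcont_on_clamp f a b : a <= b -> Rcont_on f a b ->
  forall t, Rcont (fun s => f (clamp a b s)) t.
Proof.
  intros Hab H t eps He.
  specialize (H _ (clamp_in a b t Hab) eps He). unfold within in H.
  apply locally_R_iff in H. destruct H as (d & Hd & H).
  apply locally_R_iff. exists d. split; [exact Hd|]. intros s Hs. apply H.
  - eapply Rle_lt_trans; [apply clamp_lip|exact Hs].
  - apply clamp_in; exact Hab.
Qed.

(** Composition with the projection [clamp] onto the interval makes the function continuous on the
    whole line without changing its integral. *)
Lemma is_CI_cont_on f a b : a <= b -> Rcont_on f a b -> is_CI f a b (CI f a b).
Proof.
  intros Hab H. apply (RInt_correct (V := C_R_CompleteNormedModule)).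
  exists (CI (fun s => f (clamp a b s)) a b).
  apply (is_CI_ext (fun s => f (clamp a b s))).
  - intros t Ht. rewrite Rmin_left, Rmax_right in Ht by exact Hab.
    rewrite clamp_id by lra. reflexivity.
  - apply is_CI_cont. intros t _. apply Rcont_on_clamp; assumption.
Qed.

(** * The complex exponential *)

Lemma Cexp_plus z w : Cexp (z + w)%C = (Cexp z * Cexp w)%C.
Proof.
  unfold Cexp. destruct z as [a b], w as [c d]. simpl.
  rewrite exp_plus, cos_plus, sin_plus. apply injective_projections; simpl; ring.
Qed.

Lemma Cexp_0 : Cexp (RtoC 0) = RtoC 1.
Proof. unfold Cexp. simpl. rewrite exp_0, cos_0, sin_0. apply injective_projections; simpl; ring. Qed.

Lemma Cmod_Cexp z : Cmod (Cexp z) = exp (Re z).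
Proof.
  unfold Cexp, Cmod. simpl.
  replace (_ + _) with (Rsqr (exp (Re z))).
  - apply sqrt_Rsqr. left; apply exp_pos.
  - generalize (sin2_cos2 (Im z)). unfold Rsqr. intros E.
    transitivity (exp (Re z) * exp (Re z) * (sin (Im z) * sin (Im z) + cos (Im z) * cos (Im z)));
      [rewrite E; ring|ring].
Qed.

(** The only derivative computed from [exp], [cos] and [sin]. The mean value inequality on [[0, 1]]
    turns it into bounds on [Cexp z - 1] and [Cexp z - 1 - z], and these give the complex
    derivative. *)
Lemma Rderiv_Cexp_line z t : Rderiv (fun s => Cexp (RtoC s * z)) t (z * Cexp (RtoC t * z))%C.
Proof.
  destruct z as [a b].
  apply (deriv_along_ext_loc RtoC t (fun s => (exp (s * a) * cos (s * b), exp (s * a) * sin (s * b)))).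
  - intros s Hs. apply RtoC_inj; exact Hs.
  - apply filter_forall. intros s. unfold Cexp. simpl.
    apply injective_projections; simpl; f_equal; f_equal; ring.
  - replace ((a, b) * Cexp (RtoC t * (a, b)))%C with
      (a * exp (t * a) * cos (t * b) - exp (t * a) * (b * sin (t * b)),
       a * exp (t * a) * sin (t * b) + exp (t * a) * (b * cos (t * b))).
    + apply Rderiv_pair; auto_derive; trivial; ring.
    + unfold Cexp; simpl. replace (t * a - 0 * b) with (t * a) by ring.
      replace (t * b + 0 * a) with (t * b) by ring.
      apply injective_projections; simpl; ring.
Qed.

Lemma Rcont_of_Rd c t l : Rderiv c t l -> Rcont c t.
Proof. intros H. exact (deriv_along_cont RtoC t (Rcont_RtoC t) c l H). Qed.

Lemma Ccont_of_Cd f z l : Cderiv f z l -> Ccont f z.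
Proof. intros H. exact (deriv_along_cont (fun u => u) z (Ccont_id z) f l H). Qed.

Lemma exp_le_max (t x : R) : 0 <= t <= 1 -> exp (t * x) <= Rmax 1 (exp x).
Proof.
  intros Ht. destruct (Rle_dec x 0) as [H|H].
  - apply Rle_trans with 1; [|apply Rmax_l]. rewrite <- exp_0.
    destruct (Req_dec (t * x) 0) as [->|]; [lra|]. left; apply exp_increasing. nra.
  - apply Rle_trans with (exp x); [|apply Rmax_r].
    destruct (Req_dec (t * x) x) as [->|]; [lra|]. left; apply exp_increasing. nra.
Qed.

(** The factor is [Rmax 1 (exp (Re z))] rather than [exp (Cmod z)]: multiplied by the modulus of a
    Laplace kernel at [p], with [z = - (q - p) * u], it gives the larger of the moduli at [p] and at
    [q], both of which are under control. *)
Lemma Cexp_minus_1 z : Cmod (Cexp z - 1)%C <= Cmod z * Rmax 1 (exp (Re z)).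
Proof.
  replace (Cexp z - 1)%C with (Cexp (RtoC 1 * z) - Cexp (RtoC 0 * z))%C.
  2:{ rewrite Cmult_1_l, Cmult_0_l, Cexp_0. reflexivity. }
  replace (Cmod z * Rmax 1 (exp (Re z))) with ((1 - 0) * (Cmod z * Rmax 1 (exp (Re z)))) by ring.
  apply (mean_value (fun s => Cexp (RtoC s * z)) (fun s => z * Cexp (RtoC s * z))%C); [lra|..].
  - intros t _. apply Rderiv_Cexp_line.
  - intros t _. apply flim_mult; [apply _|apply flim_const; apply _|].
    apply (Rcont_of_Rd _ _ _ (Rderiv_Cexp_line z t)).
  - intros t Ht. rewrite Cmod_mult, Cmod_Cexp. apply Rmult_le_compat_l; [apply Cmod_ge_0|].
    replace (Re (RtoC t * z)) with (t * Re z) by (simpl; unfold Re; ring).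
    apply exp_le_max; exact Ht.
Qed.

(** The mean value inequality is applied to [Cexp (s z) - s z], whose derivative
    [z * (Cexp (s z) - 1)] is bounded by [Cexp_minus_1]. *)
Lemma Cexp_taylor z : Cmod (Cexp z - 1 - z)%C <= Cmod z * Cmod z * Rmax 1 (exp (Re z)).
Proof.
  assert (HM : 1 <= Rmax 1 (exp (Re z))) by apply Rmax_l.
  replace (Cexp z - 1 - z)%C
    with ((Cexp (RtoC 1 * z) - RtoC 1 * z) - (Cexp (RtoC 0 * z) - RtoC 0 * z))%C.
  2:{ rewrite !Cmult_1_l, !Cmult_0_l, Cexp_0. ring. }
  replace (Cmod z * Cmod z * Rmax 1 (exp (Re z)))
    with ((1 - 0) * (Cmod z * (Cmod z * Rmax 1 (exp (Re z))))) by ring.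
  apply (mean_value (fun s => Cexp (RtoC s * z) - RtoC s * z)%C
           (fun s => z * (Cexp (RtoC s * z) - 1))%C); [lra|..].
  - intros t _. replace (z * (Cexp (RtoC t * z) - 1))%C
      with (z * Cexp (RtoC t * z) - (RtoC 1 * z + RtoC t * RtoC 0))%C by ring.
    apply deriv_along_minus; [apply Rderiv_Cexp_line|]. apply (deriv_along_mult RtoC t (Rcont_RtoC t) RtoC (fun _ => z)).
    + apply deriv_along_id.
    + apply deriv_along_const.
  - intros t _. apply flim_mult; [apply _|apply flim_const; apply _|].
    apply flim_minus; [apply _|apply (Rcont_of_Rd _ _ _ (Rderiv_Cexp_line z t))|apply flim_const; apply _].
  - intros t Ht. rewrite Cmod_mult. apply Rmult_le_compat_l; [apply Cmod_ge_0|].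
    eapply Rle_trans; [apply Cexp_minus_1|].
    rewrite Cmod_mult, Cmod_R, Rabs_pos_eq by lra.
    replace (Re (RtoC t * z)) with (t * Re z) by (simpl; unfold Re; ring).
    assert (Rmax 1 (exp (t * Re z)) <= Rmax 1 (exp (Re z))).
    { apply Rmax_lub; [exact HM|apply exp_le_max; exact Ht]. }
    assert (0 <= Rmax 1 (exp (t * Re z))) by (eapply Rle_trans; [|apply Rmax_l]; lra).
    apply Rmult_le_compat; auto.
    + apply Rmult_le_pos; [lra|apply Cmod_ge_0].
    + generalize (Cmod_ge_0 z). nra.
Qed.

Lemma Cderiv_Cexp z : Cderiv Cexp z (Cexp z).
Proof.
  apply deriv_along_intro; [auto|]. intros eps He.
  assert (Hz : 0 < Cmod (Cexp z) * exp 1).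
  { apply Rmult_lt_0_compat; [rewrite Cmod_Cexp|]; apply exp_pos. }
  (* The radius [1] keeps the exponential factor of [Cexp_taylor] below [exp 1]. *)
  apply locally_C_iff. exists (Rmin 1 (eps / (Cmod (Cexp z) * exp 1))). split.
  { apply Rmin_pos; [lra|]. apply Rdiv_lt_0_compat; lra. }
  intros u Hu.
  assert (H1 : Cmod (u - z) < 1) by (eapply Rlt_le_trans; [exact Hu|apply Rmin_l]).
  assert (H2 : Cmod (u - z) < eps / (Cmod (Cexp z) * exp 1))
    by (eapply Rlt_le_trans; [exact Hu|apply Rmin_r]).
  replace (Cexp u - Cexp z - Cexp z * (u - z))%C
    with (Cexp z * (Cexp (u - z) - 1 - (u - z)))%C.
  2:{ replace u with (z + (u - z))%C at 3 by ring. rewrite Cexp_plus. ring. }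
  rewrite Cmod_mult.
  assert (H3 : Rmax 1 (exp (Re (u - z))) <= exp 1).
  { apply Rmax_lub.
    - rewrite <- exp_0 at 1. left; apply exp_increasing; lra.
    - assert (Re (u - z) <= Cmod (u - z)).
      { eapply Rle_trans; [apply Rle_abs|apply re_le_Cmod]. }
      left; apply exp_increasing; lra. }
  assert (H4 := Cexp_taylor (u - z)).
  assert (H5 : Cmod (u - z) * (Cmod (Cexp z) * exp 1) <= eps).
  { apply Rmult_le_reg_r with (/ (Cmod (Cexp z) * exp 1)); [apply Rinv_0_lt_compat; exact Hz|].
    rewrite Rmult_assoc, Rinv_r by lra. unfold Rdiv in H2. lra. }
  assert (H0 := Cmod_ge_0 (u - z)). assert (H6 := Cmod_ge_0 (Cexp z)).
  apply Rle_trans with (Cmod (Cexp z) * (Cmod (u - z) * Cmod (u - z) * exp 1)).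
  - apply Rmult_le_compat_l; [exact H6|]. eapply Rle_trans; [exact H4|].
    apply Rmult_le_compat_l; [apply Rmult_le_pos; exact H0|exact H3].
  - replace (Cmod (Cexp z) * (Cmod (u - z) * Cmod (u - z) * exp 1))
      with ((Cmod (u - z) * (Cmod (Cexp z) * exp 1)) * Cmod (u - z)) by ring.
    apply Rmult_le_compat_r; [exact H0|exact H5].
Qed.

Lemma Rderiv_RtoC t : Rderiv RtoC t (RtoC 1).
Proof. exact (deriv_along_id RtoC t). Qed.

Lemma Cderiv_comp (f g : C -> C) z l m :
  Cderiv f (g z) l -> Cderiv g z m -> Cderiv (fun u => f (g u)) z (l * m)%C.
Proof. exact (deriv_along_comp (fun u : C => u) z (Ccont_id z) f g l m). Qed.

Lemma Rderiv_comp (f : C -> C) (c : R -> C) t l m :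
  Cderiv f (c t) l -> Rderiv c t m -> Rderiv (fun s => f (c s)) t (l * m)%C.
Proof. exact (deriv_along_comp RtoC t (Rcont_RtoC t) f c l m). Qed.

Lemma Rcont_comp (f : C -> C) (c : R -> C) t : Ccont f (c t) -> Rcont c t -> Rcont (fun s => f (c s)) t.
Proof. intros Hf Hc. exact (flim_Ccont (locally t) c f (c t) Hc Hf). Qed.

Lemma Ccont_comp (f g : C -> C) z : Ccont f (g z) -> Ccont g z -> Ccont (fun s => f (g s)) z.
Proof.
  intros Hf Hg. exact (flim_Ccont (locally (T := C_UniformSpace) z) g f (g z) Hg Hf).
Qed.

Lemma deriv_along_eq {T : UniformSpace} (i f : T -> C) t l m : deriv_along i f t l -> l = m -> deriv_along i f t m.
Proof. intros H <-. exact H. Qed.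

Lemma affine_Rd w1 v t : Rderiv (fun t => w1 + RtoC t * v)%C t v.
Proof.
  apply (deriv_along_eq _ _ _ (RtoC 0 + (RtoC 1 * v + RtoC t * RtoC 0))%C); [|ring].
  apply deriv_along_plus; [apply deriv_along_const|].
  apply (deriv_along_mult RtoC t (Rcont_RtoC t) RtoC (fun _ => v)); [apply deriv_along_id|apply deriv_along_const].
Qed.

Definition Csegment (z z' : C) (s : R) : C := (z + RtoC s * (z' - z))%C.

Lemma Cmod_segment_bound (Q q : C -> C) z z' M :
  (forall s, 0 <= s <= 1 -> Cderiv Q (Csegment z z' s) (q (Csegment z z' s)) /\
     Ccont q (Csegment z z' s) /\ Cmod (q (Csegment z z' s)) <= M) ->
  Cmod (Q z' - Q z) <= Cmod (z' - z) * M.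
Proof.
  intros Hs.
  assert (E1 : Csegment z z' 1 = z') by (unfold Csegment; ring).
  assert (E0 : Csegment z z' 0 = z) by (unfold Csegment; ring).
  rewrite <- E1 at 1. rewrite <- E0 at 2.
  replace (Cmod (z' - z) * M) with ((1 - 0) * (M * Cmod (z' - z))) by ring.
  apply (mean_value (fun s => Q (Csegment z z' s)) (fun s => q (Csegment z z' s) * (z' - z))%C); [lra|..].
  - intros t Ht. apply (Rderiv_comp Q); [apply Hs; exact Ht|apply affine_Rd].
  - intros t Ht. apply flim_mult; [apply _| |apply flim_const; apply _].
    apply (Rcont_comp q (Csegment z z')); [apply Hs; exact Ht|].
    apply (Rcont_of_Rd _ _ _ (affine_Rd z (z' - z)%C t)).
  - intros t Ht. rewrite Cmod_mult. apply Rmult_le_compat_r; [apply Cmod_ge_0|apply Hs; exact Ht].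
Qed.

(** * Goursat's lemma and primitives *)

Lemma Rderiv_horizontal y t : Rderiv (fun s => (s, y)) t (RtoC 1).
Proof. apply Rderiv_pair; auto_derive; trivial. Qed.

Lemma Rderiv_vertical x t : Rderiv (fun s => (x, s)) t Ci.
Proof. apply Rderiv_pair; auto_derive; trivial. Qed.

(** The boundary is run counterclockwise: bottom, right, top, left. *)
Definition rect_int (f : C -> C) (a b c d : R) : C :=
  (CI (fun s => f (s, c)) a b + Ci * CI (fun s => f (b, s)) c d
   - CI (fun s => f (s, d)) a b - Ci * CI (fun s => f (a, s)) c d)%C.

Definition cont_rect (f : C -> C) (a b c d : R) : Prop :=
  forall x y, a <= x <= b -> c <= y <= d -> Ccont f (x, y).

Lemma cont_rect_sub f a b c d a' b' c' d' :
  cont_rect f a b c d -> a <= a' -> b' <= b -> c <= c' -> d' <= d -> cont_rect f a' b' c' d'.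
Proof. intros H ? ? ? ? x y Hx Hy. apply H; lra. Qed.

Lemma is_CI_hor f a b y :
  (forall x, Rmin a b <= x <= Rmax a b -> Ccont f (x, y)) ->
  is_CI (fun s => f (s, y)) a b (CI (fun s => f (s, y)) a b).
Proof.
  intros H. apply is_CI_cont. intros t Ht.
  apply (Rcont_comp f (fun s => (s, y))); [apply H; exact Ht|].
  apply (Rcont_of_Rd _ _ _ (Rderiv_horizontal y t)).
Qed.

Lemma is_CI_ver f c d x :
  (forall y, Rmin c d <= y <= Rmax c d -> Ccont f (x, y)) ->
  is_CI (fun s => f (x, s)) c d (CI (fun s => f (x, s)) c d).
Proof.
  intros H. apply is_CI_cont. intros t Ht.
  apply (Rcont_comp f (fun s => (x, s))); [apply H; exact Ht|].
  apply (Rcont_of_Rd _ _ _ (Rderiv_vertical x t)).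
Qed.

Lemma is_CI_horizontal f a b y : a <= b ->
  (forall x, a <= x <= b -> Ccont f (x, y)) ->
  is_CI (fun s => f (s, y)) a b (CI (fun s => f (s, y)) a b).
Proof. intros Hab H. apply is_CI_hor. rewrite Rmin_left, Rmax_right by exact Hab. exact H. Qed.

Lemma is_CI_vertical f c d x : c <= d ->
  (forall y, c <= y <= d -> Ccont f (x, y)) ->
  is_CI (fun s => f (x, s)) c d (CI (fun s => f (x, s)) c d).
Proof. intros Hcd H. apply is_CI_ver. rewrite Rmin_left, Rmax_right by exact Hcd. exact H. Qed.

Lemma rect_int_split_x f a m b c d : a <= m <= b -> c <= d -> cont_rect f a b c d ->
  rect_int f a b c d = (rect_int f a m c d + rect_int f m b c d)%C.
Proof.
  intros Hm Hcd H. unfold rect_int.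
  rewrite (is_CI_CI (fun s => f (s, c)) a b
    (CI (fun s => f (s, c)) a m + CI (fun s => f (s, c)) m b)%C).
  2:{ apply is_CI_Chasles with m; apply is_CI_horizontal; try lra; intros; apply H; lra. }
  rewrite (is_CI_CI (fun s => f (s, d)) a b
    (CI (fun s => f (s, d)) a m + CI (fun s => f (s, d)) m b)%C).
  2:{ apply is_CI_Chasles with m; apply is_CI_horizontal; try lra; intros; apply H; lra. }
  ring.
Qed.

Lemma rect_int_split_y f a b c n d : a <= b -> c <= n <= d -> cont_rect f a b c d ->
  rect_int f a b c d = (rect_int f a b c n + rect_int f a b n d)%C.
Proof.
  intros Hab Hn H. unfold rect_int.
  rewrite (is_CI_CI (fun s => f (a, s)) c d
    (CI (fun s => f (a, s)) c n + CI (fun s => f (a, s)) n d)%C).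
  2:{ apply is_CI_Chasles with n; apply is_CI_vertical; try lra; intros; apply H; lra. }
  rewrite (is_CI_CI (fun s => f (b, s)) c d
    (CI (fun s => f (b, s)) c n + CI (fun s => f (b, s)) n d)%C).
  2:{ apply is_CI_Chasles with n; apply is_CI_vertical; try lra; intros; apply H; lra. }
  ring.
Qed.

Lemma rect_int_bound f a b c d M : a <= b -> c <= d -> cont_rect f a b c d ->
  (forall x y, a <= x <= b -> c <= y <= d -> Cmod (f (x, y)) <= M) ->
  Cmod (rect_int f a b c d) <= 2 * ((b - a) + (d - c)) * M.
Proof.
  intros Hab Hcd H HM. unfold rect_int, Cminus.
  assert (H1 : Cmod (CI (fun s => f (s, c)) a b) <= (b - a) * M).
  { apply (is_CI_le_const (fun s => f (s, c)) a b); auto.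
    - intros t Ht; apply HM; lra.
    - apply is_CI_horizontal; auto. intros; apply H; lra. }
  assert (H2 : Cmod (CI (fun s => f (s, d)) a b) <= (b - a) * M).
  { apply (is_CI_le_const (fun s => f (s, d)) a b); auto.
    - intros t Ht; apply HM; lra.
    - apply is_CI_horizontal; auto. intros; apply H; lra. }
  assert (H3 : Cmod (CI (fun s => f (a, s)) c d) <= (d - c) * M).
  { apply (is_CI_le_const (fun s => f (a, s)) c d); auto.
    - intros t Ht; apply HM; lra.
    - apply is_CI_vertical; auto. intros; apply H; lra. }
  assert (H4 : Cmod (CI (fun s => f (b, s)) c d) <= (d - c) * M).
  { apply (is_CI_le_const (fun s => f (b, s)) c d); auto.
    - intros t Ht; apply HM; lra.
    - apply is_CI_vertical; auto. intros; apply H; lra. }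
  eapply Rle_trans; [apply Cmod_triangle|]. rewrite Cmod_opp, Cmod_mult, Cmod_Ci.
  eapply Rle_trans; [apply Rplus_le_compat_r; apply Cmod_triangle|]. rewrite Cmod_opp.
  eapply Rle_trans; [apply Rplus_le_compat_r; apply Rplus_le_compat_r; apply Cmod_triangle|].
  rewrite Cmod_mult, Cmod_Ci. lra.
Qed.

Lemma rect_int_minus f g a b c d : a <= b -> c <= d -> cont_rect f a b c d -> cont_rect g a b c d ->
  rect_int (fun z => f z - g z)%C a b c d = (rect_int f a b c d - rect_int g a b c d)%C.
Proof.
  intros Hab Hcd Hf Hg. unfold rect_int.
  rewrite (is_CI_CI (fun s => f (s, c) - g (s, c))%C a b
    (CI (fun s => f (s, c)) a b - CI (fun s => g (s, c)) a b)%C).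
  2:{ apply is_CI_minus; apply is_CI_horizontal; try lra; intros; [apply Hf|apply Hg]; lra. }
  rewrite (is_CI_CI (fun s => f (s, d) - g (s, d))%C a b
    (CI (fun s => f (s, d)) a b - CI (fun s => g (s, d)) a b)%C).
  2:{ apply is_CI_minus; apply is_CI_horizontal; try lra; intros; [apply Hf|apply Hg]; lra. }
  rewrite (is_CI_CI (fun s => f (a, s) - g (a, s))%C c d
    (CI (fun s => f (a, s)) c d - CI (fun s => g (a, s)) c d)%C).
  2:{ apply is_CI_minus; apply is_CI_vertical; try lra; intros; [apply Hf|apply Hg]; lra. }
  rewrite (is_CI_CI (fun s => f (b, s) - g (b, s))%C c d
    (CI (fun s => f (b, s)) c d - CI (fun s => g (b, s)) c d)%C).
  2:{ apply is_CI_minus; apply is_CI_vertical; try lra; intros; [apply Hf|apply Hg]; lra. }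
  ring.
Qed.

Lemma CI_horizontal_primitive F f a b y : a <= b ->
  (forall x, a <= x <= b -> Cderiv F (x, y) (f (x, y)) /\ Ccont f (x, y)) ->
  is_CI (fun s => f (s, y)) a b (F (b, y) - F (a, y))%C.
Proof.
  intros Hab H.
  apply (CI_FTC (fun s => F (s, y)) (fun s => f (s, y))); rewrite Rmin_left, Rmax_right by auto.
  - intros t Ht. rewrite <- (Cmult_1_r (f (t, y))).
    apply (Rderiv_comp F (fun s => (s, y))); [apply H; exact Ht|apply Rderiv_horizontal].
  - intros t Ht. apply (Rcont_comp f (fun s => (s, y))); [apply H; exact Ht|].
    apply (Rcont_of_Rd _ _ _ (Rderiv_horizontal y t)).
Qed.

Lemma CI_vertical_primitive F f c d x : c <= d ->
  (forall y, c <= y <= d -> Cderiv F (x, y) (f (x, y)) /\ Ccont f (x, y)) ->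
  is_CI (fun s => Ci * f (x, s))%C c d (F (x, d) - F (x, c))%C.
Proof.
  intros Hab H.
  apply (CI_FTC (fun s => F (x, s)) (fun s => Ci * f (x, s))%C); rewrite Rmin_left, Rmax_right by auto.
  - intros t Ht. rewrite Cmult_comm.
    apply (Rderiv_comp F (fun s => (x, s))); [apply H; exact Ht|apply Rderiv_vertical].
  - intros t Ht. apply flim_mult; [apply _|apply flim_const; apply _|].
    apply (Rcont_comp f (fun s => (x, s))); [apply H; exact Ht|].
    apply (Rcont_of_Rd _ _ _ (Rderiv_vertical x t)).
Qed.

Lemma rect_int_primitive F f a b c d : a <= b -> c <= d ->
  (forall z, Cderiv F z (f z)) -> (forall z, Ccont f z) -> rect_int f a b c d = RtoC 0.
Proof.
  intros Hab Hcd HF Hf. unfold rect_int.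
  assert (V : forall x, (Ci * CI (fun s => f (x, s)) c d)%C = (F (x, d) - F (x, c))%C).
  { intros x. apply (is_CI_unique (fun s => Ci * f (x, s))%C c d).
    - apply is_CI_scal. apply is_CI_vertical; auto.
    - apply CI_vertical_primitive; auto. }
  rewrite !V.
  rewrite (is_CI_CI _ _ _ _ (CI_horizontal_primitive F f a b c Hab ltac:(auto))).
  rewrite (is_CI_CI _ _ _ _ (CI_horizontal_primitive F f a b d Hab ltac:(auto))).
  ring.
Qed.

Lemma nested_intervals (a b : nat -> R) :
  (forall n, a n <= a (S n)) -> (forall n, b (S n) <= b n) -> (forall n, a n <= b n) ->
  exists x, forall n, a n <= x <= b n.
Proof.
  intros Ha Hb Hab.
  assert (Ma : forall n m, (n <= m)%nat -> a n <= a m).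
  { intros n m Hnm. induction Hnm; [lra|]. generalize (Ha m); lra. }
  assert (Mb : forall n m, (n <= m)%nat -> b m <= b n).
  { intros n m Hnm. induction Hnm; [lra|]. generalize (Hb m); lra. }
  assert (Mab : forall n m, a n <= b m).
  { intros n m. generalize (Ma n (max n m) ltac:(lia)) (Mb m (max n m) ltac:(lia)) (Hab (max n m)).
    lra. }
  destruct (completeness (fun x => exists n, x = a n)) as [x [H1 H2]].
  - exists (b 0%nat). intros x [n ->]. apply Mab.
  - exists (a 0%nat), 0%nat. reflexivity.
  - exists x. intros n. split.
    + apply H1. exists n. reflexivity.
    + apply H2. intros y [m ->]. apply Mab.
Qed.

Lemma half_pow_small (L e : R) : 0 <= L -> 0 < e -> exists n, L * (/ 2) ^ n < e.
Proof.
  intros HL He. destruct (pow_lt_1_zero (/ 2) ltac:(rewrite Rabs_pos_eq; lra) (e / (L + 1))) as [N HN].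
  { apply Rdiv_lt_0_compat; lra. }
  exists N. specialize (HN N (le_n _)). rewrite Rabs_pos_eq in HN by (apply pow_le; lra).
  apply Rle_lt_trans with ((L + 1) * (/ 2) ^ N).
  - apply Rmult_le_compat_r; [apply pow_le; lra|lra].
  - replace e with ((L + 1) * (e / (L + 1))) by (field; lra).
    apply Rmult_lt_compat_l; lra.
Qed.

Record rect := Rect { rl : R; rr : R; rb : R; rt : R }.

Definition quarter (p q : rect) : Prop :=
  ((rl q = rl p /\ rr q = (rl p + rr p) / 2) \/ (rl q = (rl p + rr p) / 2 /\ rr q = rr p)) /\
  ((rb q = rb p /\ rt q = (rb p + rt p) / 2) \/ (rb q = (rb p + rt p) / 2 /\ rt q = rt p)).

(** A failure of [P] would be inherited by a sequence of nested quarters shrinking to a point, near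
    which the last hypothesis gives [P]. *)
Lemma bisection (P : rect -> Prop) (p0 : rect) :
  rl p0 <= rr p0 -> rb p0 <= rt p0 ->
  (forall p, rl p <= rr p -> rb p <= rt p -> rl p0 <= rl p -> rr p <= rr p0 ->
     rb p0 <= rb p -> rt p <= rt p0 ->
     (forall q, quarter p q -> P q) -> P p) ->
  (forall x y, rl p0 <= x <= rr p0 -> rb p0 <= y <= rt p0 ->
     exists e, 0 < e /\ forall p, rl p <= x <= rr p -> rb p <= y <= rt p ->
       rl p0 <= rl p -> rr p <= rr p0 -> rb p0 <= rb p -> rt p <= rt p0 ->
       rr p - rl p + (rt p - rb p) < e -> P p) ->
  P p0.
Proof.
  intros Hx Hy Hstep Hloc. apply NNPP.
  intros Hn.
  pose (next := fun p => epsilon (inhabits p) (fun q => quarter p q /\ ~ P q)).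
  pose (Q := fun n => Nat.iter n next p0).
  assert (Inv : forall n, ~ P (Q n) /\ rl (Q n) <= rr (Q n) /\ rb (Q n) <= rt (Q n) /\
    rl p0 <= rl (Q n) /\ rr (Q n) <= rr p0 /\ rb p0 <= rb (Q n) /\ rt (Q n) <= rt p0 /\
    rr (Q n) - rl (Q n) + (rt (Q n) - rb (Q n)) = (rr p0 - rl p0 + (rt p0 - rb p0)) * (/ 2) ^ n
    /\ quarter (Q n) (Q (S n))).
  { assert (Hq : forall p, ~ P p -> rl p <= rr p -> rb p <= rt p -> rl p0 <= rl p -> rr p <= rr p0 ->
      rb p0 <= rb p -> rt p <= rt p0 -> quarter p (next p) /\ ~ P (next p)).
    { intros p HP ? ? ? ? ? ?. unfold next. apply epsilon_spec. apply NNPP. intros H'.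
      apply HP. apply Hstep; try assumption. intros q Hq. apply NNPP. intros Hq'.
      apply H'. exists q. split; assumption. }
    intros n. induction n as [|n IH].
    - change (Q 0%nat) with p0. change (Q 1%nat) with (next p0).
      split; [exact Hn|]. do 6 (split; [lra|]). split; [simpl; ring|].
      apply Hq; auto; lra.
    - destruct IH as (HP & H1 & H2 & H3 & H4 & H5 & H6 & H7 & H8).
      assert (K : ~ P (Q (S n))) by (apply Hq; assumption).
      assert (G : rl (Q (S n)) <= rr (Q (S n)) /\ rb (Q (S n)) <= rt (Q (S n)) /\
        rl p0 <= rl (Q (S n)) /\ rr (Q (S n)) <= rr p0 /\ rb p0 <= rb (Q (S n)) /\
        rt (Q (S n)) <= rt p0 /\
        rr (Q (S n)) - rl (Q (S n)) + (rt (Q (S n)) - rb (Q (S n)))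
          = (rr p0 - rl p0 + (rt p0 - rb p0)) * (/ 2) ^ (S n)).
      { destruct H8 as [[[A1 A2]|[A1 A2]] [[B1 B2]|[B1 B2]]]; rewrite A1, A2, B1, B2; simpl;
        repeat split; try lra. }
      destruct G as (G1 & G2 & G3 & G4 & G5 & G6 & G7). repeat (split; [assumption|]).
      apply Hq; assumption. }
  destruct (nested_intervals (fun n => rl (Q n)) (fun n => rr (Q n))) as [x Px].
  { intros n. destruct (Inv n) as (_ & H1 & _ & _ & _ & _ & _ & _ & [[[A1 A2]|[A1 A2]] _]); lra. }
  { intros n. destruct (Inv n) as (_ & H1 & _ & _ & _ & _ & _ & _ & [[[A1 A2]|[A1 A2]] _]); lra. }
  { intros n. apply Inv. }
  destruct (nested_intervals (fun n => rb (Q n)) (fun n => rt (Q n))) as [y Py].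
  { intros n. destruct (Inv n) as (_ & _ & H1 & _ & _ & _ & _ & _ & [_ [[A1 A2]|[A1 A2]]]); lra. }
  { intros n. destruct (Inv n) as (_ & _ & H1 & _ & _ & _ & _ & _ & [_ [[A1 A2]|[A1 A2]]]); lra. }
  { intros n. apply Inv. }
  destruct (Hloc x y (Px 0%nat) (Py 0%nat)) as (e & He & HP).
  destruct (half_pow_small (rr p0 - rl p0 + (rt p0 - rb p0)) e ltac:(lra) He) as [n Hn'].
  destruct (Inv n) as (K & H1 & H2 & H3 & H4 & H5 & H6 & H7 & H8).
  apply K. apply HP; try assumption; [apply Px|apply Py|lra].
Qed.

Lemma Goursat f a b c d : a <= b -> c <= d ->
  (forall x y, a <= x <= b -> c <= y <= d -> exists l, Cderiv f (x, y) l) ->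
  rect_int f a b c d = RtoC 0.
Proof.
  intros Hab Hcd H.
  assert (Hc : cont_rect f a b c d).
  { intros x y Hx Hy. destruct (H x y Hx Hy) as [l Hl]. apply (Ccont_of_Cd _ _ _ Hl). }
  assert (HE : forall e, 0 < e -> Cmod (rect_int f a b c d) <= e * (b - a + (d - c)) ^ 2).
  2:{ apply Cmod_eq_0. apply Rle_antisym; [|apply Cmod_ge_0].
      apply Rnot_lt_le. intros Hlt.
      assert (Hp : 0 <= (b - a + (d - c)) ^ 2) by apply pow2_ge_0.
      specialize (HE (Cmod (rect_int f a b c d) / 2 / ((b - a + (d - c)) ^ 2 + 1))).
      assert (H0 : 0 < Cmod (rect_int f a b c d) / 2 / ((b - a + (d - c)) ^ 2 + 1)).
      { apply Rdiv_lt_0_compat; lra. }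
      specialize (HE H0).
      assert (Cmod (rect_int f a b c d) / 2 / ((b - a + (d - c)) ^ 2 + 1) * ((b - a + (d - c)) ^ 2 + 1)
              = Cmod (rect_int f a b c d) / 2) by (field; lra).
      lra. }
  intros e He.
  (* The bound is quadratic in the half-perimeter: each quarter has half of it, so the four bounds
     add up to exactly the bound for the whole rectangle. *)
  apply (bisection (fun p => Cmod (rect_int f (rl p) (rr p) (rb p) (rt p))
    <= e * (rr p - rl p + (rt p - rb p)) ^ 2) (Rect a b c d)); simpl; auto.
  - intros p H1 H2 H3 H4 H5 H6 HP.
    pose (m := (rl p + rr p) / 2). pose (n := (rb p + rt p) / 2).
    assert (E1 := HP (Rect (rl p) m (rb p) n) ltac:(unfold quarter, m, n; simpl; auto)).
    assert (E2 := HP (Rect m (rr p) (rb p) n) ltac:(unfold quarter, m, n; simpl; auto)).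
    assert (E3 := HP (Rect (rl p) m n (rt p)) ltac:(unfold quarter, m, n; simpl; auto)).
    assert (E4 := HP (Rect m (rr p) n (rt p)) ltac:(unfold quarter, m, n; simpl; auto)).
    simpl in E1, E2, E3, E4.
    assert (Hm : rl p <= m <= rr p) by (unfold m; lra).
    assert (Hn : rb p <= n <= rt p) by (unfold n; lra).
    rewrite (rect_int_split_x f (rl p) m (rr p)); auto.
    2:{ eapply cont_rect_sub; [exact Hc|..]; lra. }
    rewrite (rect_int_split_y f (rl p) m (rb p) n (rt p)); auto; try lra.
    2:{ eapply cont_rect_sub; [exact Hc|..]; lra. }
    rewrite (rect_int_split_y f m (rr p) (rb p) n (rt p)); auto; try lra.
    2:{ eapply cont_rect_sub; [exact Hc|..]; lra. }
    eapply Rle_trans; [apply Cmod_triangle|].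
    eapply Rle_trans; [apply Rplus_le_compat; apply Cmod_triangle|].
    eapply Rle_trans; [apply Rplus_le_compat; apply Rplus_le_compat; eassumption|].
    right. unfold m, n. field.
  - intros x y Hx Hy. destruct (H x y Hx Hy) as [l Hl].
    assert (E := deriv_along_elim _ _ _ _ Hl (e / 2) ltac:(lra)).
    apply locally_C_iff in E. destruct E as (r & Hr & E).
    exists r. split; [exact Hr|]. intros p H1 H2 H3 H4 H5 H6 H7.
    (* The tangent map [A] has a primitive, so it integrates to zero. The remainder is at most
       [e / 2 * pp] on a rectangle of perimeter [2 * pp]. *)
    pose (A := fun z : C => (f (x, y) + l * (z - (x, y)))%C).
    assert (HA : forall z, Cderiv A z l).
    { intros z. replace l with (RtoC 0 + l * (RtoC 1 - RtoC 0))%C by ring. unfold A.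
      apply (deriv_along_plus (fun u : C => u) z (fun _ => f (x, y)) (fun z => l * (z - (x, y)))%C).
      - apply deriv_along_const.
      - apply (deriv_along_scal (fun u : C => u) z (Ccont_id z)). apply deriv_along_minus; [apply deriv_along_id|apply deriv_along_const]. }
    assert (HAc : forall z, Ccont A z) by (intros z; apply (Ccont_of_Cd _ _ _ (HA z))).
    assert (HI : rect_int A (rl p) (rr p) (rb p) (rt p) = RtoC 0).
    { apply (rect_int_primitive (fun z => f (x, y) * z + (l / 2) * ((z - (x, y)) * (z - (x, y))))%C); try lra; auto.
      intros z. unfold A.
      assert (D1 : Cderiv (fun z => z - (x, y))%C z (RtoC 1 - RtoC 0)%C).
      { apply deriv_along_minus; [apply deriv_along_id|apply deriv_along_const]. }
      replace (f (x, y) + l * (z - (x, y)))%C with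
        (f (x, y) * RtoC 1 + l / 2 * ((RtoC 1 - RtoC 0) * (z - (x, y)) + (z - (x, y)) * (RtoC 1 - RtoC 0)))%C.
      2:{ field. }
      apply deriv_along_plus; apply (deriv_along_scal (fun u : C => u) z (Ccont_id z)).
      - apply deriv_along_id.
      - apply (deriv_along_mult (fun u : C => u) z (Ccont_id z)); assumption. }
    assert (Hcp : cont_rect f (rl p) (rr p) (rb p) (rt p)).
    { eapply cont_rect_sub; [exact Hc|..]; lra. }
    replace (rect_int f (rl p) (rr p) (rb p) (rt p)) with
      (rect_int (fun z => f z - A z)%C (rl p) (rr p) (rb p) (rt p)).
    2:{ rewrite rect_int_minus; try lra; auto. { rewrite HI. ring. } intros u v _ _. apply HAc. }
    set (pp := rr p - rl p + (rt p - rb p)) in *.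
    eapply Rle_trans; [apply rect_int_bound with (M := e / 2 * pp); try lra|].
    + intros u v Hu Hv. apply flim_minus; [apply _|apply Hcp; lra|apply HAc].
    + intros u v Hu Hv.
      assert (Hd : Cmod ((u, v) - (x, y)) <= pp).
      { eapply Rle_trans; [apply Cmod_le_abs|]. simpl. unfold pp.
        apply Rplus_le_compat; apply Rabs_le; lra. }
      specialize (E (u, v) ltac:(lra)).
      unfold A. replace (f (u, v) - (f (x, y) + l * ((u, v) - (x, y))))%C
        with (f (u, v) - f (x, y) - l * ((u, v) - (x, y)))%C by ring.
      eapply Rle_trans; [exact E|]. apply Rmult_le_compat_l; lra.
    + fold pp. right. field.
Qed.

(** All pieces of a subdivision avoid [w], except one rectangle around [w] of side at most [2 * e],
    on which continuity bounds [f]. The lemma serves for difference quotients based at [w], which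
    are only known to be continuous there. *)
Lemma Goursat_punctured f (w : C) a b c d : a <= b -> c <= d ->
  cont_rect f a b c d ->
  (forall z, a <= Re z <= b -> c <= Im z <= d -> z <> w -> exists l, Cderiv f z l) ->
  rect_int f a b c d = RtoC 0.
Proof.
  intros Hab Hcd Hc H. destruct w as [wx wy].
  destruct (classic (exists z0 : C, a <= Re z0 <= b /\ c <= Im z0 <= d /\ z0 = (wx, wy))) as [Hw|Hw].
  2:{ apply Goursat; auto. intros x y Hx Hy. apply H; auto. intros E. apply Hw.
      exists (x, y). auto. }
  destruct Hw as (z0 & Hw1 & Hw2 & ->). simpl in Hw1, Hw2.
  assert (Hloc := Hc wx wy Hw1 Hw2 1 Rlt_0_1). apply locally_C_iff in Hloc.
  destruct Hloc as (r & Hr & Hloc).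
  set (M := Cmod (f (wx, wy)) + 1).
  assert (HM : 0 < M) by (generalize (Cmod_ge_0 (f (wx, wy))); unfold M; lra).
  assert (HE : forall e, 0 < e < r / 4 -> Cmod (rect_int f a b c d) <= 8 * e * M).
  { intros e He.
    (* When [w] lies on a side of the rectangle, the strip beyond it is degenerate; the first two
       cases of [Z] cover this. *)
    pose (x1 := Rmax a (wx - e)). pose (x2 := Rmin b (wx + e)).
    pose (y1 := Rmax c (wy - e)). pose (y2 := Rmin d (wy + e)).
    assert (X1 : a <= x1 /\ x1 <= wx /\ wx - e <= x1 /\ (x1 = a \/ x1 < wx)).
    { unfold x1, Rmax. destruct Rle_dec; lra. }
    assert (X2 : x2 <= b /\ wx <= x2 /\ x2 <= wx + e /\ (x2 = b \/ wx < x2)).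
    { unfold x2, Rmin. destruct Rle_dec; lra. }
    assert (Y1 : c <= y1 /\ y1 <= wy /\ wy - e <= y1 /\ (y1 = c \/ y1 < wy)).
    { unfold y1, Rmax. destruct Rle_dec; lra. }
    assert (Y2 : y2 <= d /\ wy <= y2 /\ y2 <= wy + e /\ (y2 = d \/ wy < y2)).
    { unfold y2, Rmin. destruct Rle_dec; lra. }
    assert (Z : forall a' b' c' d', a <= a' -> a' <= b' -> b' <= b -> c <= c' -> c' <= d' -> d' <= d ->
      (a' = b' \/ c' = d' \/ b' < wx \/ wx < a' \/ d' < wy \/ wy < c') ->
      rect_int f a' b' c' d' = RtoC 0).
    { intros a' b' c' d' ? ? ? ? ? ? [<-|[<-|K]].
      - unfold rect_int. rewrite !(is_CI_CI _ _ _ _ (is_CI_point _ a')). ring.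
      - unfold rect_int. rewrite !(is_CI_CI _ _ _ _ (is_CI_point _ c')). ring.
      - apply Goursat; auto. intros x y Hx Hy. apply H; simpl; try lra.
        intros E. injection E. lra. }
    rewrite (rect_int_split_x f a x1 b) by (auto; lra).
    rewrite (Z a x1 c d) by lra.
    rewrite (rect_int_split_x f x1 x2 b) by first [lra | eapply cont_rect_sub; [exact Hc|..]; lra].
    rewrite (Z x2 b c d) by lra.
    rewrite (rect_int_split_y f x1 x2 c y1 d) by first [lra | eapply cont_rect_sub; [exact Hc|..]; lra].
    rewrite (Z x1 x2 c y1) by lra.
    rewrite (rect_int_split_y f x1 x2 y1 y2 d) by first [lra | eapply cont_rect_sub; [exact Hc|..]; lra].
    rewrite (Z x1 x2 y2 d) by lra.
    rewrite !Cplus_0_l, !Cplus_0_r.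
    eapply Rle_trans; [apply rect_int_bound with (M := M); try lra|].
    - eapply cont_rect_sub; [exact Hc|..]; lra.
    - intros x y Hx Hy. assert (K : Cmod ((x, y) - (wx, wy)) < r).
      { eapply Rle_lt_trans; [apply Cmod_le_abs|]. simpl.
        assert (Rabs (x + - wx) <= e) by (apply Rabs_le; lra).
        assert (Rabs (y + - wy) <= e) by (apply Rabs_le; lra). lra. }
      specialize (Hloc _ K).
      replace (f (x, y)) with ((f (x, y) - f (wx, wy)) + f (wx, wy))%C by ring.
      eapply Rle_trans; [apply Cmod_triangle|]. unfold M. lra.
    - apply Rmult_le_compat_r; lra. }
  apply Cmod_eq_0. apply Rle_antisym; [|apply Cmod_ge_0]. apply Rnot_lt_le. intros Hlt.
  set (I := Cmod (rect_int f a b c d)) in *.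
  pose (e := Rmin (r / 8) (I / (16 * M))).
  assert (He : 0 < e < r / 4).
  { split; [apply Rmin_pos; [lra|apply Rdiv_lt_0_compat; lra]|].
    eapply Rle_lt_trans; [apply Rmin_l|lra]. }
  specialize (HE e He).
  assert (e <= I / (16 * M)) by apply Rmin_r.
  assert (e * (16 * M) <= I).
  { apply Rle_trans with (I / (16 * M) * (16 * M)); [apply Rmult_le_compat_r; lra|right; field; lra]. }
  lra.
Qed.

Lemma is_CI_le_abs f a b l M :
  (forall t, Rmin a b <= t <= Rmax a b -> Cmod (f t) <= M) -> is_CI f a b l ->
  Cmod l <= Rabs (b - a) * M.
Proof.
  intros H Hf. destruct (Rle_dec a b) as [Hab|Hab].
  - rewrite Rabs_pos_eq by lra. apply (is_CI_le_const f a b); auto.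
    intros t Ht. apply H. rewrite Rmin_left, Rmax_right by auto. exact Ht.
  - rewrite Rabs_left by lra. apply is_CI_swap in Hf. rewrite <- Cmod_opp.
    replace (- (b - a)) with (a - b) by ring. apply (is_CI_le_const f b a); [lra| |exact Hf].
    intros t Ht. apply H. rewrite Rmin_right, Rmax_left by lra. exact Ht.
Qed.

Definition copen (D : C -> Prop) : Prop :=
  forall z, D z -> exists r, 0 < r /\ forall u, Cmod (u - z) < r -> D u.

(* Domains in which every point is joined to every real point of the domain by a real segment
   followed by a vertical one, and in which these paths sweep out rectangles of the domain. *)
Definition comb (D : C -> Prop) : Prop :=
  copen D /\
  forall x x' y s t, D (x, y) -> D (x', y) -> x <= s <= x' -> Rabs t <= Rabs y -> D (s, t).

Lemma between_Rmin_Rmax a b s : Rmin a b <= s <= Rmax a b -> a <= s <= b \/ b <= s <= a.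
Proof. unfold Rmin, Rmax. destruct Rle_dec; lra. Qed.

Lemma Rabs_between_0 t y : Rmin 0 y <= t <= Rmax 0 y -> Rabs t <= Rabs y.
Proof.
  intros H. apply between_Rmin_Rmax in H. unfold Rabs; repeat destruct Rcase_abs; lra.
Qed.

(** The primitive integrates along the real axis and then vertically. Goursat's lemma on the
    rectangle between the axis and height [y] trades this path for one that is horizontal at height
    [y], so increments in both directions are integrals over short segments. *)
Lemma primitive_exists (D : C -> Prop) (f : C -> C) (w : C) (b0 : R) :
  comb D -> D (RtoC b0) -> (forall z, D z -> Ccont f z) ->
  (forall z, D z -> z <> w -> exists l, Cderiv f z l) ->
  exists F, F (RtoC b0) = RtoC 0 /\ forall z, D z -> Cderiv F z (f z).
Proof.
  intros [Ho Hr] Hb Hc Hd.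
  pose (F := fun z : C => (CI (fun s => f (s, 0)) b0 (fst z) + Ci * CI (fun s => f (fst z, s)) 0 (snd z))%C).
  exists F. split.
  { unfold F. cbn [fst snd RtoC]. rewrite !(is_CI_CI _ _ _ _ (is_CI_point _ _)). ring. }
  assert (Hre : forall x y, D (x, y) -> D (x, 0)).
  { intros x y H. apply (Hr x x y x 0 H H); [lra|]. rewrite Rabs_R0. apply Rabs_pos. }
  assert (Hver : forall x y t, D (x, y) -> Rabs t <= Rabs y -> D (x, t)).
  { intros x y t H Ht. apply (Hr x x y); auto; lra. }
  assert (Hhor : forall x x' y s, D (x, y) -> D (x', y) -> Rmin x x' <= s <= Rmax x x' -> D (s, y)).
  { intros x x' y s H H' Hs. apply between_Rmin_Rmax in Hs.
    destruct Hs; [apply (Hr x x' y)|apply (Hr x' x y)]; auto; lra. }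
  assert (Hdiff0 : forall x x' y, D (x, y) -> D (x', y) -> x <= x' ->
    (F (x', y) - F (x, y))%C = CI (fun s => f (s, y)) x x').
  { intros x x' y H H' Hx. unfold F. cbn [fst snd].
    assert (E1 : (CI (fun s => f (s, 0)) b0 x' = CI (fun s => f (s, 0)) b0 x + CI (fun s => f (s, 0)) x x')%C).
    { apply is_CI_CI. apply is_CI_Chasles with x; apply is_CI_hor; intros s Hs; apply Hc.
      - apply (Hhor b0 x 0 s Hb); [apply (Hre x y H)|exact Hs].
      - apply (Hhor x x' 0 s); [apply (Hre x y H)|apply (Hre x' y H')|exact Hs]. }
    rewrite E1.
    assert (HD : forall s t, x <= s <= x' -> Rabs t <= Rabs y -> D (s, t)).
    { intros s t Hs Ht. apply (Hr x x' y); auto. }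
    destruct (Rle_dec 0 y) as [Hy|Hy].
    - assert (G : rect_int f x x' 0 y = RtoC 0).
      { apply (Goursat_punctured f w); auto.
        - intros s t Hs Ht. apply Hc. apply HD; auto. rewrite !Rabs_pos_eq; lra.
        - intros [s t] Hs Ht Hw. apply Hd; auto. simpl in Hs, Ht.
          apply HD; auto. rewrite !Rabs_pos_eq; lra. }
      unfold rect_int in G.
      replace (CI (fun s => f (s, y)) x x') with
        ((RtoC 0) + CI (fun s => f (s, y)) x x')%C by ring.
      rewrite <- G. ring.
    - assert (G : rect_int f x x' y 0 = RtoC 0).
      { apply (Goursat_punctured f w); auto; try lra.
        - intros s t Hs Ht. apply Hc. apply HD; auto. rewrite !Rabs_left1; lra.
        - intros [s t] Hs Ht Hw. apply Hd; auto. simpl in Hs, Ht.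
          apply HD; auto. rewrite !Rabs_left1; lra. }
      assert (SW : forall u, x <= u <= x' -> CI (fun s => f (u, s)) y 0 = (- CI (fun s => f (u, s)) 0 y)%C).
      { intros u Hu. apply is_CI_CI. apply is_CI_swap. apply is_CI_ver. intros s Hs. apply Hc.
        apply HD; auto. apply Rabs_between_0; exact Hs. }
      unfold rect_int in G. rewrite !SW in G by lra.
      replace (CI (fun s => f (s, y)) x x') with
        (CI (fun s => f (s, y)) x x' - RtoC 0)%C by ring.
      rewrite <- G. ring. }
  assert (Hdiff : forall x x' y, D (x, y) -> D (x', y) ->
    is_CI (fun s => f (s, y)) x x' (F (x', y) - F (x, y))%C).
  { intros x x' y H H'. destruct (Rle_dec x x') as [Hx|Hx].
    - rewrite Hdiff0 by auto. apply is_CI_hor. intros s Hs. apply Hc. apply (Hhor x x' y s); auto.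
    - replace (F (x', y) - F (x, y))%C with (- (F (x, y) - F (x', y)))%C by ring.
      apply is_CI_swap. rewrite Hdiff0 by (auto; lra). apply is_CI_hor. intros s Hs. apply Hc.
      apply (Hhor x' x y s); auto. }
  intros [x y] Hz. apply deriv_along_intro; [auto|]. intros eps He.
  destruct (Ho _ Hz) as (r & Hr0 & HD).
  assert (Hc0 := Hc _ Hz (eps / 2) ltac:(lra)). apply locally_C_iff in Hc0.
  destruct Hc0 as (r' & Hr' & Hc0).
  (* Half the radius, because horizontal and vertical distances add up to at most twice the
     modulus. *)
  apply locally_C_iff. exists (Rmin r r' / 2).
  assert (Hrr : 0 < Rmin r r') by (apply Rmin_pos; lra).
  split; [lra|]. intros [x' y'] Hu.
  assert (Hx : Rabs (x' - x) <= Cmod ((x', y') - (x, y))) by apply (re_le_Cmod ((x', y') - (x, y))%C).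
  assert (Hy : Rabs (y' - y) <= Cmod ((x', y') - (x, y))) by apply (im_le_Cmod ((x', y') - (x, y))%C).
  set (m := Cmod ((x', y') - (x, y))) in *.
  assert (Hnear : forall s t, Rabs (s - x) <= Rabs (x' - x) -> Rabs (t - y) <= Rabs (y' - y) ->
    Cmod ((s, t) - (x, y)) < Rmin r r').
  { intros s t Hs Ht. eapply Rle_lt_trans; [apply Cmod_le_abs|]. simpl.
    change (Rabs (s - x) + Rabs (t - y) < Rmin r r'). lra. }
  assert (Hin : forall s t, Rabs (s - x) <= Rabs (x' - x) -> Rabs (t - y) <= Rabs (y' - y) -> D (s, t)).
  { intros s t Hs Ht. apply HD. eapply Rlt_le_trans; [apply Hnear; auto|apply Rmin_l]. }
  assert (Hcl : forall s t, Rabs (s - x) <= Rabs (x' - x) -> Rabs (t - y) <= Rabs (y' - y) ->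
    Cmod (f (s, t) - f (x, y)) <= eps / 2).
  { intros s t Hs Ht. left. apply Hc0. eapply Rlt_le_trans; [apply Hnear; auto|apply Rmin_r]. }
  assert (Bx : forall s, Rmin x x' <= s <= Rmax x x' -> Rabs (s - x) <= Rabs (x' - x)).
  { intros s Hs. apply between_Rmin_Rmax in Hs. unfold Rabs; repeat destruct Rcase_abs; lra. }
  assert (By : forall s, Rmin y y' <= s <= Rmax y y' -> Rabs (s - y) <= Rabs (y' - y)).
  { intros s Hs. apply between_Rmin_Rmax in Hs. unfold Rabs; repeat destruct Rcase_abs; lra. }
  assert (Z0 : forall v v', Rabs (v - v) <= Rabs (v' - v)).
  { intros v v'. rewrite Rminus_diag, Rabs_R0. apply Rabs_pos. }
  assert (I1 := Hdiff x x' y Hz ltac:(apply Hin; [lra|apply Z0])).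
  assert (I2 : is_CI (fun s => f (x', s)) y y' (CI (fun s => f (x', s)) y y')).
  { apply is_CI_ver. intros s Hs. apply Hc. apply Hin; [lra|apply By; exact Hs]. }
  assert (E2 : (F (x', y') - F (x', y))%C = (Ci * CI (fun s => f (x', s)) y y')%C).
  { unfold F. cbn [fst snd].
    replace (CI (fun s => f (x', s)) 0 y') with
      (CI (fun s => f (x', s)) 0 y + CI (fun s => f (x', s)) y y')%C; [ring|].
    symmetry. apply is_CI_CI. apply is_CI_Chasles with y; [|exact I2].
    apply is_CI_ver. intros s Hs. apply Hc. apply (Hver x' y).
    - apply Hin; [lra|apply Z0].
    - apply Rabs_between_0; exact Hs. }
  assert (J1 := is_CI_minus _ _ _ _ _ _ I1 (is_CI_const (f (x, y)) x x')).
  assert (J2 := is_CI_minus _ _ _ _ _ _ I2 (is_CI_const (f (x, y)) y y')).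
  apply is_CI_le_abs with (M := eps / 2) in J1.
  2:{ intros s Hs. apply Hcl; [apply Bx; exact Hs|apply Z0]. }
  apply is_CI_le_abs with (M := eps / 2) in J2.
  2:{ intros s Hs. apply Hcl; [lra|apply By; exact Hs]. }
  replace (F (x', y') - F (x, y) - f (x, y) * ((x', y') - (x, y)))%C with
    ((F (x', y) - F (x, y) - RtoC (x' - x) * f (x, y))
     + Ci * (CI (fun s => f (x', s)) y y' - RtoC (y' - y) * f (x, y)))%C.
  2:{ replace ((x', y') - (x, y))%C with (RtoC (x' - x) + Ci * RtoC (y' - y))%C.
      - replace (F (x', y')) with (F (x', y) + (F (x', y') - F (x', y)))%C by ring.
        rewrite E2. ring.
      - apply injective_projections; simpl; ring. }
  eapply Rle_trans; [apply Cmod_triangle|]. rewrite (Cmod_mult Ci), Cmod_Ci.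
  assert (Rabs (x' - x) * (eps / 2) <= m * (eps / 2)) by (apply Rmult_le_compat_r; lra).
  assert (Rabs (y' - y) * (eps / 2) <= m * (eps / 2)) by (apply Rmult_le_compat_r; lra).
  lra.
Qed.

(** * Geometry of neighborhoods of -oo *)

(** The cone [C_minus] of real apex [x0] and half-angle [atan m]: slopes replace angles and make
    membership a linear inequality. The half-angle [PI / 2] is not of this form. *)
Definition Cone (x0 m : R) (w : C) : Prop := Rabs (Im w) < m * (x0 - Re w).

Lemma C_minus_iff (w0 w : C) (theta : R) : theta <= PI / 2 ->
  (C_minus w0 theta w <->
   0 < Re (w0 - w) /\ Rabs (atan (Im (w0 - w) / Re (w0 - w))) < theta).
Proof.
  intros Ht. split.
  - intros (u & Hu & (al & [_ Hal] & Habs) & Hw).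
    assert (E : (w0 - w)%C = u) by (rewrite Hw; ring). rewrite E.
    assert (Hb := Rabs_def2 _ _ Habs).
    assert (Hc : 0 < cos al) by (apply cos_gt_0; lra).
    assert (Hm : 0 < Cmod u) by (apply Cmod_gt_0; exact Hu).
    assert (E1 : Re u = Cmod u * cos al) by (rewrite Hal at 1; simpl; ring).
    assert (E2 : Im u = Cmod u * sin al) by (rewrite Hal at 1; simpl; ring).
    rewrite E1, E2. split; [apply Rmult_lt_0_compat; lra|].
    replace (Cmod u * sin al / (Cmod u * cos al)) with (tan al) by (unfold tan; field; lra).
    rewrite atan_tan by lra. exact Habs.
  - intros [Hre Hat]. exists (w0 - w)%C. set (u := (w0 - w)%C) in *.
    assert (Hu : u <> RtoC 0).
    { intros E. rewrite E in Hre. simpl in Hre. lra. }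
    split; [exact Hu|]. split; [|unfold u; ring].
    exists (atan (Im u / Re u)). split; [|exact Hat]. split.
    + generalize (atan_bound (Im u / Re u)) PI_RGT_0. lra.
    + rewrite cos_atan, sin_atan.
      assert (Hs : Cmod u = Re u * sqrt (1 + Rsqr (Im u / Re u))).
      { rewrite <- (sqrt_Rsqr (Re u)) at 1 by lra. rewrite <- sqrt_mult; try apply Rle_0_sqr.
        - unfold Cmod. f_equal. change (fst u) with (Re u). change (snd u) with (Im u).
          unfold Rsqr. field. lra.
        - generalize (Rle_0_sqr (Im u / Re u)). lra. }
      assert (Hp : 0 < sqrt (1 + Rsqr (Im u / Re u))).
      { apply sqrt_lt_R0. generalize (Rle_0_sqr (Im u / Re u)). lra. }
      rewrite Hs. destruct u as [ux uy]. simpl in *.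
      apply injective_projections; simpl; field; lra.
Qed.

Lemma Cone_C_minus x0 m w : 0 < m -> (Cone x0 m w <-> C_minus (RtoC x0) (atan m) w).
Proof.
  intros Hm. rewrite C_minus_iff by (generalize (atan_bound m); lra).
  unfold Cone. destruct w as [x y]. simpl.
  replace (0 + - y) with (- y) by ring.
  split.
  - intros H. assert (Hx : 0 < x0 + - x).
    { apply Rmult_lt_reg_l with m; [exact Hm|]. generalize (Rabs_pos y). lra. }
    split; [exact Hx|].
    assert (H2 : Rabs y / (x0 + - x) < m).
    { apply Rmult_lt_reg_r with (x0 + - x); [exact Hx|]. unfold Rdiv.
      rewrite Rmult_assoc, Rinv_l by lra. lra. }
    assert (H3 : - m < - y / (x0 + - x) < m).
    { apply Rabs_def2 in H.
      split; apply Rmult_lt_reg_r with (x0 + - x); try exact Hx; unfold Rdiv;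
      rewrite ?Rmult_assoc, Rinv_l by lra; lra. }
    apply Rabs_def1; [apply atan_increasing; lra|].
    rewrite <- atan_opp. apply atan_increasing; lra.
  - intros [Hx H]. apply Rabs_def2 in H. destruct H as [H1 H2].
    rewrite <- atan_opp in H2.
    assert (K : forall u v, atan u < atan v -> u < v).
    { intros u v Huv. destruct (Rlt_or_le u v) as [|[Hl| ->]]; auto; [|lra].
      apply atan_increasing in Hl. lra. }
    apply K in H1. apply K in H2.
    apply Rmult_lt_compat_r with (r := x0 + - x) in H1; [|exact Hx].
    apply Rmult_lt_compat_r with (r := x0 + - x) in H2; [|exact Hx].
    unfold Rdiv in H1, H2. rewrite Rmult_assoc, Rinv_l in H1, H2 by lra.
    apply Rabs_def1; lra.
Qed.

Lemma C_minus_mono w0 t t' w : t <= t' -> C_minus w0 t w -> C_minus w0 t' w.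
Proof.
  intros H (u & Hu & (al & Ha & Hb) & Hw). exists u. split; [exact Hu|]. split; [|exact Hw].
  exists al. split; [exact Ha|lra].
Qed.

(** A half-angle [PI / 2] has no slope, but the half-angle midway between the argument of the given
    point and [theta] always has one. *)
Lemma C_minus_sub_Cone x0 theta w : theta <= PI / 2 -> C_minus (RtoC x0) theta w ->
  exists m, 0 < m /\ Cone x0 m w /\ forall w', Cone x0 m w' -> C_minus (RtoC x0) theta w'.
Proof.
  intros Ht H. rewrite C_minus_iff in H by exact Ht. destruct H as [H1 H2].
  set (r := Rabs (atan (Im (RtoC x0 - w) / Re (RtoC x0 - w)))) in *.
  assert (Hr : 0 <= r) by apply Rabs_pos.
  assert (Ha : atan (tan ((r + theta) / 2)) = (r + theta) / 2) by (apply atan_tan; lra).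
  assert (Hm : 0 < tan ((r + theta) / 2)) by (apply tan_gt_0; lra).
  exists (tan ((r + theta) / 2)). split; [exact Hm|]. split.
  - apply Cone_C_minus; [exact Hm|]. rewrite Ha. rewrite C_minus_iff by lra.
    split; [exact H1|]. fold r. lra.
  - intros w' Hw'. apply Cone_C_minus in Hw'; [|exact Hm]. rewrite Ha in Hw'.
    eapply C_minus_mono; [|exact Hw']. lra.
Qed.

(** What the analysis retains of a neighborhood of [-oo], apart from the logarithmic region inside
    it. The last field pushes paths that touch the border into the domain. *)
Record left_domain (H : C -> Prop) : Prop := {
  ld_open : copen H;
  ld_left : forall x y x' y', H (x, y) -> x' <= x -> Rabs y' <= Rabs y -> H (x', y');
  ld_Re : forall w, H w -> Re w <= -1;
  ld_cone : forall m, 0 < m -> exists x0, forall w, Cone x0 m w -> H w;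
  ld_shift : forall z e, closure H z -> 0 < e -> H (z - RtoC e)%C }.

Lemma nbhd_minfty_cone H w : nbhd_minfty H -> H w ->
  exists x0 m, 0 < m /\ Cone x0 m w /\ forall w', Cone x0 m w' -> H w'.
Proof.
  intros [_ HH] Hw. apply HH in Hw. destruct Hw as (x0 & th & Hx0 & Hb & Hw).
  destruct (C_minus_sub_Cone x0 th w (proj1 Hb) Hw) as (m & Hm & Hc & Hs).
  exists x0, m. split; [exact Hm|]. split; [exact Hc|]. intros w' Hw'. apply Hb. apply Hs; exact Hw'.
Qed.

Lemma Cone_left x0 m x y x' y' : 0 < m -> Cone x0 m (x, y) -> x' <= x -> Rabs y' <= Rabs y ->
  Cone x0 m (x', y').
Proof. unfold Cone. simpl. intros. nra. Qed.

Lemma Cone_open x0 m : 0 < m -> copen (Cone x0 m).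
Proof.
  intros Hm z Hz. unfold Cone in Hz. exists ((m * (x0 - Re z) - Rabs (Im z)) / (m + 1)).
  assert (Hp : 0 < (m * (x0 - Re z) - Rabs (Im z)) / (m + 1)) by (apply Rdiv_lt_0_compat; lra).
  split; [exact Hp|]. intros u Hu. unfold Cone.
  set (d := (m * (x0 - Re z) - Rabs (Im z)) / (m + 1)) in *.
  assert (Hd : d * (m + 1) = m * (x0 - Re z) - Rabs (Im z)) by (unfold d; field; lra).
  assert (H1 : Rabs (Re u - Re z) < d).
  { eapply Rle_lt_trans; [apply (re_le_Cmod (u - z)%C)|exact Hu]. }
  assert (H2 : Rabs (Im u - Im z) < d).
  { eapply Rle_lt_trans; [apply (im_le_Cmod (u - z)%C)|exact Hu]. }
  assert (H3 : Rabs (Im u) <= Rabs (Im z) + Rabs (Im u - Im z)).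
  { replace (Im u) with (Im z + (Im u - Im z)) at 1 by ring. apply Rabs_triang. }
  apply Rabs_def2 in H1.
  assert (m * (x0 - Re u) > m * (x0 - Re z) - m * d) by nra. nra.
Qed.

Lemma nbhd_minfty_left_domain H : nbhd_minfty H -> (forall w, H w -> Re w <= -1) -> left_domain H.
Proof.
  intros HH HRe.
  assert (Hleft : forall x y x' y', H (x, y) -> x' <= x -> Rabs y' <= Rabs y -> H (x', y')).
  { intros x y x' y' Hz Hx Hy. destruct (nbhd_minfty_cone H _ HH Hz) as (x0 & m & Hm & Hc & Hs).
    apply Hs. eapply Cone_left; eassumption. }
  constructor; auto.
  - intros z Hz. destruct (nbhd_minfty_cone H _ HH Hz) as (x0 & m & Hm & Hc & Hs).
    destruct (Cone_open x0 m Hm z Hc) as (r & Hr & Ho). exists r. split; [exact Hr|].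
    intros u Hu. apply Hs. apply Ho; exact Hu.
  - intros m Hm. destruct HH as [H1 _].
    destruct (H1 (atan m)) as (w0 & Hw0 & Hs).
    { generalize (atan_bound m). rewrite <- atan_0.
      assert (atan 0 < atan m) by (apply atan_increasing; exact Hm). lra. }
    (* The apex [w0] need not be real; moving left by [|Im w0| / m] brings a real point whose cone
       of slope [m] lies in that of [w0]. *)
    exists (Re w0 - Rabs (Im w0) / m). intros w Hw. apply Hs.
    unfold Cone in Hw.
    assert (K : m * (Re w0 - Rabs (Im w0) / m - Re w) = m * (Re w0 - Re w) - Rabs (Im w0)).
    { field. lra. }
    rewrite K in Hw.
    replace w with (w0 - (w0 - w))%C by ring.
    assert (C1 : Cone 0 m (- (w0 - w))%C).
    { unfold Cone. destruct w0 as [a b], w as [x y]. simpl in *.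
      replace (0 - - (a + - x)) with (a - x) by ring.
      assert (Rabs (- (b + - y)) <= Rabs b + Rabs y); [|lra].
      rewrite Rabs_Ropp. eapply Rle_trans; [apply Rabs_triang|]. rewrite Rabs_Ropp. lra. }
    apply Cone_C_minus in C1; [|exact Hm]. destruct C1 as (u & Hu & Ha & E).
    exists u. split; [exact Hu|]. split; [exact Ha|].
    assert (E' : (w0 - w)%C = u). { replace (w0 - w)%C with (- - (w0 - w))%C by ring. rewrite E. ring. }
    rewrite E'. reflexivity.
  - intros [x y] e Hz He.
    change ((x, y) - RtoC e)%C with (x - e, y - 0). rewrite Rminus_0_r.
    destruct (Req_dec y 0) as [->|Hy].
    + destruct (Hz (e / 2) ltac:(lra)) as ([x' y'] & Hz' & Hd).
      assert (Hx := re_le_Cmod ((x', y') - (x, 0))%C). simpl in Hx.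
      assert (Hx' := Rle_lt_trans _ _ _ Hx Hd). apply Rabs_def2 in Hx'.
      apply (Hleft x' y'); auto; [lra|]. rewrite Rabs_R0. apply Rabs_pos.
    + assert (Hya : 0 < Rabs y) by (apply Rabs_pos_lt; exact Hy).
      (* scale the approximating point away from the apex of its cone by |y| / (|y| - eta) *)
      pose (eta := Rmin (Rmin (e / 2) (Rabs y / 2)) (e * Rabs y / (4 * (Rabs x + Rabs y + 1)))).
      assert (Hx0 := Rabs_pos x).
      assert (P3 : 0 < e * Rabs y / (4 * (Rabs x + Rabs y + 1))).
      { apply Rdiv_lt_0_compat; [apply Rmult_lt_0_compat; lra|lra]. }
      assert (Heta : 0 < eta) by (repeat apply Rmin_pos; lra).
      assert (E1 : eta <= e / 2) by (eapply Rle_trans; [apply Rmin_l|apply Rmin_l]).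
      assert (E2 : eta <= Rabs y / 2) by (eapply Rle_trans; [apply Rmin_l|apply Rmin_r]).
      assert (E3 : eta * (4 * (Rabs x + Rabs y + 1)) <= e * Rabs y).
      { apply Rle_trans with (e * Rabs y / (4 * (Rabs x + Rabs y + 1)) * (4 * (Rabs x + Rabs y + 1))).
        - apply Rmult_le_compat_r; [lra|apply Rmin_r].
        - right. field. lra. }
      destruct (Hz eta Heta) as ([x' y'] & Hz' & Hd).
      assert (Hx := re_le_Cmod ((x', y') - (x, y))%C). simpl in Hx.
      assert (Hx' := Rle_lt_trans _ _ _ Hx Hd). apply Rabs_def2 in Hx'.
      assert (Hyy := im_le_Cmod ((x', y') - (x, y))%C). simpl in Hyy.
      assert (Hyy' := Rle_lt_trans _ _ _ Hyy Hd).
      assert (Hy2 : Rabs y - eta <= Rabs y').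
      { assert (Rabs y <= Rabs y' + Rabs (y' + - y)); [|lra].
        replace y with (y' + - (y' + - y)) at 1 by ring.
        eapply Rle_trans; [apply Rabs_triang|]. rewrite Rabs_Ropp. lra. }
      destruct (nbhd_minfty_cone H _ HH Hz') as (x0 & m & Hm & Hc & Hs).
      assert (Hcx : x' < x0).
      { unfold Cone in Hc. simpl in Hc. generalize (Rabs_pos y'). intros.
        apply Rmult_lt_reg_l with m; nra. }
      (* The real points just left of the apex belong to [H], hence to [Re w <= -1]. This bounds
         [x0 - x'], and with it the displacement due to the scaling. *)
      assert (Hx0' : x0 <= -1).
      { apply Rnot_lt_le. intros Hlt.
        assert (K : H (RtoC ((x0 + Rmax (-1) x') / 2))).
        { apply Hs. unfold Cone. simpl. rewrite Rabs_R0. apply Rmult_lt_0_compat; [exact Hm|].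
          assert (Rmax (-1) x' < x0) by (apply Rmax_lub_lt; lra). lra. }
        apply HRe in K. simpl in K. generalize (Rmax_l (-1) x'). lra. }
      set (s := Rabs y / (Rabs y - eta)).
      assert (Hs1 : s * (Rabs y - eta) = Rabs y) by (unfold s; field; lra).
      assert (Hs2 : 1 <= s).
      { apply Rmult_le_reg_r with (Rabs y - eta); [lra|]. rewrite Hs1. lra. }
      assert (Hs3 : (s - 1) * Rabs y <= 2 * eta).
      { assert ((s - 1) * (Rabs y - eta) = eta) by lra. nra. }
      assert (Hcone : Cone x0 m (x0 - s * (x0 - x'), s * y')).
      { unfold Cone in *. simpl in *. rewrite Rabs_mult, (Rabs_pos_eq s) by lra.
        replace (m * (x0 - (x0 - s * (x0 - x')))) with (s * (m * (x0 - x'))) by ring.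
        apply Rmult_lt_compat_l; lra. }
      apply (Hleft (x0 - s * (x0 - x')) (s * y')); [apply Hs; exact Hcone| |].
      * assert (L1 : x0 - x' <= Rabs x + Rabs y).
        { assert (- x <= Rabs x) by (rewrite <- Rabs_Ropp; apply Rle_abs). lra. }
        assert (L2 : (s - 1) * (x0 - x') <= e / 2).
        { apply Rmult_le_reg_r with (Rabs y); [exact Hya|].
          apply Rle_trans with (2 * eta * (x0 - x')).
          - replace ((s - 1) * (x0 - x') * Rabs y) with ((s - 1) * Rabs y * (x0 - x')) by ring.
            apply Rmult_le_compat_r; lra.
          - apply Rle_trans with (2 * eta * (Rabs x + Rabs y)); [|nra].
            apply Rmult_le_compat_l; lra. }
        nra.
      * rewrite Rabs_mult, (Rabs_pos_eq s) by lra. rewrite <- Hs1 at 1.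
        apply Rmult_le_compat_l; lra.
Qed.

Lemma left_domain_comb H : left_domain H -> comb H.
Proof.
  intros L. split; [apply (ld_open H L)|]. intros x x' y s t _ H2 Hs Ht.
  apply (ld_left H L x' y); auto. lra.
Qed.

(** The supremum of the abscissas of the points of the segment that lie in [H] gives a border
    point. *)
Lemma horizontal_border (H : C -> Prop) x' x y : H (x', y) -> ~ H (x, y) -> x' <= x ->
  exists b, x' <= b <= x /\ border H (b, y).
Proof.
  intros H1 H2 Hx.
  destruct (completeness (fun s => x' <= s <= x /\ H (s, y))) as [b [Hb1 Hb2]].
  - exists x. intros s Hs. apply Hs.
  - exists x'. split; [lra|exact H1].
  - assert (B1 : x' <= b) by (apply Hb1; split; [lra|exact H1]).
    assert (B2 : b <= x) by (apply Hb2; intros s Hs; apply Hs).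
    exists b. split; [lra|].
    assert (Hdist : forall s, Cmod ((s, y) - (b, y)) = Rabs (s - b)).
    { intros s. replace ((s, y) - (b, y))%C with (RtoC (s - b)).
      - apply Cmod_R.
      - apply injective_projections; simpl; ring. }
    split.
    + intros eps He.
      destruct (classic (exists s, b - eps < s /\ x' <= s <= x /\ H (s, y))) as [(s & Hs1 & Hs2 & Hs3)|Hn].
      * exists (s, y). split; [exact Hs3|]. rewrite Hdist.
        assert (s <= b) by (apply Hb1; auto). rewrite Rabs_left1; lra.
      * exfalso. assert (b <= b - eps); [|lra]. apply Hb2. intros s Hs.
        apply Rnot_lt_le. intros Hlt. apply Hn. exists s. auto.
    + intros eps He. destruct (Req_dec b x) as [->|Hne].
      * exists (x, y). split; [exact H2|]. rewrite Hdist, Rminus_diag, Rabs_R0. exact He.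
      * exists (Rmin x (b + eps / 2), y).
        assert (K : b < Rmin x (b + eps / 2)) by (apply Rmin_glb_lt; lra).
        assert (K2 := Rmin_r x (b + eps / 2)). assert (K3 := Rmin_l x (b + eps / 2)).
        split.
        -- intros Hin. assert (Rmin x (b + eps / 2) <= b) by (apply Hb1; split; [lra|exact Hin]).
           lra.
        -- rewrite Hdist, Rabs_pos_eq; lra.
Qed.

Lemma convex_lower_bound rho Y : convex_on_Rplus rho -> 0 <= Y ->
  exists m, forall y, 0 <= y <= Y -> m <= rho y.
Proof.
  intros Hc HY.
  (* the chord through [Y + 1] and [Y + 2] lies below [rho] on its left *)
  pose (s := rho (Y + 2) - rho (Y + 1)).
  exists (rho (Y + 1) - Rabs s * (Y + 1)). intros y Hy.
  pose (l := 1 / (Y + 2 - y)).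
  assert (Hl : 0 <= l <= 1).
  { unfold l. split; [apply Rlt_le, Rdiv_lt_0_compat; lra|].
    apply Rmult_le_reg_r with (Y + 2 - y); [lra|]. unfold Rdiv.
    rewrite Rmult_assoc, Rinv_l by lra. lra. }
  assert (K := Hc y (Y + 2) l ltac:(lra) ltac:(lra) Hl).
  replace (l * y + (1 - l) * (Y + 2)) with (Y + 1) in K by (unfold l; field; lra).
  assert (E : l * (Y + 2 - y) = 1) by (unfold l; field; lra).
  assert (K2 : rho (Y + 1) * (Y + 2 - y) <= rho y + (Y + 1 - y) * rho (Y + 2)).
  { apply Rmult_le_compat_r with (r := Y + 2 - y) in K; [|lra].
    replace ((l * rho y + (1 - l) * rho (Y + 2)) * (Y + 2 - y)) with
      ((l * (Y + 2 - y)) * rho y + ((Y + 2 - y) - l * (Y + 2 - y)) * rho (Y + 2)) in K by ring.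
    rewrite E in K. replace (Y + 2 - y - 1) with (Y + 1 - y) in K by ring. lra. }
  assert (K3 : rho y >= rho (Y + 1) - (Y + 1 - y) * s) by (unfold s; nra).
  assert (K4 : (Y + 1 - y) * s <= Rabs s * (Y + 1)).
  { apply Rle_trans with ((Y + 1 - y) * Rabs s).
    - apply Rmult_le_compat_l; [lra|apply Rle_abs].
    - rewrite Rmult_comm. apply Rmult_le_compat_l; [apply Rabs_pos|lra]. }
  lra.
Qed.

(** A point strictly left of the profile but outside [H1] would be separated from far points of [H1]
    on its horizontal line by a border point, and border points lie on the profile. With [1 + |y|]
    in the logarithm, a single formula also covers the heights where the profile is only known to be
    convex. *)
Lemma logarithmic_region a k H : 0 < k -> logarithmic_of_type a k H ->
  exists A, forall x y, x <= A - k * ln (1 + Rabs y) -> H (x, y).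
Proof.
  intros Hk (_ & H1 & ((HN1 & HN2) & rho & [Hconv Hbord] & Y & HY) & Hincl).
  destruct (convex_lower_bound rho (Rmax Y 1 + 1) Hconv) as [m Hm].
  { generalize (Rmax_r Y 1). lra. }
  exists (Rmin a m - 1). intros x y Hx. apply Hincl.
  assert (Hy := Rabs_pos y).
  assert (Hrho : x < rho (Rabs y)).
  { assert (L0 : 0 <= ln (1 + Rabs y)).
    { rewrite <- ln_1. destruct (Req_dec (Rabs y) 0) as [->|]; [rewrite Rplus_0_r; lra|].
      left; apply ln_increasing; lra. }
    destruct (Rle_dec (Rabs y) (Rmax Y 1 + 1)) as [Hle|Hgt].
    - assert (m <= rho (Rabs y)) by (apply Hm; lra).
      assert (Rmin a m <= m) by apply Rmin_r. nra.
    - assert (M1 := Rmax_l Y 1). assert (M2 := Rmax_r Y 1).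
      rewrite HY by lra.
      assert (ln (Rabs y) < ln (1 + Rabs y)) by (apply ln_increasing; lra).
      assert (Rmin a m <= a) by apply Rmin_l. nra. }
  apply NNPP. intros Hn.
  (* A cone of positive half-angle reaches every height far enough to the left; this supplies a
     point of [H1] at height [y]. *)
  destruct (HN1 (PI / 4)) as (w1 & _ & Hw1).
  { generalize PI_RGT_0. lra. }
  pose (x' := Rmin x (Re w1 - Rabs (Im w1 - y) - 1)).
  assert (Hx'1 : x' <= x) by apply Rmin_l.
  assert (Hx'2 : x' <= Re w1 - Rabs (Im w1 - y) - 1) by apply Rmin_r.
  assert (Hin : H1 (x', y)).
  { apply Hw1. apply C_minus_iff; [generalize PI_RGT_0; lra|].
    destruct w1 as [u v]. simpl in *. fold (v - y) in *. fold (u - x') in *.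
    assert (Q := Rabs_pos (v - y)). split; [lra|].
    rewrite <- atan_1.
    assert (B : - 1 < (v - y) / (u - x') < 1).
    { assert (- Rabs (v - y) <= v - y <= Rabs (v - y)).
      { split; [|apply Rle_abs]. generalize (Rle_abs (- (v - y))). rewrite Rabs_Ropp. lra. }
      split; apply Rmult_lt_reg_r with (u - x'); try lra; unfold Rdiv;
      rewrite Rmult_assoc, Rinv_l by lra; lra. }
    apply Rabs_def1; [apply atan_increasing; lra|].
    rewrite <- atan_opp. apply atan_increasing; lra. }
  destruct (horizontal_border H1 x' x y Hin Hn Hx'1) as (b & Hb & Hbd).
  apply Hbord in Hbd. lra.
Qed.

(** * Laplace integrals along curves *)

Definition is_Int0 (f : R -> C) (l : C) : Prop := flim (fun T => CI f 0 T) (Rbar_locally p_infty) l.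
Definition Int0 (f : R -> C) : C := the_C (is_Int0 f).

(** The majorant [M / (1 + y) ^ 2] has integral exactly [M] over the half-line, so the same constant
    bounds the integrand and the integral. *)
Definition dominated (f : R -> C) (M : R) : Prop :=
  (forall y, 0 <= y -> Rcont f y) /\ (forall y, 0 <= y -> Cmod (f y) <= M / (1 + y) ^ 2).

Lemma is_Int0_unique f l m : is_Int0 f l -> is_Int0 f m -> l = m.
Proof. apply flim_unique. apply Rbar_locally_filter. Qed.

Lemma is_Int0_Int0 f l : is_Int0 f l -> Int0 f = l.
Proof.
  intros H. apply (is_Int0_unique f); [|exact H].
  unfold Int0, the_C. apply epsilon_spec. exists l. exact H.
Qed.

Lemma dominated_CI f M S T : dominated f M -> 0 <= S -> 0 <= T -> is_CI f S T (CI f S T).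
Proof.
  intros [Hc _] HS HT. apply is_CI_cont. intros t Ht. apply Hc.
  apply between_Rmin_Rmax in Ht. lra.
Qed.

Lemma dominated_pos f M : dominated f M -> 0 <= M.
Proof.
  intros [_ H]. specialize (H 0 (Rle_refl 0)). generalize (Cmod_ge_0 (f 0)).
  rewrite Rplus_0_r, pow1, Rdiv_1_r in H. lra.
Qed.

Lemma dominated_tail f M S T : dominated f M -> 0 <= S <= T ->
  Cmod (CI f 0 T - CI f 0 S) <= M / (1 + S) - M / (1 + T).
Proof.
  intros Hf HS.
  assert (E : (CI f 0 T - CI f 0 S)%C = CI f S T).
  { rewrite (is_CI_CI f 0 T (CI f 0 S + CI f S T)%C); [ring|].
    apply is_CI_Chasles with S; apply (dominated_CI f M); auto; lra. }
  rewrite E.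
  apply (is_CI_le f (fun y => M / (1 + y) ^ 2) S T); [lra| | |].
  - intros t Ht. apply Hf. lra.
  - apply (dominated_CI f M); auto; lra.
  - replace (M / (1 + S) - M / (1 + T)) with (minus (- M / (1 + T)) (- M / (1 + S))).
    2:{ unfold minus, plus, opp; simpl. field; lra. }
    apply (is_RInt_derive (V := R_CompleteNormedModule) (fun y => - M / (1 + y))).
    + intros y Hy. rewrite Rmin_left, Rmax_right in Hy by lra.
      auto_derive; [lra|]. field. lra.
    + intros y Hy. rewrite Rmin_left, Rmax_right in Hy by lra.
      apply (ex_derive_continuous (K := R_AbsRing) (V := R_NormedModule)). auto_derive.
      repeat split; apply Rgt_not_eq; nra.
Qed.

Lemma dominated_is_Int0 f M : dominated f M -> is_Int0 f (Int0 f).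
Proof.
  intros Hf. assert (HM := dominated_pos f M Hf).
  assert (E : exists l, filterlim (fun T => CI f 0 T) (Rbar_locally p_infty)
    (locally (T := C_UniformSpace) l)).
  { apply (filterlim_locally_cauchy (U := C_CompleteNormedModule) (F := Rbar_locally p_infty)).
    intros eps.
    exists (fun T => 2 * M / eps < T /\ 0 < T). split.
    - exists (Rmax (2 * M / eps) 0). intros x Hx. split; eapply Rle_lt_trans; try exact Hx;
      [apply Rmax_l|apply Rmax_r].
    - assert (G : forall u v, 2 * M / eps < u -> 0 < u <= v -> Cmod (CI f 0 v - CI f 0 u)%C < eps).
      { intros u v Hu Huv. assert (He := cond_pos eps).
        eapply Rle_lt_trans; [apply (dominated_tail f M); [exact Hf|lra]|].
        assert (0 <= M / (1 + v)) by (apply Rdiv_le_0_compat; lra).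
        assert (M / (1 + u) < eps); [|lra].
        apply Rmult_lt_reg_r with (1 + u); [lra|]. unfold Rdiv at 1.
        rewrite Rmult_assoc, Rinv_l, Rmult_1_r by lra.
        apply (Rmult_lt_compat_r eps) in Hu; [|lra]. unfold Rdiv in Hu.
        rewrite Rmult_assoc, Rinv_l in Hu by lra. nra. }
      intros u v [Hu1 Hu2] [Hv1 Hv2]. apply C_NormedModule_mixin_compat1.
      destruct (Rle_dec u v).
      + apply G; auto.
      + change (minus (CI f 0 v) (CI f 0 u)) with (CI f 0 v - CI f 0 u)%C.
        replace (CI f 0 v - CI f 0 u)%C with (- (CI f 0 u - CI f 0 v))%C by ring.
        rewrite Cmod_opp. apply G; auto; lra. }
  destruct E as [l Hl]. assert (Hl' : is_Int0 f l) by (apply flim_filterlim; [apply _|exact Hl]).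
  rewrite (is_Int0_Int0 f l Hl'). exact Hl'.
Qed.

Lemma Cmod_flim_le {T} (F : (T -> Prop) -> Prop) {FF : ProperFilter F} (f : T -> C) l m M :
  flim f F l -> F (fun t => Cmod (f t - m) <= M) -> Cmod (l - m) <= M.
Proof.
  intros Hl HM. apply Rnot_lt_le. intros Hlt.
  assert (Hp : 0 < Cmod (l - m) - M) by lra.
  destruct (filter_ex _ (filter_and _ _ HM (Hl _ Hp))) as (t & H1 & H2).
  assert (Cmod (l - m) <= Cmod (f t - l) + Cmod (f t - m)); [|lra].
  replace (l - m)%C with (- (f t - l) + (f t - m))%C by ring.
  rewrite <- (Cmod_opp (f t - l)). apply Cmod_triangle.
Qed.

Lemma Int0_le f M : dominated f M -> Cmod (Int0 f) <= M.
Proof.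
  intros Hf. assert (HM := dominated_pos f M Hf).
  replace (Int0 f) with (Int0 f - RtoC 0)%C by ring.
  apply (Cmod_flim_le (Rbar_locally p_infty) (fun T => CI f 0 T)).
  - apply (dominated_is_Int0 f M Hf).
  - exists 0. intros T HT.
    assert (E := dominated_tail f M 0 T Hf ltac:(lra)).
    rewrite (is_CI_CI _ _ _ _ (is_CI_point f 0)) in E.
    assert (0 <= M / (1 + T)) by (apply Rdiv_le_0_compat; lra).
    rewrite Rplus_0_r, Rdiv_1_r in E. lra.
Qed.

Lemma dominated_plus f g M N : dominated f M -> dominated g N ->
  dominated (fun y => f y + g y)%C (M + N).
Proof.
  intros [H1 H2] [H3 H4]. split.
  - intros y Hy. apply flim_plus; [apply _|apply H1; exact Hy|apply H3; exact Hy].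
  - intros y Hy. eapply Rle_trans; [apply Cmod_triangle|].
    specialize (H2 y Hy). specialize (H4 y Hy). unfold Rdiv in *. lra.
Qed.

Lemma dominated_scal c f M : dominated f M -> dominated (fun y => c * f y)%C (Cmod c * M).
Proof.
  intros [H1 H2]. split.
  - intros y Hy. apply flim_mult; [apply _|apply flim_const; apply _|apply H1; exact Hy].
  - intros y Hy. rewrite Cmod_mult. unfold Rdiv. rewrite Rmult_assoc.
    apply Rmult_le_compat_l; [apply Cmod_ge_0|apply H2; exact Hy].
Qed.

Lemma is_Int0_ext f g l : (forall y, 0 < y -> f y = g y) -> is_Int0 f l -> is_Int0 g l.
Proof.
  intros H. apply flim_ext_loc; [apply _|]. exists 0. intros T HT.
  apply (RInt_ext (V := C_R_CompleteNormedModule)). intros y Hy. apply H.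
  rewrite Rmin_left in Hy by lra. lra.
Qed.

Lemma Int0_ext f g : (forall y, 0 <= y -> f y = g y) -> Int0 f = Int0 g.
Proof.
  intros H. unfold Int0. f_equal. apply functional_extensionality. intros l.
  apply PropExtensionality.propositional_extensionality.
  split; apply is_Int0_ext; intros y Hy; [|symmetry]; apply H; lra.
Qed.

Lemma Int0_plus f g M N : dominated f M -> dominated g N ->
  Int0 (fun y => f y + g y)%C = (Int0 f + Int0 g)%C.
Proof.
  intros Hf Hg. apply is_Int0_Int0.
  apply (flim_ext_loc _ (fun T => CI f 0 T + CI g 0 T)%C).
  - exists 0. intros T HT. symmetry. apply is_CI_CI.
    apply is_CI_plus; eapply dominated_CI; try eassumption; lra.
  - apply flim_plus; [apply _|eapply dominated_is_Int0; eassumption..].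
Qed.

Lemma Int0_scal c f M : dominated f M -> Int0 (fun y => c * f y)%C = (c * Int0 f)%C.
Proof.
  intros Hf. apply is_Int0_Int0.
  apply (flim_ext_loc _ (fun T => c * CI f 0 T)%C).
  - exists 0. intros T HT. symmetry. apply is_CI_CI.
    apply is_CI_scal; eapply dominated_CI; try eassumption; lra.
  - apply flim_mult; [apply _|apply flim_const; apply _|eapply dominated_is_Int0; eassumption..].
Qed.

Lemma Int0_minus f g M N : dominated f M -> dominated g N ->
  Int0 (fun y => f y - g y)%C = (Int0 f - Int0 g)%C.
Proof.
  intros Hf Hg. apply is_Int0_Int0.
  apply (flim_ext_loc _ (fun T => CI f 0 T - CI g 0 T)%C).
  - exists 0. intros T HT. symmetry. apply is_CI_CI.
    apply is_CI_minus; eapply dominated_CI; try eassumption; lra.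
  - apply flim_minus; [apply _|eapply dominated_is_Int0; eassumption..].
Qed.

Definition weighted_laplace (f U : R -> C) (p : C) : C := Int0 (fun y => f y * Cexp (- (p * U y)))%C.

(** Domination of the kernel with [j] powers of [U] to spare: the Lipschitz bound in [p] consumes
    one, the second-order remainder two. *)
Definition weight_ok (f U : R -> C) (j : nat) (M : R) (p : C) : Prop :=
  forall y, 0 <= y -> Cmod (f y) * exp (- Re (p * U y)) * (1 + Cmod (U y)) ^ j <= M / (1 + y) ^ 2.

Lemma Re_opp z : Re (- z)%C = - Re z.
Proof. reflexivity. Qed.

Lemma Rcont_kernel f U p y : Rcont f y -> Rcont U y -> Rcont (fun y => f y * Cexp (- (p * U y)))%C y.
Proof.
  intros Hf HU. apply flim_mult; [apply _|exact Hf|].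
  apply (Rcont_comp Cexp); [apply (Ccont_of_Cd _ _ _ (Cderiv_Cexp _))|].
  apply flim_opp; [apply _|]. apply flim_mult; [apply _|apply flim_const; apply _|exact HU].
Qed.

Lemma Rabs_m1 : Rabs (-1) = 1.
Proof. rewrite Rabs_left; lra. Qed.

Section WeightedLaplace.
Context (f U : R -> C) (Hf : forall y, 0 <= y -> Rcont f y) (HU : forall y, 0 <= y -> Rcont U y).

Lemma weight_ok_le i j M p : (i <= j)%nat -> weight_ok f U j M p -> weight_ok f U i M p.
Proof.
  intros Hij H y Hy. eapply Rle_trans; [|apply H; exact Hy].
  apply Rmult_le_compat_l.
  - apply Rmult_le_pos; [apply Cmod_ge_0|left; apply exp_pos].
  - apply Rle_pow; [generalize (Cmod_ge_0 (U y)); lra|exact Hij].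
Qed.

Lemma weight_dominated j M p : weight_ok f U j M p -> dominated (fun y => f y * Cexp (- (p * U y)))%C M.
Proof.
  intros H. apply (weight_ok_le 0) in H; [|lia]. split.
  - intros y Hy. apply Rcont_kernel; auto.
  - intros y Hy. rewrite Cmod_mult, Cmod_Cexp, Re_opp. specialize (H y Hy). rewrite pow_O, Rmult_1_r in H. exact H.
Qed.

Lemma weight_dominated_U M p : weight_ok f U 1 M p ->
  dominated (fun y => (- U y * f y) * Cexp (- (p * U y)))%C M.
Proof.
  intros H. split.
  - intros y Hy. apply (Rcont_kernel (fun y => - U y * f y)%C); auto.
    apply flim_mult; [apply _|apply flim_opp; [apply _|]|]; [apply HU|apply Hf]; exact Hy.
  - intros y Hy. rewrite !Cmod_mult, Cmod_Cexp, Re_opp, Cmod_opp. eapply Rle_trans; [|apply H; exact Hy].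
    assert (0 <= Cmod (f y) * exp (- Re (p * U y))).
    { apply Rmult_le_pos; [apply Cmod_ge_0|left; apply exp_pos]. }
    generalize (Cmod_ge_0 (U y)). rewrite pow_1. nra.
Qed.

(** Domination is assumed at the two points only, not around them: the estimate therefore holds up
    to the edge of the region of convergence, which is where boundary values on the real axis are
    taken. *)
Lemma weighted_laplace_lipschitz M p q : weight_ok f U 1 M p -> weight_ok f U 1 M q ->
  Cmod (weighted_laplace f U q - weighted_laplace f U p) <= M * Cmod (q - p).
Proof.
  intros Hp Hq. unfold weighted_laplace.
  rewrite <- (Int0_minus _ _ M M) by (eapply weight_dominated; eassumption).
  apply Int0_le. split.
  { intros y Hy. apply flim_minus; [apply _|..]; apply Rcont_kernel; auto. }
  intros y Hy.
  replace (f y * Cexp (- (q * U y)) - f y * Cexp (- (p * U y)))%C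
    with (f y * Cexp (- (p * U y)) * (Cexp (- ((q - p) * U y)) - 1))%C.
  2:{ replace (- (q * U y))%C with (- (p * U y) + - ((q - p) * U y))%C by ring.
      rewrite Cexp_plus. ring. }
  rewrite !Cmod_mult, Cmod_Cexp, Re_opp.
  assert (H1 := Cexp_minus_1 (- ((q - p) * U y))). rewrite Cmod_opp, Cmod_mult, Re_opp in H1.
  assert (Hfp := Cmod_ge_0 (f y)). assert (HUp := Cmod_ge_0 (U y)). assert (Hqp := Cmod_ge_0 (q - p)).
  set (A := Cmod (f y) * exp (- Re (p * U y))).
  assert (HA : 0 <= A) by (apply Rmult_le_pos; [lra|left; apply exp_pos]).
  assert (K : A * Rmax 1 (exp (- Re ((q - p) * U y))) * (1 + Cmod (U y)) <= M / (1 + y) ^ 2).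
  { unfold Rmax. destruct Rle_dec.
    - unfold A. rewrite (Rmult_assoc (Cmod (f y))), <- exp_plus.
      replace (- Re (p * U y) + - Re ((q - p) * U y)) with (- Re (q * U y)).
      2:{ unfold Re. simpl. ring. }
      specialize (Hq y Hy). rewrite pow_1 in Hq. exact Hq.
    - specialize (Hp y Hy). fold A in Hp. rewrite pow_1 in Hp. rewrite Rmult_1_r. exact Hp. }
  apply Rle_trans with (A * (Cmod (q - p) * Cmod (U y) * Rmax 1 (exp (- Re ((q - p) * U y))))).
  { apply Rmult_le_compat_l; [exact HA|exact H1]. }
  assert (HR : 0 <= Rmax 1 (exp (- Re ((q - p) * U y)))).
  { eapply Rle_trans; [|apply Rmax_l]. lra. }
  set (m := Rmax 1 (exp (- Re ((q - p) * U y)))) in *.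
  assert (0 <= A * m) by (apply Rmult_le_pos; lra).
  apply Rle_trans with (Cmod (q - p) * (A * m * (1 + Cmod (U y)))).
  - replace (A * (Cmod (q - p) * Cmod (U y) * m)) with (Cmod (q - p) * (A * m * Cmod (U y))) by ring.
    apply Rmult_le_compat_l; [exact Hqp|]. nra.
  - replace (M * Cmod (q - p) / (1 + y) ^ 2) with (Cmod (q - p) * (M / (1 + y) ^ 2))
      by (unfold Rdiv; ring).
    apply Rmult_le_compat_l; [exact Hqp|exact K].
Qed.

(** [Cexp_taylor] bounds the remainder of the kernel by [|q - p|^2 |U|^2] times its larger modulus
    at [p] or [q]; two spare powers of [U] make this integrable. *)
Lemma weighted_laplace_derive M r p : 0 < r -> (forall q, Cmod (q - p) < r -> weight_ok f U 2 M q) ->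
  Cderiv (weighted_laplace f U) p (weighted_laplace (fun y => - U y * f y)%C U p).
Proof.
  intros Hr H.
  assert (Hp : weight_ok f U 2 M p).
  { apply H. replace (p - p)%C with (RtoC 0) by ring. rewrite Cmod_0. exact Hr. }
  assert (HM : 0 <= M) by (eapply dominated_pos, weight_dominated; exact Hp).
  assert (D1 := weight_dominated_U M p (weight_ok_le 1 2 M p ltac:(lia) Hp)).
  apply deriv_along_intro; [auto|]. intros eps He. apply locally_C_iff.
  exists (Rmin r (eps / (M + 1))). split.
  { apply Rmin_pos; [exact Hr|apply Rdiv_lt_0_compat; lra]. }
  intros q Hq.
  assert (Hq1 : Cmod (q - p) < r) by (eapply Rlt_le_trans; [exact Hq|apply Rmin_l]).
  assert (Hq2 : Cmod (q - p) <= eps / (M + 1)) by (left; eapply Rlt_le_trans; [exact Hq|apply Rmin_r]).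
  specialize (H q Hq1).
  assert (Hqp := Cmod_ge_0 (q - p)).
  apply Rle_trans with (Cmod (q - p) * Cmod (q - p) * M).
  2:{ assert (Cmod (q - p) * (M + 1) <= eps).
      { apply Rle_trans with (eps / (M + 1) * (M + 1)); [apply Rmult_le_compat_r; lra|].
        right; field; lra. }
      nra. }
  unfold weighted_laplace. rewrite Cmult_comm, <- (Int0_scal (q - p)%C _ _ D1).
  rewrite <- (Int0_minus _ _ M M) by (eapply weight_dominated; eassumption).
  rewrite <- (Int0_minus _ _ (M + M) (Cmod (q - p) * M)).
  2:{ apply (dominated_plus _ _ M M); [eapply weight_dominated; exact H|].
      assert (D2 := dominated_scal (RtoC (-1)) _ _ (weight_dominated 2 M p Hp)).
      rewrite Cmod_R, Rabs_m1, Rmult_1_l in D2.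
      destruct D2 as [D3 D4]. split.
      - intros y Hy. apply flim_opp; [apply _|]. apply Rcont_kernel; auto.
      - intros y Hy. specialize (D4 y Hy). rewrite Cmod_opp.
        rewrite Cmod_mult, Cmod_R, Rabs_m1, Rmult_1_l in D4. exact D4. }
  2:{ apply dominated_scal. exact D1. }
  apply Int0_le. split.
  { intros y Hy. apply flim_minus; [apply _|apply flim_minus; [apply _|..]; apply Rcont_kernel; auto|].
    apply flim_mult; [apply _|apply flim_const; apply _|]. apply D1; exact Hy. }
  intros y Hy.
  replace (f y * Cexp (- (q * U y)) - f y * Cexp (- (p * U y))
    - (q - p) * (- U y * f y * Cexp (- (p * U y))))%C
    with (f y * Cexp (- (p * U y)) * (Cexp (- ((q - p) * U y)) - 1 - - ((q - p) * U y)))%C.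
  2:{ replace (- (q * U y))%C with (- (p * U y) + - ((q - p) * U y))%C by ring.
      rewrite Cexp_plus. ring. }
  rewrite !Cmod_mult, Cmod_Cexp, Re_opp.
  assert (H1 := Cexp_taylor (- ((q - p) * U y))). rewrite Cmod_opp, Cmod_mult, Re_opp in H1.
  assert (Hfp := Cmod_ge_0 (f y)). assert (HUp := Cmod_ge_0 (U y)).
  set (A := Cmod (f y) * exp (- Re (p * U y))).
  assert (HA : 0 <= A) by (apply Rmult_le_pos; [lra|left; apply exp_pos]).
  assert (K : A * Rmax 1 (exp (- Re ((q - p) * U y))) * (1 + Cmod (U y)) ^ 2 <= M / (1 + y) ^ 2).
  { unfold Rmax. destruct Rle_dec.
    - unfold A. rewrite (Rmult_assoc (Cmod (f y))), <- exp_plus.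
      replace (- Re (p * U y) + - Re ((q - p) * U y)) with (- Re (q * U y)).
      2:{ unfold Re. simpl. ring. }
      apply H; exact Hy.
    - rewrite Rmult_1_r. apply (Hp y Hy). }
  apply Rle_trans with (A * (Cmod (q - p) * Cmod (U y) * (Cmod (q - p) * Cmod (U y))
                             * Rmax 1 (exp (- Re ((q - p) * U y))))).
  { apply Rmult_le_compat_l; [exact HA|exact H1]. }
  assert (HR : 0 <= Rmax 1 (exp (- Re ((q - p) * U y)))).
  { eapply Rle_trans; [|apply Rmax_l]. lra. }
  set (m := Rmax 1 (exp (- Re ((q - p) * U y)))) in *.
  assert (0 <= A * m) by (apply Rmult_le_pos; lra).
  replace (Cmod (q - p) * Cmod (q - p) * M / (1 + y) ^ 2)
    with (Cmod (q - p) * Cmod (q - p) * (M / (1 + y) ^ 2)) by (unfold Rdiv; ring).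
  apply Rle_trans with (Cmod (q - p) * Cmod (q - p) * (A * m * (1 + Cmod (U y)) ^ 2)).
  - replace (A * (Cmod (q - p) * Cmod (U y) * (Cmod (q - p) * Cmod (U y)) * m))
      with (Cmod (q - p) * Cmod (q - p) * (A * m * (Cmod (U y) * Cmod (U y)))) by ring.
    apply Rmult_le_compat_l; [nra|]. apply Rmult_le_compat_l; [assumption|]. nra.
  - apply Rmult_le_compat_l; [nra|exact K].
Qed.
End WeightedLaplace.

(** * Curves along which the Laplace kernel decays *)

Lemma ln_le_linear (c x : R) : 0 < c -> 0 < x -> ln x <= x / c + ln c.
Proof.
  intros Hc Hx. replace x with (x / c * c) at 1 by (field; lra).
  assert (Hxc : 0 < x / c) by (apply Rdiv_lt_0_compat; lra).
  rewrite ln_mult by lra.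
  assert (ln (x / c) <= x / c); [|lra].
  assert (H := exp_ineq1_le (ln (x / c))). rewrite exp_ln in H by exact Hxc. lra.
Qed.

Lemma log_minus_linear (al q : R) : 0 <= al -> 0 < q ->
  exists c, forall y, 0 <= y -> al * ln (1 + y) - q * y <= c.
Proof.
  intros Ha Hq. exists (q + al * ln ((al + 1) / q)). intros y Hy.
  assert (Hc : 0 < (al + 1) / q) by (apply Rdiv_lt_0_compat; lra).
  assert (K := ln_le_linear ((al + 1) / q) (1 + y) Hc ltac:(lra)).
  apply (Rmult_le_compat_l al) in K; [|exact Ha].
  assert (al * ((1 + y) / ((al + 1) / q)) <= q * (1 + y)); [|lra].
  replace (al * ((1 + y) / ((al + 1) / q))) with (q * (1 + y) * (al / (al + 1))) by (field; lra).
  rewrite <- (Rmult_1_r (q * (1 + y))) at 2. apply Rmult_le_compat_l; [nra|].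
  apply Rmult_le_reg_r with (al + 1); [lra|]. unfold Rdiv. rewrite Rmult_assoc, Rinv_l; lra.
Qed.

Lemma exp_mul_ln_nat n x : 0 < x -> exp (INR n * ln x) = x ^ n.
Proof.
  intros Hx. induction n as [|n IH].
  - simpl. rewrite Rmult_0_l. apply exp_0.
  - rewrite S_INR, Rmult_plus_distr_r, Rmult_1_l, exp_plus, IH, exp_ln by exact Hx.
    simpl. ring.
Qed.

Lemma Re_mult z w : Re (z * w)%C = Re z * Re w - Im z * Im w.
Proof. reflexivity. Qed.

(** Common interface of the halves of the contour, used for [p] on one side of the real axis, and of
    the real half-line, used for [Re p < 0]. The decay is locally uniform in [p], for
    differentiation; its logarithmic term allows for the real part of the contour. *)
Record decay_curve (H : C -> Prop) (w0 : R) (U U' : R -> C) (P : C -> Prop) : Prop := {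
  dc_start : U 0 = RtoC w0;
  dc_in : forall y, 0 <= y -> H (U y);
  dc_deriv : forall y, 0 <= y -> Rderiv U y (U' y);
  dc_cont : forall y, 0 <= y -> Rcont U' y;
  dc_growth : exists W, 0 <= W /\ forall y, 0 <= y -> Cmod (U' y) <= W /\ Cmod (U y) <= W * (1 + y);
  dc_decay : forall p0, P p0 -> exists r c al q, 0 < r /\ 0 <= al /\ 0 < q /\
    forall p, Cmod (p - p0) < r -> forall y, 0 <= y ->
      - Re (p * U y) <= c + al * ln (1 + y) - q * y }.

Definition bounded_on (H : C -> Prop) (h : C -> C) : Prop :=
  exists M, 0 <= M /\ forall w, H w -> Cmod (h w) <= M.

Definition curve_laplace (h : C -> C) (U U' : R -> C) (p : C) : C := weighted_laplace (fun y => h (U y) * U' y)%C U p.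

Lemma exp_le a b : a <= b -> exp a <= exp b.
Proof. intros [H| ->]; [left; apply exp_increasing; exact H|lra]. Qed.

Section DecayCurve.
Context (H : C -> Prop) (w0 : R) (U U' : R -> C) (P : C -> Prop) (D : decay_curve H w0 U U' P).

Lemma dc_curve_cont y : 0 <= y -> Rcont U y.
Proof. intros Hy. apply (Rcont_of_Rd _ _ _ (dc_deriv _ _ _ _ _ D y Hy)). Qed.

Lemma dc_weight_cont h y : (forall z, H z -> Ccont h z) -> 0 <= y -> Rcont (fun y => h (U y) * U' y)%C y.
Proof.
  intros Hc Hy. apply flim_mult; [apply _| |apply (dc_cont _ _ _ _ _ D); exact Hy].
  apply (Rcont_comp h); [apply Hc; apply (dc_in _ _ _ _ _ D); exact Hy|apply dc_curve_cont; exact Hy].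
Qed.

Lemma dc_weight_ok f K p0 : 0 <= K -> (forall y, 0 <= y -> Cmod (f y) <= K) -> P p0 ->
  exists r M, 0 < r /\ forall p, Cmod (p - p0) < r -> weight_ok f U 2 M p.
Proof.
  intros HK Hf Hp.
  destruct (dc_growth _ _ _ _ _ D) as (W & HW & HU).
  destruct (dc_decay _ _ _ _ _ D p0 Hp) as (r & c & al & q & Hr & Hal & Hq & Hdec).
  (* Four powers of [1 + y]: two for [(1 + Cmod (U y)) ^ 2] and two for the majorant of
     [weight_ok]. *)
  destruct (log_minus_linear (al + 4) q ltac:(lra) Hq) as [c' Hc'].
  exists r, (K * exp (c + c') * (1 + W) ^ 2). split; [exact Hr|].
  intros p Hpp y Hy. destruct (HU y Hy) as [H1 H2]. specialize (Hdec p Hpp y Hy).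
  specialize (Hc' y Hy).
  assert (E : exp (- Re (p * U y)) <= exp (c + c') / (1 + y) ^ 4).
  { apply Rle_trans with (exp (c + c' - INR 4 * ln (1 + y))).
    - apply exp_le. replace (INR 4) with 4 by (simpl; ring). lra.
    - unfold Rminus. rewrite exp_plus, exp_Ropp, exp_mul_ln_nat by lra. right. reflexivity. }
  assert (Hy4 : 0 < (1 + y) ^ 4) by (apply pow_lt; lra).
  assert (Hy2 : 0 < (1 + y) ^ 2) by (apply pow_lt; lra).
  assert (K2 : (1 + Cmod (U y)) ^ 2 <= ((1 + W) * (1 + y)) ^ 2).
  { apply pow_incr. generalize (Cmod_ge_0 (U y)). nra. }
  apply Rle_trans with (K * (exp (c + c') / (1 + y) ^ 4) * ((1 + W) * (1 + y)) ^ 2).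
  - apply Rmult_le_compat; try exact K2.
    + apply Rmult_le_pos; [apply Cmod_ge_0|left; apply exp_pos].
    + apply pow2_ge_0.
    + apply Rmult_le_compat; auto; [apply Cmod_ge_0|left; apply exp_pos].
  - right. field. lra.
Qed.

Lemma dc_curve_weight_ok h p0 : bounded_on H h -> P p0 ->
  exists r M, 0 < r /\ forall p, Cmod (p - p0) < r -> weight_ok (fun y => h (U y) * U' y)%C U 2 M p.
Proof.
  intros (Mh & HMh & Hh) Hp.
  destruct (dc_growth _ _ _ _ _ D) as (W & HW & HU).
  apply (dc_weight_ok _ (Mh * W)); [nra| |exact Hp].
  intros y Hy. rewrite Cmod_mult. apply Rmult_le_compat; try apply Cmod_ge_0.
  - apply Hh, (dc_in _ _ _ _ _ D); exact Hy.
  - apply HU; exact Hy.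
Qed.

Lemma curve_laplace_cont h p0 : bounded_on H h -> (forall z, H z -> Ccont h z) -> P p0 ->
  Ccont (curve_laplace h U U') p0.
Proof.
  intros Hb Hc Hp. destruct (dc_curve_weight_ok h p0 Hb Hp) as (r & M & Hr & Hok).
  eapply Ccont_of_Cd. apply (weighted_laplace_derive _ U) with (M := M) (r := r); auto.
  - intros y Hy. apply dc_weight_cont; assumption.
  - intros y Hy. apply dc_curve_cont; exact Hy.
Qed.

Lemma curve_laplace_derive h p0 : bounded_on H h -> bounded_on H (fun w => / (- w) * h w)%C ->
  (forall z, H z -> z <> RtoC 0) -> (forall z, H z -> Ccont h z) -> P p0 ->
  Cderiv (curve_laplace (fun w => / (- w) * h w)%C U U') p0 (curve_laplace h U U' p0).
Proof.
  intros Hb Hb' H0 Hc Hp.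
  destruct (dc_curve_weight_ok _ p0 Hb' Hp) as (r & M & Hr & Hok).
  assert (K := weighted_laplace_derive (fun y => / (- U y) * h (U y) * U' y)%C U).
  unfold curve_laplace.
  replace (weighted_laplace (fun y => h (U y) * U' y)%C U p0)
    with (weighted_laplace (fun y => - U y * (/ (- U y) * h (U y) * U' y))%C U p0).
  - apply (K) with (M := M) (r := r); auto.
    + intros y Hy. apply (dc_weight_cont (fun w => / (- w) * h w)%C); auto. intros z Hz.
      apply flim_mult; [apply _| |apply Hc; exact Hz].
      apply flim_inv; [apply _| |apply flim_opp; [apply _|apply Ccont_id]].
      intros E. apply (H0 z Hz). replace z with (- - z)%C by ring. rewrite E. ring.
    + intros y Hy. apply dc_curve_cont; exact Hy.
  - apply Int0_ext. intros y Hy. f_equal.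
    assert (HUy : U y <> RtoC 0) by (apply H0, (dc_in _ _ _ _ _ D); exact Hy).
    field. exact HUy.
Qed.

Lemma kernel_Ccont h p z : Ccont h z -> Ccont (fun w => h w * Cexp (- (p * w)))%C z.
Proof.
  intros Hc. apply flim_mult; [apply _|exact Hc|].
  apply (Ccont_comp Cexp (fun w => - (p * w))%C); [apply (Ccont_of_Cd _ _ _ (Cderiv_Cexp _))|].
  apply flim_opp; [apply _|]. apply flim_mult; [apply _|apply flim_const; apply _|apply Ccont_id].
Qed.

(** One primitive of the kernel on all of [H] gives the integrals along all curves, so independence
    of the curve becomes a comparison of the limits of [F] at infinity. *)
Lemma curve_laplace_limit h p F : bounded_on H h -> (forall z, H z -> Ccont h z) -> P p ->
  F (RtoC w0) = RtoC 0 -> (forall z, H z -> Cderiv F z (h z * Cexp (- (p * z)))%C) ->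
  flim (fun T => F (U T)) (Rbar_locally p_infty) (curve_laplace h U U' p).
Proof.
  intros Hb Hc Hp HF0 HF.
  destruct (dc_curve_weight_ok h p Hb Hp) as (r & M & Hr & Hok).
  assert (Hok' := Hok p ltac:(replace (p - p)%C with (RtoC 0) by ring; rewrite Cmod_0; exact Hr)).
  assert (Hdom := weight_dominated _ U (fun y Hy => dc_weight_cont h y Hc Hy) dc_curve_cont 2 M p Hok').
  assert (K := dominated_is_Int0 _ _ Hdom).
  revert K. apply flim_ext_loc; [apply _|]. exists 0. intros T HT.
  apply is_CI_CI.
  replace (F (U T)) with (F (U T) - F (U 0))%C.
  2:{ rewrite (dc_start _ _ _ _ _ D), HF0. ring. }
  apply (is_CI_ext (fun y => (h (U y) * Cexp (- (p * U y))) * U' y)%C).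
  { intros y _. ring. }
  apply (CI_FTC (fun y => F (U y))); rewrite Rmin_left, Rmax_right by lra; intros y Hy.
  - apply (Rderiv_comp F U); [apply HF, (dc_in _ _ _ _ _ D); lra|apply (dc_deriv _ _ _ _ _ D); lra].
  - apply flim_mult; [apply _| |apply (dc_cont _ _ _ _ _ D); lra].
    apply (Rcont_comp (fun w => h w * Cexp (- (p * w)))%C); [|apply dc_curve_cont; lra].
    apply kernel_Ccont. apply Hc, (dc_in _ _ _ _ _ D). lra.
Qed.
End DecayCurve.

Lemma segment_estimate (H : C -> Prop) h p F M z z' :
  (forall w, H w -> Cmod (h w) <= M) -> 0 <= M ->
  (forall w, H w -> Ccont h w) -> (forall w, H w -> Cderiv F w (h w * Cexp (- (p * w)))%C) ->
  (forall s, 0 <= s <= 1 -> H (Csegment z z' s)) ->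
  Cmod (F z' - F z) <= Cmod (z' - z) * M * (exp (- Re (p * z)) + exp (- Re (p * z'))).
Proof.
  intros HM HM0 Hc HF Hs. rewrite Rmult_assoc.
  apply (Cmod_segment_bound F (fun w => h w * Cexp (- (p * w)))%C).
  intros t Ht. specialize (Hs t Ht). split; [apply HF; exact Hs|].
  split; [apply kernel_Ccont, Hc; exact Hs|].
  rewrite Cmod_mult, Cmod_Cexp, Re_opp.
  apply Rmult_le_compat; [apply Cmod_ge_0|left; apply exp_pos|apply HM; exact Hs|].
  (* The exponent is affine along the segment, so the kernel is bounded by its larger value at the
     two ends. *)
  replace (- Re (p * Csegment z z' t)) with
    ((1 - t) * (- Re (p * z)) + t * (- Re (p * z'))).
  2:{ unfold Csegment. rewrite !Re_mult. simpl. unfold Re, Im. ring. }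
  assert (X1 := exp_pos (- Re (p * z))). assert (X2 := exp_pos (- Re (p * z'))).
  destruct (Rle_dec (- Re (p * z)) (- Re (p * z'))).
  - apply Rle_trans with (exp (- Re (p * z'))); [apply exp_le; nra|lra].
  - apply Rle_trans with (exp (- Re (p * z))); [apply exp_le; nra|lra].
Qed.

Definition decays (p : C) (z : R -> C) : Prop :=
  exists W c al q, 0 <= al /\ 0 < q /\ 0 <= W /\ forall T, 0 <= T ->
    Cmod (z T) <= W * (1 + T) /\ - Re (p * z T) <= c + al * ln (1 + T) - q * T.

Lemma pinfty_inv_lt C0 eps : 0 < eps -> Rbar_locally p_infty (fun T => C0 / (1 + T) < eps).
Proof.
  intros He. exists (Rmax 0 (C0 / eps)). intros T HT.
  assert (T0 : 0 < T) by (eapply Rle_lt_trans; [apply Rmax_l|exact HT]).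
  assert (T1 : C0 / eps < T) by (eapply Rle_lt_trans; [apply Rmax_r|exact HT]).
  apply Rmult_lt_reg_r with (1 + T); [lra|]. unfold Rdiv. rewrite Rmult_assoc, Rinv_l by lra.
  apply Rmult_lt_compat_r with (r := eps) in T1; [|lra].
  unfold Rdiv in T1. rewrite Rmult_assoc, Rinv_l in T1 by lra. nra.
Qed.

Lemma decays_small p z : decays p z ->
  exists C0, 0 <= C0 /\ forall T, 0 <= T -> exp (- Re (p * z T)) <= C0 / (1 + T) ^ 2.
Proof.
  intros (W & c & al & q & Hal & Hq & HW & Hz).
  destruct (log_minus_linear (al + 2) q ltac:(lra) Hq) as [c' Hc'].
  exists (exp (c + c')). split; [left; apply exp_pos|]. intros T HT.
  specialize (Hc' T HT). destruct (Hz T HT) as [_ H2].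
  apply Rle_trans with (exp (c + c' - INR 2 * ln (1 + T))).
  - apply exp_le. replace (INR 2) with 2 by (simpl; ring). lra.
  - unfold Rminus. rewrite exp_plus, exp_Ropp, exp_mul_ln_nat by lra. right. reflexivity.
Qed.

(** The joining segment has length [O(T)], and on it the kernel is [O(T^(-2))]. *)
Lemma tails_agree (H : C -> Prop) h p F (z z' : R -> C) :
  bounded_on H h -> (forall w, H w -> Ccont h w) ->
  (forall w, H w -> Cderiv F w (h w * Cexp (- (p * w)))%C) ->
  decays p z -> decays p z' ->
  Rbar_locally p_infty (fun T => forall s, 0 <= s <= 1 -> H (Csegment (z T) (z' T) s)) ->
  flim (fun T => F (z' T) - F (z T))%C (Rbar_locally p_infty) (RtoC 0).
Proof.
  intros (M & HM0 & HM) Hc HF Hz Hz' Hseg.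
  destruct (decays_small p z Hz) as (C1 & HC1 & B1).
  destruct (decays_small p z' Hz') as (C2 & HC2 & B2).
  destruct Hz as (W & c & al & q & Hal & Hq & HW & Hz).
  destruct Hz' as (W' & c' & al' & q' & Hal' & Hq' & HW' & Hz').
  apply (flim_squeeze _ _ _ (fun T => ((W + W') * M * (C1 + C2)) / (1 + T))).
  - apply pinfty_inv_lt.
  - assert (H0 : Rbar_locally p_infty (fun T => 0 < T)) by (exists 0; auto).
    generalize (filter_and _ _ H0 Hseg). apply filter_imp. intros T [HT Hs].
    replace (F (z' T) - F (z T) - 0)%C with (F (z' T) - F (z T))%C by ring.
    eapply Rle_trans; [apply (segment_estimate H h p F M); assumption|].
    specialize (B1 T ltac:(lra)). specialize (B2 T ltac:(lra)).
    destruct (Hz T ltac:(lra)) as [G1 _]. destruct (Hz' T ltac:(lra)) as [G2 _].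
    assert (G : Cmod (z' T - z T) <= (W + W') * (1 + T)).
    { eapply Rle_trans; [apply Cmod_triangle|]. rewrite Cmod_opp. lra. }
    apply Rle_trans with ((W + W') * (1 + T) * M * (C1 / (1 + T) ^ 2 + C2 / (1 + T) ^ 2)).
    + apply Rmult_le_compat.
      * apply Rmult_le_pos; [apply Cmod_ge_0|exact HM0].
      * generalize (exp_pos (- Re (p * z T))) (exp_pos (- Re (p * z' T))). lra.
      * apply Rmult_le_compat_r; assumption.
      * lra.
    + right. field. lra.
Qed.

Lemma ray_decays p w1 v : 0 < Re (p * v) -> decays p (fun T => w1 + RtoC T * v)%C.
Proof.
  intros Hv. exists (Cmod w1 + Cmod v), (- Re (p * w1)), 0, (Re (p * v)).
  assert (P1 := Cmod_ge_0 w1). assert (P2 := Cmod_ge_0 v).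
  split; [lra|]. split; [exact Hv|]. split; [lra|]. intros T HT. split.
  - eapply Rle_trans; [apply Cmod_triangle|]. rewrite Cmod_mult, Cmod_R, Rabs_pos_eq by exact HT. nra.
  - rewrite !Re_mult. simpl. unfold Re, Im. right. ring.
Qed.

Lemma left_domain_far H w1 v w1' v' : left_domain H -> Re v < 0 -> Re v' < 0 ->
  Rbar_locally p_infty (fun T => forall s, 0 <= s <= 1 ->
    H (Csegment (w1 + RtoC T * v) (w1' + RtoC T * v') s)).
Proof.
  intros L Hv Hv'.
  pose (c := Rmin (- Re v) (- Re v')).
  assert (Hc : 0 < c) by (apply Rmin_pos; lra).
  assert (Hc1 : c <= - Re v) by apply Rmin_l. assert (Hc2 : c <= - Re v') by apply Rmin_r.
  pose (V := Rabs (Im v) + Rabs (Im v')). pose (Y := Rabs (Im w1) + Rabs (Im w1')).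
  pose (X := Rabs (Re w1) + Rabs (Re w1')).
  (* [V] bounds the vertical speed of both rays and [c] is a lower bound of their speed to the left;
     a cone of slope greater than [V / c] contains everything from some time on. *)
  pose (m := (V + 1) / c).
  assert (PV : 0 <= Rabs (Im v) /\ 0 <= Rabs (Im v')) by (split; apply Rabs_pos).
  assert (PY : 0 <= Rabs (Im w1) /\ 0 <= Rabs (Im w1')) by (split; apply Rabs_pos).
  assert (Hm : 0 < m) by (unfold m; apply Rdiv_lt_0_compat; unfold V; lra).
  assert (Hmc : m * c = V + 1) by (unfold m; field; lra).
  destruct (ld_cone H L m Hm) as [x0 Hx0].
  exists (Rmax 0 (Y + m * (X + Rabs x0))). intros T HT s Hs. apply Hx0.
  assert (T0 : 0 < T) by (eapply Rle_lt_trans; [apply Rmax_l|exact HT]).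
  assert (T1 : Y + m * (X + Rabs x0) < T) by (eapply Rle_lt_trans; [apply Rmax_r|exact HT]).
  assert (EI : Im (Csegment (w1 + RtoC T * v) (w1' + RtoC T * v') s)
    = (1 - s) * (Im w1 + T * Im v) + s * (Im w1' + T * Im v')).
  { unfold Csegment. simpl. unfold Re, Im. ring. }
  assert (ER : Re (Csegment (w1 + RtoC T * v) (w1' + RtoC T * v') s)
    = (1 - s) * (Re w1 + T * Re v) + s * (Re w1' + T * Re v')).
  { unfold Csegment. simpl. unfold Re, Im. ring. }
  unfold Cone. rewrite EI, ER.
  assert (A1 : Rabs (Im w1 + T * Im v) <= Y + T * V).
  { eapply Rle_trans; [apply Rabs_triang|]. rewrite Rabs_mult, (Rabs_pos_eq T) by lra.
    unfold Y, V. nra. }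
  assert (A2 : Rabs (Im w1' + T * Im v') <= Y + T * V).
  { eapply Rle_trans; [apply Rabs_triang|]. rewrite Rabs_mult, (Rabs_pos_eq T) by lra.
    unfold Y, V. nra. }
  assert (A : Rabs ((1 - s) * (Im w1 + T * Im v) + s * (Im w1' + T * Im v')) <= Y + T * V).
  { eapply Rle_trans; [apply Rabs_triang|]. rewrite !Rabs_mult, (Rabs_pos_eq s), (Rabs_pos_eq (1 - s)) by lra.
    nra. }
  assert (B1 : Re w1 + T * Re v <= X - T * c).
  { assert (Re w1 <= X). { unfold X. generalize (Rle_abs (Re w1)) (Rabs_pos (Re w1')). lra. } nra. }
  assert (B2 : Re w1' + T * Re v' <= X - T * c).
  { assert (Re w1' <= X). { unfold X. generalize (Rle_abs (Re w1')) (Rabs_pos (Re w1)). lra. } nra. }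
  assert (B : (1 - s) * (Re w1 + T * Re v) + s * (Re w1' + T * Re v') <= X - T * c) by nra.
  assert (Hx := Rle_abs (- x0)). rewrite Rabs_Ropp in Hx.
  apply Rle_lt_trans with (Y + T * V); [exact A|].
  apply Rlt_le_trans with (m * (- Rabs x0 - X + T * c)).
  - replace (m * (- Rabs x0 - X + T * c)) with (T * (m * c) - m * (X + Rabs x0)) by ring.
    rewrite Hmc. lra.
  - apply Rmult_le_compat_l; lra.
Qed.

(** * The Laplace transform *)

Lemma C1_curve_Rd h : C1_curve h -> exists d, (forall t, Rderiv h t (d t)) /\ (forall t, Rcont d t).
Proof.
  intros (d & H1 & H2). exists d. split; intros t.
  - apply Rderiv_is_derive. apply H1.
  - apply Rcont_continuous. apply H2.
Qed.

Lemma velocity_Rd c h t l : locally t (fun s => c s = h s) -> Rderiv h t l -> velocity c t = l.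
Proof.
  intros Hloc Hd. unfold velocity.
  rewrite (Derive_ext_loc (fun s => Re (c s)) (fun s => Re (h s))).
  2:{ revert Hloc. apply filter_imp. intros s ->. reflexivity. }
  rewrite (Derive_ext_loc (fun s => Im (c s)) (fun s => Im (h s))).
  2:{ revert Hloc. apply filter_imp. intros s ->. reflexivity. }
  rewrite (surjective_pairing l). f_equal; apply is_derive_unique;
    [apply (Rderiv_fst _ _ _ Hd)|apply (Rderiv_snd _ _ _ Hd)].
Qed.

Lemma locally_open_interval (a b t : R) (Q : R -> Prop) : a < t < b ->
  (forall s, a < s < b -> Q s) -> locally t Q.
Proof.
  intros Ht HQ. apply locally_R_iff. exists (Rmin (t - a) (b - t)).
  split; [apply Rmin_pos; lra|]. intros s Hs. apply Rabs_def2 in Hs. apply HQ.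
  generalize (Rmin_l (t - a) (b - t)) (Rmin_r (t - a) (b - t)). lra.
Qed.

Lemma velocity_piece c h d a b t : (forall t, Rderiv h t (d t)) ->
  (forall t, a <= t <= b -> c t = h t) -> a < t < b -> velocity c t = d t.
Proof.
  intros Hd Hc Ht. apply (velocity_Rd c h); [|apply Hd].
  apply (locally_open_interval a b); [exact Ht|]. intros s Hs. apply Hc; lra.
Qed.

Lemma piecewise_C1_lt c a b : piecewise_C1 c a b -> a < b.
Proof. induction 1; lra. Qed.

Lemma Rcont_bounded (d : R -> C) a b : (forall t, a <= t <= b -> Rcont d t) ->
  exists M, 0 <= M /\ forall t, a <= t <= b -> Cmod (d t) <= M.
Proof.
  intros H.
  destruct (bounded_continuity (V := C_R_NormedModule) d a b) as [M HM].
  { intros t Ht. apply Rcont_continuous. apply H; exact Ht. }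
  exists (Rmax 0 M). split; [apply Rmax_l|]. intros t Ht. left.
  rewrite <- norm_C_R. eapply Rlt_le_trans; [apply HM; exact Ht|apply Rmax_r].
Qed.

Definition ccont_on (K : C -> Prop) (f : C -> C) : Prop :=
  forall z, K z -> flim f (within K (locally (T := C_UniformSpace) z)) (f z).

Lemma ccont_on_ball K f z e : ccont_on K f -> K z -> 0 < e ->
  exists r, 0 < r /\ forall u, K u -> Cmod (u - z) < r -> Cmod (f u - f z) < e.
Proof.
  intros H Hz He. specialize (H z Hz e He). unfold within in H. apply locally_C_iff in H.
  destruct H as (r & Hr & H). exists r. split; [exact Hr|]. auto.
Qed.

Lemma closure_incl H z : H z -> closure H z.
Proof.
  intros Hz e He. exists z. split; [exact Hz|].
  replace (z - z)%C with (RtoC 0) by ring. rewrite Cmod_0. exact He.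
Qed.

Lemma at_right_0_iff (Q : R -> Prop) :
  at_right 0 Q <-> exists d, 0 < d /\ forall e, 0 < e < d -> Q e.
Proof.
  split.
  - intros H. unfold at_right, within in H. apply locally_R_iff in H. destruct H as (d & Hd & H).
    exists d. split; [exact Hd|]. intros e He. apply H; [|lra]. rewrite Rminus_0_r, Rabs_pos_eq; lra.
  - intros (d & Hd & H). unfold at_right, within. apply locally_R_iff. exists d. split; [exact Hd|].
    intros e He He0. apply H. rewrite Rminus_0_r, Rabs_pos_eq in He by lra. lra.
Qed.

(** Uniform continuity by compactness of [[a, b]]: the values at [h t] and at [h t - e] are both
    compared with the value at the centre [h x] of a nearby patch. The patch radii are first chosen
    as a function of the centre. *)
Lemma shift_uniform (H : C -> Prop) f (h : R -> C) a b eta :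
  (forall z e, closure H z -> 0 < e -> H (z - RtoC e)%C) ->
  ccont_on (closure H) f -> (forall t, Rcont h t) ->
  (forall t, a <= t <= b -> closure H (h t)) -> 0 < eta ->
  exists d, 0 < d /\ forall e t, 0 < e < d -> a <= t <= b ->
    Cmod (f (h t - RtoC e)%C - f (h t)) < eta.
Proof.
  intros Hsh Hf Hh Hin Heta.
  assert (Hd : forall t, exists d : posreal, a <= t <= b ->
    forall e s, 0 <= e < d -> Rabs (s - t) < d -> a <= s <= b ->
      Cmod (f (h s - RtoC e)%C - f (h t)) < eta / 2).
  { intros t. destruct (classic (a <= t <= b)) as [Ht|Ht].
    2:{ exists (mkposreal 1 Rlt_0_1). intros; contradiction. }
    destruct (ccont_on_ball _ _ _ (eta / 2) Hf (Hin t Ht) ltac:(lra)) as (r & Hr & Hball).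
    assert (Hr2 : 0 < r / 2) by lra.
    assert (Hht := Hh t (r / 2) Hr2). apply locally_R_iff in Hht. destruct Hht as (d & Hd & Hht).
    assert (Hm : 0 < Rmin d (r / 2)) by (apply Rmin_pos; lra).
    exists (mkposreal _ Hm). simpl. intros _ e s He Hs Hab. apply Hball.
    - destruct (Req_dec e 0) as [->|Hne].
      + replace (h s - 0)%C with (h s) by ring. apply Hin; exact Hab.
      + apply closure_incl. apply Hsh; [apply Hin; exact Hab|lra].
    - replace (h s - RtoC e - h t)%C with ((h s - h t) + - RtoC e)%C by ring.
      eapply Rle_lt_trans; [apply Cmod_triangle|]. rewrite Cmod_opp, Cmod_R, Rabs_pos_eq by lra.
      generalize (Rmin_l d (r / 2)) (Rmin_r d (r / 2)). intros.
      assert (Cmod (h s - h t) < r / 2) by (apply Hht; lra). lra. }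
  apply choice in Hd. destruct Hd as [delta Hdelta].
  destruct (compactness_value_1d a b delta) as [d Hd].
  exists d. split; [apply cond_pos|]. intros e t He Ht.
  apply NNPP. intros Hn. apply (Hd t Ht). intros (x & Hx & Hxt & Hdx).
  apply Hn. clear Hn.
  assert (K1 := Hdelta x Hx e t ltac:(lra) ltac:(lra) Ht).
  assert (K2 := Hdelta x Hx 0 t ltac:(lra) ltac:(lra) Ht).
  replace (h t - 0)%C with (h t) in K2 by ring.
  replace (f (h t - RtoC e) - f (h t))%C with
    ((f (h t - RtoC e) - f (h x)) + - (f (h t) - f (h x)))%C by ring.
  eapply Rle_lt_trans; [apply Cmod_triangle|]. rewrite Cmod_opp. lra.
Qed.

Lemma at_right_const_unique {f : R -> C} {l m : C} :
  flim f (at_right 0) l -> flim f (at_right 0) m -> l = m.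
Proof. apply flim_unique. apply at_right_proper_filter. Qed.

(* The path may touch the border of [H], so it is first shifted to the left by [e]. *)
Lemma closure_path_integral (H : C -> Prop) f F c a b :
  (forall z e, closure H z -> 0 < e -> H (z - RtoC e)%C) ->
  ccont_on (closure H) f -> (forall z, H z -> Ccont f z) -> (forall z, H z -> Cderiv F z (f z)) ->
  piecewise_C1 c a b -> (forall t, a <= t <= b -> closure H (c t)) ->
  exists I, is_path_int f c a b I /\
    flim (fun e => F (c b - RtoC e) - F (c a - RtoC e))%C (at_right 0) I.
Proof.
  intros Hsh Hf Hfc HF Hc. induction Hc as [a b h Hab Hh Hch|a m b Hc1 IH1 Hc2 IH2]; intros Hin.
  - destruct (C1_curve_Rd h Hh) as (d & Hd & Hdc).
    assert (Hin' : forall t, a <= t <= b -> closure H (h t)).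
    { intros t Ht. rewrite <- Hch by exact Ht. apply Hin; exact Ht. }
    assert (Hhc : forall t, Rcont h t) by (intros t; apply (Rcont_of_Rd _ _ _ (Hd t))).
    assert (Hon : Rcont_on (fun t => f (h t) * d t)%C a b).
    { intros t Ht. apply flim_mult; [apply _| |].
      - apply (flim_comp h f (within (fun s => a <= s <= b) (locally t))
          (within (closure H) (locally (T := C_UniformSpace) (h t)))); [|apply Hf, Hin'; exact Ht].
        intros Q HQ. unfold within in HQ. apply locally_C_iff in HQ. destruct HQ as (r & Hr & HQ).
        unfold filtermap, within. generalize (Hhc t r Hr). apply filter_imp. intros s Hs Hss.
        apply HQ; [exact Hs|apply Hin'; exact Hss].
      - intros e He. unfold within. generalize (Hdc t e He). apply filter_imp. auto. }
    assert (K := is_CI_cont_on _ a b (Rlt_le _ _ Hab) Hon).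
    exists (CI (fun t => f (h t) * d t)%C a b). split.
    { apply (is_CI_ext (fun t => f (h t) * d t)%C); [|exact K].
      intros t Ht. rewrite Rmin_left, Rmax_right in Ht by lra.
      rewrite (velocity_piece c h d a b t Hd Hch Ht), Hch by lra. reflexivity. }
    rewrite !Hch by lra.
    destruct (Rcont_bounded d a b (fun t _ => Hdc t)) as (Md & HMd & HMd').
    intros eps He. apply at_right_0_iff.
    destruct (shift_uniform H f h a b (eps / 2 / ((b - a) * (Md + 1))) Hsh Hf Hhc Hin') as (dl & Hdl & Hu).
    { apply Rdiv_lt_0_compat; [lra|]. apply Rmult_lt_0_compat; lra. }
    exists dl. split; [exact Hdl|]. intros e Hee.
    assert (Ke : is_CI (fun t => f (h t - RtoC e) * d t)%C a b (F (h b - RtoC e) - F (h a - RtoC e))%C).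
    { apply (CI_FTC (fun t => F (h t - RtoC e)%C)); rewrite Rmin_left, Rmax_right by lra; intros t Ht.
      - apply (Rderiv_comp F (fun t => h t - RtoC e)%C); [apply HF, Hsh; [apply Hin'; exact Ht|lra]|].
        replace (d t) with (d t - RtoC 0)%C by ring. apply deriv_along_minus; [apply Hd|apply deriv_along_const].
      - apply flim_mult; [apply _| |apply Hdc].
        apply (Rcont_comp f (fun t => h t - RtoC e)%C).
        + apply Hfc, Hsh; [apply Hin'; exact Ht|lra].
        + apply flim_minus; [apply _|apply Hhc|apply flim_const; apply _]. }
    assert (Kd := is_CI_minus _ _ _ _ _ _ Ke K).
    apply is_CI_le_const with (M := eps / 2 / ((b - a) * (Md + 1)) * (Md + 1)) in Kd; [|lra|].
    + eapply Rle_lt_trans; [exact Kd|].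
      replace ((b - a) * (eps / 2 / ((b - a) * (Md + 1)) * (Md + 1))) with (eps / 2) by (field; lra). lra.
    + intros t Ht.
      replace (f (h t - RtoC e) * d t - f (h t) * d t)%C
        with ((f (h t - RtoC e) - f (h t)) * d t)%C by ring.
      rewrite Cmod_mult. apply Rmult_le_compat; try apply Cmod_ge_0.
      * left. apply Hu; auto.
      * specialize (HMd' t Ht). lra.
  - assert (L1 := piecewise_C1_lt _ _ _ Hc1). assert (L2 := piecewise_C1_lt _ _ _ Hc2).
    destruct IH1 as (I1 & A1 & B1); [intros; apply Hin; lra|].
    destruct IH2 as (I2 & A2 & B2); [intros; apply Hin; lra|].
    exists (I1 + I2)%C. split; [apply (is_CI_Chasles _ a m b); assumption|].
    apply (flim_ext _ (fun e => (F (c m - RtoC e) - F (c a - RtoC e))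
      + (F (c b - RtoC e) - F (c m - RtoC e)))%C); [intros; ring|].
    apply flim_plus; [apply _|exact B1|exact B2].
Qed.

Lemma affine_C1 w1 v : C1_curve (fun t => w1 + RtoC t * v)%C.
Proof.
  exists (fun _ => v). split; intros t.
  - apply Rderiv_is_derive. apply affine_Rd.
  - apply Rcont_continuous. apply flim_const; apply _.
Qed.

Lemma flim_shift_cont F z : Ccont F z -> flim (fun e => F (z - RtoC e)%C) (at_right 0) (F z).
Proof.
  intros Hc eps He. specialize (Hc eps He). apply locally_C_iff in Hc. destruct Hc as (d & Hd & Hc).
  apply at_right_0_iff. exists d. split; [exact Hd|]. intros e Hee. apply Hc.
  replace (z - RtoC e - z)%C with (- RtoC e)%C by ring.
  rewrite Cmod_opp, Cmod_R, Rabs_pos_eq; lra.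
Qed.

Section LaplaceValue.
Context (H : C -> Prop) (w0 : R) (g : C -> C) (p L : C).
Context (HL : left_domain H) (Hw0 : H (RtoC w0)) (Hb : bounded_on H g).
Context (Hgc : forall z, H z -> Ccont g z) (Hgon : ccont_on (closure H) g).
Context (F : C -> C) (HF0 : F (RtoC w0) = RtoC 0)
  (HF : forall z, H z -> Cderiv F z (g z * Cexp (- (p * z)))%C).
(* The primitive tends to [L] along one, hence along every, ray on which [exp (- p w)] decays. *)
Context (v0 : C) (Hv0 : Re v0 < 0) (Hpv0 : 0 < Re (p * v0))
  (Hlim : flim (fun T => F (RtoC w0 + RtoC T * v0)%C) (Rbar_locally p_infty) L).

Let f (w : C) : C := (g w * Cexp (- (p * w)))%C.

Lemma kernel_on : ccont_on (closure H) f.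
Proof.
  intros z Hz. apply flim_mult; [apply _|apply Hgon; exact Hz|].
  intros e He. unfold within.
  assert (K : Ccont (fun w => Cexp (- (p * w))) z).
  { apply (Ccont_comp Cexp (fun w => - (p * w))%C); [apply (Ccont_of_Cd _ _ _ (Cderiv_Cexp _))|].
    apply flim_opp; [apply _|]. apply flim_mult; [apply _|apply flim_const; apply _|apply Ccont_id]. }
  generalize (K e He). apply filter_imp. auto.
Qed.

(** Points of equal parameter on two admissible rays are joined by segments that eventually lie in
    [H]. *)
Lemma ray_limit w1 v : Re v < 0 -> 0 < Re (p * v) ->
  flim (fun T => F (w1 + RtoC T * v)%C) (Rbar_locally p_infty) L.
Proof.
  intros Hv Hpv.
  apply (flim_ext _ (fun T => F (RtoC w0 + RtoC T * v0)
    + (F (w1 + RtoC T * v) - F (RtoC w0 + RtoC T * v0)))%C); [intros; ring|].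
  apply (flim_eq _ _ (L + RtoC 0)%C); [|ring].
  apply flim_plus; [apply _|exact Hlim|].
  apply (tails_agree H g p F); auto.
  - apply ray_decays; exact Hpv0.
  - apply ray_decays; exact Hpv.
  - apply left_domain_far; assumption.
Qed.

Lemma left_domain_ray_far w1 v : Re v < 0 ->
  Rbar_locally p_infty (fun T => H (w1 + RtoC T * v)%C).
Proof.
  intros Hv. generalize (left_domain_far H w1 v w1 v HL Hv Hv). apply filter_imp.
  intros T HT. specialize (HT 0 ltac:(lra)). unfold Csegment in HT.
  replace (w1 + RtoC T * v)%C with (w1 + RtoC T * v + RtoC 0 * (w1 + RtoC T * v - (w1 + RtoC T * v)))%C
    by ring. exact HT.
Qed.

(** The ray may start on the border, where [F] carries no information; its limit [J1] from the left
    replaces the value. *)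
Lemma ray_primitive w1 v J1 :
  (forall t, 0 <= t -> closure H (w1 + RtoC t * v)%C) -> Re v < 0 ->
  flim (fun e => F (w1 - RtoC e)%C) (at_right 0) J1 ->
  Rbar_locally p_infty (fun T => is_CI (fun t => f (w1 + RtoC t * v) * v)%C 0 T
    (F (w1 + RtoC T * v) - J1)%C).
Proof.
  intros Hin Hv HJ.
  assert (H0 : Rbar_locally p_infty (fun T => 0 < T)) by (exists 0; auto).
  generalize (filter_and _ _ H0 (left_domain_ray_far w1 v Hv)). apply filter_imp. intros T [HT HTin].
  destruct (closure_path_integral H f F (fun t => w1 + RtoC t * v)%C 0 T (ld_shift H HL) kernel_on)
    as (J & K1 & K2).
  - intros z Hz. apply kernel_Ccont. apply Hgc; exact Hz.
  - exact HF.
  - apply piecewise_C1_piece with (fun t => w1 + RtoC t * v)%C; [exact HT|apply affine_C1|auto].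
  - intros t Ht. apply Hin; lra.
  - assert (E : J = (F (w1 + RtoC T * v) - J1)%C).
    { apply (at_right_const_unique K2). apply flim_minus; [apply _| |].
      - apply flim_shift_cont. apply (Ccont_of_Cd _ _ _ (HF _ HTin)).
      - revert HJ. apply flim_ext; [apply _|]. intros e. f_equal. ring. }
    rewrite <- E. apply (is_CI_ext (fun t => f (w1 + RtoC t * v) * velocity (fun t => w1 + RtoC t * v)%C t)%C);
      [|exact K1].
    intros t Ht. f_equal. apply (velocity_Rd _ (fun t => w1 + RtoC t * v)%C); [apply filter_forall; auto|].
    apply affine_Rd.
Qed.

Lemma is_Laplace_unique l : is_Laplace H w0 g p l -> l = L.
Proof.
  intros (w1 & v & c & I1 & I2 & Hv & Hpv & Hray & Hc & Hc0 & Hc1 & Hcin & HI1 & HI2 & ->).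
  destruct (closure_path_integral H f F c 0 1 (ld_shift H HL) kernel_on) as (J1 & K1 & K2); auto.
  { intros z Hz. apply kernel_Ccont. apply Hgc; exact Hz. }
  assert (E1 : I1 = J1) by (apply (is_CI_unique _ _ _ _ _ HI1 K1)). subst J1.
  rewrite Hc0, Hc1 in K2.
  (* As [F] vanishes at [w0], the path integral is the boundary value of [F] at the start of the
     ray. *)
  assert (K3 : flim (fun e => F (w1 - RtoC e)%C) (at_right 0) I1).
  { apply (flim_ext _ (fun e => (F (w1 - RtoC e) - F (RtoC w0 - RtoC e)) + F (RtoC w0 - RtoC e))%C);
      [intros; ring|].
    apply (flim_eq _ _ (I1 + F (RtoC w0))%C); [|rewrite HF0; ring].
    apply flim_plus; [apply _|exact K2|]. apply flim_shift_cont.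
    apply (Ccont_of_Cd _ _ _ (HF _ Hw0)). }
  assert (K4 := ray_primitive w1 v I1 Hray Hv K3).
  assert (K5 : flim (fun T => F (w1 + RtoC T * v) - I1)%C (Rbar_locally p_infty) I2).
  { intros eps He.
    assert (HP : locally (T := C_R_NormedModule) I2 (fun z => Cmod (z - I2) < eps)).
    { apply (locally_C_iff I2). exists eps. auto. }
    specialize (HI2 _ HP). destruct HI2 as [Q R HQ HR HQR].
    generalize (filter_and _ _ HR K4). apply filter_imp. intros T [HRT HT].
    destruct (HQR 0 T HQ HRT) as (y & Hy1 & Hy2). simpl in Hy1.
    rewrite (is_CI_unique _ _ _ _ _ HT Hy1). exact Hy2. }
  apply (flim_unique (Rbar_locally p_infty) (fun T => F (w1 + RtoC T * v)%C)).
  - apply (flim_ext _ (fun T => I1 + (F (w1 + RtoC T * v) - I1))%C); [intros; ring|].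
    apply flim_plus; [apply _|apply flim_const; apply _|exact K5].
  - apply ray_limit; assumption.
Qed.

Lemma is_Laplace_exists : is_Laplace H w0 g p L.
Proof.
  (* start the ray far enough to the left for it to stay in the domain *)
  destruct (ld_cone H HL ((Rabs (Im v0) + 1) / - Re v0)) as [x0 Hx0].
  { apply Rdiv_lt_0_compat; [generalize (Rabs_pos (Im v0)); lra|lra]. }
  pose (x1 := Rmin (x0 - 1) (w0 - 1)).
  assert (X1 : x1 <= x0 - 1) by apply Rmin_l. assert (X2 : x1 <= w0 - 1) by apply Rmin_r.
  assert (Hray : forall t, 0 <= t -> H (RtoC x1 + RtoC t * v0)%C).
  { intros t Ht. apply Hx0. unfold Cone.
    replace (Im (RtoC x1 + RtoC t * v0)) with (t * Im v0) by (simpl; unfold Im; ring).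
    replace (Re (RtoC x1 + RtoC t * v0)) with (x1 + t * Re v0) by (simpl; unfold Re; ring).
    rewrite Rabs_mult, (Rabs_pos_eq t) by exact Ht.
    assert (Hm : 0 < (Rabs (Im v0) + 1) / - Re v0).
    { apply Rdiv_lt_0_compat; [generalize (Rabs_pos (Im v0)); lra|lra]. }
    replace ((Rabs (Im v0) + 1) / - Re v0 * (x0 - (x1 + t * Re v0)))
      with ((Rabs (Im v0) + 1) / - Re v0 * (x0 - x1) + t * (Rabs (Im v0) + 1)) by (field; lra).
    nra. }
  pose (c := fun t => (RtoC w0 + RtoC t * RtoC (x1 - w0))%C).
  assert (Hcin : forall t, 0 <= t <= 1 -> closure H (c t)).
  { intros t Ht. apply closure_incl. unfold c.
    replace (RtoC w0 + RtoC t * RtoC (x1 - w0))%C with (w0 + t * (x1 - w0), 0).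
    - apply (ld_left H HL w0 0); [exact Hw0|nra|lra].
    - apply injective_projections; simpl; ring. }
  assert (Hcp : piecewise_C1 c 0 1).
  { apply piecewise_C1_piece with c; [lra|apply affine_C1|auto]. }
  assert (Hc0 : c 0 = RtoC w0) by (unfold c; ring).
  assert (Hc1 : c 1 = RtoC x1) by (unfold c; rewrite RtoC_minus; ring).
  destruct (closure_path_integral H f F c 0 1 (ld_shift H HL) kernel_on) as (J1 & K1 & K2); auto.
  { intros z Hz. apply kernel_Ccont. apply Hgc; exact Hz. }
  rewrite Hc0, Hc1 in K2.
  assert (Hx1 : H (RtoC x1)).
  { specialize (Hray 0 (Rle_refl 0)). replace (RtoC x1) with (RtoC x1 + RtoC 0 * v0)%C by ring. exact Hray. }
  assert (E1 : J1 = F (RtoC x1)).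
  { apply (at_right_const_unique K2). apply (flim_eq _ _ (F (RtoC x1) - F (RtoC w0))%C).
    - apply flim_minus; [apply _|..]; apply flim_shift_cont;
        [apply (Ccont_of_Cd F _ _ (HF _ Hx1))|apply (Ccont_of_Cd F _ _ (HF _ Hw0))].
    - rewrite HF0. ring. }
  exists (RtoC x1), v0, c, J1, (L - J1)%C.
  split; [exact Hv0|]. split; [exact Hpv0|]. split; [intros t Ht; apply closure_incl, Hray; exact Ht|].
  split; [exact Hcp|]. split; [exact Hc0|]. split; [exact Hc1|]. split; [exact Hcin|].
  split; [exact K1|]. split; [|ring].
  assert (K4 := ray_primitive (RtoC x1) v0 J1 (fun t Ht => closure_incl H _ (Hray t Ht)) Hv0
    ltac:(rewrite E1; apply flim_shift_cont; apply (Ccont_of_Cd F _ _ (HF _ Hx1)))).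
  assert (K5 : flim (fun T => F (RtoC x1 + RtoC T * v0) - J1)%C (Rbar_locally p_infty) (L - J1)%C).
  { apply flim_minus; [apply _|apply ray_limit; assumption|apply flim_const; apply _]. }
  intros Q HQ. apply (locally_C_iff (L - J1)%C) in HQ. destruct HQ as (r & Hr & HQ).
  apply (Filter_prod _ _ _ (fun x => x = 0)
    (fun T => is_CI (fun t => f (RtoC x1 + RtoC t * v0) * v0)%C 0 T (F (RtoC x1 + RtoC T * v0) - J1)%C
      /\ Cmod ((F (RtoC x1 + RtoC T * v0)%C - J1) - (L - J1)) < r)).
  - reflexivity.
  - apply filter_and; [exact K4|exact (K5 r Hr)].
  - intros x T -> [HT1 HT2]. exists (F (RtoC x1 + RtoC T * v0) - J1)%C. split; [exact HT1|].
    apply HQ; exact HT2.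
Qed.

Lemma Laplace_value : Laplace H w0 g p = L.
Proof.
  apply is_Laplace_unique. unfold Laplace, the_C. apply epsilon_spec.
  exists L. apply is_Laplace_exists.
Qed.
End LaplaceValue.

(** * Holomorphy, half-planes and elementary bounds *)

Definition hol_on (D : C -> Prop) (h : C -> C) : Prop := forall z, D z -> exists l, Cderiv h z l.

Lemma hol_on_Ccont D h z : hol_on D h -> D z -> Ccont h z.
Proof. intros Hh Hz. destruct (Hh z Hz) as [l Hl]. apply (Ccont_of_Cd _ _ _ Hl). Qed.

Lemma Cderiv_kernel h p z l : Cderiv h z l ->
  Cderiv (fun w => h w * Cexp (- (p * w)))%C z
     (l * Cexp (- (p * z)) + h z * (Cexp (- (p * z)) * - (p * RtoC 1)))%C.
Proof.
  intros Hl. apply (deriv_along_mult (fun u : C => u) z (Ccont_id z)); [exact Hl|].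
  apply (Cderiv_comp Cexp (fun w => - (p * w))%C); [apply Cderiv_Cexp|].
  apply deriv_along_opp. apply (deriv_along_scal (fun u : C => u) z (Ccont_id z)). apply deriv_along_id.
Qed.

Lemma locally_Im_lt s p : s = 1 \/ s = -1 -> s * Im p < 0 ->
  locally (T := C_UniformSpace) p (fun u => s * Im u < 0).
Proof.
  intros Hs Hp. apply locally_C_iff. exists (- (s * Im p)). split; [lra|]. intros u Hu.
  assert (P2 : Rabs (Im u - Im p) <= Cmod (u - p)) by apply (im_le_Cmod (u - p)%C).
  assert (P3 := Rle_lt_trans _ _ _ P2 Hu). apply Rabs_def2 in P3.
  destruct Hs as [-> | ->]; lra.
Qed.

Lemma locally_Re_lt p c : Re p < c -> locally (T := C_UniformSpace) p (fun u => Re u < c).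
Proof.
  intros Hp. apply locally_C_iff. exists (c - Re p). split; [lra|]. intros u Hu.
  assert (P2 : Rabs (Re u - Re p) <= Cmod (u - p)) by apply (re_le_Cmod (u - p)%C).
  assert (P3 := Rle_lt_trans _ _ _ P2 Hu). apply Rabs_def2 in P3. lra.
Qed.

Lemma ln_1p_pos y : 0 <= y -> 0 <= ln (1 + y).
Proof.
  intros Hy. rewrite <- ln_1. destruct Hy as [Hy| <-].
  - left; apply ln_increasing; lra.
  - rewrite Rplus_0_r. lra.
Qed.

Lemma ln_1p_le y : 0 <= y -> ln (1 + y) <= y.
Proof.
  intros Hy. assert (K := exp_ineq1_le (ln (1 + y))). rewrite exp_ln in K by lra. lra.
Qed.

Lemma frac_bounds y : 0 <= y -> 0 <= y / (1 + y) <= 1.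
Proof.
  intros Hy. split; [apply Rdiv_le_0_compat; lra|].
  apply Rmult_le_reg_r with (1 + y); [lra|]. unfold Rdiv. rewrite Rmult_assoc, Rinv_l; lra.
Qed.

(** The leftward half-line from a point off [[0, +oo)] stays off it; [D] is constant there and tends
    to zero. Hence the choice made in [primitive_minfty] is determined off [[0, +oo)]. *)
Lemma decaying_constant_0 (D : C -> C) :
  (forall p, ~ in_Rplus p -> Cderiv D p (RtoC 0)) ->
  (forall eps, 0 < eps -> exists M, forall p, Re p < M -> Cmod (D p) < eps) ->
  forall p, ~ in_Rplus p -> D p = RtoC 0.
Proof.
  intros HD Hdec [x y] Hp. apply Cmod_eq_0. apply Rle_antisym; [|apply Cmod_ge_0].
  apply Rnot_lt_le. intros Hlt. destruct (Hdec _ Hlt) as [M HM].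
  pose (x' := Rmin x (M - 1)). assert (X1 : x' <= x) by apply Rmin_l.
  assert (X2 : x' <= M - 1) by apply Rmin_r.
  specialize (HM (x', y) ltac:(simpl; lra)).
  assert (K : Cmod (D (x, y) - D (x', y)) <= (x - x') * 0).
  { apply (mean_value (fun s => D (s, y)) (fun _ => RtoC 0)); [exact X1| | |].
    - intros t Ht. apply (deriv_along_eq _ _ _ (RtoC 0 * RtoC 1)%C); [|ring].
      apply (Rderiv_comp D (fun s => (s, y))); [|apply Rderiv_horizontal].
      apply HD. intros [K1 K2]. apply Hp. simpl in *. split; simpl; lra.
    - intros t _. apply flim_const; apply _.
    - intros t _. rewrite Cmod_0. lra. }
  assert (Cmod (D (x, y)) <= Cmod (D (x, y) - D (x', y)) + Cmod (D (x', y))); [|lra].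
  replace (D (x, y)) with ((D (x, y) - D (x', y)) + D (x', y))%C at 1 by ring.
  apply Cmod_triangle.
Qed.

Lemma flim_ext_at {f g : C -> C} {z : C} :
  locally (T := C_UniformSpace) z (fun u => f u = g u) -> Ccont f z -> Ccont g z.
Proof.
  intros Hloc Hf. unfold Ccont. assert (E := locally_self (T := C_UniformSpace) z _ Hloc).
  cbv beta in E. rewrite <- E.
  apply (flim_ext_loc _ f); [exact Hloc|exact Hf].
Qed.

Fixpoint divn (g : C -> C) (n : nat) : C -> C :=
  match n with
  | O => g
  | S n => fun w => (/ (- w) * divn g n w)%C
  end.

(** * Jumps of the iterated primitives *)

Definition square (t r : R) (u : C) : Prop := Rabs (Re u - t) < r /\ Rabs (Im u) < r.

Lemma square_comb t r : comb (square t r).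
Proof.
  split.
  - intros z [H1 H2]. exists (Rmin (r - Rabs (Re z - t)) (r - Rabs (Im z))).
    split; [apply Rmin_pos; lra|]. intros u Hu.
    assert (K1 : Rabs (Re u - Re z) <= Cmod (u - z)) by apply (re_le_Cmod (u - z)%C).
    assert (K2 : Rabs (Im u - Im z) <= Cmod (u - z)) by apply (im_le_Cmod (u - z)%C).
    assert (R1 := Rmin_l (r - Rabs (Re z - t)) (r - Rabs (Im z))).
    assert (R2 := Rmin_r (r - Rabs (Re z - t)) (r - Rabs (Im z))).
    split.
    + replace (Re u - t) with ((Re z - t) + (Re u - Re z)) by ring.
      eapply Rle_lt_trans; [apply Rabs_triang|]. lra.
    + replace (Im u) with (Im z + (Im u - Im z)) by ring.
      eapply Rle_lt_trans; [apply Rabs_triang|]. lra.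
  - intros x x' y s u [H1 H2] [H3 H4] Hs Hu. simpl in *. split; simpl; [|lra].
    apply Rabs_def2 in H1. apply Rabs_def2 in H3. apply Rabs_def1; lra.
Qed.

Lemma within_Im_proper s x : s = 1 \/ s = -1 ->
  ProperFilter (within (fun p : C => 0 < s * Im p) (locally (T := C_UniformSpace) (RtoC x))).
Proof.
  intros Hs. constructor; [|apply within_filter; apply locally_filter].
  intros Q HQ. unfold within in HQ. apply locally_C_iff in HQ. destruct HQ as (d & Hd & HQ).
  exists (x, s * (d / 2)). apply HQ.
  - replace ((x, (s * (d / 2))%R) - RtoC x)%C with (RtoC (s * (d / 2)) * Ci)%C.
    + rewrite Cmod_mult, Cmod_Ci, Cmod_R, Rabs_mult, (Rabs_pos_eq (d / 2)) by lra.
      destruct Hs as [-> | ->]; rewrite ?Rabs_R1, ?Rabs_m1; lra.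
    + apply injective_projections; simpl; ring.
  - simpl. destruct Hs as [-> | ->]; lra.
Qed.

(** The sign [s] selects the half-plane, so that limits from above and from below share their
    lemmas. *)
Definition boundary_value (s : R) (F : C -> C) (t : R) : C :=
  the_C (flim F (within (fun p : C => 0 < s * Im p) (locally (T := C_UniformSpace) (RtoC t)))).

Lemma boundary_value_unique s F t l : s = 1 \/ s = -1 ->
  flim F (within (fun p : C => 0 < s * Im p) (locally (T := C_UniformSpace) (RtoC t))) l ->
  boundary_value s F t = l.
Proof.
  intros Hs Hl. unfold boundary_value, the_C.
  apply (@flim_unique _ _ (within_Im_proper s t Hs) F); [|exact Hl].
  apply epsilon_spec. exists l. exact Hl.
Qed.

Lemma value_from_above_boundary F t : value_from_above F t = boundary_value 1 F t.
Proof.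
  unfold value_from_above, boundary_value. f_equal. apply functional_extensionality. intros l.
  assert (E : within (fun p : C => 0 < Im p) (locally (T := C_UniformSpace) (RtoC t))
    = within (fun p : C => 0 < 1 * Im p) (locally (T := C_UniformSpace) (RtoC t))).
  { assert (E0 : @eq (C -> Prop) (fun p => 0 < Im p) (fun p => 0 < 1 * Im p)).
    { apply functional_extensionality. intros p. rewrite Rmult_1_l. reflexivity. }
    rewrite E0. reflexivity. }
  rewrite E. apply propositional_extensionality. symmetry. apply flim_filterlim.
  apply within_filter; apply locally_filter.
Qed.

Lemma value_from_below_boundary F t : value_from_below F t = boundary_value (-1) F t.
Proof.
  unfold value_from_below, boundary_value. f_equal. apply functional_extensionality. intros l.
  assert (E : within (fun p : C => Im p < 0) (locally (T := C_UniformSpace) (RtoC t))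
    = within (fun p : C => 0 < -1 * Im p) (locally (T := C_UniformSpace) (RtoC t))).
  { assert (E0 : @eq (C -> Prop) (fun p => Im p < 0) (fun p => 0 < -1 * Im p)).
    { apply functional_extensionality. intros p. apply propositional_extensionality. lra. }
    rewrite E0. reflexivity. }
  rewrite E. apply propositional_extensionality. symmetry. apply flim_filterlim.
  apply within_filter; apply locally_filter.
Qed.

Section LocalExtension.
Context (L : nat -> C -> C) (HLd : forall j p, Im p <> 0 -> Cderiv (L (S j)) p (L j p)).
Context (t r s : R) (F : C -> C) (Hr : 0 < r) (Hs : s = 1 \/ s = -1).
Context (HF : hol_on (square t r) F) (HFL : forall u, square t r u -> 0 < s * Im u -> F u = L 0%nat u).

(** The same [F] continues the transform from both sides, but its iterated primitives acquire
    different constants of integration above and below the axis. The continuation is therefore built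
    for one side [s] at a time, each primitive being adjusted to [L (S j)] on that side. *)
Fixpoint local_ext (j : nat) : C -> C :=
  match j with
  | O => F
  | S j => epsilon (inhabits (fun _ : C => RtoC 0)) (fun A =>
      (forall u, square t r u -> Cderiv A u (local_ext j u)) /\
      forall u, square t r u -> 0 < s * Im u -> A u = L (S j) u)
  end.

(** The half-square is star-shaped about [(t, s * (r / 2))]. The constant found there is the
    constant of integration of the next extension. *)
Lemma half_square_constant (D : C -> C) :
  (forall u, square t r u -> 0 < s * Im u -> Cderiv D u (RtoC 0)) ->
  forall u, square t r u -> 0 < s * Im u -> D u = D (t, (s * (r / 2))%R).
Proof.
  intros HD u [Hu1 Hu2] Hu3. set (z := (t, s * (r / 2)) : C).
  assert (K : Cmod (D u - D z) <= Cmod (u - z) * 0).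
  { apply (Cmod_segment_bound D (fun _ => RtoC 0)). intros x Hx.
    split; [|split; [apply flim_const; apply _|rewrite Cmod_0; lra]].
    assert (Ess : s * s = 1) by (destruct Hs as [-> | ->]; ring).
    assert (EI : s * Im (Csegment z u x) = (1 - x) * (r / 2) + x * (s * Im u)).
    { transitivity ((1 - x) * (s * s * (r / 2)) + x * (s * Im u)); [|rewrite Ess; ring].
      unfold Csegment, z. simpl. unfold Re, Im. simpl. ring. }
    assert (HA : forall v, 0 < s * v -> Rabs v = s * v).
    { intros v Hv. destruct Hs as [-> | ->].
      - rewrite Rabs_pos_eq; lra.
      - rewrite Rabs_left; lra. }
    assert (HI := HA _ Hu3).
    assert (HIp : 0 < s * Im (Csegment z u x)) by (rewrite EI; nra).
    apply HD; [|exact HIp]. split; [|rewrite (HA _ HIp), EI; nra].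
    replace (Re (Csegment z u x) - t) with (x * (Re u - t)).
    2:{ unfold Csegment, z. simpl. unfold Re, Im. simpl. ring. }
    rewrite Rabs_mult, (Rabs_pos_eq x) by lra. generalize (Rabs_pos (Re u - t)). nra. }
  replace (D u) with ((D u - D z) + D z)%C by ring.
  rewrite (Cmod_eq_0 (D u - D z)%C); [ring|].
  apply Rle_antisym; [lra|apply Cmod_ge_0].
Qed.

Lemma local_ext_spec j :
  hol_on (square t r) (local_ext j) /\
  (forall u, square t r u -> 0 < s * Im u -> local_ext j u = L j u) /\
  (forall u, square t r u -> Cderiv (local_ext (S j)) u (local_ext j u)).
Proof.
  assert (Step : forall j, hol_on (square t r) (local_ext j) ->
    (forall u, square t r u -> 0 < s * Im u -> local_ext j u = L j u) ->
    (forall u, square t r u -> Cderiv (local_ext (S j)) u (local_ext j u)) /\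
    forall u, square t r u -> 0 < s * Im u -> local_ext (S j) u = L (S j) u).
  { intros i Hi1 Hi2. cbn [local_ext]. apply epsilon_spec.
    assert (Ht : square t r (RtoC t)).
    { split; simpl; [rewrite Rminus_diag|]; rewrite Rabs_R0; exact Hr. }
    destruct (primitive_exists (square t r) (local_ext i) (RtoC 0) t (square_comb t r) Ht) as (G & _ & HGd).
    - intros z Hz. apply (hol_on_Ccont (square t r)); assumption.
    - intros z Hz _. apply Hi1; exact Hz.
    - pose (D := fun u => (G u - L (S i) u)%C).
      exists (fun u => (G u - D (t, (s * (r / 2))%R))%C). split.
      + intros u Hu. apply (deriv_along_eq _ _ _ (local_ext i u - RtoC 0)%C); [|ring].
        apply deriv_along_minus; [apply HGd; exact Hu|apply deriv_along_const].
      + intros u Hu Hu2. rewrite <- (half_square_constant D) with (u := u); auto.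
        * unfold D. ring.
        * intros v Hv Hv2. apply (deriv_along_eq _ _ _ (local_ext i v - L i v)%C).
          -- apply deriv_along_minus; [apply HGd; exact Hv|]. apply HLd. intros E. rewrite E in Hv2. lra.
          -- rewrite Hi2 by assumption. ring. }
  induction j as [|j (IH1 & IH2 & IH3)].
  - split; [exact HF|]. split; [exact HFL|]. apply (Step 0%nat); assumption.
  - destruct (Step j IH1 IH2) as [S1 S2].
    assert (S3 : hol_on (square t r) (local_ext (S j))).
    { intros u Hu. eexists. apply S1; exact Hu. }
    split; [exact S3|]. split; [exact S2|]. apply (Step (S j)); assumption.
Qed.

Lemma local_ext_limit j x : Rabs (x - t) < r ->
  flim (L j) (within (fun p : C => 0 < s * Im p) (locally (T := C_UniformSpace) (RtoC x)))
    (local_ext j (RtoC x)).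
Proof.
  intros Hx. destruct (local_ext_spec j) as (H1 & H2 & _).
  assert (Hsq : square t r (RtoC x)).
  { split; simpl; [exact Hx|rewrite Rabs_R0; exact Hr]. }
  assert (Hc := hol_on_Ccont _ _ _ H1 Hsq).
  intros eps He. specialize (Hc eps He). unfold within.
  destruct (proj1 (square_comb t r) _ Hsq) as (d & Hd & Hopen).
  assert (Hl : locally (T := C_UniformSpace) (RtoC x) (square t r)).
  { apply locally_C_iff. exists d. auto. }
  generalize (filter_and _ _ Hc Hl). apply filter_imp. intros u [Hu1 Hu2] Hu3.
  rewrite <- H2 by assumption. exact Hu1.
Qed.

Lemma local_ext_deriv j x : Rabs (x - t) < r ->
  Rderiv (fun x => local_ext (S j) (RtoC x)) x (local_ext j (RtoC x)).
Proof.
  intros Hx. destruct (local_ext_spec j) as (_ & _ & H3).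
  apply (deriv_along_eq _ _ _ (local_ext j (RtoC x) * RtoC 1)%C); [|ring].
  apply (Rderiv_comp (local_ext (S j)) RtoC); [|apply Rderiv_RtoC].
  apply H3. split; simpl; [exact Hx|rewrite Rabs_R0; exact Hr].
Qed.
End LocalExtension.

Section Phi.
Context (L : C -> C) (HLd : forall j p, Im p <> 0 ->
  Cderiv (iter_primitive (S j) L) p (iter_primitive j L p)).
Context (t r : R) (F : C -> C) (Hr : 0 < r) (Hrt : r <= t).
Context (HF : hol_on (square t r) F)
  (HFL : forall u, square t r u -> Im u <> 0 -> F u = L u).

Let up (j : nat) : C -> C := local_ext (fun j => iter_primitive j L) t r 1 F j.
Let low (j : nat) : C -> C := local_ext (fun j => iter_primitive j L) t r (-1) F j.

Lemma HFL_sided s : s = 1 \/ s = -1 -> forall u, square t r u -> 0 < s * Im u -> F u = L u.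
Proof. intros Hs u Hu Hsu. apply HFL; [exact Hu|]. intros E. rewrite E in Hsu. lra. Qed.

Lemma phi_local_ext j x : Rabs (x - t) < r -> phi L j x = (low j (RtoC x) - up j (RtoC x))%C.
Proof.
  intros Hx. unfold phi. destruct Rlt_dec as [Hneg|Hneg].
  (* The assumption [r <= t] makes [x] positive, which excludes the conventional zero branch. *)
  { apply Rabs_def2 in Hx. lra. }
  rewrite value_from_below_boundary, value_from_above_boundary.
  assert (H1 : 1 = 1 \/ 1 = -1) by auto. assert (H2 : -1 = 1 \/ -1 = -1) by auto.
  f_equal; [|f_equal].
  - apply boundary_value_unique; [exact H2|].
    apply (local_ext_limit (fun j => iter_primitive j L) HLd t r (-1) F Hr H2 HF (HFL_sided _ H2)); exact Hx.
  - apply boundary_value_unique; [exact H1|].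
    apply (local_ext_limit (fun j => iter_primitive j L) HLd t r 1 F Hr H1 HF (HFL_sided _ H1)); exact Hx.
Qed.

Lemma phi_deriv j x : Rabs (x - t) < r -> Rderiv (phi L (S j)) x (phi L j x).
Proof.
  intros Hx.
  assert (H1 : 1 = 1 \/ 1 = -1) by auto. assert (H2 : -1 = 1 \/ -1 = -1) by auto.
  apply (deriv_along_ext_loc RtoC x (fun x => low (S j) (RtoC x) - up (S j) (RtoC x))%C).
  - intros y Hy. apply RtoC_inj; exact Hy.
  - apply Rabs_def2 in Hx. apply (locally_open_interval (t - r) (t + r)); [lra|].
    intros y Hy. symmetry. apply phi_local_ext. apply Rabs_def1; lra.
  - rewrite phi_local_ext by exact Hx. apply deriv_along_minus.
    + apply (local_ext_deriv (fun j => iter_primitive j L) HLd t r (-1) F Hr H2 HF (HFL_sided _ H2)); exact Hx.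
    + apply (local_ext_deriv (fun j => iter_primitive j L) HLd t r 1 F Hr H1 HF (HFL_sided _ H1)); exact Hx.
Qed.

Lemma CDerive_n_phi N i x : (i <= N)%nat -> Rabs (x - t) < r ->
  CDerive_n (phi L N) i x = phi L (N - i) x.
Proof.
  revert x. induction i as [|i IH]; intros x Hi Hx.
  - rewrite Nat.sub_0_r. unfold CDerive_n. simpl. symmetry. apply surjective_pairing.
  - assert (Hloc : locally x (fun y => CDerive_n (phi L N) i y = phi L (N - i) y)).
    { apply Rabs_def2 in Hx. apply (locally_open_interval (t - r) (t + r)); [lra|].
      intros y Hy. apply IH; [lia|]. apply Rabs_def1; lra. }
    assert (HD := phi_deriv (N - S i) x Hx). replace (S (N - S i)) with (N - i)%nat in HD by lia.
    rewrite (surjective_pairing (phi L (N - S i) x)). unfold CDerive_n. cbn [Derive_n]. f_equal.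
    + rewrite (Derive_ext_loc _ (fun y => Re (phi L (N - i) y))).
      * apply is_derive_unique. apply (Rderiv_fst _ _ _ HD).
      * revert Hloc. apply filter_imp. intros y <-. reflexivity.
    + rewrite (Derive_ext_loc _ (fun y => Im (phi L (N - i) y))).
      * apply is_derive_unique. apply (Rderiv_snd _ _ _ HD).
      * revert Hloc. apply filter_imp. intros y <-. reflexivity.
Qed.

Lemma phi_sided_limits j : exists a b : C,
  flim (iter_primitive j L)
    (within (fun p : C => 0 < 1 * Im p) (locally (T := C_UniformSpace) (RtoC t))) a /\
  flim (iter_primitive j L)
    (within (fun p : C => 0 < -1 * Im p) (locally (T := C_UniformSpace) (RtoC t))) b /\
  phi L j t = (b - a)%C.
Proof.
  assert (H1 : 1 = 1 \/ 1 = -1) by auto. assert (H2 : -1 = 1 \/ -1 = -1) by auto.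
  assert (Ht : Rabs (t - t) < r) by (rewrite Rminus_diag, Rabs_R0; exact Hr).
  exists (up j (RtoC t)), (low j (RtoC t)). split; [|split].
  - apply (local_ext_limit (fun j => iter_primitive j L) HLd t r 1 F Hr H1 HF (HFL_sided _ H1)); exact Ht.
  - apply (local_ext_limit (fun j => iter_primitive j L) HLd t r (-1) F Hr H2 HF (HFL_sided _ H2)); exact Ht.
  - apply phi_local_ext; exact Ht.
Qed.
End Phi.

(** * Loop integrals *)

Lemma primitive_along_path P f c a b : piecewise_C1 c a b ->
  forall al be, a <= al -> al <= be -> be <= b ->
  (forall t, al <= t <= be -> Cderiv P (c t) (f (c t)) /\ Ccont f (c t)) ->
  is_path_int f c al be (P (c be) - P (c al))%C.
Proof.
  intros Hc. induction Hc as [a b h Hab Hh Hch|a m b Hc1 IH1 Hc2 IH2]; intros al be H1 H2 H3 HP.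
  - destruct (C1_curve_Rd h Hh) as (d & Hd & Hdc).
    apply (is_CI_ext (fun t => f (h t) * d t)%C).
    { intros t Ht. rewrite Rmin_left, Rmax_right in Ht by lra.
      rewrite (velocity_piece c h d a b t Hd Hch ltac:(lra)), Hch by lra. reflexivity. }
    rewrite !Hch by lra.
    apply (CI_FTC (fun t => P (h t))); rewrite Rmin_left, Rmax_right by lra; intros t Ht.
    + apply (Rderiv_comp P h); [|apply Hd]. rewrite <- Hch by lra. apply HP; exact Ht.
    + apply flim_mult; [apply _| |apply Hdc].
      apply (Rcont_comp f h); [|apply (Rcont_of_Rd _ _ _ (Hd t))].
      rewrite <- Hch by lra. apply HP; exact Ht.
  - assert (L1 := piecewise_C1_lt _ _ _ Hc1). assert (L2 := piecewise_C1_lt _ _ _ Hc2).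
    destruct (Rle_dec be m) as [Hm|Hm]; [apply IH1; auto|].
    destruct (Rle_dec m al) as [Hm'|Hm']; [apply IH2; auto|].
    replace (P (c be) - P (c al))%C with ((P (c m) - P (c al)) + (P (c be) - P (c m)))%C by ring.
    apply (is_CI_Chasles _ al m be).
    + apply IH1; try lra. intros t Ht. apply HP; lra.
    + apply IH2; try lra. intros t Ht. apply HP; lra.
Qed.

Lemma piecewise_C1_cont c a b : piecewise_C1 c a b -> Rcont_on c a b.
Proof.
  intros Hc. induction Hc as [a b h Hab Hh Hch|a m b Hc1 IH1 Hc2 IH2]; intros t Ht eps He.
  - destruct (C1_curve_Rd h Hh) as (d & Hd & _).
    unfold within. generalize (Rcont_of_Rd _ _ _ (Hd t) eps He). apply filter_imp.
    intros s Hs Hss. rewrite !Hch by assumption. exact Hs.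
  - assert (L1 := piecewise_C1_lt _ _ _ Hc1). assert (L2 := piecewise_C1_lt _ _ _ Hc2).
    unfold within.
    assert (A1 : locally t (fun s => a <= s <= m -> Cmod (c s - c t) < eps)).
    { destruct (Rle_dec t m) as [Hm|Hm].
      - apply (IH1 t ltac:(lra) eps He).
      - apply locally_R_iff. exists (t - m). split; [lra|]. intros s Hs Hs2.
        apply Rabs_def2 in Hs. lra. }
    assert (A2 : locally t (fun s => m <= s <= b -> Cmod (c s - c t) < eps)).
    { destruct (Rle_dec m t) as [Hm|Hm].
      - apply (IH2 t ltac:(lra) eps He).
      - apply locally_R_iff. exists (m - t). split; [lra|]. intros s Hs Hs2.
        apply Rabs_def2 in Hs. lra. }
    generalize (filter_and _ _ A1 A2). apply filter_imp. intros s [B1 B2] Hs.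
    destruct (Rle_dec s m); [apply B1; lra|apply B2; lra].
Qed.

Lemma is_CI_endpoints_limit (f : R -> C) al be I : al < be -> is_CI f al be I ->
  flim (fun e => CI f (al + e) (be - e)) (at_right 0) I.
Proof.
  intros Hab HI.
  (* Extended by zero, the function is integrable around [[al, be]], as continuity of the integral
     in both of its bounds requires. *)
  pose (f0 := fun t => match excluded_middle_informative (al < t < be) with
    | left _ => f t | right _ => RtoC 0 end).
  assert (H0 : is_CI f0 al be I).
  { apply (is_CI_ext f); [|exact HI]. intros t Ht. rewrite Rmin_left, Rmax_right in Ht by lra.
    unfold f0. destruct excluded_middle_informative; [reflexivity|contradiction]. }
  assert (Hz : forall u v, (forall t, Rmin u v < t < Rmax u v -> ~ al < t < be) -> is_CI f0 u v (RtoC 0)).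
  { intros u v Huv. apply (is_CI_ext (fun _ => RtoC 0)).
    - intros t Ht. unfold f0. destruct excluded_middle_informative as [K|K]; [|reflexivity].
      exfalso. apply (Huv t Ht K).
    - assert (K := is_CI_const (RtoC 0) u v).
      replace (RtoC (v - u) * RtoC 0)%C with (RtoC 0) in K by ring. exact K. }
  assert (Hbig : is_CI f0 (al - 1) (be + 1) (RtoC 0 + I + RtoC 0)%C).
  { apply is_CI_Chasles with be; [apply is_CI_Chasles with al|]; [|exact H0|].
    - apply Hz. intros t Ht. rewrite Rmin_left, Rmax_right in Ht by lra. lra.
    - apply Hz. intros t Ht. rewrite Rmin_left, Rmax_right in Ht by lra. lra. }
  assert (Hex : forall u v, al - 1 <= u <= be + 1 -> al - 1 <= v <= be + 1 -> is_CI f0 u v (CI f0 u v)).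
  { intros u v Hu Hv. apply (RInt_correct (V := C_R_CompleteNormedModule)).
    apply (ex_RInt_inside (V := C_R_CompleteNormedModule) f0 u v ((al + be) / 2) ((be - al) / 2 + 1)).
    - replace ((al + be) / 2 - ((be - al) / 2 + 1)) with (al - 1) by field.
      replace ((al + be) / 2 + ((be - al) / 2 + 1)) with (be + 1) by field.
      eexists. exact Hbig.
    - apply Rabs_le; lra.
    - apply Rabs_le; lra. }
  assert (Hcont := continuous_RInt (V := C_R_NormedModule) f0 al be (fun u v => CI f0 u v)).
  assert (Hloc : locally (al, be) (fun z : R * R => is_CI f0 (fst z) (snd z) (CI f0 (fst z) (snd z)))).
  { exists (mkposreal 1 Rlt_0_1). intros [u v] [Hu Hv]. simpl in *.
    unfold ball in Hu, Hv; simpl in Hu, Hv. unfold AbsRing_ball in Hu, Hv.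
    unfold abs, minus, plus, opp in Hu, Hv; simpl in Hu, Hv.
    apply Rabs_def2 in Hu. apply Rabs_def2 in Hv. apply Hex; lra. }
  specialize (Hcont Hloc).
  rewrite <- (is_CI_CI _ _ _ _ H0).
  intros eps He.
  assert (HP : locally (T := C_R_NormedModule) (CI f0 al be) (fun z => Cmod (z - CI f0 al be) < eps)).
  { apply (locally_C_iff (CI f0 al be)). exists eps. auto. }
  specialize (Hcont _ HP). destruct Hcont as [d Hd].
  apply at_right_0_iff. exists (Rmin d ((be - al) / 2)).
  split; [apply Rmin_pos; [apply cond_pos|lra]|]. intros e Hee.
  assert (R1 := Rmin_l d ((be - al) / 2)). assert (R2 := Rmin_r d ((be - al) / 2)).
  assert (E : CI f (al + e) (be - e) = CI f0 (al + e) (be - e)).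
  { apply (RInt_ext (V := C_R_CompleteNormedModule)). intros t Ht.
    rewrite Rmin_left, Rmax_right in Ht by lra.
    unfold f0. destruct excluded_middle_informative as [K|K]; [reflexivity|]. exfalso. apply K. lra. }
  rewrite E. apply (Hd (al + e, be - e)). split; simpl.
  - unfold ball; simpl. unfold AbsRing_ball, abs, minus, plus, opp; simpl.
    replace (al + e + - al) with e by ring. rewrite Rabs_pos_eq; lra.
  - unfold ball; simpl. unfold AbsRing_ball, abs, minus, plus, opp; simpl.
    replace (be - e + - be) with (- e) by ring. rewrite Rabs_Ropp, Rabs_pos_eq; lra.
Qed.

(** Only the limits of [P] at the ends of the arc count: on a loop these ends lie on the real axis,
    where a primitive known in one half-plane has no prescribed value. *)
Lemma open_arc_integral P f c a b al be I pa pb :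
  piecewise_C1 c a b -> a <= al -> al < be -> be <= b ->
  (forall t, al < t < be -> Cderiv P (c t) (f (c t)) /\ Ccont f (c t)) ->
  flim (fun e => P (c (al + e))) (at_right 0) pa ->
  flim (fun e => P (c (be - e))) (at_right 0) pb ->
  is_path_int f c al be I -> I = (pb - pa)%C.
Proof.
  intros Hc H1 H2 H3 HP Ha Hb HI.
  apply is_CI_endpoints_limit in HI; [|exact H2].
  apply (at_right_const_unique HI).
  apply (flim_ext_loc _ (fun e => P (c (be - e)%R) - P (c (al + e)%R))%C).
  - apply at_right_0_iff. exists ((be - al) / 2). split; [lra|]. intros e He. symmetry.
    apply is_CI_CI. apply (primitive_along_path P f c a b); auto; try lra.
    intros t Ht. apply HP. lra.
  - apply flim_minus; [apply _|exact Hb|exact Ha].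
Qed.

Lemma is_CI_split (f : R -> C) a m b I : a <= m <= b -> is_CI f a b I ->
  exists I1 I2, is_CI f a m I1 /\ is_CI f m b I2 /\ I = (I1 + I2)%C.
Proof.
  intros Hm HI. assert (E : ex_RInt (V := C_R_CompleteNormedModule) f a b) by (exists I; exact HI).
  assert (E1 := ex_RInt_Chasles_1 (V := C_R_CompleteNormedModule) f a m b Hm E).
  assert (E2 := ex_RInt_Chasles_2 (V := C_R_CompleteNormedModule) f a m b Hm E).
  apply (RInt_correct (V := C_R_CompleteNormedModule)) in E1, E2.
  eexists. eexists. split; [exact E1|]. split; [exact E2|].
  apply (is_CI_unique f a b); [exact HI|]. apply (is_CI_Chasles f a m b); assumption.
Qed.

(** [sg] is the direction of approach from inside the parameter interval: [1] at the start of an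
    arc, [-1] at its end. *)
Lemma path_limit (c : R -> C) a b (Q : C -> Prop) (sg t0 : R) : Rcont_on c a b -> a < b ->
  (sg = 1 /\ a <= t0 < b) \/ (sg = -1 /\ a < t0 <= b) ->
  at_right 0 (fun e => Q (c (t0 + sg * e))) ->
  filterlim (fun e => c (t0 + sg * e)) (at_right 0)
    (within Q (locally (T := C_UniformSpace) (c t0))).
Proof.
  intros Hc Hab Hsg HQ A HA. unfold filtermap, within in *.
  assert (Ht0 : a <= t0 <= b) by lra.
  apply locally_C_iff in HA. destruct HA as (d & Hd & HA).
  specialize (Hc t0 Ht0 d Hd). unfold within in Hc. apply locally_R_iff in Hc.
  destruct Hc as (d' & Hd' & Hc).
  assert (K : at_right 0 (fun e => Cmod (c (t0 + sg * e) - c t0) < d)).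
  { apply at_right_0_iff.
    exists (Rmin d' (if Rle_dec sg 0 then t0 - a else b - t0)). split.
    - destruct Rle_dec; apply Rmin_pos; lra.
    - intros e He. apply Hc.
      + replace (t0 + sg * e - t0) with (sg * e) by ring. rewrite Rabs_mult, (Rabs_pos_eq e) by lra.
        generalize (Rmin_l d' (if Rle_dec sg 0 then t0 - a else b - t0)).
        destruct Hsg as [[-> _]|[-> _]]; rewrite ?Rabs_R1, ?Rabs_m1; lra.
      + assert (K := Rmin_r d' (if Rle_dec sg 0 then t0 - a else b - t0)).
        destruct Rle_dec; destruct Hsg as [[-> ?]|[-> ?]]; lra. }
  generalize (filter_and _ _ HQ K). apply filter_imp. intros e [B1 B2]. apply HA; assumption.
Qed.

(** The loop runs from [y] to [x] above the axis and back below it, whence the signs. The two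
    primitives are never compared with each other, and the shape of the loop has disappeared from
    the result. *)
Lemma loop_integral P1 P2 f x y c I p1x p1y p2x p2y :
  encircling_loop x y c -> is_path_int f c 0 1 I ->
  (forall p, 0 < Im p -> Cderiv P1 p (f p)) -> (forall p, Im p < 0 -> Cderiv P2 p (f p)) ->
  (forall p, Im p <> 0 -> Ccont f p) ->
  flim P1 (within (fun p => 0 < 1 * Im p) (locally (T := C_UniformSpace) (RtoC x))) p1x ->
  flim P1 (within (fun p => 0 < 1 * Im p) (locally (T := C_UniformSpace) (RtoC y))) p1y ->
  flim P2 (within (fun p => 0 < -1 * Im p) (locally (T := C_UniformSpace) (RtoC x))) p2x ->
  flim P2 (within (fun p => 0 < -1 * Im p) (locally (T := C_UniformSpace) (RtoC y))) p2y ->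
  I = ((p1x - p1y) + (p2y - p2x))%C.
Proof.
  intros (Hc & _ & m & Hm & Hc0 & Hcm & Hc1 & Hup & Hlow) HI HP1 HP2 Hf L1x L1y L2x L2y.
  destruct (is_CI_split _ 0 m 1 I ltac:(lra) HI) as (I1 & I2 & K1 & K2 & ->).
  assert (Hcont := piecewise_C1_cont _ _ _ Hc).
  f_equal.
  - apply (open_arc_integral P1 f c 0 1 0 m); auto; try lra.
    + intros t Ht. specialize (Hup t Ht). split; [apply HP1; exact Hup|apply Hf; lra].
    + apply (flim_ext _ (fun e => P1 (c (0 + 1 * e)))); [intros; f_equal; f_equal; ring|].
      rewrite <- Hc0 in L1y. refine (flim_comp _ P1 _ _ _ _ L1y).
      apply (path_limit c 0 1); auto; try lra. apply at_right_0_iff. exists m. split; [lra|].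
      intros e He. rewrite Rmult_1_l. apply Hup. lra.
    + apply (flim_ext _ (fun e => P1 (c (m + -1 * e)))); [intros; f_equal; f_equal; ring|].
      rewrite <- Hcm in L1x. refine (flim_comp _ P1 _ _ _ _ L1x).
      apply (path_limit c 0 1); auto; try lra. apply at_right_0_iff. exists m. split; [lra|].
      intros e He. rewrite Rmult_1_l. apply Hup. lra.
  - apply (open_arc_integral P2 f c 0 1 m 1); auto; try lra.
    + intros t Ht. specialize (Hlow t Ht). split; [apply HP2; exact Hlow|apply Hf; lra].
    + apply (flim_ext _ (fun e => P2 (c (m + 1 * e)))); [intros; f_equal; f_equal; ring|].
      rewrite <- Hcm in L2x. refine (flim_comp _ P2 _ _ _ _ L2x).
      apply (path_limit c 0 1); auto; try lra. apply at_right_0_iff. exists (1 - m). split; [lra|].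
      intros e He. generalize (Hlow (m + 1 * e) ltac:(lra)). lra.
    + apply (flim_ext _ (fun e => P2 (c (1 + -1 * e)))); [intros; f_equal; f_equal; ring|].
      rewrite <- Hc1 in L2y. refine (flim_comp _ P2 _ _ _ _ L2y).
      apply (path_limit c 0 1); auto; try lra. apply at_right_0_iff. exists (1 - m). split; [lra|].
      intros e He. generalize (Hlow (1 + -1 * e) ltac:(lra)). lra.
Qed.

Definition circle (x y t : R) : C :=
  ((x + y) / 2 + (y - x) / 2 * cos (2 * PI * t), (y - x) / 2 * sin (2 * PI * t)).

Lemma circle_Rd x y t : Rderiv (circle x y) t
  (- ((y - x) / 2 * (2 * PI)) * sin (2 * PI * t), (y - x) / 2 * (2 * PI) * cos (2 * PI * t)).
Proof. apply Rderiv_pair; auto_derive; trivial; field. Qed.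

Lemma circle_C1 x y : C1_curve (circle x y).
Proof.
  exists (fun t => (- ((y - x) / 2 * (2 * PI)) * sin (2 * PI * t), (y - x) / 2 * (2 * PI) * cos (2 * PI * t))).
  split; intros t.
  - apply Rderiv_is_derive. apply circle_Rd.
  - apply Rcont_continuous. apply Rcont_pair;
    apply (ex_derive_continuous (K := R_AbsRing) (V := R_NormedModule)); auto_derive; trivial.
Qed.

Lemma circle_upper x y t : x < y -> 0 < t < 1 / 2 -> 0 < Im (circle x y t).
Proof.
  intros Hxy Ht. simpl. assert (P := PI_RGT_0). apply Rmult_lt_0_compat; [lra|].
  apply sin_gt_0; nra.
Qed.

Lemma circle_lower x y t : x < y -> 1 / 2 < t < 1 -> Im (circle x y t) < 0.
Proof.
  intros Hxy Ht. simpl. assert (P := PI_RGT_0).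
  assert (sin (2 * PI * t) < 0) by (apply sin_lt_0; nra). nra.
Qed.

Lemma circle_0 x y : circle x y 0 = RtoC y.
Proof. unfold circle. rewrite Rmult_0_r, cos_0, sin_0. apply injective_projections; simpl; field. Qed.

Lemma circle_half x y : circle x y (1 / 2) = RtoC x.
Proof.
  unfold circle. replace (2 * PI * (1 / 2)) with PI by field. rewrite cos_PI, sin_PI.
  apply injective_projections; simpl; field.
Qed.

Lemma circle_1 x y : circle x y 1 = RtoC y.
Proof.
  unfold circle. rewrite Rmult_1_r, cos_2PI, sin_2PI. apply injective_projections; simpl; field.
Qed.

Lemma circle_loop x y : x < y -> encircling_loop x y (circle x y).
Proof.
  intros Hxy. assert (P := PI_RGT_0). split; [|split].
  - apply piecewise_C1_piece with (circle x y); [lra|apply circle_C1|auto].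
  - intros s t Hs Ht E. unfold circle in E. injection E as E1 E2.
    assert (C1 : cos (2 * PI * s) = cos (2 * PI * t)) by nra.
    assert (S1 : sin (2 * PI * s) = sin (2 * PI * t)) by nra.
    (* Equal coordinates make the cosine of the difference [1], hence [sin (PI * (s - t)) = 0];
       within one turn this leaves only [s = t]. *)
    assert (Cs : cos (2 * PI * s - 2 * PI * t) = 1).
    { rewrite cos_minus, C1, S1. generalize (sin2_cos2 (2 * PI * t)). unfold Rsqr. lra. }
    replace (2 * PI * s - 2 * PI * t) with (2 * (PI * (s - t))) in Cs by ring.
    rewrite cos_2a_sin in Cs.
    assert (Sn : sin (PI * (s - t)) = 0) by nra.
    apply Rle_antisym; apply Rnot_lt_le; intros Hlt.
    + assert (0 < sin (PI * (s - t))) by (apply sin_gt_0; nra). lra.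
    + assert (0 < sin (PI * (t - s))) by (apply sin_gt_0; nra).
      replace (PI * (t - s)) with (- (PI * (s - t))) in H by ring. rewrite sin_neg in H. lra.
  - exists (1 / 2). split; [lra|]. split; [apply circle_0|]. split; [apply circle_half|].
    split; [apply circle_1|]. split; intros t Ht; [apply circle_upper|apply circle_lower]; assumption.
Qed.

(** A partial sum is a selected value, meaningful once some loop has an integral; the circle of
    diameter [[x, y]] provides one. It meets [[0, +oo)] at [y] only, and [f0] is a version of the
    integrand that is continuous there. *)
Lemma loop_integral_exists x y f f0 : x < y ->
  Ccont f0 (RtoC y) -> (forall p, p <> RtoC y -> ~ (in_Rplus p) -> Ccont f0 p) -> x < 0 ->
  (forall p, ~ in_Rplus p -> f0 p = f p) -> 
  exists c I, encircling_loop x y c /\ is_path_int f c 0 1 I.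
Proof.
  intros Hxy Hy Hf0 Hx Hff.
  assert (Hin : forall t, 0 < t < 1 -> ~ in_Rplus (circle x y t)).
  { intros t Ht [K1 K2]. destruct (Rtotal_order t (1 / 2)) as [H1|[->|H1]].
    - generalize (circle_upper x y t Hxy ltac:(lra)). lra.
    - rewrite circle_half in K1. simpl in K1. lra.
    - generalize (circle_lower x y t Hxy ltac:(lra)). lra. }
  pose (d := fun t => ((- ((y - x) / 2 * (2 * PI)) * sin (2 * PI * t), (y - x) / 2 * (2 * PI) * cos (2 * PI * t)) : C)).
  exists (circle x y), (CI (fun t => f0 (circle x y t) * d t)%C 0 1).
  split; [apply circle_loop; exact Hxy|].
  apply (is_CI_ext (fun t => f0 (circle x y t) * d t)%C).
  - intros t Ht. rewrite Rmin_left, Rmax_right in Ht by lra. rewrite Hff by (apply Hin; exact Ht).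
    f_equal. symmetry. apply (velocity_Rd _ (circle x y)); [apply filter_forall; auto|apply circle_Rd].
  - apply is_CI_cont. rewrite Rmin_left, Rmax_right by lra. intros t Ht.
    apply flim_mult; [apply _| |].
    + apply (Rcont_comp f0 (circle x y)); [|apply (Rcont_of_Rd _ _ _ (circle_Rd x y t))].
      destruct (Req_dec t 0) as [->|Ht0]; [rewrite circle_0; exact Hy|].
      destruct (Req_dec t 1) as [->|Ht1]; [rewrite circle_1; exact Hy|].
      assert (K := Hin t ltac:(lra)). apply Hf0; [|exact K].
      intros E. destruct (Rtotal_order t (1 / 2)) as [H1|[->|H1]].
      * generalize (circle_upper x y t Hxy ltac:(lra)). rewrite E. simpl. lra.
      * rewrite circle_half in E. apply RtoC_inj in E. lra.
      * generalize (circle_lower x y t Hxy ltac:(lra)). rewrite E. simpl. lra.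
    + apply Rcont_pair; apply (ex_derive_continuous (K := R_AbsRing) (V := R_NormedModule)); auto_derive; trivial.
Qed.

(** * The complex logarithm along a curve *)

(** The principal logarithm; the half-angle formula for the argument is smooth on the whole plane
    slit along the nonpositive reals, where [slit_pos] keeps its denominator positive. *)
Definition Clog (z : C) : C :=
  (ln (sqrt (Re z ^ 2 + Im z ^ 2)), 2 * atan (Im z / (sqrt (Re z ^ 2 + Im z ^ 2) + Re z))).

Lemma slit_pos (x y : R) : (y = 0 -> 0 < x) ->
  0 < x ^ 2 + y ^ 2 /\ 0 < sqrt (x ^ 2 + y ^ 2) + x.
Proof.
  intros Hs. assert (P : 0 < x ^ 2 + y ^ 2).
  { destruct (Req_dec y 0) as [->|Hy].
    - specialize (Hs eq_refl). nra.
    - assert (0 < y ^ 2) by (apply pow2_gt_0; exact Hy). assert (0 <= x ^ 2) by apply pow2_ge_0. lra. }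
  split; [exact P|].
  destruct (Req_dec y 0) as [->|Hy].
  - specialize (Hs eq_refl). generalize (sqrt_pos (x ^ 2 + 0 ^ 2)). lra.
  - assert (K : sqrt (Rsqr x) < sqrt (x ^ 2 + y ^ 2)).
    { apply sqrt_lt_1; [apply Rle_0_sqr|lra|]. unfold Rsqr.
      assert (0 < y ^ 2) by (apply pow2_gt_0; exact Hy). nra. }
    rewrite sqrt_Rsqr_abs in K. assert (K2 := Rle_abs (- x)). rewrite Rabs_Ropp in K2. lra.
Qed.

Lemma Rderiv_Clog (X Y : R -> R) t X' Y' : is_derive X t X' -> is_derive Y t Y' ->
  (Y t = 0 -> 0 < X t) -> Rderiv (fun s => Clog (X s, Y s)) t ((X', Y') / (X t, Y t))%C.
Proof.
  intros HX HY Hs. destruct (slit_pos _ _ Hs) as [P1 P2].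
  set (r := sqrt (X t ^ 2 + Y t ^ 2)) in *.
  assert (Hr : 0 < r) by (apply sqrt_lt_R0; exact P1).
  assert (Hrr : r * r = X t ^ 2 + Y t ^ 2) by (apply sqrt_sqrt; lra).
  replace ((X', Y') / (X t, Y t))%C with
    ((X t * X' + Y t * Y') / (r * r), (X t * Y' - Y t * X') / (r * r)).
  2:{ rewrite Hrr. unfold Cdiv, Cinv, Cmult. apply injective_projections; simpl; field; simpl in P1; lra. }
  apply (Rderiv_pair (fun s => ln (sqrt (X s ^ 2 + Y s ^ 2)))
    (fun s => 2 * atan (Y s / (sqrt (X s ^ 2 + Y s ^ 2) + X s)))).
  - auto_derive; fold r.
    + split; [eexists; exact HX|]. split; [eexists; exact HY|]. simpl in *. fold r.
      repeat split; lra.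
    + simpl in *. fold r.
      change (fun x : R => X x) with X. change (fun x : R => Y x) with Y.
      replace (Derive X t) with X' by (symmetry; apply is_derive_unique; exact HX).
      replace (Derive Y t) with Y' by (symmetry; apply is_derive_unique; exact HY).
      field. lra.
  - auto_derive; fold r.
    + simpl in *. fold r. split; [eexists; exact HY|]. split; [eexists; exact HX|].
      split; [eexists; exact HY|]. split; [lra|]. split; [eexists; exact HX|]. split; [lra|exact I].
    + simpl in *. fold r.
      change (fun x : R => X x) with X. change (fun x : R => Y x) with Y.
      replace (Derive X t) with X' by (symmetry; apply is_derive_unique; exact HX).
      replace (Derive Y t) with Y' by (symmetry; apply is_derive_unique; exact HY).
      (* This identity, an instance of [r ^ 2 = X ^ 2 + Y ^ 2], simplifies the denominator in the
         derivative of the arctangent. *)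
      assert (E : (r + X t) ^ 2 + Y t ^ 2 = 2 * r * (r + X t)) by (simpl; lra).
      assert (Q : 0 < (r + X t) ^ 2 + Y t ^ 2) by (rewrite E; nra).
      set (a := r + X t) in *. simpl in E. simpl.
      replace (1 + Y t * / a * (Y t * / a * 1)) with (2 * r / a).
      2:{ replace (1 + Y t * / a * (Y t * / a * 1)) with ((a * (a * 1) + Y t * (Y t * 1)) / (a * a))
            by (field; lra).
          rewrite E. field. lra. }
      assert (E3 : Y' * a * r - Y t * (X t * X' + Y t * Y') - Y t * X' * r = a * (X t * Y' - Y t * X')).
      { unfold a. simpl in Hrr.
        replace (Y' * (r + X t) * r) with (Y' * (r * r) + Y' * X t * r) by ring. rewrite Hrr. ring. }
      transitivity ((Y' * a * r - Y t * (X t * X' + Y t * Y') - Y t * X' * r) / (a * (r * r))).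
      * field. lra.
      * rewrite E3. field. lra.
Qed.

(** These are the imaginary and the real part of [Clog] at points tending to [s * i]. *)
Lemma is_lim_atan_quotient (x y : R -> R) (s : R) : s = 1 \/ s = -1 ->
  is_lim x p_infty 0 -> is_lim y p_infty s ->
  is_lim (fun T => 2 * atan (y T / (sqrt (x T ^ 2 + y T ^ 2) + x T))) p_infty (s * (PI / 2)) /\
  is_lim (fun T => ln (sqrt (x T ^ 2 + y T ^ 2))) p_infty 0.
Proof.
  intros Hs Hx Hy.
  assert (Hss : s * s = 1) by (destruct Hs as [-> | ->]; ring).
  assert (Hx2 : is_lim (fun T => x T ^ 2) p_infty 0).
  { replace (Finite 0) with (Rbar_mult 0 0) by (simpl; f_equal; ring).
    apply (is_lim_ext (fun T => x T * x T)); [intros; ring|]. apply is_lim_mult; auto. exact I. }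
  assert (Hy2 : is_lim (fun T => y T ^ 2) p_infty 1).
  { replace (Finite 1) with (Rbar_mult s s) by (simpl; f_equal; exact Hss).
    apply (is_lim_ext (fun T => y T * y T)); [intros; ring|]. apply is_lim_mult; auto. exact I. }
  assert (Hxy : is_lim (fun T => x T ^ 2 + y T ^ 2) p_infty 1).
  { replace (Finite 1) with (Rbar_plus 0 1) by (simpl; f_equal; ring).
    apply (is_lim_plus _ _ _ 0 1); auto. reflexivity. }
  assert (Hsq : is_lim (fun T => sqrt (x T ^ 2 + y T ^ 2)) p_infty 1).
  { replace 1 with (sqrt 1) by apply sqrt_1.
    apply (is_lim_comp_continuous (fun T => x T ^ 2 + y T ^ 2) sqrt p_infty 1); [exact Hxy|].
    apply continuity_pt_filterlim. apply continuity_pt_sqrt. lra. }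
  split.
  - replace (Finite (s * (PI / 2))) with (Rbar_mult 2 (atan (s / 1))).
    2:{ simpl. f_equal. rewrite Rdiv_1_r.
        destruct Hs as [-> | ->]; rewrite ?atan_opp; [|replace (-1) with (- (1)) by ring; rewrite atan_opp];
        rewrite atan_1; field. }
    apply is_lim_scal_l. apply (is_lim_comp_continuous (fun T => y T / (sqrt (x T ^ 2 + y T ^ 2) + x T)) atan p_infty (s / 1)).
    + apply (is_lim_div y (fun T => sqrt (x T ^ 2 + y T ^ 2) + x T) p_infty s 1); auto.
      * replace (Finite 1) with (Rbar_plus 1 0) by (simpl; f_equal; ring).
        apply (is_lim_plus _ _ _ 1 0); auto. reflexivity.
      * intros E. injection E. lra.
      * simpl. lra.
    + apply continuity_pt_filterlim. apply derivable_continuous_pt. apply derivable_pt_atan.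
  - rewrite <- ln_1. apply (is_lim_comp_continuous (fun T => sqrt (x T ^ 2 + y T ^ 2)) ln p_infty 1); [exact Hsq|].
    apply continuity_pt_filterlim. apply derivable_continuous_pt. exists (/ 1).
    apply derivable_pt_lim_ln. lra.
Qed.

Lemma is_lim_flim_pair (f g : R -> R) (a b : R) :
  is_lim f p_infty a -> is_lim g p_infty b ->
  flim (fun T => (f T, g T)) (Rbar_locally p_infty) (a, b).
Proof.
  intros Hf Hg eps He.
  assert (F1 := Hf (fun u => Rabs (u - a) < eps / 2)). assert (G1 := Hg (fun u => Rabs (u - b) < eps / 2)).
  assert (L1 : Rbar_locally a (fun u => Rabs (u - a) < eps / 2)).
  { apply locally_R_iff. exists (eps / 2). split; [lra|auto]. }
  assert (L2 : Rbar_locally b (fun u => Rabs (u - b) < eps / 2)).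
  { apply locally_R_iff. exists (eps / 2). split; [lra|auto]. }
  specialize (F1 L1). specialize (G1 L2). unfold filtermap in F1, G1.
  change (Rbar_locally' p_infty) with (Rbar_locally p_infty) in F1, G1.
  generalize (filter_and _ _ F1 G1). apply filter_imp. intros T [A1 A2].
  eapply Rle_lt_trans; [apply Cmod_le_abs|]. simpl.
  change (Rabs (f T - a) + Rabs (g T - b) < eps). lra.
Qed.

(** In a difference of two logarithms the terms [ln T] cancel, so points that escape to infinity can
    be rescaled to convergent ones. *)
Lemma Clog_scale X Y T : 0 < T -> (Y = 0 -> 0 < X) ->
  Clog (X, Y) = (Clog ((X / T)%R, (Y / T)%R) + RtoC (ln T))%C.
Proof.
  intros HT Hs. destruct (slit_pos X Y Hs) as [P1 P2].
  assert (E : sqrt ((X / T) ^ 2 + (Y / T) ^ 2) = sqrt (X ^ 2 + Y ^ 2) / T).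
  { replace ((X / T) ^ 2 + (Y / T) ^ 2) with ((X ^ 2 + Y ^ 2) / (T * T)) by (field; lra).
    rewrite sqrt_div by (simpl; nra). f_equal. apply sqrt_square; lra. }
  assert (Hr : 0 < sqrt (X ^ 2 + Y ^ 2)) by (apply sqrt_lt_R0; exact P1).
  unfold Clog, Cplus, RtoC. cbn [Re Im fst snd]. rewrite E. f_equal.
  - unfold Rdiv. rewrite (ln_mult _ _ Hr (Rinv_0_lt_compat _ HT)), (ln_Rinv T HT). ring.
  - rewrite Rplus_0_r. f_equal. f_equal. field. split; lra.
Qed.

Lemma Cmod_pos_neq z z' : 0 < Cmod (z - z') -> (z - z')%C <> RtoC 0.
Proof. intros K E. rewrite E, Cmod_0 in K. lra. Qed.

(** * Finite sums and repeated integration by parts *)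

Fixpoint csum (f : nat -> C) (n : nat) : C :=
  match n with O => RtoC 0 | S n => (csum f n + f n)%C end.

Lemma sum_n_csum (f : nat -> C) n : sum_n (G := C_AbelianGroup) f n = csum f (S n).
Proof.
  induction n as [|n IH].
  - rewrite sum_O. simpl. ring.
  - rewrite sum_Sn, IH. reflexivity.
Qed.

Lemma csum_ext f g n : (forall j, (j < n)%nat -> f j = g j) -> csum f n = csum g n.
Proof.
  intros Hfg. induction n as [|n IH]; [reflexivity|]. simpl. rewrite IH by (intros; apply Hfg; lia).
  rewrite Hfg by lia. reflexivity.
Qed.

Lemma csum_minus f g n : csum (fun j => f j - g j)%C n = (csum f n - csum g n)%C.
Proof. induction n as [|n IH]; simpl; [ring|rewrite IH; ring]. Qed.

Lemma flim_csum {T} (F : (T -> Prop) -> Prop) {FF : Filter F} (f : nat -> T -> C) l n :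
  (forall j, (j < n)%nat -> flim (f j) F (l j)) ->
  flim (fun t => csum (fun j => f j t) n) F (csum l n).
Proof.
  intros Hf. induction n as [|n IH]; simpl; [apply flim_const; apply _|].
  apply flim_plus; [apply _|apply IH; intros; apply Hf; lia|apply Hf; lia].
Qed.

Lemma Cderiv_exp_mult w p : Cderiv (fun p => Cexp (p * w))%C p (Cexp (p * w) * w)%C.
Proof.
  apply (Cderiv_comp Cexp (fun p => p * w)%C); [apply Cderiv_Cexp|].
  apply (deriv_along_eq _ _ _ (RtoC 1 * w + p * RtoC 0)%C); [|ring].
  apply (deriv_along_mult (fun u : C => u) p (Ccont_id p) (fun u => u) (fun _ => w)); [apply deriv_along_id|apply deriv_along_const].
Qed.

(* Integration by parts, [n] times. *)
Lemma Cderiv_parts (I : nat -> C -> C) w p n :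
  (forall j, (j < n)%nat -> Cderiv (I (S j)) p (I j p)) ->
  Cderiv (fun p => csum (fun j => (- w) ^ j * I (S j) p * Cexp (p * w))%C n) p
    (I 0%nat p * Cexp (p * w) - (- w) ^ n * I n p * Cexp (p * w))%C.
Proof.
  intros HI. induction n as [|n IH]; simpl.
  - apply (deriv_along_eq _ _ _ (RtoC 0)); [apply deriv_along_const|ring].
  - apply (deriv_along_eq _ _ _ ((I 0%nat p * Cexp (p * w) - (- w) ^ n * I n p * Cexp (p * w))
      + (((- w) ^ n * I n p) * Cexp (p * w) + ((- w) ^ n * I (S n) p) * (Cexp (p * w) * w)))%C); [|ring].
    apply deriv_along_plus; [apply IH; intros; apply HI; lia|].
    apply (deriv_along_mult (fun u : C => u) p (Ccont_id p)); [|apply Cderiv_exp_mult].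
    apply (deriv_along_scal (fun u : C => u) p (Ccont_id p)). apply HI. lia.
Qed.

Lemma not_in_Rplus_open p : ~ in_Rplus p ->
  locally (T := C_UniformSpace) p (fun u => ~ in_Rplus u).
Proof.
  intros Hp. destruct (Req_dec (Im p) 0) as [E|E].
  - assert (Hre : Re p < 0).
    { apply Rnot_le_lt. intros K. apply Hp. split; assumption. }
    generalize (locally_Re_lt p 0 Hre). apply filter_imp. intros u Hu [K _]. lra.
  - destruct (Rlt_dec (Im p) 0).
    + generalize (locally_Im_lt 1 p (or_introl eq_refl) ltac:(lra)). apply filter_imp.
      intros u Hu [_ K]. lra.
    + generalize (locally_Im_lt (-1) p (or_intror eq_refl) ltac:(lra)). apply filter_imp.
      intros u Hu [_ K]. lra.
Qed.

Lemma Im_not_in_Rplus p : Im p <> 0 -> ~ in_Rplus p.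
Proof. intros Hp [_ K]. contradiction. Qed.

(** * A family of logarithmic neighborhoods *)

(* The affine piece on [0, 1] extends the logarithmic one to a convex function. *)
Definition lprofile (a k y : R) : R := if Rle_dec y 1 then a + k * (1 - y) else a - k * ln y.
Definition lslope (k y : R) : R := if Rle_dec y 1 then k else k / y.
Definition ldomain (a k : R) (w : C) : Prop := Re w < lprofile a k (Rabs (Im w)).

Section LogDomain.
Context (a k : R) (Hk : 0 < k).

Lemma ln_le_minus_1 x : 0 < x -> ln x <= x - 1.
Proof. intros Hx. assert (K := exp_ineq1_le (ln x)). rewrite exp_ln in K by exact Hx. lra. Qed.

Lemma lslope_bounds y : 0 <= y -> 0 < lslope k y <= k.
Proof.
  intros Hy. unfold lslope. destruct Rle_dec; [lra|]. split; [apply Rdiv_lt_0_compat; lra|].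
  apply Rmult_le_reg_r with y; [lra|]. unfold Rdiv. rewrite Rmult_assoc, Rinv_l by lra. nra.
Qed.

(** Supporting lines, all consequences of [ln x <= x - 1], yield convexity, the Lipschitz bound and
    the tangent cones alike. *)
Lemma lprofile_subgradient s y : 0 <= s -> 0 <= y ->
  lprofile a k y - lslope k y * (s - y) <= lprofile a k s.
Proof.
  intros Hs Hy. unfold lprofile, lslope. destruct (Rle_dec y 1), (Rle_dec s 1).
  - lra.
  - assert (K := ln_le_minus_1 s ltac:(lra)). nra.
  - assert (K := ln_le_minus_1 (/ y) ltac:(apply Rinv_0_lt_compat; lra)).
    rewrite ln_Rinv in K by lra.
    replace (a - k * ln y - k / y * (s - y)) with (a + k * (- ln y) + k - k * (s / y)) by (field; lra).
    assert (P : 0 < / y) by (apply Rinv_0_lt_compat; lra).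
    assert (P1 : / y <= 1). { rewrite <- Rinv_1. apply Rinv_le_contravar; lra. }
    unfold Rdiv. assert (/ y - 1 - s * / y <= - s) by nra. nra.
  - assert (K := ln_le_minus_1 (s / y) ltac:(apply Rdiv_lt_0_compat; lra)).
    unfold Rdiv in K at 1. rewrite ln_mult, ln_Rinv in K by (try apply Rinv_0_lt_compat; lra).
    replace (k / y * (s - y)) with (k * (s / y - 1)) by (field; lra). nra.
Qed.

Lemma lprofile_convex : convex_on_Rplus (lprofile a k).
Proof.
  intros x y l Hx Hy Hl. set (z := l * x + (1 - l) * y).
  assert (Hz : 0 <= z) by (unfold z; nra).
  assert (K1 := lprofile_subgradient x z Hx Hz). assert (K2 := lprofile_subgradient y z Hy Hz).
  apply (Rmult_le_compat_l l) in K1; [|lra]. apply (Rmult_le_compat_l (1 - l)) in K2; [|lra].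
  assert (E : l * (x - z) + (1 - l) * (y - z) = 0) by (unfold z; ring).
  assert (l * (lslope k z * (x - z)) + (1 - l) * (lslope k z * (y - z)) = 0).
  { replace (l * (lslope k z * (x - z)) + (1 - l) * (lslope k z * (y - z)))
      with (lslope k z * (l * (x - z) + (1 - l) * (y - z))) by ring. rewrite E. ring. }
  lra.
Qed.

Lemma lprofile_lipschitz s y : 0 <= s -> 0 <= y -> lprofile a k s <= lprofile a k y + k * Rabs (s - y).
Proof.
  intros Hs Hy. assert (K := lprofile_subgradient y s Hy Hs).
  destruct (lslope_bounds s Hs) as [B1 B2].
  assert (lslope k s * (y - s) <= k * Rabs (s - y)); [|lra].
  rewrite Rabs_minus_sym. apply Rle_trans with (lslope k s * Rabs (y - s)).
  - apply Rmult_le_compat_l; [lra|apply Rle_abs].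
  - apply Rmult_le_compat_r; [apply Rabs_pos|lra].
Qed.

(* The half-lines tangent to the profile at height [y] bound a cone with real apex. *)
Lemma tangent_cone y d w : 0 <= y -> 0 < d ->
  Cone (lprofile a k y + lslope k y * y - d) (/ lslope k y) w ->
  Re w < lprofile a k (Rabs (Im w)) - d.
Proof.
  intros Hy Hd Hc. unfold Cone in Hc. destruct (lslope_bounds y Hy) as [B1 _].
  assert (K := lprofile_subgradient (Rabs (Im w)) y (Rabs_pos _) Hy).
  apply (Rmult_lt_compat_l (lslope k y)) in Hc; [|exact B1].
  rewrite <- Rmult_assoc, Rinv_r, Rmult_1_l in Hc by lra. nra.
Qed.

(** The supremum of the admissible angles is attained because the inequality on the argument in
    [C_minus] is strict: each point of the limiting cone already lies in a narrower admissible one.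
    The angle [0], with its empty cone, is admissible. *)
Lemma biggest_angle_exists (H : C -> Prop) (x0 : C) : exists theta, biggest_angle H x0 theta.
Proof.
  assert (P := PI_RGT_0).
  destruct (completeness (fun t => t <= PI / 2 /\ set_incl (C_minus x0 t) H)) as [m [M1 M2]].
  - exists (PI / 2). intros t Ht. apply Ht.
  - exists 0. split; [lra|]. intros w (u & _ & (al & _ & Hal) & _).
    generalize (Rabs_pos al). lra.
  - exists m. split; [|split].
    + apply M2. intros t Ht. apply Ht.
    + intros w (u & Hu & (al & Ha & Hal) & Hw).
      destruct (classic (exists t, Rabs al < t /\ t <= PI / 2 /\ set_incl (C_minus x0 t) H))
        as [(t & T1 & T2 & T3)|Hn].
      * apply T3. exists u. split; [exact Hu|]. split; [|exact Hw]. exists al. split; assumption.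
      * exfalso. assert (m <= Rabs al); [|lra]. apply M2. intros t [T1 T2].
        apply Rnot_lt_le. intros Hlt. apply Hn. exists t. auto.
    + intros t Ht1 Ht2. apply M1. split; assumption.
Qed.

Lemma tangent_cone_incl y d : 0 <= y -> 0 < d ->
  set_incl (C_minus (RtoC (lprofile a k y + lslope k y * y - d)) (atan (/ lslope k y))) (ldomain a k).
Proof.
  intros Hy Hd w Hw. destruct (lslope_bounds y Hy) as [B1 _].
  apply Cone_C_minus in Hw; [|apply Rinv_0_lt_compat; exact B1].
  apply tangent_cone in Hw; [|exact Hy|exact Hd]. unfold ldomain. lra.
Qed.

Lemma tangent_apex y d : 0 <= y -> 0 < d -> ldomain a k (RtoC (lprofile a k y + lslope k y * y - d)).
Proof.
  intros Hy Hd. unfold ldomain. simpl. rewrite Rabs_R0.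
  assert (K := lprofile_subgradient 0 y (Rle_refl 0) Hy). lra.
Qed.

Lemma ldomain_nbhd_minfty : nbhd_minfty (ldomain a k).
Proof.
  split.
  (* High enough for the tangent there, of slope [k / y], to bound a cone of half-angle at least
     [theta]. *)
  - intros theta Ht. pose (y := Rmax 1 (k * tan theta) + 1).
    assert (Y1 : 1 < y) by (unfold y; generalize (Rmax_l 1 (k * tan theta)); lra).
    assert (Y2 : k * tan theta <= y) by (unfold y; generalize (Rmax_r 1 (k * tan theta)); lra).
    exists (RtoC (lprofile a k y + lslope k y * y - 1)). split; [apply tangent_apex; lra|].
    intros w Hw. apply (tangent_cone_incl y 1); [lra|lra|].
    apply (C_minus_mono _ theta); [|exact Hw].
    rewrite <- (atan_tan theta) by (generalize PI_RGT_0; lra).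
    assert (E : tan theta <= / lslope k y).
    { unfold lslope. destruct Rle_dec; [lra|].
      replace (/ (k / y)) with (y / k) by (field; lra).
      apply Rmult_le_reg_r with k; [exact Hk|]. unfold Rdiv. rewrite Rmult_assoc, Rinv_l by lra. lra. }
    destruct E as [E| ->]; [left; apply atan_increasing; exact E|lra].
  - intros w. split.
    + intros Hw. unfold ldomain in Hw. set (y := Rabs (Im w)) in *.
      assert (Hy : 0 <= y) by apply Rabs_pos. destruct (lslope_bounds y Hy) as [B1 _].
      (* Half of the gap: moving the tangent cone left by [d] puts its apex inside the domain and
         keeps [w] in the cone. *)
      pose (d := (lprofile a k y - Re w) / 2). assert (Hd : 0 < d) by (unfold d; lra).
      set (x0 := lprofile a k y + lslope k y * y - d).
      destruct (biggest_angle_exists (ldomain a k) (RtoC x0)) as [theta Hth].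
      exists x0, theta. split; [apply tangent_apex; assumption|]. split; [exact Hth|].
      apply (C_minus_mono _ (atan (/ lslope k y))).
      * apply Hth; [generalize (atan_bound (/ lslope k y)); lra|]. apply tangent_cone_incl; assumption.
      * apply Cone_C_minus; [apply Rinv_0_lt_compat; exact B1|]. unfold Cone. fold y.
        apply Rmult_lt_reg_l with (lslope k y); [exact B1|].
        rewrite <- Rmult_assoc, Rinv_r, Rmult_1_l by lra. unfold x0, d. lra.
    + intros (x0 & theta & _ & (_ & Hin & _) & Hw). apply Hin; exact Hw.
Qed.

Lemma lprofile_Rabs_lip (u v : R) :
  lprofile a k (Rabs u) <= lprofile a k (Rabs v) + k * Rabs (u - v).
Proof.
  eapply Rle_trans; [apply lprofile_lipschitz; apply Rabs_pos|].
  apply Rplus_le_compat_l. apply Rmult_le_compat_l; [lra|]. apply Rabs_triang_inv2.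
Qed.

Lemma ldomain_border : border_profile (ldomain a k) (lprofile a k).
Proof.
  split; [apply lprofile_convex|]. intros x y. split.
  - intros [H1 H2]. apply Rle_antisym; apply Rnot_lt_le; intros Hlt.
    (* Within distance [e] the abscissa and the profile together change by at most [(k + 1) * e],
       the width of the gap. *)
    + pose (e := (x - lprofile a k (Rabs y)) / (k + 1)).
      assert (He : 0 < e) by (unfold e; apply Rdiv_lt_0_compat; lra).
      assert (Ee : e * (k + 1) = x - lprofile a k (Rabs y)) by (unfold e; field; lra).
      destruct (H1 e He) as ([x' y'] & Hin & Hd). unfold ldomain in Hin. simpl in Hin.
      assert (K1 := re_le_Cmod ((x', y') - (x, y))%C). assert (K2 := im_le_Cmod ((x', y') - (x, y))%C).
      simpl in K1, K2. fold (x' - x) in K1. fold (y' - y) in K2.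
      assert (K3 := Rle_lt_trans _ _ _ K1 Hd). apply Rabs_def2 in K3.
      assert (K4 := lprofile_Rabs_lip y' y). nra.
    + pose (e := (lprofile a k (Rabs y) - x) / (k + 1)).
      assert (He : 0 < e) by (unfold e; apply Rdiv_lt_0_compat; lra).
      assert (Ee : e * (k + 1) = lprofile a k (Rabs y) - x) by (unfold e; field; lra).
      destruct (H2 e He) as ([x' y'] & Hin & Hd). unfold ldomain in Hin. simpl in Hin.
      assert (K1 := re_le_Cmod ((x', y') - (x, y))%C). assert (K2 := im_le_Cmod ((x', y') - (x, y))%C).
      simpl in K1, K2. fold (x' - x) in K1. fold (y' - y) in K2.
      assert (K3 := Rle_lt_trans _ _ _ K1 Hd). apply Rabs_def2 in K3.
      assert (K4 := lprofile_Rabs_lip y y'). rewrite Rabs_minus_sym in K4. apply Rnot_lt_le in Hin. nra.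
  - intros ->. split.
    + intros e He. exists (lprofile a k (Rabs y) - e / 2, y). split; [unfold ldomain; simpl; lra|].
      replace ((lprofile a k (Rabs y) - e / 2)%R, y) with ((lprofile a k (Rabs y) - e / 2, y) : C) by reflexivity.
      eapply Rle_lt_trans; [apply Cmod_le_abs|]. simpl.
      replace (lprofile a k (Rabs y) - e / 2 + - lprofile a k (Rabs y)) with (- (e / 2)) by ring.
      replace (y + - y) with 0 by ring. rewrite Rabs_R0, Rabs_Ropp, Rabs_pos_eq; lra.
    + apply closure_incl. unfold ldomain. simpl. lra.
Qed.

Lemma ldomain_logarithmic : logarithmic (ldomain a k).
Proof.
  exists a, k. split; [exact Hk|]. split; [apply ldomain_nbhd_minfty|].
  exists (ldomain a k). split; [|intros w Hw; exact Hw].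
  split; [apply ldomain_nbhd_minfty|]. exists (lprofile a k). split; [apply ldomain_border|].
  exists 1. intros y Hy. unfold lprofile. destruct Rle_dec; [lra|reflexivity].
Qed.
End LogDomain.

(** * Estimates on the final neighborhood and the boundary terms *)

Lemma two_pi_i_neq0 : (2 * Ci * RtoC PI)%C <> RtoC 0.
Proof.
  assert (P := PI_RGT_0). intros E. apply (f_equal Cmod) in E.
  rewrite !Cmod_mult, Cmod_Ci, Cmod_0, !Cmod_R, (Rabs_pos_eq PI) in E by lra.
  rewrite Rabs_pos_eq in E; lra.
Qed.

Lemma Cmod_inv_two_pi_i : Cmod (/ (2 * Ci * RtoC PI)) <= 1 / 2.
Proof.
  rewrite Cmod_inv by apply two_pi_i_neq0. assert (P := PI2_1).
  rewrite !Cmod_mult, Cmod_Ci, !Cmod_R, (Rabs_pos_eq PI), (Rabs_pos_eq 2) by lra.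
  replace (1 / 2) with (/ 2) by field. apply Rinv_le_contravar; lra.
Qed.

Lemma half_pow_eventually C0 eps : 0 <= C0 -> 0 < eps ->
  exists n0, forall n, (n0 <= n)%nat -> C0 * (/ 2) ^ n < eps.
Proof.
  intros HC He. destruct (half_pow_small C0 eps HC He) as [n0 Hn0]. exists n0. intros n Hn.
  eapply Rle_lt_trans; [|exact Hn0]. apply Rmult_le_compat_l; [exact HC|].
  replace n with (n0 + (n - n0))%nat by lia. rewrite pow_add.
  rewrite <- (Rmult_1_r ((/ 2) ^ n0)) at 2. apply Rmult_le_compat_l; [apply pow_le; lra|].
  rewrite pow_inv. rewrite <- Rinv_1. apply Rinv_le_contravar; [lra|]. apply pow_R1_Rle. lra.
Qed.

(** [Cmod w] is at most [(1 - Re w) * (1 + |Im w|)], and [Re w / (2 * k)] contains two shares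
    [Re w / (8 * k)], one for the square of each factor. For the second factor the type [16 * k]
    yields [- 2 * ln |Im w|] at large heights; for the first, a linear function beats the logarithm.
    The depth [a] then supplies [d]. *)
Lemma deep_bound k a d w : 0 < k -> 0 < d -> a + 16 * k <= 0 ->
  a / (8 * k) <= ln d - (1 / (8 * k) + 2 * ln (16 * k)) - 2 * ln 2 - 2 ->
  ldomain a (16 * k) w -> Cmod w ^ 2 * exp (Re w / (2 * k)) <= d.
Proof.
  intros Hk Hd Ha1 Ha2 Hw. unfold ldomain in Hw.
  set (x := Re w) in *. set (y := Rabs (Im w)) in *.
  assert (Hy : 0 <= y) by apply Rabs_pos.
  assert (Pk : 0 < / (8 * k)) by (apply Rinv_0_lt_compat; lra).
  assert (Ly := ln_1p_pos y Hy).
  assert (Hx : x <= 0 /\ 2 * ln (1 + y) + x / (8 * k) <= 2 * ln 2 + 2 + a / (8 * k)).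
  { unfold lprofile in Hw. assert (L2 : 0 < ln 2) by (rewrite <- ln_1; apply ln_increasing; lra).
    destruct Rle_dec as [Hy1|Hy1].
    - split; [nra|].
      assert (ln (1 + y) <= ln 2).
      { destruct (Req_dec (1 + y) 2) as [->|]; [lra|]. left; apply ln_increasing; lra. }
      assert (K : x * / (8 * k) <= (a + 16 * k) * / (8 * k)) by (apply Rmult_le_compat_r; nra).
      replace ((a + 16 * k) * / (8 * k)) with (a / (8 * k) + 2) in K by (field; lra).
      unfold Rdiv in *. lra.
    - assert (Lny : 0 < ln y) by (rewrite <- ln_1; apply ln_increasing; lra).
      split; [nra|].
      assert (ln (1 + y) <= ln 2 + ln y).
      { rewrite <- ln_mult by lra. destruct (Req_dec (1 + y) (2 * y)) as [->|]; [lra|].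
        left; apply ln_increasing; lra. }
      assert (K : x * / (8 * k) <= (a - 16 * k * ln y) * / (8 * k)) by (apply Rmult_le_compat_r; lra).
      replace ((a - 16 * k * ln y) * / (8 * k)) with (a / (8 * k) - 2 * ln y) in K by (field; lra).
      unfold Rdiv in *. lra. }
  destruct Hx as [Hx0 Hx1].
  assert (Lx := ln_le_linear (16 * k) (1 - x) ltac:(lra) ltac:(lra)).
  assert (Hx2 : 2 * ln (1 - x) + x / (8 * k) <= 1 / (8 * k) + 2 * ln (16 * k)).
  { replace (1 / (8 * k)) with (2 * ((1 - x) / (16 * k)) + x / (8 * k)) by (field; lra). lra. }
  assert (Hc : Cmod w <= exp (ln (1 - x) + ln (1 + y))).
  { rewrite exp_plus, !exp_ln by lra. eapply Rle_trans; [apply Cmod_le_abs|]. fold x y.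
    rewrite Rabs_left1 by exact Hx0. nra. }
  apply Rle_trans with (exp (ln (1 - x) + ln (1 + y)) ^ 2 * exp (x / (2 * k))).
  - apply Rmult_le_compat_r; [left; apply exp_pos|]. apply pow_incr. split; [apply Cmod_ge_0|exact Hc].
  - replace (exp (ln (1 - x) + ln (1 + y)) ^ 2 * exp (x / (2 * k)))
      with (exp ((ln (1 - x) + ln (1 + y)) + (ln (1 - x) + ln (1 + y)) + x / (2 * k)))
      by (rewrite !exp_plus; ring).
    rewrite <- (exp_ln d Hd). apply exp_le.
    replace (x / (2 * k)) with (x / (8 * k) + x / (8 * k) + x / (4 * k)) by (field; lra).
    assert (x / (4 * k) <= 0).
    { assert (0 < / (4 * k)) by (apply Rinv_0_lt_compat; lra). unfold Rdiv. nra. }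
    lra.
Qed.

Lemma exp_nat_mul n x : exp (INR n * x) = exp x ^ n.
Proof. rewrite <- (exp_mul_ln_nat n (exp x)) by apply exp_pos. rewrite ln_exp. reflexivity. Qed.

(** The derivative of order [n + 2 - j] lowers the index [n + 3] to [j + 1]; in this form the sum is
    the difference of the boundary terms of the two integrations by parts. *)
Lemma BT2_csum (L : C -> C) k n w r (F : C -> C) :
  (forall j p, Im p <> 0 -> Cderiv (iter_primitive (S j) L) p (iter_primitive j L p)) ->
  0 < r -> r <= t_ k n -> hol_on (square (t_ k n) r) F ->
  (forall u, square (t_ k n) r u -> Im u <> 0 -> F u = L u) ->
  BT2 L k n w =
  csum (fun j => (- w) ^ j * phi L (S j) (t_ k n) * Cexp (RtoC (t_ k n) * w))%C (n + 3).
Proof.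
  intros Hd Hr Hrt HF HFL. unfold BT2. rewrite sum_n_csum.
  replace (S (n + 2)) with (n + 3)%nat by lia. apply csum_ext. intros j Hj.
  rewrite (CDerive_n_phi L Hd (t_ k n) r F Hr Hrt HF HFL (n + 3) (n + 2 - j) (t_ k n)).
  - replace (n + 3 - (n + 2 - j))%nat with (S j) by lia.
    replace ((- w) ^ j)%C with ((-1) ^ j * w ^ j)%C.
    + rewrite (Cmult_comm w). ring.
    + rewrite <- Cpow_mult_l. f_equal. ring.
  - lia.
  - rewrite Rminus_diag, Rabs_R0. exact Hr.
Qed.

(** * The contour *)

Section Setting.
Context (H : C -> Prop) (w0 k B : R) (HL : left_domain H) (Hw0 : H (RtoC w0)).
Context (Hk : 0 < k) (HB : 0 <= B).

(* The contour starts at [w0]; its term in [B] bends it quickly to the left, into the part of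
   [H] bounded by the logarithmic profile. *)
Definition gamma_re (y : R) : R := w0 - B * y / (1 + y) - k * ln (1 + y).
Definition gamma (s y : R) : C := (gamma_re y, s * y).
Definition gamma' (s y : R) : C := (- B / (1 + y) ^ 2 - k / (1 + y), s).
Definition hray (y : R) : C := (w0 - y, 0).
Definition hray' (y : R) : C := (-1, 0).

Lemma gamma_re_le y : 0 <= y -> gamma_re y <= w0.
Proof.
  intros Hy. unfold gamma_re. assert (K := ln_1p_pos y Hy). destruct (frac_bounds y Hy).
  replace (B * y / (1 + y)) with (B * (y / (1 + y))) by (unfold Rdiv; ring). nra.
Qed.

Lemma gamma_re_ge y : 0 <= y -> w0 - B - k * ln (1 + y) <= gamma_re y.
Proof.
  intros Hy. unfold gamma_re. destruct (frac_bounds y Hy).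
  replace (B * y / (1 + y)) with (B * (y / (1 + y))) by (unfold Rdiv; ring). nra.
Qed.

Lemma gamma_deriv s y : 0 <= y -> Rderiv (gamma s) y (gamma' s y).
Proof.
  intros Hy. apply Rderiv_pair.
  - unfold gamma_re. auto_derive; [repeat split; lra|]. field. lra.
  - auto_derive; trivial. ring.
Qed.

Lemma gamma'_cont s y : 0 <= y -> Rcont (gamma' s) y.
Proof.
  intros Hy. apply Rcont_pair.
  - apply (ex_derive_continuous (K := R_AbsRing) (V := R_NormedModule)). auto_derive.
    repeat split; apply Rgt_not_eq; nra.
  - apply continuous_const.
Qed.

Lemma gamma_re_variation y y' : 0 <= y -> 0 <= y' -> Rabs (y' - y) <= 1 ->
  gamma_re y' - (B + k) <= gamma_re y.
Proof.
  intros Hy Hy' Hd.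
  assert (Hdd : - 1 <= y' - y <= 1).
  { apply Rabs_le_between in Hd. lra. }
  unfold gamma_re.
  assert (A1 : y / (1 + y) - y' / (1 + y') <= 1).
  { destruct (frac_bounds y Hy), (frac_bounds y' Hy'). lra. }
  assert (A2 : ln (1 + y) - ln (1 + y') <= 1).
  { assert (E : ln (1 + y) - ln (1 + y') = ln ((1 + y) * / (1 + y'))).
    { rewrite ln_mult, ln_Rinv by (try apply Rinv_0_lt_compat; lra). ring. }
    rewrite E. assert (P : 0 < / (1 + y')) by (apply Rinv_0_lt_compat; lra).
    assert (K := ln_le_minus_1 ((1 + y) * / (1 + y')) ltac:(apply Rmult_lt_0_compat; lra)).
    assert (P1 : / (1 + y') <= 1). { rewrite <- Rinv_1. apply Rinv_le_contravar; lra. }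
    assert (E2 : (1 + y) * / (1 + y') - 1 = (y - y') * / (1 + y')) by (field; lra). nra. }
  replace (B * y / (1 + y)) with (B * (y / (1 + y))) by (unfold Rdiv; ring).
  replace (B * y' / (1 + y')) with (B * (y' / (1 + y'))) by (unfold Rdiv; ring).
  nra.
Qed.

Lemma lprofile_below_gamma a y : 0 <= y ->
  a + 16 * k <= w0 - B - k * ln 2 - (B + k + 2) ->
  lprofile a (16 * k) y <= gamma_re y - (B + k + 2).
Proof.
  intros Hy Ha. assert (G2 := gamma_re_ge y Hy).
  unfold lprofile. destruct Rle_dec as [Hy1|Hy1].
  - assert (ln (1 + y) <= ln 2).
    { destruct (Req_dec (1 + y) 2) as [->|]; [lra|]. left; apply ln_increasing; lra. }
    nra.
  - assert (Lny : 0 < ln y) by (rewrite <- ln_1; apply ln_increasing; lra).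
    assert (ln (1 + y) <= ln 2 + ln y).
    { rewrite <- ln_mult by lra. destruct (Req_dec (1 + y) (2 * y)) as [->|]; [lra|].
      left; apply ln_increasing; lra. }
    nra.
Qed.

(** A point of the contour closer than [1] would have a height within [1] of [|Im w|]. Over such a
    height [gamma_re] varies by at most [B + k], whereas [w] lies more than [B + k + 2] to the left
    of the contour. *)
Lemma ldomain_far a w s y : s = 1 \/ s = -1 -> 0 <= y ->
  a + 16 * k <= w0 - B - k * ln 2 - (B + k + 2) ->
  ldomain a (16 * k) w -> 1 <= Cmod (gamma s y - w).
Proof.
  intros Hs Hy Ha Hw. unfold ldomain in Hw.
  assert (K := lprofile_below_gamma a (Rabs (Im w)) (Rabs_pos _) Ha).
  apply Rnot_lt_le. intros Hlt.
  assert (K1 := Rle_lt_trans _ _ _ (re_le_Cmod _) Hlt).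
  assert (K2 := Rle_lt_trans _ _ _ (im_le_Cmod _) Hlt).
  simpl in K1, K2. fold (Re w) in K1. fold (Im w) in K2.
  apply Rabs_def2 in K1.
  assert (K3 : Rabs (Rabs (Im w) - y) <= 1).
  { replace y with (Rabs (s * y)).
    - eapply Rle_trans; [apply Rabs_triang_inv2|]. rewrite Rabs_minus_sym. left. exact K2.
    - rewrite Rabs_mult, (Rabs_pos_eq y) by exact Hy.
      destruct Hs as [-> | ->]; rewrite ?Rabs_R1, ?Rabs_m1; ring. }
  assert (K4 := gamma_re_variation y (Rabs (Im w)) Hy (Rabs_pos _) K3).
  lra.
Qed.

Context (HG : forall y, 0 <= y -> H (gamma_re y, y)).

Lemma w0_le : w0 <= -1.
Proof. exact (ld_Re H HL _ Hw0). Qed.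

Lemma gamma_in s y : s = 1 \/ s = -1 -> 0 <= y -> H (gamma s y).
Proof.
  intros Hs Hy. apply (ld_left H HL (gamma_re y) y); [apply HG; exact Hy|lra|].
  rewrite Rabs_mult. destruct Hs as [-> | ->]; [rewrite Rabs_R1|rewrite Rabs_m1]; lra.
Qed.

Lemma gamma_growth s : s = 1 \/ s = -1 ->
  exists W, 0 <= W /\ forall y, 0 <= y ->
    Cmod (gamma' s y) <= W /\ Cmod (gamma s y) <= W * (1 + y).
Proof.
  intros Hs. exists (- w0 + B + k + 1). assert (Hw := w0_le).
  assert (Hsa : Rabs s = 1) by (destruct Hs as [-> | ->]; [apply Rabs_R1|apply Rabs_m1]).
  split; [lra|]. intros y Hy. split.
  - eapply Rle_trans; [apply Cmod_le_abs|]. simpl. rewrite Hsa.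
    assert (K : Rabs (- B / ((1 + y) * ((1 + y) * 1)) - k / (1 + y)) <= B + k); [|lra].
    assert (P1 : 0 <= / (1 + y) <= 1).
    { split; [left; apply Rinv_0_lt_compat; lra|].
      rewrite <- Rinv_1. apply Rinv_le_contravar; lra. }
    replace (- B / ((1 + y) * ((1 + y) * 1)) - k / (1 + y))
      with (- (B * (/ (1 + y) * / (1 + y)) + k * / (1 + y))) by (field; lra).
    rewrite Rabs_Ropp, Rabs_pos_eq by nra.
    assert (/ (1 + y) * / (1 + y) <= 1) by nra. nra.
  - eapply Rle_trans; [apply Cmod_le_abs|]. simpl. rewrite Rabs_mult, Hsa, (Rabs_pos_eq y) by lra.
    assert (G1 := gamma_re_le y Hy). assert (G2 := gamma_re_ge y Hy).
    assert (G3 := ln_1p_le y Hy). rewrite Rabs_left1 by lra. nra.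
Qed.

Lemma gamma_decay_curve s : s = 1 \/ s = -1 ->
  decay_curve H w0 (gamma s) (gamma' s) (fun p => s * Im p < 0).
Proof.
  intros Hs. constructor.
  - unfold gamma, gamma_re. rewrite Rplus_0_r, ln_1. apply injective_projections; simpl; field.
  - intros y Hy. apply gamma_in; assumption.
  - intros y Hy. apply gamma_deriv; exact Hy.
  - intros y Hy. apply gamma'_cont; exact Hy.
  - apply gamma_growth; exact Hs.
  - intros p0 Hp0. assert (Hw := w0_le).
    (* Half of the decay rate at [p0] survives in a disc of radius [q]. *)
    pose (q := - (s * Im p0) / 2). pose (a := Rabs (Re p0) + 1).
    assert (Ha : 1 <= a) by (unfold a; generalize (Rabs_pos (Re p0)); lra).
    assert (Hq : 0 < q) by (unfold q; lra).
    exists (Rmin 1 q), (a * (B - w0)), (a * k), q.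
    split; [apply Rmin_pos; lra|]. split; [nra|]. split; [exact Hq|].
    intros p Hp y Hy.
    assert (R1 := Rmin_l 1 q). assert (R2 := Rmin_r 1 q).
    assert (P1 : Rabs (Re p - Re p0) <= Cmod (p - p0)) by apply (re_le_Cmod (p - p0)%C).
    assert (P2 : Rabs (Im p - Im p0) <= Cmod (p - p0)) by apply (im_le_Cmod (p - p0)%C).
    rewrite Re_mult. cbn [Re Im fst snd gamma].
    assert (G1 := gamma_re_le y Hy). assert (G2 := gamma_re_ge y Hy).
    assert (HR : Re p <= a).
    { assert (Re p <= Rabs (Re p0) + Rabs (Re p - Re p0)); [|unfold a; lra].
      generalize (Rle_abs (Re p0)) (Rle_abs (Re p - Re p0)). lra. }
    assert (HI : s * Im p <= - q).
    { assert (s * (Im p - Im p0) <= Rabs (Im p - Im p0)).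
      { destruct Hs as [-> | ->].
        - rewrite Rmult_1_l. apply Rle_abs.
        - rewrite <- Rabs_Ropp. eapply Rle_trans; [|apply Rle_abs]. right; ring. }
      assert (E : s * Im p = s * Im p0 + s * (Im p - Im p0)) by ring.
      assert (s * Im p0 = - 2 * q) by (unfold q; field). lra. }
    set (X := gamma_re y) in *.
    assert (M1 : - (Re p * X) <= a * (B - w0 + k * ln (1 + y))).
    { apply Rle_trans with (a * - X); [nra|]. apply Rmult_le_compat_l; lra. }
    assert (M2 : s * Im p * y <= - q * y) by (apply Rmult_le_compat_r; lra).
    lra.
Qed.

Lemma ray_decay_curve : decay_curve H w0 (hray) hray' (fun p => Re p < 0).
Proof.
  assert (Hw := w0_le). constructor.
  - unfold hray. apply injective_projections; simpl; ring.
  - intros y Hy. apply (ld_left H HL w0 0); [exact Hw0|lra|lra].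
  - intros y Hy. apply Rderiv_pair; auto_derive; trivial; ring.
  - intros y Hy. apply Rcont_pair; apply continuous_const.
  - exists (1 - w0). split; [lra|]. intros y Hy. split.
    + eapply Rle_trans; [apply Cmod_le_abs|]. simpl. rewrite Rabs_m1, Rabs_R0. lra.
    + eapply Rle_trans; [apply Cmod_le_abs|]. simpl. rewrite Rabs_left1, Rabs_R0 by lra. nra.
  - intros p0 Hp0. pose (q := - Re p0 / 2). assert (Hq : 0 < q) by (unfold q; lra).
    exists q, 0, 0, q. split; [exact Hq|]. split; [lra|]. split; [exact Hq|].
    intros p Hp y Hy. rewrite Re_mult. cbn [Re Im fst snd hray].
    assert (P1 : Rabs (Re p - Re p0) <= Cmod (p - p0)) by apply (re_le_Cmod (p - p0)%C).
    assert (HR : Re p <= - q).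
    { assert (Re p - Re p0 <= q) by (eapply Rle_trans; [apply Rle_abs|]; lra).
      assert (Re p0 = - 2 * q) by (unfold q; field). lra. }
    assert (- (Re p * (w0 - y)) <= - q * y); [|lra]. nra.
Qed.

(* For [Im p > 0], [exp (- p u)] decays along the lower half of the contour. *)
Definition laplace (h : C -> C) (p : C) : C :=
  if Rlt_dec 0 (Im p) then curve_laplace h (gamma (-1)) (gamma' (-1)) p
  else if Rlt_dec (Im p) 0 then curve_laplace h (gamma 1) (gamma' 1) p
  else curve_laplace h (hray) hray' p.

(** * The transform along the contour and its iterated primitives *)

Lemma kernel_primitive h p : hol_on H h ->
  exists F, F (RtoC w0) = RtoC 0 /\ forall z, H z -> Cderiv F z (h z * Cexp (- (p * z)))%C.
Proof.
  intros Hh.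
  apply (primitive_exists H (fun w => h w * Cexp (- (p * w)))%C (RtoC 0) w0
    (left_domain_comb H HL) Hw0).
  - intros z Hz. apply kernel_Ccont. apply (hol_on_Ccont H); assumption.
  - intros z Hz _. destruct (Hh z Hz) as [l Hl].
    eexists. apply Cderiv_kernel. exact Hl.
Qed.

(** A steep direction, tilted to the left so that it is admissible for a ray, but too little for
    [dl * Re p] to spoil the decay due to the imaginary part. *)
Lemma decay_direction s p : s * Im p < 0 -> exists dl, 0 < dl /\ 0 < Re (p * (- dl, s)).
Proof.
  intros Hp. pose (dl := - (s * Im p) / (2 * (Rabs (Re p) + 1))).
  assert (Pr := Rabs_pos (Re p)).
  assert (Hdl : 0 < dl) by (apply Rdiv_lt_0_compat; lra).
  assert (Edl : dl * (2 * (Rabs (Re p) + 1)) = - (s * Im p)) by (unfold dl; field; lra).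
  exists dl. split; [exact Hdl|]. rewrite Re_mult. cbn [Re Im fst snd].
  assert (Re p * dl <= Rabs (Re p) * dl) by (apply Rmult_le_compat_r; [lra|apply Rle_abs]). nra.
Qed.

(** The contour has no limiting direction to the left, so the comparison of rays does not apply to
    it. It is first compared with a steep ray on the same side, and that ray with the given one. *)
Lemma gamma_ray_limit h p F s : s = 1 \/ s = -1 -> s * Im p < 0 ->
  bounded_on H h -> hol_on H h -> F (RtoC w0) = RtoC 0 ->
  (forall z, H z -> Cderiv F z (h z * Cexp (- (p * z)))%C) ->
  forall v, Re v < 0 -> 0 < Re (p * v) ->
  flim (fun T => F (RtoC w0 + RtoC T * v)%C) (Rbar_locally p_infty)
    (curve_laplace h (gamma s) (gamma' s) p).
Proof.
  intros Hs Hp Hb Hh HF0 HF v Hv Hpv.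
  assert (Hc : forall z, H z -> Ccont h z) by (intros; apply (hol_on_Ccont H); assumption).
  assert (D := gamma_decay_curve s Hs).
  assert (K := curve_laplace_limit H w0 _ _ _ D h p F Hb Hc Hp HF0 HF).
  assert (Hw := w0_le).
  destruct (decay_direction s p Hp) as (dl & Hdl & Hpv').
  pose (v' := (- dl, s) : C).
  assert (Hv' : Re v' < 0) by (unfold v'; simpl; lra).
  change (0 < Re (p * v')) in Hpv'.
  assert (Dg : decays p (gamma s)).
  { destruct (gamma_growth s Hs) as (W & HW & HWU).
    destruct (dc_decay _ _ _ _ _ D p Hp) as (r & c & al & q & Hr & Hal & Hq & Hdec).
    exists W, c, al, q. split; [exact Hal|]. split; [exact Hq|]. split; [exact HW|].
    intros T HT. split; [apply HWU; exact HT|]. apply Hdec; [|exact HT].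
    replace (p - p)%C with (RtoC 0) by ring. rewrite Cmod_0. exact Hr. }
  assert (Hhor : flim (fun T => F (gamma s T) - F (RtoC w0 + RtoC T * v'))%C
    (Rbar_locally p_infty) (RtoC 0)).
  { apply (tails_agree H h p F); auto; [apply ray_decays; exact Hpv'|].
    assert (H0 : Rbar_locally p_infty (fun T => 0 < T)) by (exists 0; auto).
    generalize (filter_and _ _ H0 (left_domain_ray_far H HL (RtoC w0) v' Hv')).
    apply filter_imp. intros T [HT HTin] t Ht.
    (* At equal parameters the steep ray and the contour have the same height, so the joining
       segment is horizontal and lies to the left of one of its ends, both of which are in [H]. *)
    assert (Hg := gamma_in s T Hs ltac:(lra)).
    assert (E1 : (RtoC w0 + RtoC T * v')%C = (w0 - T * dl, s * T)).
    { unfold v'. apply injective_projections; simpl; ring. }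
    rewrite E1 in *.
    assert (E2 : Csegment (w0 - T * dl, s * T) (gamma s T) t
      = ((1 - t) * (w0 - T * dl) + t * gamma_re T, s * T)).
    { unfold Csegment, gamma. apply injective_projections; simpl; ring. }
    rewrite E2. unfold gamma in Hg.
    destruct (Rle_dec (w0 - T * dl) (gamma_re T)).
    - apply (ld_left H HL (gamma_re T) (s * T)); [exact Hg|nra|lra].
    - apply (ld_left H HL (w0 - T * dl) (s * T)); [exact HTin|nra|lra]. }
  assert (Hray : flim (fun T => F (RtoC w0 + RtoC T * v) - F (RtoC w0 + RtoC T * v'))%C
    (Rbar_locally p_infty) (RtoC 0)).
  { apply (tails_agree H h p F); auto; try (apply ray_decays; assumption).
    apply left_domain_far; assumption. }
  apply (flim_ext _ (fun T => F (gamma s T) - (F (gamma s T) - F (RtoC w0 + RtoC T * v'))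
    + (F (RtoC w0 + RtoC T * v) - F (RtoC w0 + RtoC T * v')))%C); [intros; ring|].
  apply (flim_eq _ _ (curve_laplace h (gamma s) (gamma' s) p - RtoC 0 + RtoC 0)%C); [|ring].
  apply flim_plus; [apply _|apply flim_minus; [apply _|exact K|exact Hhor]|exact Hray].
Qed.

Lemma horizontal_ray_limit h p F : Re p < 0 ->
  bounded_on H h -> hol_on H h -> F (RtoC w0) = RtoC 0 ->
  (forall z, H z -> Cderiv F z (h z * Cexp (- (p * z)))%C) ->
  flim (fun T => F (RtoC w0 + RtoC T * RtoC (-1))%C) (Rbar_locally p_infty) (curve_laplace h (hray) hray' p).
Proof.
  intros Hp Hb Hh HF0 HF.
  assert (Hc : forall z, H z -> Ccont h z) by (intros; apply (hol_on_Ccont H); assumption).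
  assert (K := curve_laplace_limit H w0 _ _ _ ray_decay_curve h p F Hb Hc Hp HF0 HF).
  revert K. apply flim_ext; [apply _|]. intros T. f_equal. unfold hray.
  apply injective_projections; simpl; ring.
Qed.

(** For [Re p < 0] the three branches of [laplace] are limits of the same primitive, hence agree;
    this is what makes it differentiable across the negative axis. *)
Lemma laplace_horizontal h p : Re p < 0 -> bounded_on H h -> hol_on H h -> laplace h p = curve_laplace h (hray) hray' p.
Proof.
  intros Hp Hb Hh. destruct (kernel_primitive h p Hh) as (F & HF0 & HF).
  assert (Hv : Re (RtoC (-1)) < 0) by (simpl; lra).
  assert (Hpv : 0 < Re (p * RtoC (-1))) by (rewrite Re_mult; simpl; lra).
  assert (K := horizontal_ray_limit h p F Hp Hb Hh HF0 HF).
  unfold laplace. destruct Rlt_dec as [H1|H1]; [|destruct Rlt_dec as [H2|H2]; [|reflexivity]].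
  - apply (flim_unique (Rbar_locally p_infty) _ _ _ (gamma_ray_limit h p F (-1) (or_intror eq_refl) ltac:(lra)
      Hb Hh HF0 HF (RtoC (-1)) Hv Hpv) K).
  - apply (flim_unique (Rbar_locally p_infty) _ _ _ (gamma_ray_limit h p F 1 (or_introl eq_refl) ltac:(lra)
      Hb Hh HF0 HF (RtoC (-1)) Hv Hpv) K).
Qed.

Lemma laplace_ray_limit h p F : ~ in_Rplus p ->
  bounded_on H h -> hol_on H h -> F (RtoC w0) = RtoC 0 ->
  (forall z, H z -> Cderiv F z (h z * Cexp (- (p * z)))%C) ->
  exists v, Re v < 0 /\ 0 < Re (p * v) /\
    flim (fun T => F (RtoC w0 + RtoC T * v)%C) (Rbar_locally p_infty) (laplace h p).
Proof.
  intros Hp Hb Hh HF0 HF.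
  assert (G : forall s, s = 1 \/ s = -1 -> s * Im p < 0 ->
    exists v, Re v < 0 /\ 0 < Re (p * v) /\
    flim (fun T => F (RtoC w0 + RtoC T * v)%C) (Rbar_locally p_infty)
      (curve_laplace h (gamma s) (gamma' s) p)).
  { intros s Hs Hsp.
    destruct (decay_direction s p Hsp) as (dl & Hdl & Hpv).
    exists (- dl, s). split; [simpl; lra|].
    split; [exact Hpv|]. apply gamma_ray_limit; auto. simpl; lra. }
  unfold laplace. destruct Rlt_dec as [H1|H1].
  { apply G; [right; reflexivity|lra]. }
  destruct Rlt_dec as [H2|H2].
  { apply G; [left; reflexivity|lra]. }
  assert (Hre : Re p < 0).
  { apply Rnot_le_lt. intros Hle. apply Hp. split; [exact Hle|lra]. }
  exists (RtoC (-1)). split; [simpl; lra|]. split; [rewrite Re_mult; simpl; lra|].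
  apply horizontal_ray_limit; auto.
Qed.

Lemma Laplace_laplace g p : ~ in_Rplus p -> bounded_on H g -> hol_on H g -> ccont_on (closure H) g ->
  Laplace H w0 g p = laplace g p.
Proof.
  intros Hp Hb Hh Hon. destruct (kernel_primitive g p Hh) as (F & HF0 & HF).
  destruct (laplace_ray_limit g p F Hp Hb Hh HF0 HF) as (v & Hv & Hpv & Hlim).
  apply (Laplace_value H w0 g p (laplace g p) HL Hw0 Hb) with (F := F) (v0 := v); auto.
  intros z Hz. apply (hol_on_Ccont H); assumption.
Qed.

Lemma in_H_neq0 z : H z -> z <> RtoC 0.
Proof. intros Hz E. assert (K := ld_Re H HL z Hz). rewrite E in K. simpl in K. lra. Qed.

Lemma in_H_Cmod z : H z -> 1 <= Cmod z.
Proof.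
  intros Hz. assert (K := ld_Re H HL z Hz). assert (K2 := re_le_Cmod z).
  rewrite Rabs_left1 in K2 by lra. lra.
Qed.

Lemma bounded_on_div h : bounded_on H h -> bounded_on H (fun w => / (- w) * h w)%C.
Proof.
  intros (M & HM & Hh). exists M. split; [exact HM|]. intros w Hw.
  assert (H1 := in_H_Cmod w Hw).
  rewrite Cmod_mult, Cmod_inv.
  2:{ intros E. apply (in_H_neq0 w Hw). replace w with (- - w)%C by ring. rewrite E. ring. }
  rewrite Cmod_opp. specialize (Hh w Hw).
  assert (/ Cmod w <= 1). { rewrite <- Rinv_1. apply Rinv_le_contravar; lra. }
  assert (0 < / Cmod w) by (apply Rinv_0_lt_compat; lra).
  assert (0 <= Cmod (h w)) by apply Cmod_ge_0. nra.
Qed.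

Lemma hol_on_div h : hol_on H h -> hol_on H (fun w => / (- w) * h w)%C.
Proof.
  intros Hh z Hz. destruct (Hh z Hz) as [l Hl].
  assert (Hn : (- z)%C <> RtoC 0).
  { intros E. apply (in_H_neq0 z Hz). replace z with (- - z)%C by ring. rewrite E. ring. }
  eexists. apply (deriv_along_mult (fun u : C => u) z (Ccont_id z) (fun w => / (- w))%C h); [|exact Hl].
  apply (Cderiv_comp (fun u => / u)%C (fun w => - w)%C); [apply Cderiv_inv; exact Hn|].
  apply deriv_along_opp. apply deriv_along_id.
Qed.

Lemma laplace_derive h p : ~ in_Rplus p -> bounded_on H h -> hol_on H h ->
  Cderiv (laplace (fun w => / (- w) * h w)%C) p (laplace h p).
Proof.
  intros Hp Hb Hh.
  assert (Hb' := bounded_on_div h Hb). assert (Hh' := hol_on_div h Hh).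
  assert (Hc : forall z, H z -> Ccont h z) by (intros; apply (hol_on_Ccont H); assumption).
  destruct (Rlt_dec 0 (Im p)) as [H1|H1].
  { apply (deriv_along_ext_loc (fun u : C => u) p (curve_laplace (fun w => / (- w) * h w)%C (gamma (-1)) (gamma' (-1))));
      [auto| |].
    - generalize (locally_Im_lt (-1) p (or_intror eq_refl) ltac:(lra)). apply filter_imp.
      intros u Hu. unfold laplace. destruct Rlt_dec; [reflexivity|lra].
    - unfold laplace at 1. destruct Rlt_dec; [|lra].
      apply (curve_laplace_derive H w0 _ _ _ (gamma_decay_curve (-1) (or_intror eq_refl))); auto; [apply in_H_neq0|lra]. }
  destruct (Rlt_dec (Im p) 0) as [H2|H2].
  { apply (deriv_along_ext_loc (fun u : C => u) p (curve_laplace (fun w => / (- w) * h w)%C (gamma 1) (gamma' 1)));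
      [auto| |].
    - generalize (locally_Im_lt 1 p (or_introl eq_refl) ltac:(lra)). apply filter_imp.
      intros u Hu. unfold laplace. destruct Rlt_dec; [lra|]. destruct Rlt_dec; [reflexivity|lra].
    - unfold laplace at 1. destruct Rlt_dec; [lra|]. destruct Rlt_dec; [|lra].
      apply (curve_laplace_derive H w0 _ _ _ (gamma_decay_curve 1 (or_introl eq_refl))); auto; [apply in_H_neq0|lra]. }
  assert (Hre : Re p < 0).
  { apply Rnot_le_lt. intros Hle. apply Hp. split; [exact Hle|lra]. }
  apply (deriv_along_ext_loc (fun u : C => u) p (curve_laplace (fun w => / (- w) * h w)%C (hray) hray')); [auto| |].
  - generalize (locally_Re_lt p 0 Hre). apply filter_imp. intros u Hu. symmetry. apply laplace_horizontal; auto.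
  - rewrite laplace_horizontal by auto.
    apply (curve_laplace_derive H w0 _ _ _ ray_decay_curve); auto. apply in_H_neq0.
Qed.

Lemma laplace_decay h : bounded_on H h -> hol_on H h ->
  forall eps, 0 < eps -> exists M, forall p, Re p < M -> Cmod (laplace h p) < eps.
Proof.
  intros Hb Hh eps He. destruct Hb as (Mh & HMh & HMb).
  assert (Hw := w0_le).
  (* As [Re w <= -1] on the half-line, the kernel carries a factor [exp (- q)]. The [2] pays for the
     weight [(1 + y) ^ (-2)], the other term for [exp (- q) < / q]. *)
  exists (- (2 + (Mh + 1) / eps)). intros p Hp.
  assert (Hme : 0 < (Mh + 1) / eps) by (apply Rdiv_lt_0_compat; lra).
  rewrite laplace_horizontal; [|lra|exists Mh; auto|exact Hh].
  set (q := - Re p). assert (Hq : 2 + (Mh + 1) / eps < q) by (unfold q; lra).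
  assert (Hdom : dominated (fun y => (h (hray y) * hray' y) * Cexp (- (p * hray y)))%C (Mh * exp (- q))).
  { split.
    - intros y Hy. apply (Rcont_kernel (fun y => h (hray y) * hray' y)%C).
      + apply (dc_weight_cont H w0 _ _ _ ray_decay_curve); auto.
        intros z Hz. apply (hol_on_Ccont H); assumption.
      + apply (dc_curve_cont H w0 _ _ _ ray_decay_curve); exact Hy.
    - intros y Hy. rewrite !Cmod_mult, Cmod_Cexp, Re_opp, Re_mult. cbn [hray Re Im fst snd].
      assert (E1 : Cmod (hray' y) = 1).
      { unfold hray'. change (-1, 0) with (RtoC (-1)). rewrite Cmod_R. apply Rabs_m1. }
      rewrite E1, Rmult_1_r.
      assert (Hhb : Cmod (h (hray y)) <= Mh).
      { apply HMb. apply (dc_in H w0 _ _ _ ray_decay_curve); exact Hy. }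
      assert (E2 : exp (- (Re p * (w0 - y) - Im p * 0)) <= exp (- q) / (1 + y) ^ 2).
      { apply Rle_trans with (exp (- q - INR 2 * ln (1 + y))).
        - apply exp_le. replace (INR 2) with 2 by (simpl; ring).
          assert (K := ln_1p_le y Hy). replace (Re p) with (- q) by (unfold q; ring). nra.
        - unfold Rminus. rewrite exp_plus, exp_Ropp, (exp_Ropp (INR 2 * _)), exp_mul_ln_nat by lra.
          right. reflexivity. }
      unfold Rdiv in *. rewrite Rmult_assoc.
      apply Rmult_le_compat; try assumption; [apply Cmod_ge_0|left; apply exp_pos]. }
  eapply Rle_lt_trans; [apply (Int0_le _ _ Hdom)|].
  assert (E3 : exp (- q) < / q).
  { rewrite exp_Ropp. apply Rinv_lt_contravar.
    - apply Rmult_lt_0_compat; [lra|apply exp_pos].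
    - generalize (exp_ineq1 q ltac:(lra)). lra. }
  assert (Hq0 : 0 < q) by lra.
  apply Rle_lt_trans with ((Mh + 1) * / q).
  - assert (P := exp_pos (- q)). nra.
  - apply Rmult_lt_reg_r with q; [exact Hq0|]. rewrite Rmult_assoc, Rinv_l, Rmult_1_r by lra.
    assert ((Mh + 1) / eps * eps = Mh + 1) by (field; lra). nra.
Qed.

Lemma divn_bounded g n : bounded_on H g -> bounded_on H (divn g n).
Proof. intros Hg. induction n; simpl; [exact Hg|apply bounded_on_div; assumption]. Qed.

Lemma divn_hol g n : hol_on H g -> hol_on H (divn g n).
Proof. intros Hg. induction n; simpl; [exact Hg|apply hol_on_div; assumption]. Qed.

Lemma laplace_cont h p : ~ in_Rplus p -> bounded_on H h -> hol_on H h -> Ccont (laplace h) p.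
Proof.
  intros Hp Hb Hh.
  assert (Hc : forall z, H z -> Ccont h z) by (intros; apply (hol_on_Ccont H); assumption).
  destruct (Rlt_dec 0 (Im p)) as [H1|H1].
  { apply (@flim_ext_at (curve_laplace h (gamma (-1)) (gamma' (-1)))).
    - generalize (locally_Im_lt (-1) p (or_intror eq_refl) ltac:(lra)). apply filter_imp.
      intros u Hu. unfold laplace. destruct Rlt_dec; [reflexivity|lra].
    - apply (curve_laplace_cont H w0 _ _ _ (gamma_decay_curve (-1) (or_intror eq_refl))); auto.
      lra. }
  destruct (Rlt_dec (Im p) 0) as [H2|H2].
  { apply (@flim_ext_at (curve_laplace h (gamma 1) (gamma' 1))).
    - generalize (locally_Im_lt 1 p (or_introl eq_refl) ltac:(lra)). apply filter_imp.
      intros u Hu. unfold laplace. destruct Rlt_dec; [lra|]. destruct Rlt_dec; [reflexivity|lra].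
    - apply (curve_laplace_cont H w0 _ _ _ (gamma_decay_curve 1 (or_introl eq_refl))); auto.
      lra. }
  assert (Hre : Re p < 0).
  { apply Rnot_le_lt. intros Hle. apply Hp. split; [exact Hle|lra]. }
  apply (@flim_ext_at (curve_laplace h (hray) hray')).
  - generalize (locally_Re_lt p 0 Hre). apply filter_imp. intros u Hu. symmetry. apply laplace_horizontal; auto.
  - apply (curve_laplace_cont H w0 _ _ _ (ray_decay_curve)); auto.
Qed.

(** The primitive is selected by [epsilon]: exhibiting a transform shows that the selection meets
    its specification, and [decaying_constant_0] that it equals this transform off the half-line. *)
Lemma iter_primitive_laplace L0 g : bounded_on H g -> hol_on H g ->
  (forall p, ~ in_Rplus p -> L0 p = laplace g p) ->
  forall n p, ~ in_Rplus p -> iter_primitive n L0 p = laplace (divn g n) p.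
Proof.
  intros Hb Hh HL0 n. induction n as [|n IH]; intros p Hp; [apply HL0; exact Hp|].
  assert (Hbn := divn_bounded g n Hb). assert (Hhn := divn_hol g n Hh).
  set (h := iter_primitive n L0) in *.
  assert (E : is_primitive_minfty h (laplace (divn g (S n)))).
  { split.
    - intros q Hq. apply Cderiv_is_derive. rewrite IH by exact Hq.
      apply (laplace_derive); assumption.
    - apply (laplace_decay).
      + apply (divn_bounded g (S n)); exact Hb.
      + apply (divn_hol g (S n)); exact Hh. }
  change (iter_primitive (S n) L0) with (primitive_minfty h).
  assert (E' : is_primitive_minfty h (primitive_minfty h)).
  { unfold primitive_minfty. apply epsilon_spec. eexists. exact E. }
  destruct E as [E1 E2], E' as [E1' E2'].
  assert (Z := decaying_constant_0 (fun p => primitive_minfty h p - laplace (divn g (S n)) p)%C).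
  cbv beta in Z.
  replace (primitive_minfty h p) with
    ((primitive_minfty h p - laplace (divn g (S n)) p) + laplace (divn g (S n)) p)%C by ring.
  rewrite Z; [ring| | |exact Hp].
  - intros q Hq. apply (deriv_along_eq _ _ _ (h q - h q)%C); [|ring].
    apply deriv_along_minus; apply Cderiv_is_derive; [apply E1'|apply E1]; exact Hq.
  - intros eps He. destruct (E2 (eps / 2) ltac:(lra)) as [M1 HM1].
    destruct (E2' (eps / 2) ltac:(lra)) as [M2 HM2]. exists (Rmin M1 M2). intros q Hq.
    assert (Q1 := Rmin_l M1 M2). assert (Q2 := Rmin_r M1 M2).
    specialize (HM1 q ltac:(lra)). specialize (HM2 q ltac:(lra)).
    eapply Rle_lt_trans; [apply Cmod_triangle|]. rewrite Cmod_opp. lra.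
Qed.
(** * Cauchy's formula along the contour *)

Section Cauchy.
(** The modulus is at least [1] on [H] and at least the height [y], hence at least their mean. *)
Lemma gamma_lower s y : s = 1 \/ s = -1 -> 0 <= y -> (1 + y) / 2 <= Cmod (gamma s y).
Proof.
  intros Hs Hy. assert (K1 := in_H_Cmod _ (gamma_in s y Hs Hy)).
  assert (K2 := im_le_Cmod (gamma s y)). simpl in K2.
  rewrite Rabs_mult, (Rabs_pos_eq y) in K2 by exact Hy.
  assert (Rabs s = 1) by (destruct Hs as [-> | ->]; [apply Rabs_R1|apply Rabs_m1]).
  rewrite H0 in K2. lra.
Qed.

Context (w : C) (Hw : H w) (Hleft : Re w < gamma_re (Rabs (Im w)))
  (Hdist : forall s y, s = 1 \/ s = -1 -> 0 <= y -> 1 <= Cmod (gamma s y - w)).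

(** An auxiliary pole outside [H], at the height of [w]. It makes [/ (u - w) - / (u - c0)]
    integrable at infinity, and [Clog (c0 - u)] never meets its slit because [Re u < 0]. *)
Let c0 : C := (0, Im w).

Lemma c0_dist u : H u -> 1 <= Cmod (u - c0).
Proof.
  intros Hu. assert (K := ld_Re H HL u Hu). assert (K2 := re_le_Cmod (u - c0)%C).
  unfold c0 in K2. simpl in K2. rewrite Rabs_left1 in K2 by (unfold Re in K; lra).
  unfold Re in K. unfold c0. lra.
Qed.

Definition log_kernel (u : C) : C := (/ (u - w) - / (u - c0))%C.

Lemma log_kernel_dominated s : s = 1 \/ s = -1 ->
  exists M, dominated (fun y => log_kernel (gamma s y) * gamma' s y)%C M.
Proof.
  intros Hs. destruct (gamma_growth s Hs) as (W & HW & HWU).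
  assert (Pw := Cmod_ge_0 w). assert (Pc := Cmod_ge_0 c0).
  exists (Cmod (w - c0) * (2 * (1 + Cmod w)) * (2 * (1 + Cmod c0)) * W). split.
  - intros y Hy. assert (D := gamma_decay_curve s Hs).
    assert (HUc := dc_curve_cont _ _ _ _ _ D y Hy).
    specialize (Hdist s y Hs Hy).
    assert (Hc := c0_dist _ (gamma_in s y Hs Hy)).
    apply flim_mult; [apply _| |apply (dc_cont _ _ _ _ _ D); exact Hy].
    apply flim_minus; [apply _|..]; (apply flim_inv; [apply _|apply Cmod_pos_neq; lra|]);
    (apply flim_minus; [apply _|exact HUc|apply flim_const; apply _]).
  - intros y Hy. assert (D1 := Hdist s y Hs Hy).
    assert (D2 := c0_dist _ (gamma_in s y Hs Hy)).
    assert (LB := gamma_lower s y Hs Hy). destruct (HWU y Hy) as [HW' _].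
    set (u := gamma s y) in *.
    assert (N1 : (u - w)%C <> RtoC 0) by (apply Cmod_pos_neq; lra).
    assert (N2 : (u - c0)%C <> RtoC 0) by (apply Cmod_pos_neq; lra).
    replace (log_kernel u) with ((w - c0) * (/ (u - w) * / (u - c0)))%C by (unfold log_kernel; field; auto).
    rewrite !Cmod_mult, !Cmod_inv by assumption.
    assert (G : forall v, 1 <= Cmod (u - v) -> / Cmod (u - v) <= 2 * (1 + Cmod v) / (1 + y)).
    { intros v Hv. assert (Cmod u <= Cmod (u - v) + Cmod v).
      { replace u with ((u - v) + v)%C at 1 by ring. apply Cmod_triangle. }
      assert (Pv := Cmod_ge_0 v).
      apply Rmult_le_reg_l with (Cmod (u - v)); [lra|]. rewrite Rinv_r by lra.
      apply Rmult_le_reg_r with (1 + y); [lra|].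
      replace (Cmod (u - v) * (2 * (1 + Cmod v) / (1 + y)) * (1 + y))
        with (2 * (Cmod (u - v) * (1 + Cmod v))) by (field; lra). nra. }
    assert (G1 := G w D1). assert (G2 := G c0 D2).
    assert (I1 : 0 < / Cmod (u - w)) by (apply Rinv_0_lt_compat; lra).
    assert (I2 : 0 < / Cmod (u - c0)) by (apply Rinv_0_lt_compat; lra).
    apply Rle_trans with (Cmod (w - c0) * (2 * (1 + Cmod w) / (1 + y) * (2 * (1 + Cmod c0) / (1 + y))) * W).
    + apply Rmult_le_compat; [|apply Cmod_ge_0| |exact HW'].
      * apply Rmult_le_pos; [apply Cmod_ge_0|nra].
      * apply Rmult_le_compat_l; [apply Cmod_ge_0|]. apply Rmult_le_compat; lra.
    + right. field. lra.
Qed.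

(** The contour recedes only logarithmically, so seen from any fixed point it becomes vertical. *)
Lemma log_quotient_limit (a b : R) :
  is_lim (fun T => (gamma_re T - a) / T) p_infty 0 /\
  forall s, is_lim (fun T => (s * T - b) / T) p_infty s.
Proof.
  assert (Hinv : forall m, is_lim (fun T => m / T) p_infty 0).
  { intros m. replace (Finite 0) with (Rbar_mult m 0) by (simpl; f_equal; ring).
    apply is_lim_scal_l. replace (Finite 0) with (Rbar_inv p_infty) by reflexivity.
    apply is_lim_inv; [apply is_lim_id|discriminate]. }
  split.
  - apply (is_lim_le_le_loc (fun T => (w0 - B - a) / T - k * (ln (1 + T) / T))
      (fun T => (w0 - a) / T)).
    + exists 1. intros T HT. assert (G1 := gamma_re_le T ltac:(lra)).
      assert (G2 := gamma_re_ge T ltac:(lra)).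
      assert (P : 0 < / T) by (apply Rinv_0_lt_compat; lra). unfold Rdiv. split; nra.
    + replace (Finite 0) with (Rbar_minus 0 0) by (simpl; f_equal; ring).
      apply (is_lim_minus _ _ _ 0 0); [apply Hinv| |reflexivity].
      replace (Finite 0) with (Rbar_mult k 0) by (simpl; f_equal; ring).
      apply is_lim_scal_l.
      apply (is_lim_le_le_loc (fun _ => 0) (fun T => ln T / T + ln 2 / T)).
      * exists 1. intros T HT. assert (P : 0 < / T) by (apply Rinv_0_lt_compat; lra).
        assert (K := ln_1p_pos T ltac:(lra)).
        assert (K2 : ln (1 + T) <= ln T + ln 2).
        { rewrite <- ln_mult by lra. destruct (Req_dec (1 + T) (T * 2)) as [->|]; [lra|].
          left. apply ln_increasing; lra. }
        unfold Rdiv. split; nra.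
      * apply is_lim_const.
      * replace (Finite 0) with (Rbar_plus 0 0) by (simpl; f_equal; ring).
        apply (is_lim_plus _ _ _ 0 0); [apply is_lim_div_ln_p|apply Hinv|reflexivity].
    + apply Hinv.
  - intros s. apply (is_lim_ext_loc (fun T => s - b / T)).
    + exists 1. intros T HT. field. lra.
    + replace (Finite s) with (Rbar_minus s 0) by (simpl; f_equal; ring).
      apply (is_lim_minus _ _ _ s 0); [apply is_lim_const|apply Hinv|reflexivity].
Qed.

(** Along the half of sign [s], the directions of [u - w] and [c0 - u] tend to [s * i] and
    [- s * i]; their arguments differ in the limit by [s * PI], and the moduli cancel. *)
Lemma Clog_gamma_limit s : s = 1 \/ s = -1 ->
  flim (fun T => Clog (gamma s T - w)%C - Clog (c0 - gamma s T)%C)%C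
    (Rbar_locally p_infty) (0, s * PI).
Proof.
  intros Hs.
  destruct (log_quotient_limit (Re w) (Im w)) as [X1 Y1]. specialize (Y1 s).
  destruct (log_quotient_limit 0 (Im w)) as [X2 Y2]. specialize (Y2 s).
  assert (X2' : is_lim (fun T => (0 - gamma_re T) / T) p_infty 0).
  { replace (Finite 0) with (Rbar_opp 0) by (simpl; f_equal; ring).
    apply (is_lim_ext (fun T => - ((gamma_re T - 0) / T))); [intros T; unfold Rdiv; ring|].
    apply is_lim_opp. exact X2. }
  assert (Y2' : is_lim (fun T => (Im w - s * T) / T) p_infty (- s)).
  { replace (Finite (- s)) with (Rbar_opp s) by reflexivity.
    apply (is_lim_ext (fun T => - ((s * T - Im w) / T))); [intros T; unfold Rdiv; ring|].
    apply is_lim_opp. exact Y2. }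
  destruct (is_lim_atan_quotient _ _ s Hs X1 Y1) as [A1 B1].
  assert (Hs' : - s = 1 \/ - s = -1) by (destruct Hs as [-> | ->]; [right|left]; ring).
  destruct (is_lim_atan_quotient _ _ (- s) Hs' X2' Y2') as [A2 B2].
  assert (L1 := is_lim_flim_pair _ _ _ _ B1 A1). assert (L2 := is_lim_flim_pair _ _ _ _ B2 A2).
  assert (L := flim_minus _ _ _ _ _ L1 L2).
  apply (flim_eq _ _ ((0%R, (s * (PI / 2))%R) - (0%R, (- s * (PI / 2))%R))%C).
  2:{ apply injective_projections; simpl; field. }
  revert L. apply flim_ext_loc; [apply _|].
  exists (Rabs (Im w) + 1). intros T HT.
  assert (PT : 0 < T) by (generalize (Rabs_pos (Im w)); lra).
  assert (G1 := gamma_re_le T ltac:(lra)).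
  assert (Hws : w0 <= -1) by (exact (w0_le)).
  assert (HsT : s * T - Im w <> 0).
  { intros E. assert (Im w = s * T) by lra. rewrite H0, Rabs_mult, (Rabs_pos_eq T) in HT by lra.
    assert (Rabs s = 1) by (destruct Hs as [-> | ->]; [apply Rabs_R1|apply Rabs_m1]).
    rewrite H1 in HT. lra. }
  replace (gamma s T - w)%C with ((gamma_re T - Re w, s * T - Im w) : C).
  2:{ unfold gamma. apply injective_projections; simpl; reflexivity. }
  replace (c0 - gamma s T)%C with (0 - gamma_re T, Im w - s * T).
  2:{ unfold gamma, c0. apply injective_projections; simpl; reflexivity. }
  rewrite (Clog_scale (gamma_re T - Re w) (s * T - Im w) T PT) by (intros E; contradiction).
  rewrite (Clog_scale (0 - gamma_re T) (Im w - s * T) T PT) by (intros _; lra).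
  unfold Clog. cbn [Re Im fst snd]. ring.
Qed.

Lemma log_kernel_integral s : s = 1 \/ s = -1 ->
  Int0 (fun y => log_kernel (gamma s y) * gamma' s y)%C =
  ((0%R, (s * PI)%R) - (Clog (RtoC w0 - w) - Clog (c0 - RtoC w0)))%C.
Proof.
  intros Hs. apply is_Int0_Int0.
  assert (D := gamma_decay_curve s Hs).
  destruct (log_kernel_dominated s Hs) as [M HM].
  assert (K := flim_minus _ _ _ _ _ (Clog_gamma_limit s Hs)
    (flim_const (Rbar_locally p_infty) (Clog (RtoC w0 - w) - Clog (c0 - RtoC w0))%C)).
  revert K. apply flim_ext_loc; [apply _|]. exists 0. intros T HT. symmetry. apply is_CI_CI.
  assert (U0 : gamma s 0 = RtoC w0) by apply (dc_start _ _ _ _ _ D).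
  rewrite <- U0.
  apply (CI_FTC (fun y => Clog (gamma s y - w)%C - Clog (c0 - gamma s y)%C)%C);
    rewrite Rmin_left, Rmax_right by lra; intros y Hy; [|apply HM; lra].
  assert (Hws : w0 <= -1) by (exact (w0_le)).
  assert (Gx : is_derive (gamma_re) y (- B / (1 + y) ^ 2 - k / (1 + y))).
  { apply (Rderiv_fst (gamma s) y _ (gamma_deriv s y ltac:(lra))). }
  assert (G1 := gamma_re_le y ltac:(lra)).
  assert (D1 := Hdist s y Hs ltac:(lra)).
  assert (D2 := c0_dist _ (gamma_in s y Hs ltac:(lra))).
  assert (N1 := Cmod_pos_neq _ _ (Rlt_le_trans _ _ _ Rlt_0_1 D1)).
  assert (N2 := Cmod_pos_neq _ _ (Rlt_le_trans _ _ _ Rlt_0_1 D2)).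
  assert (R1 : Rderiv (fun y => Clog (gamma_re y - Re w, s * y - Im w)) y
    (gamma' s y / (gamma s y - w))%C).
  { replace (gamma s y - w)%C with (gamma_re y - Re w, s * y - Im w)
      by (unfold gamma; apply injective_projections; simpl; reflexivity).
    apply (Rderiv_Clog (fun y => gamma_re y - Re w) (fun y => s * y - Im w)).
    - replace (- B / (1 + y) ^ 2 - k / (1 + y)) with (minus (- B / (1 + y) ^ 2 - k / (1 + y)) 0)
        by (unfold minus, plus, opp; simpl; ring).
      apply (is_derive_minus (K := R_AbsRing) (V := R_NormedModule)); [exact Gx|].
      apply (is_derive_const (K := R_AbsRing) (V := R_NormedModule)).
    - auto_derive; trivial. ring.
    (* The contour crosses the height of [w] only to the right of [w], so [u - w] avoids the
       slit. *)
    - intros E. assert (E2 : Rabs (Im w) = y).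
      { replace (Im w) with (s * y) by lra. rewrite Rabs_mult, (Rabs_pos_eq y) by lra.
        destruct Hs as [-> | ->]; rewrite ?Rabs_R1, ?Rabs_m1; ring. }
      rewrite E2 in Hleft. lra. }
  assert (R2 : Rderiv (fun y => Clog (0 - gamma_re y, Im w - s * y)) y
    (- gamma' s y / (c0 - gamma s y))%C).
  { replace (c0 - gamma s y)%C with (0 - gamma_re y, Im w - s * y)
      by (unfold gamma, c0; apply injective_projections; simpl; reflexivity).
    change (- gamma' s y)%C with ((- (- B / (1 + y) ^ 2 - k / (1 + y)), - s) : C).
    apply (Rderiv_Clog (fun y => 0 - gamma_re y) (fun y => Im w - s * y)).
    - replace (- (- B / (1 + y) ^ 2 - k / (1 + y))) with (minus 0 (- B / (1 + y) ^ 2 - k / (1 + y)))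
        by (unfold minus, plus, opp; simpl; ring).
      apply (is_derive_minus (K := R_AbsRing) (V := R_NormedModule)); [|exact Gx].
      apply (is_derive_const (K := R_AbsRing) (V := R_NormedModule)).
    - auto_derive; trivial. ring.
    - intros _. lra. }
  apply (deriv_along_eq _ _ _ (gamma' s y / (gamma s y - w) - - gamma' s y / (c0 - gamma s y))%C).
  - apply deriv_along_minus; assumption.
  - unfold log_kernel. field. split; [|split]; auto.
    intros E. apply N2. replace (gamma s y - c0)%C with (- (c0 - gamma s y))%C by ring.
    rewrite E. ring.
Qed.

Context (f : C -> C) (Cf : R) (Hf : hol_on H f) (HCf : 0 <= Cf)
  (Hfb : forall u, H u -> Cmod (f u) <= Cf / Cmod u ^ 2).

Definition cauchy_kernel (s y : R) : C :=
  (f (gamma s y) / (gamma s y - w) * gamma' s y)%C.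

Lemma cauchy_dominated s : s = 1 \/ s = -1 -> exists M, dominated (cauchy_kernel s) M.
Proof.
  intros Hs. destruct (gamma_growth s Hs) as (W & HW & HWU).
  assert (D := gamma_decay_curve s Hs).
  exists (Cf * 4 * W). split.
  - intros y Hy. assert (HUc := dc_curve_cont _ _ _ _ _ D y Hy). specialize (Hdist s y Hs Hy).
    apply flim_mult; [apply _| |apply (dc_cont _ _ _ _ _ D); exact Hy].
    apply flim_mult; [apply _| |].
    + apply (Rcont_comp f); [|exact HUc]. apply (hol_on_Ccont H); [exact Hf|].
      apply gamma_in; assumption.
    + apply flim_inv; [apply _|apply Cmod_pos_neq; lra|].
      apply flim_minus; [apply _|exact HUc|apply flim_const; apply _].
  - intros y Hy. assert (D1 := Hdist s y Hs Hy). destruct (HWU y Hy) as [HW' _].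
    assert (LB := gamma_lower s y Hs Hy).
    assert (F1 := Hfb _ (gamma_in s y Hs Hy)). unfold cauchy_kernel.
    set (u := gamma s y) in *.
    unfold Cdiv. rewrite !Cmod_mult, Cmod_inv by (apply Cmod_pos_neq; lra).
    assert (I1 : 0 < / Cmod (u - w) <= 1).
    { split; [apply Rinv_0_lt_compat; lra|]. rewrite <- Rinv_1. apply Rinv_le_contravar; lra. }
    assert (F2 : Cmod (f u) <= Cf * 4 / (1 + y) ^ 2).
    { eapply Rle_trans; [exact F1|]. unfold Rdiv. rewrite Rmult_assoc. apply Rmult_le_compat_l; [exact HCf|].
      replace (4 * / (1 + y) ^ 2) with (/ ((1 + y) / 2) ^ 2) by (field; lra).
      apply Rinv_le_contravar; [apply pow_lt; lra|]. apply pow_incr. lra. }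
    replace (Cf * 4 * W / (1 + y) ^ 2) with (Cf * 4 / (1 + y) ^ 2 * 1 * W) by (field; lra).
    apply Rmult_le_compat; [|apply Cmod_ge_0| |exact HW'].
    + apply Rmult_le_pos; [apply Cmod_ge_0|lra].
    + apply Rmult_le_compat; try lra. apply Cmod_ge_0.
Qed.

(* The function [f u - f w (w - c0) / (u - c0)] vanishes at [w] and decays at infinity; its
   quotient by [u - w] has a primitive on [H], and the contour closes up to the left. *)
Lemma cauchy_gamma :
  (Int0 (cauchy_kernel 1) - Int0 (cauchy_kernel (-1)))%C = (2 * Ci * RtoC PI * f w)%C.
Proof.
  assert (H1 : 1 = 1 \/ 1 = -1) by auto. assert (H2 : -1 = 1 \/ -1 = -1) by auto.
  pose (m := fun u => (f u - f w * (w - c0) * / (u - c0))%C).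
  assert (Nc : forall u, H u -> (u - c0)%C <> RtoC 0).
  { intros u Hu. apply Cmod_pos_neq. generalize (c0_dist u Hu). lra. }
  assert (Hm : hol_on H m).
  { intros u Hu. destruct (Hf u Hu) as [l Hl].
    eexists. apply deriv_along_minus; [exact Hl|]. apply (deriv_along_scal (fun u : C => u) u (Ccont_id u)).
    apply (Cderiv_comp (fun z => / z)%C (fun u => u - c0)%C); [apply Cderiv_inv, Nc; exact Hu|].
    apply deriv_along_minus; [apply deriv_along_id|apply deriv_along_const]. }
  assert (Hmw : m w = RtoC 0) by (unfold m; field; apply Nc; exact Hw).
  (* The Caratheodory slope of [m] at [w] is the quotient [m u / (u - w)], already completed at [w]
     by continuity; [w] is then the exceptional point allowed by [primitive_exists]. *)
  destruct (Hm w Hw) as [l Hl]. destruct Hl as (q & Hq & Hql).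
  assert (Hqw := flim_self _ _ _ Hql).
  assert (Hquot : forall u, u <> w -> q u = (m u * / (u - w))%C).
  { intros u Hu. assert (N : (u - w)%C <> RtoC 0).
    { intros E. apply Hu. replace u with ((u - w) + w)%C by ring. rewrite E. ring. }
    specialize (Hq u). rewrite Hmw in Hq.
    replace (m u) with (m u - 0)%C by ring. rewrite Hq. field. exact N. }
  assert (Hqd : forall u, H u -> u <> w -> exists l, Cderiv q u l).
  { intros u Hu Huw. assert (N : (u - w)%C <> RtoC 0).
    { intros E. apply Huw. replace u with ((u - w) + w)%C by ring. rewrite E. ring. }
    destruct (Hm u Hu) as [l' Hl']. eexists.
    apply (deriv_along_ext_loc (fun u : C => u) u (fun u => m u * / (u - w))%C).
    - auto.
    - apply locally_C_iff. exists (Cmod (u - w)). split; [apply Cmod_gt_0; exact N|].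
      intros v Hv. symmetry. apply Hquot. intros ->.
      replace (w - u)%C with (- (u - w))%C in Hv by ring. rewrite Cmod_opp in Hv. lra.
    - apply (deriv_along_mult (fun u : C => u) u (Ccont_id u)); [exact Hl'|].
      apply (Cderiv_comp (fun z => / z)%C (fun u => u - w)%C); [apply Cderiv_inv; exact N|].
      apply deriv_along_minus; [apply deriv_along_id|apply deriv_along_const]. }
  assert (Hqc : forall u, H u -> Ccont q u).
  { intros u Hu. destruct (classic (u = w)) as [->|Hne].
    - unfold Ccont. rewrite Hqw. exact Hql.
    - destruct (Hqd u Hu Hne) as [l' Hl']. apply (Ccont_of_Cd _ _ _ Hl'). }
  destruct (primitive_exists H q w w0 (left_domain_comb H HL) Hw0 Hqc Hqd) as (Q & HQ0 & HQ).
  (* By partial fractions [q] is the Cauchy integrand minus [f w] times [log_kernel]. *)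
  assert (Hint : forall s, s = 1 \/ s = -1 ->
    flim (fun T => Q (gamma s T)) (Rbar_locally p_infty)
      (Int0 (cauchy_kernel s) - f w * Int0 (fun y => log_kernel (gamma s y) * gamma' s y))%C).
  { intros s Hs. assert (D := gamma_decay_curve s Hs).
    destruct (cauchy_dominated s Hs) as [M1 HM1]. destruct (log_kernel_dominated s Hs) as [M2 HM2].
    assert (K := flim_minus _ _ _ _ _ (dominated_is_Int0 _ _ HM1)
      (flim_mult _ _ _ _ _ (flim_const (Rbar_locally p_infty) (f w)) (dominated_is_Int0 _ _ HM2))).
    revert K. apply flim_ext_loc; [apply _|]. exists 0. intros T HT.
    assert (J1 := dominated_CI _ _ 0 T HM1 (Rle_refl 0) ltac:(lra)).
    assert (J2 := is_CI_scal (f w) _ _ _ _ (dominated_CI _ _ 0 T HM2 (Rle_refl 0) ltac:(lra))).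
    assert (J := is_CI_minus _ _ _ _ _ _ J1 J2).
    apply (is_CI_unique _ _ _ _ _ J).
    replace (Q (gamma s T)) with (Q (gamma s T) - Q (gamma s 0))%C.
    2:{ rewrite (dc_start _ _ _ _ _ D), HQ0. ring. }
    apply (is_CI_ext (fun y => q (gamma s y) * gamma' s y)%C).
    - intros y Hy. rewrite Rmin_left, Rmax_right in Hy by lra.
      assert (D1 := Hdist s y Hs ltac:(lra)).
      assert (N1 := Cmod_pos_neq _ _ (Rlt_le_trans _ _ _ Rlt_0_1 D1)).
      assert (N2 := Nc _ (gamma_in s y Hs ltac:(lra))).
      rewrite Hquot.
      + unfold m, cauchy_kernel, log_kernel. field. auto.
      + intros E. apply N1. rewrite E. ring.
    - apply (CI_FTC (fun y => Q (gamma s y))); rewrite Rmin_left, Rmax_right by lra; intros y Hy.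
      + apply (Rderiv_comp Q); [apply HQ, (dc_in _ _ _ _ _ D); lra|apply (dc_deriv _ _ _ _ _ D); lra].
      + apply flim_mult; [apply _| |apply (dc_cont _ _ _ _ _ D); lra].
        apply (Rcont_comp q); [apply Hqc, (dc_in _ _ _ _ _ D); lra|apply (dc_curve_cont _ _ _ _ _ D); lra]. }
  pose (Cq := 2 * (Cf + 2 * (Cmod (f w) * Cmod (w - c0)))).
  assert (Pw := Cmod_ge_0 w).
  assert (Cq0 : 0 <= Cq).
  { unfold Cq. generalize (Rmult_le_pos _ _ (Cmod_ge_0 (f w)) (Cmod_ge_0 (w - c0))). lra. }
  assert (Hqb : forall u T, H u -> 2 * Cmod w + 2 <= T -> T <= Cmod u -> Cmod (q u) <= Cq / T ^ 2).
  { intros u T Hu HT HTu.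
    assert (HUT : Cmod u * Cmod u >= T ^ 2) by (simpl; nra).
    assert (Hc0 : Cmod c0 <= Cmod w).
    { unfold c0. change (0, Im w) with ((0, Im w) : C).
      replace ((0, Im w) : C) with (RtoC (Im w) * Ci)%C by (apply injective_projections; simpl; ring).
      rewrite Cmod_mult, Cmod_R, Cmod_Ci, Rmult_1_r. apply im_le_Cmod. }
    (* Once [Cmod u] exceeds twice [Cmod w], its distances to both poles are at least half of
       [Cmod u]; this makes [q] of order [Cmod u ^ (-2)]. *)
    assert (B1 : forall v, Cmod v <= Cmod w -> Cmod u / 2 <= Cmod (u - v)).
    { intros v Hv. assert (Cmod u <= Cmod (u - v) + Cmod v); [|lra].
      replace u with ((u - v) + v)%C at 1 by ring. apply Cmod_triangle. }
    assert (Bw := B1 w (Rle_refl _)). assert (Bc := B1 c0 Hc0).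
    assert (N1 : (u - w)%C <> RtoC 0) by (apply Cmod_pos_neq; lra).
    rewrite Hquot by (intros ->; apply N1; ring).
    rewrite Cmod_mult, Cmod_inv by exact N1.
    assert (M1 : Cmod (m u) <= (Cf + 2 * (Cmod (f w) * Cmod (w - c0))) / Cmod u).
    { unfold m, Cminus at 1. eapply Rle_trans; [apply Cmod_triangle|].
      rewrite Cmod_opp, !Cmod_mult, Cmod_inv by (apply Nc; exact Hu).
      assert (K1 : Cmod (f u) <= Cf / Cmod u).
      { eapply Rle_trans; [apply Hfb; exact Hu|]. unfold Rdiv. apply Rmult_le_compat_l; [exact HCf|].
        apply Rinv_le_contravar; [lra|]. simpl. nra. }
      assert (K2 : / Cmod (u - c0) <= 2 / Cmod u).
      { replace (2 / Cmod u) with (/ (Cmod u / 2)) by (field; lra). apply Rinv_le_contravar; lra. }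
      assert (K3 : Cmod (f w) * Cmod (w - c0) * / Cmod (u - c0)
        <= Cmod (f w) * Cmod (w - c0) * (2 / Cmod u)).
      { apply Rmult_le_compat_l; [|exact K2].
        apply Rmult_le_pos; apply Cmod_ge_0. }
      unfold Rdiv in *. lra. }
    assert (M2 : / Cmod (u - w) <= 2 / Cmod u).
    { replace (2 / Cmod u) with (/ (Cmod u / 2)) by (field; lra). apply Rinv_le_contravar; lra. }
    apply Rle_trans with ((Cf + 2 * (Cmod (f w) * Cmod (w - c0))) / Cmod u * (2 / Cmod u)).
    - apply Rmult_le_compat; try assumption; [apply Cmod_ge_0|left; apply Rinv_0_lt_compat; lra].
    - replace ((Cf + 2 * (Cmod (f w) * Cmod (w - c0))) / Cmod u * (2 / Cmod u))
        with (Cq * / (Cmod u * Cmod u)) by (unfold Cq; field; lra).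
      unfold Rdiv. apply Rmult_le_compat_l; [exact Cq0|]. apply Rinv_le_contravar; [apply pow_lt; lra|lra]. }
  assert (Hclose : flim (fun T => Q (gamma 1 T) - Q (gamma (-1) T))%C
    (Rbar_locally p_infty) (RtoC 0)).
  { apply (flim_squeeze _ _ _ (fun T => 8 * Cq / (1 + T))); [apply pinfty_inv_lt|].
    exists (2 * Cmod w + 2). intros T HT.
    replace (Q (gamma 1 T) - Q (gamma (-1) T) - 0)%C
      with (Q (gamma 1 T) - Q (gamma (-1) T))%C by ring.
    pose (x := gamma_re T).
    assert (Hx : x <= -1).
    { generalize (gamma_re_le T ltac:(lra)) (w0_le). unfold x. lra. }
    assert (Hin : forall x' y', x' <= x -> Rabs y' <= T -> H (x', y')).
    { intros x' y' Hx' Hy'. apply (ld_left H HL x T); [apply HG; lra|exact Hx'|].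
      rewrite (Rabs_pos_eq T) by lra. exact Hy'. }
    assert (S1 : forall x' y' : R, x' <= x -> Rabs y' <= T -> T <= Cmod (x', y') ->
      Cderiv Q (x', y') (q (x', y')) /\ Ccont q (x', y') /\ Cmod (q (x', y')) <= Cq / T ^ 2).
    { intros x' y' A1 A2 A3. assert (A4 := Hin x' y' A1 A2).
      split; [apply HQ; exact A4|]. split; [apply Hqc; exact A4|]. apply Hqb; auto. lra. }
    assert (Pi : forall x' y' : R, Rabs y' <= Cmod (x', y')) by (intros; apply (im_le_Cmod (x', y'))).
    assert (Pr : forall x' y' : R, Rabs x' <= Cmod (x', y')) by (intros; apply (re_le_Cmod (x', y'))).
    (* The two ends are joined by three sides of a rectangle of total length [4 * T]. The leftward
       step [T] keeps the modulus at least [T] on the vertical side, where the height may vanish. *)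
    pose (z1 := (x, T) : C). pose (z2 := (x - T, T) : C).
    pose (z3 := (x - T, - T) : C). pose (z4 := (x, - T) : C).
    assert (E1 : gamma 1 T = z1) by (unfold gamma, z1, x; f_equal; ring).
    assert (E4 : gamma (-1) T = z4) by (unfold gamma, z4, x; f_equal; ring).
    assert (L1 : Cmod (Q z1 - Q z2) <= Cmod (z1 - z2) * (Cq / T ^ 2)).
    { apply (Cmod_segment_bound Q q). intros s Hs.
      replace (Csegment z2 z1 s) with ((x - T + s * T, T) : C).
      2:{ unfold Csegment, z1, z2. apply injective_projections; simpl; ring. }
      apply S1; [nra|rewrite Rabs_pos_eq; lra|].
      eapply Rle_trans; [|apply Pi]. rewrite Rabs_pos_eq; lra. }
    assert (L2 : Cmod (Q z2 - Q z3) <= Cmod (z2 - z3) * (Cq / T ^ 2)).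
    { apply (Cmod_segment_bound Q q). intros s Hs.
      replace (Csegment z3 z2 s) with ((x - T, - T + s * (2 * T)) : C).
      2:{ unfold Csegment, z3, z2. apply injective_projections; simpl; ring. }
      apply S1; [lra|apply Rabs_le; nra|].
      eapply Rle_trans; [|apply Pr]. rewrite Rabs_left1; lra. }
    assert (L3 : Cmod (Q z3 - Q z4) <= Cmod (z3 - z4) * (Cq / T ^ 2)).
    { apply (Cmod_segment_bound Q q). intros s Hs.
      replace (Csegment z4 z3 s) with ((x - s * T, - T) : C).
      2:{ unfold Csegment, z3, z4. apply injective_projections; simpl; ring. }
      apply S1; [nra|rewrite Rabs_Ropp, Rabs_pos_eq; lra|].
      eapply Rle_trans; [|apply Pi]. rewrite Rabs_Ropp, Rabs_pos_eq; lra. }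
    assert (D1 : Cmod (z1 - z2) <= T).
    { eapply Rle_trans; [apply Cmod_le_abs|]. unfold z1, z2. simpl.
      replace (x + - (x - T)) with T by ring. replace (T + - T) with 0 by ring.
      rewrite Rabs_R0, Rabs_pos_eq; lra. }
    assert (D2 : Cmod (z2 - z3) <= 2 * T).
    { eapply Rle_trans; [apply Cmod_le_abs|]. unfold z2, z3. simpl.
      replace (x - T + - (x - T)) with 0 by ring. replace (T + - - T) with (2 * T) by ring.
      rewrite Rabs_R0, Rabs_pos_eq; lra. }
    assert (D3 : Cmod (z3 - z4) <= T).
    { eapply Rle_trans; [apply Cmod_le_abs|]. unfold z3, z4. simpl.
      replace (x - T + - x) with (- T) by ring. replace (- T + - - T) with 0 by ring.
      rewrite Rabs_R0, Rabs_Ropp, Rabs_pos_eq; lra. }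
    rewrite E1, E4.
    replace (Q z1 - Q z4)%C with ((Q z1 - Q z2) + (Q z2 - Q z3) + (Q z3 - Q z4))%C by ring.
    eapply Rle_trans; [apply Cmod_triangle|].
    eapply Rle_trans; [apply Rplus_le_compat_r; apply Cmod_triangle|].
    assert (PM : 0 <= Cq / T ^ 2) by (apply Rdiv_le_0_compat; [exact Cq0|apply pow_lt; lra]).
    apply Rle_trans with (4 * T * (Cq / T ^ 2)); [nra|].
    replace (4 * T * (Cq / T ^ 2)) with (4 * Cq * / T) by (field; lra).
    replace (8 * Cq / (1 + T)) with (4 * Cq * (2 / (1 + T))) by (field; lra).
    apply Rmult_le_compat_l; [lra|].
    replace (2 / (1 + T)) with (/ ((1 + T) / 2)) by (field; lra). apply Rinv_le_contravar; lra. }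
  assert (K := flim_minus _ _ _ _ _ (Hint 1 H1) (Hint (-1) H2)).
  assert (E := flim_unique (Rbar_locally p_infty) _ _ _ K Hclose).
  rewrite !log_kernel_integral in E by auto.
  set (A := Int0 (cauchy_kernel 1)) in *. set (A' := Int0 (cauchy_kernel (-1))) in *.
  (* The contribution of the starting point is common to both halves and cancels; the arguments at
     infinity leave [2 * i * PI]. *)
  set (Z := (Clog (RtoC w0 - w) - Clog (c0 - RtoC w0))%C) in *.
  replace (A - A')%C with
    ((A - f w * ((0%R, (1 * PI)%R) - Z) - (A' - f w * ((0%R, (-1 * PI)%R) - Z)))
      + f w * ((0%R, (1 * PI)%R) - (0%R, (-1 * PI)%R)))%C by ring.
  rewrite E.
  replace ((0%R, (1 * PI)%R) - (0%R, (-1 * PI)%R))%C with (2 * Ci * RtoC PI)%C.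
  - ring.
  - apply injective_projections; simpl; ring.
Qed.
End Cauchy.

(** * Partial sums *)

Section Remainder.
Context (g : C -> C) (Mg : R) (HMg : 0 <= Mg) (Hgb : forall u, H u -> Cmod (g u) <= Mg)
  (Hg : hol_on H g).
Context (W : R) (HW : 0 <= W) (HWU : forall s y, s = 1 \/ s = -1 -> 0 <= y ->
  Cmod (gamma' s y) <= W /\ Cmod (gamma s y) <= W * (1 + y)).
Context (n : nat) (w : C) (Hw : H w) (Hleft : Re w < gamma_re (Rabs (Im w)))
  (Hdist : forall s y, s = 1 \/ s = -1 -> 0 <= y -> 1 <= Cmod (gamma s y - w)).

Notation U s := (gamma s).
Notation U' s := (gamma' s).
Notation N := (n + 3)%nat.

(** Division by [w - u] integrates [exp (p (w - u))] with respect to [p]. *)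
Definition tail_weight (s y : R) : C := (divn g N (U s y) / (w - U s y) * U' s y)%C.

Lemma divn_value u j : u <> RtoC 0 -> ((- u) ^ j * divn g j u)%C = g u.
Proof.
  intros Hu. induction j as [|j IH]; simpl; [ring|]. rewrite <- IH.
  assert (Hn : (- u)%C <> RtoC 0).
  { intros E. apply Hu. replace u with (- - u)%C by ring. rewrite E. ring. }
  field. exact Hu.
Qed.

Lemma divn_Cmod u j : H u -> Cmod (divn g j u) <= Mg / Cmod u ^ j.
Proof.
  intros Hu. assert (H1 := in_H_Cmod u Hu).
  assert (E := divn_value u j (in_H_neq0 u Hu)).
  assert (Hp : 0 < Cmod u ^ j) by (apply pow_lt; lra).
  apply Rmult_le_reg_l with (Cmod u ^ j); [exact Hp|].
  replace (Cmod u ^ j * (Mg / Cmod u ^ j)) with Mg by (field; lra).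
  rewrite <- (Cmod_opp u) at 1. rewrite <- Cmod_pow, <- Cmod_mult, E. apply Hgb; exact Hu.
Qed.

Lemma w_U_neq s y : s = 1 \/ s = -1 -> 0 <= y -> (w - U s y)%C <> RtoC 0.
Proof.
  intros Hs Hy E. specialize (Hdist s y Hs Hy).
  replace (gamma s y - w)%C with (- (w - U s y))%C in Hdist by ring.
  rewrite E, Cmod_opp, Cmod_0 in Hdist. lra.
Qed.

Lemma tail_weight_bound s y : s = 1 \/ s = -1 -> 0 <= y ->
  Cmod (tail_weight s y) <= Mg * 2 ^ N * W / (1 + y) ^ N.
Proof.
  intros Hs Hy. unfold tail_weight, Cdiv. assert (Hin := gamma_in s y Hs Hy).
  assert (LB := gamma_lower s y Hs Hy).
  assert (D1 := Hdist s y Hs Hy). destruct (HWU s y Hs Hy) as [HW' _].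
  assert (F := divn_Cmod _ N Hin).
  rewrite !Cmod_mult, Cmod_inv by (apply w_U_neq; assumption).
  assert (I1 : 0 < / Cmod (w - U s y) <= 1).
  { replace (w - U s y)%C with (- (U s y - w))%C by ring. rewrite Cmod_opp.
    split; [apply Rinv_0_lt_compat; lra|]. rewrite <- Rinv_1. apply Rinv_le_contravar; lra. }
  assert (Hp : 0 < (1 + y) ^ N) by (apply pow_lt; lra).
  assert (F2 : Cmod (divn g N (U s y)) <= Mg * 2 ^ N / (1 + y) ^ N).
  { eapply Rle_trans; [exact F|]. unfold Rdiv. rewrite Rmult_assoc. apply Rmult_le_compat_l; [exact HMg|].
    replace (2 ^ N * / (1 + y) ^ N) with (/ ((1 + y) / 2) ^ N).
    - apply Rinv_le_contravar; [apply pow_lt; lra|]. apply pow_incr. lra.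
    - unfold Rdiv. rewrite Rpow_mult_distr, pow_inv. field. split; apply Rgt_not_eq; [lra|apply pow_lt; lra]. }
  replace (Mg * 2 ^ N * W / (1 + y) ^ N) with (Mg * 2 ^ N / (1 + y) ^ N * 1 * W) by (field; lra).
  apply Rmult_le_compat; [|apply Cmod_ge_0| |exact HW'].
  - apply Rmult_le_pos; [apply Cmod_ge_0|lra].
  - apply Rmult_le_compat; try lra. apply Cmod_ge_0.
Qed.

Lemma tail_weight_cont s y : s = 1 \/ s = -1 -> 0 <= y -> Rcont (tail_weight s) y.
Proof.
  intros Hs Hy. assert (D := gamma_decay_curve s Hs).
  assert (HUc := dc_curve_cont _ _ _ _ _ D y Hy).
  apply flim_mult; [apply _| |apply (dc_cont _ _ _ _ _ D); exact Hy].
  apply flim_mult; [apply _| |].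
  - apply (Rcont_comp (divn g N)); [|exact HUc].
    apply (hol_on_Ccont H); [apply divn_hol; assumption|apply (gamma_in); assumption].
  - apply flim_inv; [apply _|apply w_U_neq; assumption|].
    apply flim_minus; [apply _|apply flim_const; apply _|exact HUc].
Qed.

Lemma U_cont s y : s = 1 \/ s = -1 -> 0 <= y -> Rcont (U s) y.
Proof. intros Hs Hy. apply (dc_curve_cont _ _ _ _ _ (gamma_decay_curve s Hs) y Hy). Qed.

(* A primitive of [exp (p w)] times the [N]-th iterated primitive of the transform. *)
Definition parts_tail (s : R) (p : C) : C := (weighted_laplace (tail_weight s) (U s) p * Cexp (p * w))%C.

Lemma laplace_side s p h : s = 1 \/ s = -1 -> s * Im p < 0 -> laplace h p = curve_laplace h (U s) (U' s) p.
Proof.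
  intros [-> | ->] Hp; unfold laplace; destruct Rlt_dec; try lra; try reflexivity.
  destruct Rlt_dec; [reflexivity|lra].
Qed.

(** The factor [- u] from the kernel and the factor [w] from [Cexp (p * w)] add up to [w - u], which
    cancels the denominator of [tail_weight]. *)
Lemma parts_tail_derive s p : s = 1 \/ s = -1 -> s * Im p < 0 ->
  Cderiv (parts_tail s) p (laplace (divn g N) p * Cexp (p * w))%C.
Proof.
  intros Hs Hp. assert (D := gamma_decay_curve s Hs).
  destruct (dc_weight_ok H w0 _ _ _ D (tail_weight s) (Mg * 2 ^ N * W) p) as (r & M & Hr & Hok).
  { apply Rmult_le_pos; [apply Rmult_le_pos; [exact HMg|apply pow_le; lra]|exact HW]. }
  { intros y Hy. eapply Rle_trans; [apply tail_weight_bound; assumption|].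
    assert (K : 1 <= (1 + y) ^ N) by (apply pow_R1_Rle; lra).
    assert (P : 0 <= Mg * 2 ^ N * W).
    { apply Rmult_le_pos; [apply Rmult_le_pos; [exact HMg|apply pow_le; lra]|exact HW]. }
    rewrite <- (Rdiv_1_r (Mg * 2 ^ N * W)) at 2. unfold Rdiv. apply Rmult_le_compat_l; [exact P|].
    apply Rinv_le_contravar; lra. }
  { exact Hp. }
  assert (Hwc := fun y Hy => tail_weight_cont s y Hs Hy). assert (HUc := fun y Hy => U_cont s y Hs Hy).
  assert (Hokp := Hok p ltac:(replace (p - p)%C with (RtoC 0) by ring; rewrite Cmod_0; exact Hr)).
  assert (DL := weighted_laplace_derive (tail_weight s) (U s) Hwc HUc M r p Hr Hok).
  assert (D1 := weight_dominated (tail_weight s) (U s) Hwc HUc 2 M p Hokp).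
  assert (D2 := weight_dominated_U (tail_weight s) (U s) Hwc HUc M p (weight_ok_le _ _ 1 2 M p ltac:(lia) Hokp)).
  apply (deriv_along_eq _ _ _ (weighted_laplace (fun y => - U s y * tail_weight s y)%C (U s) p * Cexp (p * w)
    + weighted_laplace (tail_weight s) (U s) p * (Cexp (p * w) * w))%C).
  - apply (deriv_along_mult (fun u : C => u) p (Ccont_id p)); [exact DL|apply Cderiv_exp_mult].
  - rewrite (laplace_side s p) by assumption.
    replace (curve_laplace (divn g N) (U s) (U' s) p)
      with (weighted_laplace (fun y => - U s y * tail_weight s y)%C (U s) p + w * weighted_laplace (tail_weight s) (U s) p)%C; [ring|].
    unfold curve_laplace, weighted_laplace. rewrite <- (Int0_scal w _ _ D1).
    rewrite <- (Int0_plus _ _ _ _ D2 (dominated_scal w _ _ D1)).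
    apply Int0_ext. intros y Hy. unfold tail_weight. field. apply w_U_neq; assumption.
Qed.

Definition tail_bound : R := Mg * 2 ^ N * W * exp (INR n / k * (B - w0)) * (1 + W).

(** The count of powers that fixes [N]: the weight brings [(1 + y) ^ (- (n + 3))], the kernel at
    most [(1 + y) ^ n] when [Re p <= n / k], the spare factor of order one another [1 + y]; the
    required [(1 + y) ^ (-2)] remains. The closed half-plane is included. *)
Lemma tail_weight_ok s p : s = 1 \/ s = -1 -> s * Im p <= 0 -> Re p <= INR n / k ->
  weight_ok (tail_weight s) (U s) 1 tail_bound p.
Proof.
  intros Hs Hp Hre y Hy. assert (F := tail_weight_bound s y Hs Hy). destruct (HWU s y Hs Hy) as [_ HUb].
  assert (Hws : w0 <= -1) by (exact (w0_le)).
  assert (G1 := gamma_re_le y Hy). assert (G2 := gamma_re_ge y Hy).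
  assert (Hnk : 0 <= INR n / k) by (apply Rdiv_le_0_compat; [apply pos_INR|exact Hk]).
  assert (E : exp (- Re (p * U s y)) <= exp (INR n / k * (B - w0)) * (1 + y) ^ n).
  { rewrite <- (exp_mul_ln_nat n (1 + y)) by lra. rewrite <- exp_plus. apply exp_le.
    rewrite Re_mult. cbn [Re Im fst snd gamma].
    assert (K1 : - (Re p * gamma_re y) <= INR n / k * (B - w0 + k * ln (1 + y))).
    { apply Rle_trans with (INR n / k * - gamma_re y); [nra|]. apply Rmult_le_compat_l; lra. }
    assert (K2 : INR n / k * (k * ln (1 + y)) = INR n * ln (1 + y)) by (field; lra).
    assert (K3 : Im p * (s * y) <= 0) by nra.
    unfold Re, Im in *. lra. }
  rewrite pow_1.
  assert (HU1 : 1 + Cmod (U s y) <= (1 + W) * (1 + y)) by nra.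
  assert (P0 : 0 <= Mg * 2 ^ N * W).
  { apply Rmult_le_pos; [apply Rmult_le_pos; [exact HMg|apply pow_le; lra]|exact HW]. }
  assert (Pn : 0 < (1 + y) ^ n) by (apply pow_lt; lra).
  apply Rle_trans with (Mg * 2 ^ N * W / (1 + y) ^ N * (exp (INR n / k * (B - w0)) * (1 + y) ^ n)
    * ((1 + W) * (1 + y))).
  - apply Rmult_le_compat; [|generalize (Cmod_ge_0 (U s y)); lra| |exact HU1].
    + apply Rmult_le_pos; [apply Cmod_ge_0|left; apply exp_pos].
    + apply Rmult_le_compat; [apply Cmod_ge_0|left; apply exp_pos|exact F|exact E].
  - right. unfold tail_bound. rewrite (pow_add (1 + y)). field. split; lra.
Qed.

(** Domination holds with one constant on the closed half-plane as long as [Re p <= n / k], so the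
    Lipschitz bound reaches the axis; the strict inequality on [t] leaves room for a
    neighborhood. *)
Lemma parts_tail_boundary s t : s = 1 \/ s = -1 -> t < INR n / k ->
  flim (parts_tail s) (within (fun p : C => 0 < - s * Im p) (locally (T := C_UniformSpace) (RtoC t)))
    (parts_tail s (RtoC t)).
Proof.
  intros Hs Ht.
  assert (Hwc := fun y Hy => tail_weight_cont s y Hs Hy). assert (HUc := fun y Hy => U_cont s y Hs Hy).
  assert (Hokt := tail_weight_ok s (RtoC t) Hs ltac:(simpl; lra) ltac:(simpl; lra)).
  assert (FF : Filter (within (fun p : C => 0 < - s * Im p) (locally (T := C_UniformSpace) (RtoC t)))).
  { apply within_filter; apply locally_filter. }
  assert (Kid : flim (fun p : C => p)
    (within (fun p : C => 0 < - s * Im p) (locally (T := C_UniformSpace) (RtoC t))) (RtoC t)).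
  { intros e He. unfold within. generalize (Ccont_id (RtoC t) e He). apply filter_imp. auto. }
  apply flim_mult; [exact FF| |].
  - intros e He.
    assert (HM : 0 <= tail_bound) by (eapply dominated_pos, weight_dominated; [exact Hwc|exact HUc|exact Hokt]).
    assert (He' : 0 < e / (tail_bound + 1)) by (apply Rdiv_lt_0_compat; lra).
    assert (K2 : locally (T := C_UniformSpace) (RtoC t) (fun u => Re u < INR n / k))
      by (apply locally_Re_lt; exact Ht).
    assert (K3 := Kid _ He'). unfold within in *.
    generalize (filter_and _ _ K2 K3). apply filter_imp. intros u [Hu1 Hu2] Hu3. specialize (Hu2 Hu3).
    assert (Hoku := tail_weight_ok s u Hs ltac:(lra) ltac:(lra)).
    eapply Rle_lt_trans; [apply (weighted_laplace_lipschitz _ _ Hwc HUc tail_bound _ _ Hokt Hoku)|].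
    apply (Rmult_lt_compat_l (tail_bound + 1)) in Hu2; [|lra].
    replace ((tail_bound + 1) * (e / (tail_bound + 1))) with e in Hu2 by (field; lra).
    generalize (Cmod_ge_0 (u - RtoC t)). nra.
  - apply (flim_Ccont _ (fun p => p) (fun p => Cexp (p * w))%C (RtoC t)); [exact Kid|].
    apply (Ccont_of_Cd _ _ _ (Cderiv_exp_mult w (RtoC t))).
Qed.

Lemma tail_laplace_bound s t : s = 1 \/ s = -1 -> t <= INR n / k ->
  Cmod (weighted_laplace (tail_weight s) (U s) (RtoC t)) <= tail_bound.
Proof.
  intros Hs Ht. apply Int0_le.
  apply (weight_dominated (tail_weight s) (U s) (fun y Hy => tail_weight_cont s y Hs Hy) (fun y Hy => U_cont s y Hs Hy) 1).
  apply tail_weight_ok; simpl; auto; lra.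
Qed.

(** For [t < 0] the factor [exp (- t u)] is bounded on [H], so [f] decays like [Cmod u ^ (-2)] and
    Cauchy's formula applies, with [f w = g w]. The sign comes from [w - u] in the tails against
    [u - w] in the Cauchy kernel. *)
Lemma cauchy_term t : t < 0 ->
  ((- w) ^ N * (parts_tail (-1) (RtoC t) - parts_tail 1 (RtoC t)))%C = (2 * Ci * RtoC PI * g w)%C.
Proof.
  intros Ht.
  pose (f := fun u => ((- w) ^ N * (divn g N u * Cexp (RtoC t * (w - u))))%C).
  assert (Hwn := in_H_neq0 w Hw).
  assert (Hf : hol_on H f).
  { intros u Hu. destruct (divn_hol g N Hg u Hu) as [l Hl].
    eexists. apply (deriv_along_scal (fun u : C => u) u (Ccont_id u)).
    apply (deriv_along_mult (fun u : C => u) u (Ccont_id u)); [exact Hl|].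
    apply (Cderiv_comp Cexp (fun u => RtoC t * (w - u))%C); [apply Cderiv_Cexp|].
    apply (deriv_along_scal (fun u : C => u) u (Ccont_id u)). apply deriv_along_minus; [apply deriv_along_const|apply deriv_along_id]. }
  assert (Hfw : f w = g w).
  { unfold f. replace (RtoC t * (w - w))%C with (RtoC 0) by ring. rewrite Cexp_0.
    rewrite <- (divn_value w N Hwn). ring. }
  pose (Cf := Cmod ((- w) ^ N) * (Mg * exp (t * Re w))).
  assert (HCf : 0 <= Cf).
  { apply Rmult_le_pos; [apply Cmod_ge_0|]. apply Rmult_le_pos; [exact HMg|left; apply exp_pos]. }
  assert (Hfb : forall u, H u -> Cmod (f u) <= Cf / Cmod u ^ 2).
  { intros u Hu. unfold f, Cf, Rdiv. rewrite !Cmod_mult, Rmult_assoc.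
    apply Rmult_le_compat_l; [apply Cmod_ge_0|].
    assert (H1 := in_H_Cmod u Hu). assert (H2 := ld_Re H HL u Hu).
    rewrite Cmod_Cexp. rewrite (Rmult_comm Mg), Rmult_assoc, (Rmult_comm (Cmod (divn g N u))).
    apply Rmult_le_compat; [left; apply exp_pos|apply Cmod_ge_0| |].
    - apply exp_le. rewrite Re_mult. simpl. unfold Re in *. nra.
    - eapply Rle_trans; [apply divn_Cmod; exact Hu|]. unfold Rdiv. apply Rmult_le_compat_l; [exact HMg|].
      apply Rinv_le_contravar; [apply pow_lt; lra|]. apply Rle_pow; [exact H1|lia]. }
  assert (K := cauchy_gamma w Hw Hleft Hdist f Cf Hf HCf Hfb).
  rewrite Hfw in K. rewrite <- K.
  assert (E : forall s, s = 1 \/ s = -1 ->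
    Int0 (cauchy_kernel w f s) = (- ((- w) ^ N * parts_tail s (RtoC t)))%C).
  { intros s Hs. assert (Hnk : 0 <= INR n / k) by (apply Rdiv_le_0_compat; [apply pos_INR|exact Hk]).
    assert (Dm := weight_dominated (tail_weight s) (U s) (fun y Hy => tail_weight_cont s y Hs Hy) (fun y Hy => U_cont s y Hs Hy)
      1 tail_bound (RtoC t) (tail_weight_ok s (RtoC t) Hs ltac:(simpl; lra) ltac:(simpl; lra))).
    unfold parts_tail, weighted_laplace.
    replace (- ((- w) ^ N * (Int0 (fun y => tail_weight s y * Cexp (- (RtoC t * U s y))) * Cexp (RtoC t * w))))%C
      with ((- ((- w) ^ N * Cexp (RtoC t * w))) * Int0 (fun y => tail_weight s y * Cexp (- (RtoC t * U s y))))%C by ring.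
    rewrite <- (Int0_scal _ _ _ Dm). apply Int0_ext. intros y Hy.
    unfold cauchy_kernel, f, tail_weight.
    replace (RtoC t * (w - U s y))%C with (RtoC t * w + - (RtoC t * U s y))%C by ring.
    rewrite Cexp_plus. assert (Nz := w_U_neq s y Hs Hy).
    field. split; [exact Nz|]. intros E. apply Nz.
    replace (w - U s y)%C with (- (U s y - w))%C by ring. rewrite E. ring. }
  rewrite !E by auto. ring.
Qed.
Context (L : C -> C) (HLap : forall p, ~ in_Rplus p -> L p = laplace g p).

Lemma g_bounded : bounded_on H g.
Proof. exists Mg. split; [exact HMg|exact Hgb]. Qed.

Lemma iter_laplace j p : ~ in_Rplus p -> iter_primitive j L p = laplace (divn g j) p.
Proof. apply (iter_primitive_laplace L g g_bounded Hg HLap). Qed.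

Lemma iter_deriv j p : ~ in_Rplus p -> Cderiv (iter_primitive (S j) L) p (iter_primitive j L p).
Proof.
  intros Hp. apply (deriv_along_ext_loc (fun u : C => u) p (laplace (divn g (S j)))); [auto| |].
  - generalize (not_in_Rplus_open p Hp). apply filter_imp. intros u Hu. symmetry. apply iter_laplace; exact Hu.
  - rewrite iter_laplace by exact Hp.
    apply (laplace_derive (divn g j) p Hp).
    + apply divn_bounded, g_bounded.
    + apply divn_hol; assumption.
Qed.

Lemma iter_cont j p : ~ in_Rplus p -> Ccont (iter_primitive j L) p.
Proof.
  intros Hp. apply (@flim_ext_at (laplace (divn g j))).
  - generalize (not_in_Rplus_open p Hp). apply filter_imp. intros u Hu. symmetry. apply iter_laplace; exact Hu.
  - apply (laplace_cont); [exact Hp| |].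
    + apply divn_bounded, g_bounded.
    + apply divn_hol; assumption.
Qed.

Context (t0 tn : R) (Ht0 : t0 < 0) (Htn : 0 < tn) (Htnk : tn < INR n / k).
Context (r : R) (F : C -> C) (Hr : 0 < r) (Hrt : r <= tn) (HF : hol_on (square tn r) F)
  (HFL : forall u, square tn r u -> ~ in_Rplus u -> F u = L u).

(** A primitive of the integrand of the loop in the half-plane [s * Im p < 0]; the sign [s] is that
    of the half of the contour, opposite to the side of [p]. *)
Definition loop_primitive (s : R) (p : C) : C :=
  (csum (fun j => (- w) ^ j * iter_primitive (S j) L p * Cexp (p * w))%C N + (- w) ^ N * parts_tail s p)%C.

Lemma loop_primitive_derive s p : s = 1 \/ s = -1 -> s * Im p < 0 ->
  Cderiv (loop_primitive s) p (L p * Cexp (p * w))%C.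
Proof.
  intros Hs Hp. assert (Hp' : ~ in_Rplus p).
  { apply Im_not_in_Rplus. intros E. rewrite E in Hp. lra. }
  apply (deriv_along_eq _ _ _ ((iter_primitive 0 L p * Cexp (p * w) - (- w) ^ N * iter_primitive N L p * Cexp (p * w))
    + (- w) ^ N * (laplace (divn g N) p * Cexp (p * w)))%C).
  - apply deriv_along_plus; [apply (Cderiv_parts (fun j => iter_primitive j L)); intros j _; apply iter_deriv; exact Hp'|].
    apply (deriv_along_scal (fun u : C => u) p (Ccont_id p)).
    apply (parts_tail_derive s p Hs Hp).
  - rewrite (iter_laplace N) by exact Hp'. change (iter_primitive 0 L p) with (L p). ring.
Qed.

Lemma loop_primitive_limit s sg t (l : nat -> C) : s = 1 \/ s = -1 -> sg = - s -> t < INR n / k ->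
  (forall j, flim (iter_primitive j L)
     (within (fun p : C => 0 < sg * Im p) (locally (T := C_UniformSpace) (RtoC t))) (l j)) ->
  flim (loop_primitive s)
    (within (fun p : C => 0 < sg * Im p) (locally (T := C_UniformSpace) (RtoC t)))
    (csum (fun j => (- w) ^ j * l (S j) * Cexp (RtoC t * w))%C N + (- w) ^ N * parts_tail s (RtoC t))%C.
Proof.
  intros Hs -> Ht Hl.
  assert (FF : Filter (within (fun p : C => 0 < - s * Im p) (locally (T := C_UniformSpace) (RtoC t)))).
  { apply within_filter; apply locally_filter. }
  apply flim_plus; [exact FF| |].
  - apply (flim_csum _ (fun j p => (- w) ^ j * iter_primitive (S j) L p * Cexp (p * w))%C
      (fun j => (- w) ^ j * l (S j) * Cexp (RtoC t * w))%C).
    intros j _. apply flim_mult; [exact FF|apply flim_mult; [exact FF|apply flim_const; exact FF|apply Hl]|].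
    intros e He. unfold within.
    generalize (Ccont_of_Cd _ _ _ (Cderiv_exp_mult w (RtoC t)) e He). apply filter_imp. auto.
  - apply flim_mult; [exact FF|apply flim_const; exact FF|].
    apply (parts_tail_boundary); assumption.
Qed.

Lemma loop_value c I : encircling_loop t0 tn c ->
  is_path_int (fun p => L p * Cexp (p * w))%C c 0 1 I ->
  I = (csum (fun j => (- w) ^ j * phi L (S j) tn * Cexp (RtoC tn * w))%C N
       + (- w) ^ N * (parts_tail 1 (RtoC tn) - parts_tail (-1) (RtoC tn)) + 2 * Ci * RtoC PI * g w)%C.
Proof.
  intros Hc HI.
  assert (H1 : 1 = 1 \/ 1 = -1) by auto. assert (H2 : -1 = 1 \/ -1 = -1) by auto.
  assert (E1 : -1 = - (1)) by ring. assert (E2 : 1 = - -1) by ring.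
  assert (Ht0k : t0 < INR n / k).
  { apply Rlt_le_trans with 0; [exact Ht0|]. apply Rdiv_le_0_compat; [apply pos_INR|exact Hk]. }
  assert (Hd : forall j p, Im p <> 0 -> Cderiv (iter_primitive (S j) L) p (iter_primitive j L p)).
  { intros j p Hp. apply iter_deriv. apply Im_not_in_Rplus; exact Hp. }
  assert (HFL' : forall u, square tn r u -> Im u <> 0 -> F u = L u).
  { intros u Hu Hu2. apply HFL; [exact Hu|apply Im_not_in_Rplus; exact Hu2]. }
  assert (Hj : forall j, exists ab : C * C,
    flim (iter_primitive j L)
      (within (fun p : C => 0 < 1 * Im p) (locally (T := C_UniformSpace) (RtoC tn))) (fst ab) /\
    flim (iter_primitive j L)
      (within (fun p : C => 0 < -1 * Im p) (locally (T := C_UniformSpace) (RtoC tn))) (snd ab) /\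
    phi L j tn = (snd ab - fst ab)%C).
  { intros j. destruct (phi_sided_limits L Hd tn r F Hr Hrt HF HFL' j) as (a & b & K).
    exists (a, b). exact K. }
  apply choice in Hj. destruct Hj as [ab Hab].
  assert (Hn0 : ~ in_Rplus (RtoC t0)) by (intros [K _]; simpl in K; lra).
  (* At [t0 < 0] the iterated primitives are continuous, so both halves of the loop have the same
     boundary sum there, and it cancels; only the tails differ. *)
  assert (L0 : forall sg j, flim (iter_primitive j L)
      (within (fun p : C => 0 < sg * Im p) (locally (T := C_UniformSpace) (RtoC t0)))
      (iter_primitive j L (RtoC t0))).
  { intros sg j e He. unfold within. generalize (iter_cont j _ Hn0 e He). apply filter_imp. auto. }
  assert (K := loop_integral (loop_primitive (-1)) (loop_primitive 1) _ t0 tn c I _ _ _ _ Hc HI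
    (fun p Hp => loop_primitive_derive (-1) p H2 ltac:(lra))
    (fun p Hp => loop_primitive_derive 1 p H1 ltac:(lra))
    (fun p Hp => flim_mult _ _ _ _ _ (iter_cont 0 p (Im_not_in_Rplus p Hp))
       (Ccont_of_Cd _ _ _ (Cderiv_exp_mult w p)))
    (loop_primitive_limit (-1) 1 t0 _ H2 E2 Ht0k (L0 1))
    (loop_primitive_limit (-1) 1 tn (fun j => fst (ab j)) H2 E2 Htnk (fun j => proj1 (Hab j)))
    (loop_primitive_limit 1 (-1) t0 _ H1 E1 Ht0k (L0 (-1)))
    (loop_primitive_limit 1 (-1) tn (fun j => snd (ab j)) H1 E1 Htnk (fun j => proj1 (proj2 (Hab j))))).
  rewrite K. clear K.
  assert (KC := cauchy_term t0 Ht0).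
  rewrite (csum_ext (fun j => (- w) ^ j * phi L (S j) tn * Cexp (RtoC tn * w))%C
    (fun j => (- w) ^ j * snd (ab (S j)) * Cexp (RtoC tn * w)
      - (- w) ^ j * fst (ab (S j)) * Cexp (RtoC tn * w))%C).
  2:{ intros j _. destruct (Hab (S j)) as (_ & _ & ->). ring. }
  rewrite csum_minus. rewrite <- KC. ring.
Qed.

Lemma partial_sum_value :
  partial_sum L t0 tn w =
  (/ (2 * Ci * RtoC PI) *
    (csum (fun j => (- w) ^ j * phi L (S j) tn * Cexp (RtoC tn * w))%C N
     + (- w) ^ N * (parts_tail 1 (RtoC tn) - parts_tail (-1) (RtoC tn)) + 2 * Ci * RtoC PI * g w))%C.
Proof.
  assert (Hsq : square tn r (RtoC tn)).
  { split; simpl; [rewrite Rminus_diag|]; rewrite Rabs_R0; exact Hr. }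
  assert (Hloc : forall u, square tn r u -> locally (T := C_UniformSpace) u (square tn r)).
  { intros u Hu. destruct (proj1 (square_comb tn r) u Hu) as (d & Hd & Hop).
    apply locally_C_iff. exists d. auto. }
  (* The values of [L] on the half-line are unspecified, so its holomorphic extension [F] stands in
     for it near [tn]. *)
  pose (f0 := fun p => ((if excluded_middle_informative (square tn r p) then F p else L p) * Cexp (p * w))%C).
  assert (Hf0 : forall p, ~ in_Rplus p -> f0 p = (L p * Cexp (p * w))%C).
  { intros p Hp. unfold f0. destruct excluded_middle_informative as [K|K]; [|reflexivity].
    rewrite HFL by assumption. reflexivity. }
  assert (Hex : exists l, is_partial_sum L t0 tn w l).
  { destruct (loop_integral_exists t0 tn (fun p => L p * Cexp (p * w))%C f0) as (c & I & Hc & HI);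
      try lra; try assumption.
    - apply (@flim_ext_at (fun p => F p * Cexp (p * w))%C).
      + generalize (Hloc _ Hsq). apply filter_imp. intros u Hu. unfold f0.
        destruct excluded_middle_informative; [reflexivity|contradiction].
      + apply flim_mult; [apply _|apply (hol_on_Ccont (square tn r)); assumption|].
        apply (Ccont_of_Cd _ _ _ (Cderiv_exp_mult w (RtoC tn))).
    - intros p _ Hp. apply (@flim_ext_at (fun p => L p * Cexp (p * w))%C).
      + generalize (not_in_Rplus_open p Hp). apply filter_imp. intros u Hu. symmetry. apply Hf0; exact Hu.
      + apply flim_mult; [apply _|apply (iter_cont 0 p Hp)|].
        apply (Ccont_of_Cd _ _ _ (Cderiv_exp_mult w p)).
    - eexists. exists c, I. split; [exact Hc|]. split; [exact HI|reflexivity]. }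
  assert (K : is_partial_sum L t0 tn w (partial_sum L t0 tn w)).
  { unfold partial_sum, the_C. apply epsilon_spec. exact Hex. }
  destruct K as (c & I & Hc & HI & ->). rewrite (loop_value c I Hc HI). reflexivity.
Qed.
Lemma evanescent_error : t0 = t_ k 0 -> tn = t_ k n ->
  Cmod (evanescent_S L k n w - g w) <= Cmod w ^ N * (tail_bound * exp (tn * Re w)).
Proof.
  intros E0 En. unfold evanescent_S, S_. rewrite <- E0, <- En, partial_sum_value, En.
  rewrite (BT2_csum L k n w r F); try rewrite <- En; auto.
  2:{ intros j p Hp. apply iter_deriv, Im_not_in_Rplus; exact Hp. }
  2:{ intros u Hu Hu2. apply HFL; [exact Hu|apply Im_not_in_Rplus; exact Hu2]. }
  match goal with |- Cmod ?z <= _ =>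
    replace z with (/ (2 * Ci * RtoC PI) * ((- w) ^ N * (parts_tail 1 (RtoC tn) - parts_tail (-1) (RtoC tn))))%C end.
  2:{ field. assert (K := two_pi_i_neq0). repeat split; intros E; apply K; rewrite E; ring. }
  assert (HQ : forall s, s = 1 \/ s = -1 -> Cmod (parts_tail s (RtoC tn)) <= tail_bound * exp (tn * Re w)).
  { intros s Hs. unfold parts_tail. rewrite Cmod_mult, Cmod_Cexp.
    replace (Re (RtoC tn * w)) with (tn * Re w) by (rewrite Re_mult; simpl; ring).
    apply Rmult_le_compat_r; [left; apply exp_pos|]. apply tail_laplace_bound; [exact Hs|lra]. }
  assert (HQ12 : Cmod (parts_tail 1 (RtoC tn) - parts_tail (-1) (RtoC tn)) <= 2 * (tail_bound * exp (tn * Re w))).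
  { eapply Rle_trans; [apply Cmod_triangle|]. rewrite Cmod_opp.
    assert (K1 := HQ 1 (or_introl eq_refl)). assert (K2 := HQ (-1) (or_intror eq_refl)). lra. }
  rewrite !Cmod_mult, Cmod_pow, Cmod_opp.
  assert (PN : 0 <= Cmod w ^ N) by (apply pow_le, Cmod_ge_0).
  (* Two tails, against the factor [/ (2 * PI) <= 1 / 2]. *)
  replace (Cmod w ^ N * (tail_bound * exp (tn * Re w)))
    with (1 / 2 * (Cmod w ^ N * (2 * (tail_bound * exp (tn * Re w))))) by field.
  apply Rmult_le_compat; [apply Cmod_ge_0| |apply Cmod_inv_two_pi_i|].
  - apply Rmult_le_pos; [exact PN|apply Cmod_ge_0].
  - apply Rmult_le_compat_l; [exact PN|exact HQ12].
Qed.
End Remainder.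
End Setting.

(** * Choice of the contour and conclusion *)

(** At heights up to [y1] the contour lies to the left of points of a disc around [w0] contained in
    [H]. Above, the bend has already moved it into the logarithmic region. *)
Lemma gamma_exists H w0 k A : left_domain H -> H (RtoC w0) -> 0 < k ->
  (forall x y, x <= A - k * ln (1 + Rabs y) -> H (x, y)) ->
  exists B, 0 <= B /\ forall y, 0 <= y -> H (gamma_re w0 k B y, y).
Proof.
  intros HL Hw0 Hk HA. destruct (ld_open H HL _ Hw0) as (r & Hr & Ho).
  pose (y1 := Rmin 1 (r / 2)).
  assert (Y1 : 0 < y1) by (apply Rmin_pos; lra).
  assert (Y2 : y1 <= 1) by apply Rmin_l. assert (Y3 : y1 <= r / 2) by apply Rmin_r.
  (* For [y >= y1] one has [y / (1 + y) >= y1 / 2], so this [B] moves the contour left by at least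
     [w0 - A]. *)
  pose (B := Rmax 0 ((w0 - A) * 2 / y1)).
  exists B. assert (HB : 0 <= B) by apply Rmax_l.
  assert (HB2 : (w0 - A) * 2 / y1 <= B) by apply Rmax_r.
  split; [exact HB|]. intros y Hy.
  destruct (Rle_dec y y1) as [Hle|Hgt].
  - apply (ld_left H HL w0 y); [|apply (gamma_re_le w0 k B Hk HB); exact Hy|lra].
    apply Ho. replace ((w0, y) - RtoC w0)%C with (RtoC y * Ci)%C.
    + rewrite Cmod_mult, Cmod_Ci, Cmod_R, Rabs_pos_eq by lra. lra.
    + apply injective_projections; simpl; ring.
  - apply HA. rewrite Rabs_pos_eq by lra. unfold gamma_re.
    assert (K : w0 - A <= B * y / (1 + y)); [|lra].
    assert (K1 : y1 / 2 <= y / (1 + y)).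
    { apply Rmult_le_reg_r with (1 + y); [lra|]. replace (y / (1 + y) * (1 + y)) with y by (field; lra). nra. }
    apply Rle_trans with (B * (y1 / 2)).
    + apply Rmult_le_compat_r with (r := y1 / 2) in HB2; [|lra].
      replace ((w0 - A) * 2 / y1 * (y1 / 2)) with (w0 - A) in HB2 by (field; lra). exact HB2.
    + unfold Rdiv. rewrite Rmult_assoc. apply Rmult_le_compat_l; [exact HB|exact K1].
Qed.

Theorem theorem4 :
  forall (H : C -> Prop) (a k : R) (g : C -> C) (w0 : R),
    (0 < k)%R ->
    logarithmic_of_type a k H ->
    (forall w, H w -> (Re w <= -1)%R) ->
    E0 H g ->
    H (RtoC w0) ->
    (forall n : nat, ~ support (Laplace H w0 g) (t_ k n)) ->
    exists H' : C -> Prop,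
      logarithmic H' /\ set_incl H' H /\
      forall eps : R, (0 < eps)%R ->
        exists N : nat, forall n : nat, (N <= n)%nat ->
          forall w : C, H' w ->
            (Cmod (evanescent_S (Laplace H w0 g) k n w - g w)%C < eps)%R.
Proof.
  intros H a k g w0 Hk Hlog HRe (Hghol & (Mg0 & HMg0) & Hgon) Hw0 Hsupp.
  assert (HL := nbhd_minfty_left_domain H (proj1 Hlog) HRe).
  destruct (logarithmic_region a k H Hk Hlog) as [A HA].
  destruct (gamma_exists H w0 k A HL Hw0 Hk HA) as (B & HB & HG).
  assert (Hg : hol_on H g).
  { intros z Hz. destruct (Hghol z Hz) as [l Hl]. exists l. apply Cderiv_is_derive. exact Hl. }
  pose (Mg := Rmax 0 Mg0). assert (HMg : 0 <= Mg) by apply Rmax_l.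
  assert (Hgb : forall u, H u -> Cmod (g u) <= Mg).
  { intros u Hu. eapply Rle_trans; [apply HMg0; exact Hu|apply Rmax_r]. }
  assert (Hgc : ccont_on (closure H) g).
  { intros z Hz. apply flim_filterlim; [apply within_filter; apply locally_filter|apply Hgon; exact Hz]. }
  destruct (gamma_growth H w0 k B HL Hw0 Hk HB 1 (or_introl eq_refl)) as (W1 & HW1 & HWU1).
  destruct (gamma_growth H w0 k B HL Hw0 Hk HB (-1) (or_intror eq_refl)) as (W2 & HW2 & HWU2).
  pose (W := W1 + W2). assert (HW : 0 <= W) by (unfold W; lra).
  assert (HWU : forall s y, s = 1 \/ s = -1 -> 0 <= y ->
    Cmod (gamma' k B s y) <= W /\ Cmod (gamma w0 k B s y) <= W * (1 + y)).
  { unfold W. intros s y [-> | ->] Hy.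
    - destruct (HWU1 y Hy). split; nra.
    - destruct (HWU2 y Hy). split; nra. }
  set (L := Laplace H w0 g) in *.
  assert (HLap : forall p, ~ in_Rplus p -> L p = laplace w0 k B g p).
  { intros p Hp. apply (Laplace_laplace H w0 k B HL Hw0 Hk HB HG); auto. exists Mg. auto. }
  (* [a'] makes [|w|^2 exp (Re w / (2 k)) exp E0 <= 1 / 4] on the new neighborhood, whose
     n-th power controls the error. *)
  pose (E0 := (B - w0) / k). pose (d := exp (- E0) / 4).
  assert (Hd : 0 < d) by (unfold d; apply Rdiv_lt_0_compat; [apply exp_pos|lra]).
  pose (a1 := w0 - B - k * ln 2 - (B + k + 2) - 16 * k).
  pose (a2 := (ln d - (1 / (8 * k) + 2 * ln (16 * k)) - 2 * ln 2 - 2) * (8 * k)).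
  pose (a' := Rmin (- (16 * k)) (Rmin a1 a2)).
  assert (A0 : a' <= - (16 * k)) by apply Rmin_l.
  assert (A1 : a' <= a1) by (eapply Rle_trans; [apply Rmin_r|apply Rmin_l]).
  assert (A2 : a' <= a2) by (eapply Rle_trans; [apply Rmin_r|apply Rmin_r]).
  assert (A2' : a' / (8 * k) <= ln d - (1 / (8 * k) + 2 * ln (16 * k)) - 2 * ln 2 - 2).
  { apply Rmult_le_reg_r with (8 * k); [lra|]. unfold a2 in A2.
    replace (a' / (8 * k) * (8 * k)) with a' by (field; lra). exact A2. }
  assert (A1' : a' + 16 * k <= w0 - B - k * ln 2 - (B + k + 2)) by (unfold a1 in A1; lra).
  assert (Hincl : set_incl (ldomain a' (16 * k)) H).
  { intros [x y] Hw. unfold ldomain in Hw. simpl in Hw.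
    assert (K := lprofile_below_gamma w0 k B Hk HB a' (Rabs y) (Rabs_pos _) A1').
    apply (ld_left H HL (gamma_re w0 k B (Rabs y)) (Rabs y)); [apply HG; apply Rabs_pos|lra|].
    rewrite Rabs_Rabsolu. lra. }
  exists (ldomain a' (16 * k)). split; [apply ldomain_logarithmic; lra|]. split; [exact Hincl|].
  intros eps Heps.
  (* What [tail_bound] retains without its [n]-th powers; [8] is left over from [2 ^ (n + 3)]. *)
  pose (C0 := Mg * 8 * W * (1 + W)).
  assert (HC0 : 0 <= C0).
  { unfold C0. apply Rmult_le_pos; [apply Rmult_le_pos; [lra|exact HW]|lra]. }
  destruct (half_pow_eventually C0 eps HC0 Heps) as [n0 Hn0].
  (* From [n >= 3] follow [n + 3 <= 2 * n], which replaces [Cmod w ^ (n + 3)] by an [n]-th power,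
     and [t_n >= n / (2 * k)]. *)
  exists (n0 + 3)%nat. intros n Hn w Hw.
  eapply Rle_lt_trans; [|apply (Hn0 n); lia].
  assert (HwH := Hincl w Hw).
  assert (Hn3 : 3 <= INR n).
  { replace 3 with (INR 3) by (simpl; ring). apply le_INR. lia. }
  assert (Pik : 0 < / k) by (apply Rinv_0_lt_compat; exact Hk).
  assert (Ht0 : t_ k 0 < 0) by (unfold t_; simpl; unfold Rdiv; nra).
  assert (Htn : 0 < t_ k n) by (unfold t_, Rdiv; nra).
  assert (Htnk : t_ k n < INR n / k) by (unfold t_, Rdiv; nra).
  assert (Hext : extends_holomorphically_at L (t_ k n)).
  { apply NNPP. intros K. apply (Hsupp n). split; [lra|exact K]. }
  destruct Hext as (V & F & HVo & HVt & HFhol & HFL).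
  assert (HV := HVo _ HVt). apply locally_C_iff in HV. destruct HV as (dv & Hdv & HV).
  (* Half of [dv], because points of the square are closer than [2 * r] to its centre; at most
     [t_n], so that the square meets the real axis only at positive points, where [phi] is a
     jump. *)
  pose (r := Rmin (dv / 2) (t_ k n)).
  assert (Hr : 0 < r) by (apply Rmin_pos; lra).
  assert (Hr1 : r <= dv / 2) by apply Rmin_l. assert (Hrt : r <= t_ k n) by apply Rmin_r.
  assert (HsqV : forall u, square (t_ k n) r u -> V u).
  { intros u [S1 S2]. apply HV. eapply Rle_lt_trans; [apply Cmod_le_abs|].
    simpl. fold (Re u) (Im u). replace (Im u + - 0) with (Im u) by ring.
    change (Re u + - t_ k n) with (Re u - t_ k n). lra. }
  assert (HF : hol_on (square (t_ k n) r) F).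
  { intros u Hu. destruct (HFhol u (HsqV u Hu)) as [l Hl]. exists l. apply Cderiv_is_derive. exact Hl. }
  assert (HFL' : forall u, square (t_ k n) r u -> ~ in_Rplus u -> F u = L u).
  { intros u Hu Hu2. apply HFL; [apply HsqV; exact Hu|exact Hu2]. }
  assert (Hleft : Re w < gamma_re w0 k B (Rabs (Im w))).
  { unfold ldomain in Hw.
    assert (K := lprofile_below_gamma w0 k B Hk HB a' (Rabs (Im w)) (Rabs_pos _) A1'). lra. }
  assert (Hdist : forall s y, s = 1 \/ s = -1 -> 0 <= y -> 1 <= Cmod (gamma w0 k B s y - w)).
  { intros s y Hs Hy. apply (ldomain_far w0 k B Hk HB a'); assumption. }
  eapply Rle_trans.
  { apply (evanescent_error H w0 k B HL Hw0 Hk HB HG g Mg HMg Hgb Hg W HW HWU n w HwH Hleft Hdist L HLap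
      (t_ k 0) (t_ k n) Ht0 Htn Htnk r F Hr Hrt HF HFL' eq_refl eq_refl). }
  assert (Hc1 := in_H_Cmod H HL w HwH).
  assert (Hxneg : Re w <= -1) by (apply HRe; exact HwH).
  assert (PN : 0 <= Cmod w ^ (n + 3)) by (apply pow_le; lra).
  set (X := exp (Re w / (2 * k))). assert (PX : 0 < X) by apply exp_pos.
  assert (B1 : exp (t_ k n * Re w) <= X ^ n).
  { unfold X. rewrite <- exp_nat_mul. apply exp_le.
    replace (INR n * (Re w / (2 * k))) with (INR n / 2 * (/ k) * Re w) by (field; lra).
    unfold t_, Rdiv. assert (INR n * / 2 * / k <= (INR n - 1 * / 2) * / k) by nra. nra. }
  assert (B2 : Cmod w ^ (n + 3) <= (Cmod w ^ 2) ^ n).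
  { rewrite <- pow_mult. apply Rle_pow; [exact Hc1|]. lia. }
  assert (B3 : exp (INR n / k * (B - w0)) = exp E0 ^ n).
  { rewrite <- exp_nat_mul. f_equal. unfold E0. field. lra. }
  assert (B4 := deep_bound k a' d w Hk Hd ltac:(lra) A2' Hw). fold X in B4.
  unfold tail_bound. rewrite B3, (pow_add 2).
  replace (2 ^ 3) with 8 by (simpl; ring).
  assert (PE : 0 < exp E0) by apply exp_pos.
  assert (P2 : 0 <= (Cmod w ^ 2) ^ n) by (apply pow_le, pow_le; lra).
  apply Rle_trans with (C0 * ((Cmod w ^ 2) ^ n * X ^ n * 2 ^ n * exp E0 ^ n)).
  { replace (Cmod w ^ (n + 3) * (Mg * (2 ^ n * 8) * W * exp E0 ^ n * (1 + W) * exp (t_ k n * Re w)))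
      with (C0 * 2 ^ n * exp E0 ^ n * (Cmod w ^ (n + 3) * exp (t_ k n * Re w))) by (unfold C0; ring).
    replace (C0 * ((Cmod w ^ 2) ^ n * X ^ n * 2 ^ n * exp E0 ^ n))
      with (C0 * 2 ^ n * exp E0 ^ n * ((Cmod w ^ 2) ^ n * X ^ n)) by ring.
    apply Rmult_le_compat_l.
    - apply Rmult_le_pos; [apply Rmult_le_pos; [exact HC0|apply pow_le; lra]|apply pow_le; lra].
    - apply Rmult_le_compat; [exact PN|left; apply exp_pos|exact B2|exact B1]. }
  apply Rmult_le_compat_l; [exact HC0|].
  rewrite <- !Rpow_mult_distr. apply pow_incr.
  assert (PW2 : 0 <= Cmod w ^ 2 * X) by (apply Rmult_le_pos; [apply pow_le|]; lra).
  split; [apply Rmult_le_pos; [apply Rmult_le_pos|]; lra|].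
  (* By the choice of [d] this equals [1 / 2]; the factor [2] stems from [gamma_lower], through the
     power of [2] in [tail_bound]. *)
  apply Rle_trans with (d * 2 * exp E0).
  - apply Rmult_le_compat_r; [lra|]. apply Rmult_le_compat_r; [lra|exact B4].
  - unfold d. rewrite exp_Ropp. right. field. lra.
Qed.
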